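(* Let $1<p\le q<\infty$, $n\in\mathbb{N}\cup\{0\}$, $\omega\in\mathcal{D}$, $0<s<1$, and let $\mu$ be a positive Borel measure on $\mathbb{D}$. If the $n$-th differentiation operator $D^{(n)}:A^p_\omega\to L^q_\mu$, $f\mapsto f^{(n)}$, is bounded, then $$\|D^{(n)}\|^q_{e,A^p_\omega\to L^q_\mu}\approx \limsup_{|z|\to1}\frac{\mu(E_s(z))}{(1-|z|)^{nq}\,\omega(S(z))^{q/p}},$$ where the implicit constants do not depend on $\mu$.
   Context: $\mathbb{D}$ is the open unit disc, $dA$ the normalized area measure. A radial weight is a nonnegative $\omega\in L^1([0,1])$ extended by $\omega(z)=\omega(|z|)$; set $\hat\omega(r)=\int_r^1\omega(t)\,dt$, and assume $\hat\omega(r)>0$ for all $r<1$. $\hat{\mathcal{D}}$ is the class of radial weights with $\hat\omega(r)\le C\hat\omega(\frac{1+r}{2})$ for all $0\le r<1$ and some $C\ge1$; $\mathcal{D}$ is the class of $\omega\in\hat{\mathcal{D}}$ for which additionally there are $K>1$, $C>1$ with $\hat\omega(r)\ge C\hat\omega(1-\frac{1-r}{K})$ for all $0\le r<1$. For $\lambda\in\mathbb{D}$, the Carleson square is $S(\lambda)=\{re^{i\theta}:|\lambda|\le r<1,\ |\arg\lambda-\theta|<\frac{1-|\lambda|}{2}\}$ and $\omega(S(\lambda))=\int_{S(\lambda)}\omega\,dA$. $A^p_\omega$ is the space of analytic $f$ on $\mathbb{D}$ with $\|f\|^p_{A^p_\omega}=\int_{\mathbb{D}}|f|^p\omega\,dA<\infty$.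 $L^q_\mu$ is the Lebesgue space $L^q(\mathbb{D},\mu)$. $E_s(a)=\{z\in\mathbb{D}:|\frac{a-z}{1-\bar a z}|<s\}$ is the pseudohyperbolic disc. The essential norm of a bounded operator $T:X\to Y$ is $\|T\|_{e,X\to Y}=\inf\{\|T-K\|_{X\to Y}: K:X\to Y \text{ compact}\}$. $A\approx B$ means $A\lesssim B$ and $B\lesssim A$ with constants independent of the relevant variables. *)

(* Defs.v *)
(* mathcomp-analysis + mathcomp-real-closed (complex numbers R[i]). *)
From HB Require Import structures.
From mathcomp Require Import all_boot all_order all_algebra.
From mathcomp Require Import all_classical all_reals all_analysis.
From mathcomp Require Import complex.
Import Order.TTheory GRing.Theory Num.Theory.
Import numFieldNormedType.Exports.

Set Implicit Arguments.
Unset Strict Implicit.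
Unset Printing Implicit Defensive.

Local Open Scope classical_set_scope.
Local Open Scope ring_scope.

(* The complex plane C = R[i], viewed as a numFieldType, hence as a normed
   space over itself: derivatives below are complex derivatives. *)
Definition Cx (R : realType) : numFieldType := R[i].

Section Defs.
Variable R : realType.
Local Notation C := (Cx R).

(* identification R*R ~ C, (x,y) |-> x + i y *)
Definition toC (x : (R * R)%type) : C := Complex x.1 x.2.
(* modulus |z| as a real number *)
Definition modC (z : C) : R :=
  Num.sqrt (complex.Re (z : R[i]) ^+ 2 + complex.Im (z : R[i]) ^+ 2).
(* r e^{i t} *)
Definition polar (r t : R) : C := Complex (r * cos t) (r * sin t).

(* Lebesgue (area) measure on R*R = C *)
Definition leb2 := ((@lebesgue_measure R) \x (@lebesgue_measure R))%E.

(* the unit disc, as a subset of R*R *)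
Definition Dset : set (R * R)%type := [set x | modC (toC x) < 1].

(* integral over A (subset of C) w.r.t. the normalized area measure dA = dxdy/pi *)
Definition areaInt (A : set C) (h : C -> \bar R) : \bar R :=
  ((pi^-1)%:E * \int[leb2]_(x in toC @^-1` A) h (toC x))%E.

(* ---------- radial weights ---------- *)
Definition omega_hat (w : R -> R) (r : R) : \bar R :=
  (\int[@lebesgue_measure R]_(t in `[r, 1%R]) (w t)%:E)%E.

(* nonnegative w in L^1([0,1]), with hat w(r) > 0 for all 0 <= r < 1 *)
Definition radial_weight (w : R -> R) : Prop :=
  [/\ (forall t, 0 <= t <= 1 -> 0 <= w t),
      (@lebesgue_measure R).-integrable `[0%R, 1%R] (EFin \o w)
    & (forall r, 0 <= r < 1 -> (0 < omega_hat w r)%E)].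

Definition class_Dhat (w : R -> R) : Prop :=
  exists c : R, 1 <= c /\
    forall r, 0 <= r < 1 -> (omega_hat w r <= c%:E * omega_hat w ((1 + r) / 2))%E.

Definition class_Dcheck (w : R -> R) : Prop :=
  exists K c : R, [/\ 1 < K, 1 < c &
    forall r, 0 <= r < 1 -> (c%:E * omega_hat w (1 - (1 - r) / K) <= omega_hat w r)%E].

Definition class_D (w : R -> R) : Prop := class_Dhat w /\ class_Dcheck w.

(* the disc as a subset of C *)
Definition disc : set C := [set z | modC z < 1].

(* omega(A) = int_A omega(|z|) dA(z) *)
Definition wmeas (w : R -> R) (A : set C) : \bar R :=
  areaInt A (fun z => (w (modC z))%:E).

(* Carleson square S(lambda): the points r e^{i theta} with |lambda| <= r < 1
   and |arg lambda - theta| < (1-|lambda|)/2, where arg lambda is the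
   principal argument (in (-pi, pi], with arg 0 = 0). *)
Definition carleson (l : C) : set C :=
  [set z | exists r th th0 : R,
     [/\ (- pi < th0 <= pi) /\ (l = polar (modC l) th0) /\ (l = 0 -> th0 = 0),
         modC l <= r < 1,
         `|th0 - th| < (1 - modC l) / 2 &
         z = polar r th]].

(* pseudohyperbolic disc E_s(a) *)
Definition Edisc (s : R) (a : C) : set C :=
  [set z | modC z < 1 /\ modC ((a - z) / (1 - ((a : R[i])^*)%C * z)) < s].

(* ---------- Bergman space A^p_omega ---------- *)
Definition holo_disc (f : C -> C) : Prop :=
  forall z : C, modC z < 1 -> derivable f z 1.

(* ||f||^p_{A^p_omega} *)
Definition Apnorm_p (p : R) (w : R -> R) (f : C -> C) : \bar R :=
  areaInt disc (fun z => ((modC (f z)) `^ p * w (modC z))%:E).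

Definition inAp (p : R) (w : R -> R) (f : C -> C) : Prop :=
  holo_disc f /\ (Apnorm_p p w f < +oo)%E.

(* ---------- L^q_mu on the disc ---------- *)
Definition Lqint (mu : {measure set (R * R)%type -> \bar R}) (q : R) (g : C -> C)
  : \bar R :=
  (\int[mu]_(x in Dset) ((modC (g (toC x))) `^ q)%:E)%E.

Definition inLq (mu : {measure set (R * R)%type -> \bar R}) (q : R) (g : C -> C)
  : Prop :=
  [/\ measurable_fun Dset (fun x => complex.Re (g (toC x) : R[i])),
      measurable_fun Dset (fun x => complex.Im (g (toC x) : R[i]))
    & (Lqint mu q g < +oo)%E].

(* n-th differentiation operator *)
Definition Dn (n : nat) (f : C -> C) : C -> C := @derive1n C C n f.

(* D^(n) : A^p_omega -> L^q_mu is bounded *)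
Definition Dn_bounded (p q : R) (n : nat) (w : R -> R)
  (mu : {measure set (R * R)%type -> \bar R}) : Prop :=
  (forall f, inAp p w f -> inLq mu q (Dn n f)) /\
  exists M : R, forall f, inAp p w f ->
    (Lqint mu q (Dn n f) <= M%:E * (Apnorm_p p w f) `^ (q / p))%E.

(* compact (linear) operators K : A^p_omega -> L^q_mu; elements of L^q_mu
   are represented by functions, linearity holds mu-a.e. on the disc, and
   compactness = the image of the unit ball is relatively compact. *)
Definition compact_op (p q : R) (w : R -> R)
  (mu : {measure set (R * R)%type -> \bar R}) (K : (C -> C) -> (C -> C)) : Prop :=
  [/\ (forall f, inAp p w f -> inLq mu q (K f)),
      (forall (a : C) f g, inAp p w f -> inAp p w g ->
         {ae mu, forall x, Dset x ->
            K (fun z => a * f z + g z) (toC x) = a * K f (toC x) + K g (toC x)})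
    & (forall u : nat -> (C -> C),
         (forall k, inAp p w (u k) /\ (Apnorm_p p w (u k) <= 1)%E) ->
         exists phi : nat -> nat, (forall k, (phi k < phi k.+1)%N) /\
           exists g, inLq mu q g /\
             (fun k => Lqint mu q (fun z => K (u (phi k)) z - g z)) @ \oo --> 0%E)].

(* operator norm of T : A^p_omega -> L^q_mu *)
Definition opnorm (p q : R) (w : R -> R)
  (mu : {measure set (R * R)%type -> \bar R}) (T : (C -> C) -> (C -> C)) : \bar R :=
  ereal_sup [set ((Lqint mu q (T f)) `^ (q^-1))%E |
               f in [set f | inAp p w f /\ (Apnorm_p p w f <= 1)%E]].

(* essential norm of D^(n) : A^p_omega -> L^q_mu *)
Definition ess_norm_Dn (p q : R) (n : nat) (w : R -> R)
  (mu : {measure set (R * R)%type -> \bar R}) : \bar R :=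
  ereal_inf [set opnorm p q w mu (fun f z => Dn n f z - K f z) |
               K in [set K | compact_op p q w mu K]].

(* the quantity mu(E_s(z)) / ((1-|z|)^{nq} omega(S(z))^{q/p}) *)
Definition carleson_ratio (p q : R) (n : nat) (w : R -> R) (s : R)
  (mu : {measure set (R * R)%type -> \bar R}) (z : C) : \bar R :=
  (mu (toC @^-1` Edisc s z) *
   (((1 - modC z) `^ (n%:R * q) * (fine (wmeas w (carleson z))) `^ (q / p))^-1)%:E)%E.

(* limsup_{|z| -> 1} F(z) = inf_{0<=r<1} sup_{r<|z|<1} F(z) *)
Definition limsup_boundary (F : C -> \bar R) : \bar R :=
  ereal_inf [set ereal_sup [set F z | z in [set z : C | r < modC z < 1]]
              | r in [set r : R | 0 <= r < 1]].

End Defs.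

(* Main.v *)
(* Write [delta = 1 - |a|]; for [omega] in [D] the mass [omega(S(a))] is comparable to [delta * tail(delta)], where
   [tail(delta)] is the integral of [omega] over [[1 - delta, 1]].

   Upper bound. Near [a], Cauchy's formula on the circles [|z| = r], [r] in an annulus at distance about [delta]
   from the boundary that carries a fixed share of the tail, bounds [|f^(n)|^p] by [delta^(-np) / omega(S(a))] times
   the integral of [|f|^p omega] over the annulus against a Poisson-type kernel. Every annulus
   [theta^(k+1) < 1 - |z| <= theta^k] is covered by about [theta^(-k)] pseudohyperbolic discs; since the kernels of
   their centres have bounded sum and the integration annuli bounded overlap, the norm of [D^(n) f] on [|z| >= r]
   is controlled by the supremum of the ratio near the boundary. Subtracting the finite rank operator given by the
   Taylor polynomial of [f^(n)], cut off to [|z| <= r], leaves only that part.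

   Lower bound. Normalised powers of [(1 - |a|) / (1 - conj(a) z)] are bounded in [A^p_omega], tend to zero locally
   uniformly as [|a|] tends to 1, and their [n]-th derivatives on [E_s(a)] are at least [delta^(-n) omega(S(a))^(-1/p)].
   A compact operator maps such a sequence to one with a subsequence tending to zero: otherwise sums of [N] sparse
   terms, of norm [O(N^(1/p))], would have images of norm comparable to [N], against [p > 1]. *)
Require Import Defs.
From HB Require Import structures.
From mathcomp Require Import all_boot all_order all_algebra.
From mathcomp Require Import all_classical all_reals all_analysis.
From mathcomp Require Import complex measurable_realfun.
From mathcomp Require Import ring lra zify.
Import Order.TTheory GRing.Theory Num.Theory.
Import numFieldNormedType.Exports.

Set Implicit Arguments.
Unset Strict Implicit.
Unset Printing Implicit Defensive.

Local Open Scope classical_set_scope.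
Local Open Scope ring_scope.

(** * Complex numbers and Cauchy estimates *)

(** Compactness is sequential and concerns functions rather than classes, so weak convergence is
    avoided: images of test functions are handled through a weak Brezis-Lieb step, in which a
    far-out term raises the p-th power of the norm of a sum by an amount independent of that sum.
    Constants may depend on everything but mu, which allows crude inequalities: a factor 2 for
    complex integrals, 2^q in place of Minkowski's inequality, r between 1/2 and 1 in place of an
    exact Jacobian. The two halves of [class_D] act at different places. [class_Dcheck] yields the
    annulus that carries a fixed share of the tail, hence the local estimate; [class_Dhat] compares
    tails at comparable distances and makes high powers of the kernel admissible test functions. The
    inequality p <= q enters where local integrals i <= 1 of a function of the unit ball are raised
    to the power q/p: i^(q/p) <= i lets them be summed. Truncation maps into L^q because boundedness
    of D^(n), tested on one kernel, forces mu to be finite on the disc. *)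

Definition rC (R : realType) (x : R) : Cx R := Complex x 0.
Definition ReC (R : realType) (z : Cx R) : R := complex.Re (z : R[i]).
Definition ImC (R : realType) (z : Cx R) : R := complex.Im (z : R[i]).
Definition cjC (R : realType) (z : Cx R) : Cx R := conjc (z : R[i]).
Definition iC (R : realType) : Cx R := Complex 0 1.

Section ComplexBasics.
Variable R : realType.
Local Notation C := (Cx R).
Implicit Types (x y z : C) (r t : R).

Lemma ReCD x y : ReC (x + y) = ReC x + ReC y. Proof. by case: x => a b; case: y => c d. Qed.
Lemma ImCD x y : ImC (x + y) = ImC x + ImC y. Proof. by case: x => a b; case: y => c d. Qed.
Lemma ReCN x : ReC (- x) = - ReC x. Proof. by case: x. Qed.
Lemma ImCN x : ImC (- x) = - ImC x. Proof. by case: x. Qed.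
Lemma ReCM x y : ReC (x * y) = ReC x * ReC y - ImC x * ImC y.
Proof. by case: x => a b; case: y => c d. Qed.
Lemma ImCM x y : ImC (x * y) = ReC x * ImC y + ImC x * ReC y.
Proof. by case: x => a b; case: y => c d. Qed.
Lemma Cx_eq x y : ReC x = ReC y -> ImC x = ImC y -> x = y.
Proof. by case: x => a b; case: y => c d /= -> ->. Qed.

Lemma rC0 : rC 0 = 0 :> C. Proof. by []. Qed.
Lemma rC1 : rC 1 = 1 :> C. Proof. by []. Qed.
Lemma rCD r t : rC (r + t) = rC r + rC t.
Proof. by apply: Cx_eq; rewrite ?ReCD ?ImCD /= ?addr0. Qed.
Lemma rCN r : rC (- r) = - rC r.
Proof. by apply: Cx_eq; rewrite ?ReCN ?ImCN /= ?oppr0. Qed.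
Lemma rCB r t : rC (r - t) = rC r - rC t.
Proof. by rewrite rCD rCN. Qed.
Lemma rCM r t : rC (r * t) = rC r * rC t.
Proof. by apply: Cx_eq; rewrite ?ReCM ?ImCM /= ?mulr0 ?mul0r ?subr0 ?addr0. Qed.
Lemma rCn n : rC (n%:R) = n%:R :> C.
Proof. by elim: n => [|n IH] //; rewrite -[n.+1]addn1 !natrD rCD IH. Qed.

Lemma modCE z : modC z = Num.sqrt (ReC z ^+ 2 + ImC z ^+ 2). Proof. by []. Qed.
Lemma modC_sqr z : modC z ^+ 2 = ReC z ^+ 2 + ImC z ^+ 2.
Proof. by rewrite modCE sqr_sqrtr // addr_ge0 // sqr_ge0. Qed.
Lemma modC_ge0 z : 0 <= modC z. Proof. exact: sqrtr_ge0. Qed.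
Lemma modC_norm z : `|z| = rC (modC z).
Proof. by rewrite [LHS](normc_def (z : R[i])). Qed.
Lemma rC_inj : injective (@rC R). Proof. by move=> r t []. Qed.
Lemma rC_le r t : (rC r <= rC t) = (r <= t).
Proof. exact: (lecR r t). Qed.
Lemma rC_lt r t : (rC r < rC t) = (r < t).
Proof. exact: (ltcR r t). Qed.

Lemma modC0 : modC (0 : C) = 0.
Proof. by apply: rC_inj; rewrite -modC_norm normr0. Qed.
Lemma modC1 : modC (1 : C) = 1.
Proof. by apply: rC_inj; rewrite -modC_norm normr1. Qed.
Lemma modCM x y : modC (x * y) = modC x * modC y.
Proof. by apply: rC_inj; rewrite rCM -!modC_norm normrM. Qed.
Lemma modCN x : modC (- x) = modC x.
Proof. by apply: rC_inj; rewrite -!modC_norm normrN. Qed.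
Lemma modC_eq0 x : (modC x == 0) = (x == 0).
Proof. by rewrite -(inj_eq rC_inj) -modC_norm normr_eq0. Qed.
Lemma modCD x y : modC (x + y) <= modC x + modC y.
Proof. by rewrite -rC_le rCD -!modC_norm ler_normD. Qed.
Lemma modCB x y : modC (x - y) <= modC x + modC y.
Proof. by rewrite -(modCN y) modCD. Qed.
Lemma modC_distC x y : modC (x - y) = modC (y - x).
Proof. by rewrite -modCN opprB. Qed.
Lemma modCV x : modC x^-1 = (modC x)^-1.
Proof.
have [->|x0] := eqVneq x 0; first by rewrite invr0 modC0 invr0.
have m0 : modC x != 0 by rewrite modC_eq0.
by apply: (mulfI m0); rewrite -modCM !divff // modC1.
Qed.
Lemma modCX x n : modC (x ^+ n) = modC x ^+ n.
Proof. by elim: n => [|n IH]; rewrite ?expr0 ?modC1 // !exprS modCM IH. Qed.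
Lemma modC_rC r : modC (rC r) = `|r|.
Proof. by rewrite modCE /= expr0n addr0 sqrtr_sqr. Qed.
Lemma modC_cj x : modC (cjC x) = modC x.
Proof. by case: x => a b; rewrite !modCE /= sqrrN. Qed.
Lemma modC_gt0 x : (0 < modC x) = (x != 0).
Proof. by rewrite lt_neqAle eq_sym modC_eq0 modC_ge0 andbT. Qed.
Lemma modCBge x y : modC x - modC y <= modC (x - y).
Proof. by rewrite lerBlDr -{1}(subrK y x) modCD. Qed.
Lemma Re_le_modC z : `|ReC z| <= modC z.
Proof. by rewrite -sqrtr_sqr modCE ler_wsqrtr // lerDl sqr_ge0. Qed.
Lemma Im_le_modC z : `|ImC z| <= modC z.
Proof. by rewrite -sqrtr_sqr modCE ler_wsqrtr // lerDr sqr_ge0. Qed.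
Lemma CxE z : z = rC (ReC z) + iC R * rC (ImC z).
Proof. by apply: Cx_eq; rewrite ?(ReCD, ImCD, ReCM, ImCM) /= !(mul0r, mulr0, mul1r, addr0, subr0, add0r). Qed.
Lemma modC_iC : modC (iC R) = 1.
Proof. by rewrite modCE /= expr0n expr1n add0r sqrtr1. Qed.
Lemma modC_leReIm z : modC z <= `|ReC z| + `|ImC z|.
Proof. by rewrite {1}(CxE z) (le_trans (modCD _ _)) // modCM modC_iC mul1r !modC_rC. Qed.
Lemma mulcj z : z * cjC z = rC (modC z ^+ 2).
Proof.
rewrite modC_sqr; apply: Cx_eq; rewrite ?ReCM ?ImCM; case: z => a b /=; first by rewrite mulrN opprK !expr2.
by rewrite mulrN mulrC addNr.
Qed.
Lemma cjCM x y : cjC (x * y) = cjC x * cjC y. Proof. exact: (rmorphM (@conjc R)). Qed.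
Lemma cjCB x y : cjC (x - y) = cjC x - cjC y. Proof. exact: (rmorphB (@conjc R)). Qed.
Lemma cjC1 : cjC (1 : C) = 1. Proof. exact: (rmorph1 (@conjc R)). Qed.
Lemma cjCK x : cjC (cjC x) = x. Proof. exact: conjcK. Qed.
Lemma cjC_rC r : cjC (rC r) = rC r. Proof. by apply: Cx_eq; rewrite /= ?oppr0. Qed.

Lemma modC_sum (I : Type) (s : seq I) (F : I -> C) :
  modC (\sum_(i <- s) F i) <= \sum_(i <- s) modC (F i).
Proof.
elim: s => [|i s IH]; first by rewrite !big_nil modC0.
by rewrite !big_cons (le_trans (modCD _ _)) // lerD2l.
Qed.

(** The parameter runs over a period of length 1, so an integral over [0, 1] is directly a mean over
    the circle. *)
Definition eC (y : R) : C := Complex (cos (2 * pi * y)) (sin (2 * pi * y)).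

Lemma modC_eC (y : R) : modC (eC y) = 1.
Proof. by rewrite modCE /= cos2Dsin2 sqrtr1. Qed.
Lemma eC_neq0 (y : R) : eC y != 0.
Proof. by rewrite -modC_gt0 modC_eC. Qed.
Lemma eC0 : eC 0 = 1.
Proof. by apply: Cx_eq; rewrite /= mulr0 ?cos0 ?sin0. Qed.
Lemma eCD (x y : R) : eC (x + y) = eC x * eC y.
Proof.
apply: Cx_eq; rewrite ?ReCM ?ImCM /= mulrDr ?cosD ?sinD //.
by rewrite addrC.
Qed.
Lemma eC1 : eC 1 = 1.
Proof. by apply: Cx_eq; rewrite /= mulr1 mulr_natl ?cos2pi ?sin2pi. Qed.
Lemma cj_eC (y : R) : cjC (eC y) = (eC y)^-1.
Proof.
apply: (mulfI (eC_neq0 y)); rewrite mulcj divff ?eC_neq0 //.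
by rewrite modC_eC expr1n.
Qed.

End ComplexBasics.

(** * Topology of the plane in terms of the real modulus *)

Section Continuity.
Variable R : realType.
Local Notation C := (Cx R).

(** The norm of [Cx R] takes values in [Cx R] itself, so balls have complex radii; a radius positive
    in the order of [R[i]] is real, and the topology can be described by the real number [modC]. *)
Lemma nbhsCxP (z : C) (P : C -> Prop) :
  nbhs z P <-> exists2 d : R, 0 < d & forall y, modC (y - z) < d -> P y.
Proof.
split.
  move=> /nbhs_normP[e /= e0 H].
  have eE : e = rC (ReC e).
    by apply: Cx_eq => //=; move: e0; rewrite ltcE /= => /andP[/eqP + _].
  have e0' : 0 < ReC e by rewrite -rC_lt -eE.
  exists (ReC e) => // y yz; apply: H => /=.
  by rewrite /= modC_norm eE rC_lt modC_distC.
move=> [d d0 H]; apply/nbhs_normP; exists (rC d); first by rewrite /= -[0]rC0 rC_lt.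
by move=> y /=; rewrite modC_norm rC_lt modC_distC; exact: H.
Qed.

Lemma cvgCxP T (F : set_system T) {FF : Filter F} (f : T -> C) (l : C) :
  f @ F --> l <-> forall e : R, 0 < e -> \forall x \near F, modC (f x - l) < e.
Proof.
split.
  move=> H e e0; apply: (H [set y | modC (y - l) < e]).
  by apply/nbhsCxP; exists e.
move=> H P /nbhsCxP [d d0 dP].
by have := H d d0; apply: filterS => x /= /dP.
Qed.

Lemma continuous_rC : continuous (@rC R : R -> C).
Proof.
move=> x; apply/cvgCxP => e e0; near=> y.
rewrite -rCB modC_rC; near: y.
by have /cvgrPdistC_lt := @cvg_id _ (nbhs x); apply.
Unshelve. all: by end_near. Qed.

Lemma continuous_ReC : continuous (@ReC R).
Proof.
move=> x; apply/(@cvgrPdistC_lt _ _ _ (nbhs x) (nbhs_filter x)) => e e0.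
apply/nbhsCxP; exists e => // y; apply: le_lt_trans.
by rewrite -ReCN -ReCD Re_le_modC.
Qed.

Lemma continuous_ImC : continuous (@ImC R).
Proof.
move=> x; apply/(@cvgrPdistC_lt _ _ _ (nbhs x) (nbhs_filter x)) => e e0.
apply/nbhsCxP; exists e => // y; apply: le_lt_trans.
by rewrite -ImCN -ImCD Im_le_modC.
Qed.

Lemma continuous_modC : continuous (@modC R).
Proof.
move=> x; apply/(@cvgrPdistC_lt _ _ _ (nbhs x) (nbhs_filter x)) => e e0.
apply/nbhsCxP; exists e => // y; apply: le_lt_trans.
by rewrite ler_norml modCBge andbT lerNl opprB (le_trans (modCBge _ _)) // modC_distC.
Qed.

Lemma cvg_Complex T (F : set_system T) {FF : Filter F} (f g : T -> R) (a b : R) :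
  f @ F --> a -> g @ F --> b -> (fun x => Complex (f x) (g x) : C) @ F --> (Complex a b : C).
Proof.
move=> fa gb; apply/cvgCxP => e e0; near=> x.
apply: (le_lt_trans (modC_leReIm _)); rewrite !(ReCD, ReCN, ImCD, ImCN) /=.
rewrite [ltRHS](splitr e) ltrD //; near: x.
  by have /cvgrPdistC_lt := fa; apply; rewrite divr_gt0.
by have /cvgrPdistC_lt := gb; apply; rewrite divr_gt0.
Unshelve. all: by end_near. Qed.

Lemma continuous_eC : continuous (@eC R : R -> C).
Proof.
have h x : (fun y : R => 2 * pi * y) @ x --> 2 * pi * x.
  by apply: cvgM; [exact: cvg_cst|exact: cvg_id].
move=> x; apply: cvg_Complex.
  by apply: (cvg_comp _ _ (h x)); exact: continuous_cos.
by apply: (cvg_comp _ _ (h x)); exact: continuous_sin.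
Qed.

End Continuity.

(** * Integrals of real and complex functions over segments *)

Notation leb R := (@lebesgue_measure R).
Definition rint (R : realType) (a b : R) (g : R -> R) : R :=
  (\int[leb R]_(x in `[a, b]) g x)%R.
Definition cint (R : realType) (a b : R) (u : R -> Cx R) : Cx R :=
  Complex (rint a b (fun x => ReC (u x))) (rint a b (fun x => ImC (u x))).
(** Two-sided continuity at every point of the segment, endpoints included, is stronger than
    continuity of the restriction; it composes without any bookkeeping of subspace topologies. *)
Definition cont_on (R : realType) (T : topologicalType) (a b : R) (u : R -> T) :=
  forall x, a <= x <= b -> {for x, continuous u}.

Section Integral.
Variable R : realType.
Local Notation C := (Cx R).
Implicit Types (a b : R) (g h : R -> R) (u v : R -> C).

Lemma cont_on_within a b g : cont_on a b g -> {within `[a, b], continuous g}.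
Proof.
move=> gc; apply: continuous_in_subspaceT => x; rewrite inE /= in_itv /=; exact: gc.
Qed.

Lemma cont_on_integrable a b g : cont_on a b g ->
  (leb R).-integrable `[a, b] (EFin \o g).
Proof.
move=> gc; apply: continuous_compact_integrable; first exact: segment_compact.
exact: cont_on_within.
Qed.

Lemma cont_onS (T : topologicalType) a b c d (u : R -> T) : a <= c -> d <= b -> cont_on a b u -> cont_on c d u.
Proof. by move=> ac db H x /andP[cx xd]; apply: H; rewrite (le_trans ac cx) (le_trans xd db). Qed.

Lemma continuous_cont_on (T : topologicalType) a b (u : R -> T) : continuous u -> cont_on a b u.
Proof. by move=> H x _; exact: H. Qed.

Lemma cont_onRe a b u : cont_on a b u -> cont_on a b (fun x => ReC (u x)).
Proof. by move=> H x /H uc; apply: (continuous_comp uc); exact: continuous_ReC. Qed.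
Lemma cont_onIm a b u : cont_on a b u -> cont_on a b (fun x => ImC (u x)).
Proof. by move=> H x /H uc; apply: (continuous_comp uc); exact: continuous_ImC. Qed.
Lemma cont_on_modC a b u : cont_on a b u -> cont_on a b (fun x => modC (u x)).
Proof. by move=> H x /H uc; apply: (continuous_comp uc); exact: continuous_modC. Qed.

Lemma cont_onD a b u v : cont_on a b u -> cont_on a b v -> cont_on a b (fun x => u x + v x).
Proof. by move=> H K x /[dup] /H cu /K cv; exact: (cvgD cu cv). Qed.
Lemma cont_onN a b u : cont_on a b u -> cont_on a b (fun x => - u x).
Proof. by move=> H x /H cu; exact: (cvgN cu). Qed.
Lemma cont_onB a b u v : cont_on a b u -> cont_on a b v -> cont_on a b (fun x => u x - v x).
Proof. by move=> H K; apply: (cont_onD H); apply: cont_onN; exact: K. Qed.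
Lemma cont_onM a b u v : cont_on a b u -> cont_on a b v -> cont_on a b (fun x => u x * v x).
Proof. by move=> H K x /[dup] /H cu /K cv; exact: (cvgM cu cv). Qed.
Lemma cont_onV a b u : (forall x, a <= x <= b -> u x != 0) -> cont_on a b u ->
  cont_on a b (fun x => (u x)^-1).
Proof. by move=> u0 H x /[dup] /u0 ux /H cu; exact: (cvgV ux cu). Qed.
Lemma cont_onX a b u n : cont_on a b u -> cont_on a b (fun x => u x ^+ n).
Proof.
move=> H; elim: n => [|n IH].
  by under [fun _ => _]eq_fun do rewrite expr0; apply: continuous_cont_on => x; exact: cvg_cst.
under [fun _ => _]eq_fun do rewrite exprS; exact: cont_onM.
Qed.
Lemma cont_on_cst (T : topologicalType) a b (k : T) : cont_on a b (fun _ : R => k).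
Proof. by move=> x _; exact: cvg_cst. Qed.
Lemma cont_on_comp a b (T U : topologicalType) (u : R -> T) (f : T -> U) :
  cont_on a b u -> (forall x, a <= x <= b -> {for u x, continuous f}) -> cont_on a b (fun x => f (u x)).
Proof. by move=> H K x /[dup] /H cu /K; exact: continuous_comp. Qed.

Lemma rintD a b g h : cont_on a b g -> cont_on a b h ->
  rint a b (fun x => g x + h x) = rint a b g + rint a b h.
Proof. by move=> gc hc; rewrite /rint RintegralD //; exact: cont_on_integrable. Qed.
Lemma rintZ a b k g : cont_on a b g -> rint a b (fun x => k * g x) = k * rint a b g.
Proof. by move=> gc; rewrite /rint RintegralZl //; exact: cont_on_integrable. Qed.
Lemma rintB a b g h : cont_on a b g -> cont_on a b h ->
  rint a b (fun x => g x - h x) = rint a b g - rint a b h.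
Proof. by move=> gc hc; rewrite /rint RintegralB //; exact: cont_on_integrable. Qed.
Lemma eq_rint a b g h : (forall x, a <= x <= b -> g x = h x) -> rint a b g = rint a b h.
Proof. by move=> gh; apply: eq_Rintegral => x; rewrite inE /= in_itv /=; exact: gh. Qed.
Lemma le_rint a b g h : cont_on a b g -> cont_on a b h ->
  (forall x, a <= x <= b -> g x <= h x) -> rint a b g <= rint a b h.
Proof.
move=> gc hc gh; apply: le_Rintegral => //; first exact: cont_on_integrable.
  exact: cont_on_integrable.
Qed.
Lemma rint_cst a b k : a <= b -> rint a b (fun=> k) = k * (b - a).
Proof.
move=> ab; rewrite /rint Rintegral_cst //= lebesgue_measure_itv /= lte_fin.
by move: ab; rewrite le_eqVlt => /predU1P[->|->] //; rewrite ltxx subrr.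
Qed.
Lemma le_abs_rint a b g : cont_on a b g -> `|rint a b g| <= rint a b (fun x => `|g x|).
Proof. by move=> gc; apply: le_normr_Rintegral => //; exact: cont_on_integrable. Qed.
Lemma rint_ge0 a b g : (forall x, a <= x <= b -> 0 <= g x) -> 0 <= rint a b g.
Proof. by move=> g0; apply: Rintegral_ge0 => x /=; rewrite in_itv /=; exact: g0. Qed.
Lemma rint_split a c b g : a <= c <= b -> cont_on a b g ->
  rint a b g = rint a c g + rint c b g.
Proof.
move=> /andP[ac cb] gc.
have := @Rintegral_itvB R g (BLeft a) (BRight b) c (cont_on_integrable gc).
rewrite !bnd_simp => /(_ ac cb) H; apply/eqP; rewrite addrC -subr_eq /rint H.
apply/eqP; apply: Rintegral_itv_obnd_cbnd.
apply: integrableS (cont_on_integrable gc) => //.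
by apply: subset_itvr; rewrite bnd_simp.
Qed.

Lemma cintD a b u v : cont_on a b u -> cont_on a b v ->
  cint a b (fun x => u x + v x) = cint a b u + cint a b v.
Proof.
move=> uc vc; apply: Cx_eq; rewrite ?ReCD ?ImCD /= -rintD; try exact: cont_onRe; try exact: cont_onIm.
  by apply: eq_rint => x _; rewrite ReCD.
by apply: eq_rint => x _; rewrite ImCD.
Qed.
Lemma cintZ a b k u : cont_on a b u -> cint a b (fun x => k * u x) = k * cint a b u.
Proof.
move=> uc.
have cr : cont_on a b (fun x => ReC (u x)) by exact: cont_onRe.
have ci : cont_on a b (fun x => ImC (u x)) by exact: cont_onIm.
have sc (m : R) (g : R -> R) : cont_on a b g -> cont_on a b (fun x => m * g x).
  by move=> gc x /gc H; apply: cvgM => //; exact: cvg_cst.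
apply: Cx_eq.
  rewrite ReCM /= -(rintZ _ cr) -(rintZ _ ci) -rintB; [|exact: sc|exact: sc].
  by apply: eq_rint => x _; rewrite ReCM.
rewrite ImCM /= -(rintZ _ cr) -(rintZ _ ci) -rintD; [|exact: sc|exact: sc].
by apply: eq_rint => x _; rewrite ImCM.
Qed.
Lemma eq_cint a b u v : (forall x, a <= x <= b -> u x = v x) -> cint a b u = cint a b v.
Proof. by move=> uv; apply: Cx_eq => /=; apply: eq_rint => x /uv ->. Qed.
Lemma cintN a b u : cont_on a b u -> cint a b (fun x => - u x) = - cint a b u.
Proof.
by move=> uc; rewrite -mulN1r -cintZ //; apply: eq_cint => x _; rewrite mulN1r.
Qed.
Lemma cintB a b u v : cont_on a b u -> cont_on a b v ->
  cint a b (fun x => u x - v x) = cint a b u - cint a b v.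
Proof. by move=> uc vc; rewrite (cintD uc (cont_onN vc)) (cintN vc). Qed.
Lemma cint_split a c b u : a <= c <= b -> cont_on a b u ->
  cint a b u = cint a c u + cint c b u.
Proof.
move=> acb uc; apply: Cx_eq; rewrite ?ReCD ?ImCD /=; apply: rint_split => //.
  exact: cont_onRe.
exact: cont_onIm.
Qed.
Lemma cint_cst a b k : a <= b -> cint a b (fun=> k) = k * rC (b - a).
Proof. by move=> ab; apply: Cx_eq; rewrite ?ReCM ?ImCM /= (rint_cst _ ab) mulr0 ?subr0 ?add0r. Qed.

(** The factor 2 comes from estimating real and imaginary parts separately; it recurs in later
    bounds and is harmless, since only comparability is claimed in the end. *)
Lemma modC_cint a b u : cont_on a b u ->
  modC (cint a b u) <= 2 * rint a b (fun x => modC (u x)).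
Proof.
move=> uc; apply: (le_trans (modC_leReIm _)) => /=.
have cm := cont_on_modC uc; have cr := cont_onRe uc; have ci := cont_onIm uc.
have ca (g : R -> R) : cont_on a b g -> cont_on a b (fun x => `|g x|).
  by move=> gc x /gc H; apply: continuous_comp H _; exact: norm_continuous.
rewrite mulr_natl mulr2n lerD // (le_trans (le_abs_rint _)) // le_rint //; try exact: ca.
  by move=> x _; exact: Re_le_modC.
by move=> x _; exact: Im_le_modC.
Qed.

Lemma modC_cint_le a b u (M : R) : a <= b -> cont_on a b u ->
  (forall x, a <= x <= b -> modC (u x) <= M) -> modC (cint a b u) <= 2 * M * (b - a).
Proof.
move=> ab uc uM; apply: (le_trans (modC_cint uc)).
rewrite -mulrA ler_pM2l // -rint_cst // le_rint //; first exact: cont_on_modC.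
exact: cont_on_cst.
Qed.

(** Derivative of a curve with real parameter, taken on the two coordinates so that the real
    fundamental theorem of calculus applies to each. *)
Definition cder (u : R -> C) (x : R) (d : C) :=
  is_derive x 1 (fun x => ReC (u x)) (ReC d) /\ is_derive x 1 (fun x => ImC (u x)) (ImC d).

Lemma cder_cst k x : cder (fun=> k) x 0.
Proof. by split; exact: is_derive_cst. Qed.
Lemma cderD u v x du dv : cder u x du -> cder v x dv -> cder (fun x => u x + v x) x (du + dv).
Proof.
move=> [a1 b1] [a2 b2]; rewrite /cder ReCD ImCD; split.
  under [fun _ => _]eq_fun do rewrite ReCD; exact: is_deriveD.
under [fun _ => _]eq_fun do rewrite ImCD; exact: is_deriveD.
Qed.
Lemma cderM u v x du dv : cder u x du -> cder v x dv ->
  cder (fun x => u x * v x) x (du * v x + u x * dv).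
Proof.
move=> [a1 b1] [a2 b2]; rewrite /cder ReCD ImCD !ReCM !ImCM; split.
  under [fun _ => _]eq_fun do rewrite ReCM.
  apply: (@is_derive_eq _ _ _ _ _ _ _ _ (is_deriveB (is_deriveM a1 a2) (is_deriveM b1 b2))).
  by rewrite /GRing.scale /=; ring.
under [fun _ => _]eq_fun do rewrite ImCM.
apply: (@is_derive_eq _ _ _ _ _ _ _ _ (is_deriveD (is_deriveM a1 b2) (is_deriveM b1 a2))).
by rewrite /GRing.scale /=; ring.
Qed.
Lemma cder_rC x : cder (@rC R) x 1.
Proof. by split; [exact: is_derive_id|exact: is_derive_cst]. Qed.
Lemma cder_eC x : cder (@eC R) x (rC (2 * pi) * iC R * eC x).
Proof.
have h : is_derive x 1 (fun y : R => 2 * pi * y) (2 * pi).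
  apply: (@is_derive_eq _ _ _ _ _ _ _ _ (is_deriveM (is_derive_cst (2 * pi : R) x 1) (is_derive_id x 1))).
  by rewrite /GRing.scale /=; ring.
rewrite /cder !(ReCM, ImCM) /=; split.
  apply: (@is_derive_eq _ _ _ _ _ _ _ _ (@is_derive1_comp _ cos (fun y => 2 * pi * y) x _ _ (is_derive_cos _) h)).
  by rewrite /GRing.scale /=; ring.
apply: (@is_derive_eq _ _ _ _ _ _ _ _ (@is_derive1_comp _ sin (fun y => 2 * pi * y) x _ _ (is_derive_sin _) h)).
by rewrite /GRing.scale /=; ring.
Qed.

Lemma cder_eq u x d d' : cder u x d -> d = d' -> cder u x d'.
Proof. by move=> h <-. Qed.

Lemma rint_FTC a b g G : a <= b -> cont_on a b g ->
  (forall x, a <= x <= b -> is_derive x 1 G (g x)) -> rint a b g = G b - G a.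
Proof.
rewrite le_eqVlt => /predU1P[<-|ab] gc dG.
  by rewrite /rint set_itv1 Rintegral_set1 subrr.
rewrite /rint /Rintegral (@continuous_FTC2 _ g G) //.
  exact: cont_on_within.
- have cG x : a <= x <= b -> {for x, continuous G}.
    by move=> /dG [dGx _]; apply: differentiable_continuous; exact/derivable1_diffP.
  split.
  + by move=> x; rewrite in_itv /= => /andP[/ltW ax /ltW xb]; have [] := dG x; rewrite ?ax ?xb.
  + by apply: cvg_at_right_filter; apply: cG; rewrite lexx ltW.
  + by apply: cvg_at_left_filter; apply: cG; rewrite lexx ltW.
- move=> x; rewrite in_itv /= => /andP[/ltW ax /ltW xb].
  by rewrite derive1E; have [] := dG x; rewrite ?ax ?xb.
Qed.

Lemma cint_FTC a b u U : a <= b -> cont_on a b u ->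
  (forall x, a <= x <= b -> cder U x (u x)) -> cint a b u = U b - U a.
Proof.
move=> ab uc dU; apply: Cx_eq; rewrite ?ReCD ?ImCD ?ReCN ?ImCN /=.
  apply: (@rint_FTC a b _ (fun x => ReC (U x))) => //; first exact: cont_onRe.
  by move=> x /dU [].
apply: (@rint_FTC a b _ (fun x => ImC (U x))) => //; first exact: cont_onIm.
by move=> x /dU [].
Qed.

End Integral.

(** * Complex differentiability with real error bounds *)

Section Cdiff.
Variable R : realType.
Local Notation C := (Cx R).

(** The division-free form of the complex derivative suits the estimates below; [cdiff_derive1] and
    [derivable_cdiff] show that it agrees with [derive1]. *)
Definition cdiff (f : C -> C) (z d : C) := forall e : R, 0 < e -> exists2 r : R, 0 < r &
  forall w, modC (w - z) < r -> modC (f w - f z - d * (w - z)) <= e * modC (w - z).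

Lemma cdiff_derive1 (f : C -> C) (z d : C) : cdiff f z d -> derivable f z 1 /\ derive1 f z = d.
Proof.
move=> fd.
have H : (fun h : C => h^-1 *: (f (h + z) - f z)) @ 0^' --> d.
  apply/(@cvgCxP _ _ _ (dnbhs_filter (0:C))) => e e0.
  have e20 : 0 < e / 2 by rewrite divr_gt0.
  have [r r0 fr] := fd _ e20.
  apply/nbhsCxP; exists r => // h; rewrite subr0 => hr h0.
  have hm : 0 < modC h by rewrite modC_gt0.
  have -> : h^-1 *: (f (h + z) - f z) - d = h^-1 * (f (h + z) - f z - d * (h + z - z)).
    by rewrite addrK /GRing.scale /=; field.
  rewrite modCM modCV mulrC ltr_pdivrMr //.
  apply: le_lt_trans (fr _ _) _; rewrite addrK // ltr_pM2r //.
  by rewrite ltr_pdivrMr // mulr_natr mulr2n ltrDl.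
rewrite derive1E /derive /derivable.
have -> : (fun h : C => h^-1 *: ((f \o shift z) (h *: 1) - f z)) = (fun h : C => h^-1 *: (f (h + z) - f z)).
  by apply/funext => h /=; rewrite [h *: _]mulr1.
split; first by apply/cvg_ex; exists d.
exact: (@cvg_lim C (@norm_hausdorff _ _) _ _ _ _ _ H).
Qed.

Lemma derivable_cdiff (f : C -> C) (z : C) : derivable f z 1 -> cdiff f z (derive1 f z).
Proof.
move=> df.
have H : (fun h : C => h^-1 *: (f (h + z) - f z)) @ 0^' --> derive1 f z.
  have -> : (fun h : C => h^-1 *: (f (h + z) - f z)) = (fun h : C => h^-1 *: ((f \o shift z) (h *: 1) - f z)).
    by apply/funext => h /=; rewrite [h *: _]mulr1.
  by rewrite derive1E /derive; exact: df.
move=> e e0.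
have /(@cvgCxP _ _ _ (dnbhs_filter (0:C))) /(_ e e0) /nbhsCxP [r r0 fr] := H.
exists r => // w wr.
have [->|wz] := eqVneq w z; first by rewrite !subrr mulr0 subrr modC0 mulr0.
have wz0 : w - z != 0 by rewrite subr_eq0.
have := fr (w - z); rewrite subr0 subrK => /(_ wr wz0) /ltW h.
have -> : f w - f z - derive1 f z * (w - z) = ((w - z)^-1 *: (f w - f z) - derive1 f z) * (w - z).
  by rewrite mulrBl /GRing.scale /= mulrAC mulVf // mul1r.
by rewrite modCM ler_wpM2r // modC_ge0.
Qed.

Lemma cdiff_continuous (f : C -> C) (z d : C) : cdiff f z d -> {for z, continuous f}.
Proof.
move=> /cdiff_derive1 [df _].
by apply: differentiable_continuous; apply/derivable1_diffP.
Qed.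

End Cdiff.

(** * Goursat's theorem on a parametrised square *)

Section Goursat.
Variable R : realType.
Local Notation C := (Cx R).

(* Bisection: a quarter of the square carries at least a quarter of the value; the nested squares shrink to a point. *)
Lemma additive_square_eq0 (P : R -> R -> R -> C) :
  (forall x y h : R, 0 <= x -> 0 <= y -> 0 < h -> x + 2 * h <= 1 -> y + 2 * h <= 1 ->
    P x y (2 * h) = P x y h + P (x + h) y h + P x (y + h) h + P (x + h) (y + h) h) ->
  (forall a b : R, 0 <= a <= 1 -> 0 <= b <= 1 -> forall e : R, 0 < e -> exists2 d : R, 0 < d &
    forall x y h : R, 0 <= x -> 0 <= y -> x + h <= 1 -> y + h <= 1 -> 0 < h -> h < d ->
      x <= a <= x + h -> y <= b <= y + h -> modC (P x y h) <= e * h ^+ 2) ->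
  P 0 0 1 = 0.
Proof.
move=> Padd Ploc; apply/eqP; rewrite -modC_eq0; apply/negPn/negP => P0.
set m := modC (P 0 0 1) in P0 *.
have m0 : 0 < m by rewrite lt_neqAle eq_sym P0 modC_ge0.
pose hk k : R := 2^-1 ^+ k.
have hk0 k : 0 < hk k by rewrite exprn_gt0 // invr_gt0.
have hkS k : hk k = 2 * hk k.+1 by rewrite /hk exprS mulrA divff ?mul1r // pnatr_eq0.
(* The invariant of the bisection: the square of side 2^-k at p stays in the unit square and still
   carries its share, proportional to area, of the value on the unit square. *)
pose Q k (p : R * R) := [/\ 0 <= p.1, 0 <= p.2, p.1 + hk k <= 1, p.2 + hk k <= 1 &
   m * hk k ^+ 2 <= modC (P p.1 p.2 (hk k))].
(* The successor is chosen as a total function of level and corner; where [Q] fails any value will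
   do. *)
have step (kp : nat * (R * R)) : exists p', Q kp.1 kp.2 ->
    [/\ Q kp.1.+1 p', kp.2.1 <= p'.1 <= kp.2.1 + hk kp.1.+1 & kp.2.2 <= p'.2 <= kp.2.2 + hk kp.1.+1].
  case: kp => k [x y] /=.
  have [q|nq] := pselect (Q k (x, y)); last by exists 0 => /nq.
  case: q => /= x0 y0 x1 y1; set h := hk k.+1; rewrite (hkS k) -/h in x1 y1 * => Pm.
  have h0 : 0 < h := hk0 _.
  rewrite (Padd _ _ _ x0 y0 h0 x1 y1) in Pm.
  have [p1 [p2 [px py Pp]]] : exists p1 p2, [/\ p1 = x \/ p1 = x + h, p2 = y \/ p2 = y + h &
      m * h ^+ 2 <= modC (P p1 p2 h)].
    (* If all four quarters were below m h^2, their sum would be below 4 m h^2 = m (2 h)^2. *)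
    apply: contrapT => nE.
    have ub p1 p2 : (p1 = x \/ p1 = x + h) -> (p2 = y \/ p2 = y + h) -> modC (P p1 p2 h) < m * h ^+ 2.
      by move=> a b; rewrite ltNge; apply/negP => c; apply: nE; exists p1, p2.
    have u1 := ub x y (or_introl erefl) (or_introl erefl).
    have u2 := ub (x + h) y (or_intror erefl) (or_introl erefl).
    have u3 := ub x (y + h) (or_introl erefl) (or_intror erefl).
    have u4 := ub (x + h) (y + h) (or_intror erefl) (or_intror erefl).
    have t1 := modCD (P x y h + P (x + h) y h + P x (y + h) h) (P (x + h) (y + h) h).
    have t2 := modCD (P x y h + P (x + h) y h) (P x (y + h) h).
    have t3 := modCD (P x y h) (P (x + h) y h).
    have : m * (2 * h) ^+ 2 = 4 * (m * h ^+ 2) by ring.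
    lra.
  exists (p1, p2) => _ /=.
  by case: px Pp => ->; case: py => -> Pp; (split; [split|..]) => //=; rewrite -/h; lra.
have [f Hf] := choice step.
pose s := fix s k := if k is k'.+1 then f (k', s k') else (0 : R * R).
have Qs k : Q k (s k).
  elim: k => [|k IH]; last by have [] := Hf (k, s k) IH.
  by split; rewrite /= /hk ?expr0 ?addr0 ?add0r // expr1n mulr1.
have ns1 k : (s k).1 <= (s k.+1).1 <= (s k).1 + hk k.+1 by have [] := Hf (k, s k) (Qs k).
have ns2 k : (s k).2 <= (s k.+1).2 <= (s k).2 + hk k.+1 by have [] := Hf (k, s k) (Qs k).
(* The left ends increase and stay below every right end, so their supremum lies in all the
   intervals. *)
have nest (u : nat -> R) : (forall k, u k <= u k.+1 <= u k + hk k.+1) -> exists a, forall k, u k <= a <= u k + hk k.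
  move=> nu.
  have up k j : u k <= u (k + j)%N.
    by elim: j => [|j IH]; rewrite ?addn0 // addnS (le_trans IH) //; case/andP: (nu (k + j)%N).
  have dn k j : u (k + j)%N + hk (k + j)%N <= u k + hk k.
    elim: j => [|j IH]; rewrite ?addn0 // addnS (le_trans _ IH) // [in leRHS]hkS.
    case/andP: (nu (k + j)%N) => _; lra.
  have ub k j : u j <= u k + hk k.
    rewrite (le_trans (up j k)) // addnC (le_trans _ (dn k j)) // lerDl ltW //.
  have su : has_sup (range u).
    by split; [exists (u 0%N), 0%N|exists (u 0%N + hk 0%N) => _ [j _ <-]].
  exists (sup (range u)) => k; apply/andP; split.
    by apply: ub_le_sup; [case: su|exists k].
  by apply: ge_sup; [case: su|move=> _ [j _ <-]].
have [a Ha] := nest _ ns1; have [b Hb] := nest _ ns2.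
have a01 : 0 <= a <= 1.
  by have [q1 q2 q3 q4 q5] := Qs 0%N; move: (Ha 0%N) => /andP[h1 h2]; rewrite (le_trans q1 h1) (le_trans h2 q3).
have b01 : 0 <= b <= 1.
  by have [q1 q2 q3 q4 q5] := Qs 0%N; move: (Hb 0%N) => /andP[h1 h2]; rewrite (le_trans q2 h1) (le_trans h2 q4).
(* With tolerance m/2 the local bound contradicts [Q] on a small enough square around the limit
   point (a, b). *)
have m20 : 0 < m / 2 by rewrite divr_gt0.
have [d d0 Hd] := Ploc _ _ a01 b01 _ m20.
have [k hkd] : exists k, hk k < d.
  have : (hk : nat -> R) @ \oo --> (0 : R).
    by apply: cvg_expr; rewrite ger0_norm ?invr_ge0 // invf_lt1 // ltr1n.
  move=> /cvgrPdist_lt /(_ d d0) [N _ HN]; exists N.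
  by have := HN N (leqnn N); rewrite /= sub0r normrN ger0_norm // ltW.
have [q1 q2 q3 q4 q5] := Qs k.
have := Hd _ _ _ q1 q2 q3 q4 (hk0 k) hkd (Ha k) (Hb k).
move=> q6; have := le_trans q5 q6.
by rewrite ler_pM2r ?exprn_gt0 //; lra.
Qed.

(** The affine part has the primitive A w + B (w - z0)^2 / 2, which the fundamental theorem
    integrates along the curve; what is left is the error, of size M times the speed bound L. *)
Lemma curve_integral_approx (a b M L : R) (u du : R -> C) (phi : C -> C) (A B z0 : C) :
  a <= b -> cont_on a b du -> cont_on a b u -> (forall x, a <= x <= b -> cder u x (du x)) ->
  (forall x, a <= x <= b -> modC (du x) <= L) ->
  (forall x, a <= x <= b -> {for u x, continuous phi}) ->
  (forall x, a <= x <= b -> modC (phi (u x) - (A + B * (u x - z0))) <= M) ->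
  modC (cint a b (fun x => phi (u x) * du x) -
    ((A * u b + B * (u b - z0) ^+ 2 / 2) - (A * u a + B * (u a - z0) ^+ 2 / 2))) <= 2 * (M * L) * (b - a).
Proof.
move=> ab cdu cu du_ duL cphi HM.
have cc : forall k : C, cont_on a b (fun=> k) by move=> k; exact: cont_on_cst.
have cuz : cont_on a b (fun x => u x - z0) by apply: (cont_onB cu); exact: cc.
have caff : cont_on a b (fun x => A + B * (u x - z0)).
  by apply: (cont_onD (cc A)); apply: (cont_onM (cc B)); exact: cuz.
have cph : cont_on a b (fun x => phi (u x)) by exact: (@cont_on_comp R a b _ _ u phi cu cphi).
have ciA : cont_on a b (fun x => (A + B * (u x - z0)) * du x) by exact: (cont_onM caff cdu).
have FTC := @cint_FTC R a b (fun x => (A + B * (u x - z0)) * du x)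
  (fun x => A * u x + B * (u x - z0) ^+ 2 / 2) ab ciA.
rewrite -FTC.
  rewrite -cintB; [|exact: (cont_onM cph cdu)|exact: ciA].
  apply: modC_cint_le; [exact: ab| |].
    by apply: cont_onB; [exact: (cont_onM cph cdu)|exact: ciA].
  move=> x xab; rewrite -mulrBl modCM ler_pM ?modC_ge0 //; [exact: HM|exact: duL].
move=> x /du_ cx.
have h1 := cderM (cder_cst A x) cx.
have h2 := cderD cx (cder_cst (- z0) x).
have h3 := cderM (cderM (cder_cst B x) (cderM h2 h2)) (cder_cst (2^-1) x).
apply: (cder_eq (cderD h1 h3)).
have n2 : (2 : C) != 0 by rewrite pnatr_eq0.
by field.
Qed.

(** Integral of [phi] along the image under [g] of the boundary of the square with corner (x, y) and
    side h, pulled back to the parameters and oriented counterclockwise; [gx] and [gy] stand for the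
    partial derivatives of [g]. *)
Definition loop_sum (g gx gy : R -> R -> C) (phi : C -> C) (x y h : R) : C :=
  let V t := cint y (y + h) (fun s => phi (g t s) * gy t s) in
  let H s := cint x (x + h) (fun t => phi (g t s) * gx t s) in
  V (x + h) - V x - H (y + h) + H y.

(** A parametrised square, unlike a triangle in the plane, gives a loop theorem that applies at once
    to the region between two circles. The loop sum is additive under bisection; near a point [phi]
    is affine up to o(distance), the affine part integrates to zero around the loop, and the error
    is o(h^2). *)
Lemma Goursat (g gx gy : R -> R -> C) (phi : C -> C) (L : R) :
  (forall t s, cder (g ^~ s) t (gx t s)) -> (forall t s, cder (g t) s (gy t s)) ->
  (forall s, continuous (gx ^~ s)) -> (forall t, continuous (gy t)) ->
  (forall s, continuous (g ^~ s)) -> (forall t, continuous (g t)) ->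
  (forall t s : R, 0 <= t <= 1 -> 0 <= s <= 1 -> modC (gx t s) <= L) ->
  (forall t s : R, 0 <= t <= 1 -> 0 <= s <= 1 -> modC (gy t s) <= L) ->
  (forall t s : R, 0 <= t <= 1 -> 0 <= s <= 1 -> exists d, cdiff phi (g t s) d) ->
  loop_sum g gx gy phi 0 0 1 = 0.
Proof.
move=> dgx dgy cgx cgy cg1 cg2 Lx Ly dphi.
have cphi t s : 0 <= t <= 1 -> 0 <= s <= 1 -> {for g t s, continuous phi}.
  by move=> t01 s01; have [d /cdiff_continuous] := dphi t s t01 s01.
have L0 : 0 <= L by apply: le_trans (Lx 0 0 _ _); rewrite ?modC_ge0 // lexx ler01.
have cV t y z : 0 <= t <= 1 -> 0 <= y -> z <= 1 -> cont_on y z (fun s => phi (g t s) * gy t s).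
  move=> t01 y0 z1; apply: cont_onM; last exact: continuous_cont_on.
  apply: cont_on_comp; first exact: continuous_cont_on.
  by move=> s /andP[ys sz]; apply: cphi => //; rewrite (le_trans y0 ys) (le_trans sz z1).
have cH s y z : 0 <= s <= 1 -> 0 <= y -> z <= 1 -> cont_on y z (fun t => phi (g t s) * gx t s).
  move=> s01 y0 z1; apply: cont_onM; last by apply: continuous_cont_on; exact: cgx.
  apply: cont_on_comp; first by apply: continuous_cont_on; exact: cg1.
  by move=> t /andP[yt tz]; apply: cphi => //; rewrite (le_trans y0 yt) (le_trans tz z1).
apply: (@additive_square_eq0 (loop_sum g gx gy phi)).
  move=> x y h x0 y0 h0 x1 y1; rewrite /loop_sum.
  have -> : x + h + h = x + 2 * h by ring.
  have -> : y + h + h = y + 2 * h by ring.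
  have sp1 t : 0 <= t <= 1 -> cint y (y + 2 * h) (fun s => phi (g t s) * gy t s) =
     cint y (y + h) (fun s => phi (g t s) * gy t s) + cint (y + h) (y + 2 * h) (fun s => phi (g t s) * gy t s).
    by move=> t01; apply: cint_split; [lra|exact: cV].
  have sp2 s : 0 <= s <= 1 -> cint x (x + 2 * h) (fun t => phi (g t s) * gx t s) =
     cint x (x + h) (fun t => phi (g t s) * gx t s) + cint (x + h) (x + 2 * h) (fun t => phi (g t s) * gx t s).
    by move=> t01; apply: cint_split; [lra|exact: cH].
  rewrite !sp1 ?sp2; try (apply/andP; split; lra).
  by ring.
move=> a b a01 b01 e e0.
have [B dB] := dphi a b a01 b01.
(* The four sides contribute at most 4 times 2 (e1 4 L h L) h = 32 L^2 e1 h^2; the added 1 covers L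
   = 0. *)
pose e1 := e / (32 * L ^+ 2 + 1).
have D0 : 0 < 32 * L ^+ 2 + 1 by rewrite ltr_wpDl // mulr_ge0 // sqr_ge0.
have e10 : 0 < e1 by rewrite divr_gt0.
have [r r0 Hr] := dB _ e10.
exists (r / (4 * L + 1)); first by rewrite divr_gt0 // ltr_wpDl // mulr_ge0.
move=> x y h x0 y0 x1 y1 h0; rewrite ltr_pdivlMr ?ltr_wpDl ?mulr_ge0 // => hr ax by_.
have [a1 a2] := andP ax; have [b1 b2] := andP by_.
have lipy (t s s' : R) : 0 <= t <= 1 -> 0 <= s <= 1 -> 0 <= s' <= 1 -> modC (g t s - g t s') <= 2 * L * `|s - s'|.
  move=> t01; wlog ss : s s' / s' <= s.
    move=> W s01 s'01; have [/W|/ltW /W] := leP s' s; first exact.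
    by rewrite modC_distC distrC; exact.
  move=> /andP[s0 s1] /andP[s'0 s'1].
  rewrite -(@cint_FTC _ s' s (gy t) (g t)) // ?ger0_norm ?subr_ge0 //; last exact: continuous_cont_on.
  apply: modC_cint_le; [exact: ss|exact: continuous_cont_on|].
  by move=> z /andP[z0 z1]; apply: Ly => //; rewrite (le_trans s'0 z0) (le_trans z1 s1).
have lipx (s t t' : R) : 0 <= s <= 1 -> 0 <= t <= 1 -> 0 <= t' <= 1 -> modC (g t s - g t' s) <= 2 * L * `|t - t'|.
  move=> t01; wlog ss : t t' / t' <= t.
    move=> W s01 s'01; have [/W|/ltW /W] := leP t' t; first exact.
    by rewrite modC_distC distrC; exact.
  move=> /andP[s0 s1] /andP[s'0 s'1].
  rewrite -(@cint_FTC _ t' t (gx ^~ s) (g ^~ s)) // ?ger0_norm ?subr_ge0 //; last by apply: continuous_cont_on; exact: cgx.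
  apply: modC_cint_le; [exact: ss|by apply: continuous_cont_on; exact: cgx|].
  by move=> z /andP[z0 z1]; apply: Lx => //; rewrite (le_trans s'0 z0) (le_trans z1 s1).
(* From (t, s) to (a, b) one passes through (t, b); each of the two parameter lines costs 2 L h,
   where 2 is the factor of [modC_cint_le]. *)
have near (t s : R) : x <= t <= x + h -> y <= s <= y + h -> modC (g t s - g a b) <= 4 * L * h.
  move=> /andP[t1 t2] /andP[s1 s2].
  have -> : g t s - g a b = (g t s - g t b) + (g t b - g a b) by ring.
  apply: (le_trans (modCD _ _)).
  have -> : 4 * L * h = 2 * L * h + 2 * L * h by ring.
  apply: lerD.
    apply: (le_trans (lipy _ _ _ _ _ _)); try (apply/andP; split; lra).
    by rewrite ler_wpM2l ?mulr_ge0 // ler_norml; lra.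
  apply: (le_trans (lipx _ _ _ _ _ _)); try (apply/andP; split; lra).
  by rewrite ler_wpM2l ?mulr_ge0 // ler_norml; lra.
have apx (t s : R) : x <= t <= x + h -> y <= s <= y + h ->
    modC (phi (g t s) - (phi (g a b) + B * (g t s - g a b))) <= e1 * (4 * L * h).
  move=> tx sy; have n := near t s tx sy.
  rewrite opprD addrA (le_trans (Hr _ _)) //; last by rewrite ler_pM2l.
  apply: le_lt_trans n _; lra.
have xh : x <= x + h by rewrite lerDl ltW.
have yh : y <= y + h by rewrite lerDl ltW.
have hx : x <= x <= x + h by rewrite lexx.
have hxh : x <= x + h <= x + h by rewrite lexx xh.
have hy : y <= y <= y + h by rewrite lexx.
have hyh : y <= y + h <= y + h by rewrite lexx yh.
have in01x t : x <= t <= x + h -> 0 <= t <= 1 by move=> /andP[? ?]; apply/andP; split; lra.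
have in01y t : y <= t <= y + h -> 0 <= t <= 1 by move=> /andP[? ?]; apply/andP; split; lra.
have EV t : x <= t <= x + h -> modC (cint y (y + h) (fun s => phi (g t s) * gy t s) -
   ((phi (g a b) * g t (y + h) + B * (g t (y + h) - g a b) ^+ 2 / 2) - (phi (g a b) * g t y + B * (g t y - g a b) ^+ 2 / 2)))
   <= 2 * (e1 * (4 * L * h) * L) * (y + h - y).
  move=> tx; apply: (@curve_integral_approx y (y + h) (e1 * (4 * L * h)) L (g t) (gy t)) => //.
  - exact: continuous_cont_on.
  - exact: continuous_cont_on.
  - by move=> s sy; apply: Ly; [exact: in01x|exact: in01y].
  - by move=> s sy; apply: cphi; [exact: in01x|exact: in01y].
  - by move=> s sy; exact: apx.
have EH s : y <= s <= y + h -> modC (cint x (x + h) (fun t => phi (g t s) * gx t s) -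
   ((phi (g a b) * g (x + h) s + B * (g (x + h) s - g a b) ^+ 2 / 2) - (phi (g a b) * g x s + B * (g x s - g a b) ^+ 2 / 2)))
   <= 2 * (e1 * (4 * L * h) * L) * (x + h - x).
  move=> sy; apply: (@curve_integral_approx x (x + h) (e1 * (4 * L * h)) L (g ^~ s) (gx ^~ s)) => //.
  - by apply: continuous_cont_on; exact: cgx.
  - by apply: continuous_cont_on; exact: cg1.
  - by move=> t tx; apply: Lx; [exact: in01x|exact: in01y].
  - by move=> t tx; apply: cphi; [exact: in01x|exact: in01y].
  - by move=> t tx; exact: apx.
have := EV _ hx; have := EV _ hxh; have := EH _ hy; have := EH _ hyh.
rewrite /loop_sum.
set V1 := cint y _ _; set V0 := cint y _ _; set H1 := cint x _ _; set H0 := cint x _ _.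
set u00 := phi (g a b) * g x y + _; set u01 := phi (g a b) * g x (y + h) + _.
set u10 := phi (g a b) * g (x + h) y + _; set u11 := phi (g a b) * g (x + h) (y + h) + _.
rewrite (addrC x h) addrK (addrC y h) addrK.
move=> i1 i2 i3 i4.
(* The values of the primitive at the four corners cancel around the loop, so only the four errors
   remain. *)
have -> : V1 - V0 - H1 + H0 = ((V1 - (u11 - u10)) - (V0 - (u01 - u00))) + (- (H1 - (u11 - u01)) + (H0 - (u10 - u00))) by ring.
apply: (le_trans (modCD _ _)).
have t1 := modCB (V1 - (u11 - u10)) (V0 - (u01 - u00)).
have t2 := modCD (- (H1 - (u11 - u01))) (H0 - (u10 - u00)).
rewrite modCN in t2.
apply: (@le_trans _ _ (4 * (2 * (e1 * (4 * L * h) * L) * h))); first lra.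
have -> : 4 * (2 * (e1 * (4 * L * h) * L) * h) = e1 * (32 * L ^+ 2) * h ^+ 2 by ring.
rewrite ler_pM2r ?exprn_gt0 // /e1 mulrAC ler_pdivrMr //.
by rewrite ler_pM2l // lerDl.
Qed.

End Goursat.

(** * Cauchy's integral formula *)

Section CauchyFormula.
Variable R : realType.
Local Notation C := (Cx R).

Lemma cdiffP (f : C -> C) (z d : C) : cdiff f z d <-> is_derive z 1 f d.
Proof.
split; first by move=> /cdiff_derive1 [h1 h2]; split; [exact: h1|rewrite -derive1E; exact: h2].
by move=> [h1 h2]; rewrite -h2 -derive1E; exact: derivable_cdiff.
Qed.

Lemma cdiff_cst (k z : C) : cdiff (fun=> k) z 0.
Proof. by apply/cdiffP; exact: is_derive_cst. Qed.
Lemma cdiff_id (z : C) : cdiff id z 1.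
Proof. by apply/cdiffP; exact: is_derive_id. Qed.
Lemma cdiffD (f g : C -> C) z df dg : cdiff f z df -> cdiff g z dg -> cdiff (fun w => f w + g w) z (df + dg).
Proof. by move=> /cdiffP h1 /cdiffP h2; apply/cdiffP; exact: is_deriveD. Qed.
Lemma cdiffN (f : C -> C) z df : cdiff f z df -> cdiff (fun w => - f w) z (- df).
Proof. by move=> /cdiffP h1; apply/cdiffP; exact: is_deriveN. Qed.
Lemma cdiffM (f g : C -> C) z df dg : cdiff f z df -> cdiff g z dg ->
  cdiff (fun w => f w * g w) z (df * g z + f z * dg).
Proof.
move=> /cdiffP h1 /cdiffP h2; apply/cdiffP.
apply: (@is_derive_eq _ _ _ _ _ _ _ _ (is_deriveM h1 h2)).
by rewrite addrC mulrC.
Qed.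
Lemma cdiff_eq (f : C -> C) z d d' : cdiff f z d -> d = d' -> cdiff f z d'.
Proof. by move=> h <-. Qed.

Lemma cdiffV (f : C -> C) (z d : C) : f z != 0 -> cdiff f z d ->
  cdiff (fun w => (f w)^-1) z (- d / f z ^+ 2).
Proof.
move=> a0 fd e e0.
have cf := cdiff_continuous fd.
set a := f z in a0 *; have am : 0 < modC a by rewrite modC_gt0.
pose K := (2 / modC a ^+ 3) * (modC a + modC d).
have K0 : 0 <= K by rewrite mulr_ge0 ?addr_ge0 ?modC_ge0 // divr_ge0 // exprn_ge0 // modC_ge0.
pose e1 := e / (K + 1).
have e10 : 0 < e1 by rewrite divr_gt0 // ltr_wpDl.
have [r1 r10 H1] := fd _ e10.
have /nbhsCxP [r2 r20 H2] : \forall w \near z, modC (f w - a) < Num.min (modC a / 2) e1.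
  have /(@cvgCxP _ _ (nbhs z) (nbhs_filter z)) := cf.
  by apply; rewrite lt_min divr_gt0.
exists (Num.min r1 r2); first by rewrite lt_min r10.
move=> w; rewrite lt_min => /andP[/H1 {}H1 /H2]; rewrite lt_min => /andP[h2 h3].
have fwm : modC a / 2 < modC (f w).
  have := modCBge a (a - f w); rewrite opprB addrCA subrr addr0 modC_distC => h; lra.
have fw0 : f w != 0 by rewrite -modC_gt0; apply: lt_trans fwm; rewrite divr_gt0.
have -> : (f w)^-1 - a^-1 - - d / a ^+ 2 * (w - z) =
   (- ((f w - a - d * (w - z)) * a) + d * (w - z) * (f w - a)) * (a ^+ 2 * f w)^-1.
  by field; rewrite a0 fw0.
rewrite modCM modCV modCM modCX.
have num : modC (- ((f w - a - d * (w - z)) * a) + d * (w - z) * (f w - a)) <=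
    e1 * modC (w - z) * (modC a + modC d).
  apply: (le_trans (modCD _ _)); rewrite modCN !modCM.
  have p1 : modC (f w - a - d * (w - z)) * modC a <= e1 * modC (w - z) * modC a by rewrite ler_wpM2r ?modC_ge0.
  have p2 : modC d * modC (w - z) * modC (f w - a) <= modC d * modC (w - z) * e1.
    by rewrite ler_wpM2l ?mulr_ge0 ?modC_ge0 // ltW.
  by lra.
have den : (modC a ^+ 2 * modC (f w))^-1 <= 2 / modC a ^+ 3.
  rewrite -[leRHS]invf_div lef_pV2 ?posrE ?mulr_gt0 ?divr_gt0 ?exprn_gt0 ?modC_gt0 //.
  by rewrite exprSr -mulrA ler_pM2l ?exprn_gt0 // ltW.
apply: (le_trans (ler_pM _ _ num den)); rewrite ?modC_ge0 ?invr_ge0 ?mulr_ge0 ?exprn_ge0 ?modC_ge0 //.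
have -> : e1 * modC (w - z) * (modC a + modC d) * (2 / modC a ^+ 3) = (e1 * K) * modC (w - z).
  by rewrite /K; ring.
rewrite ler_wpM2r ?modC_ge0 // /e1 mulrAC ler_pdivrMr ?ltr_wpDl //.
by rewrite ler_pM2l // lerDl.
Qed.

Lemma cdiffX (f : C -> C) z d n : cdiff f z d -> cdiff (fun w => f w ^+ n) z (n%:R * f z ^+ n.-1 * d).
Proof.
move=> fd; elim: n => [|n IH].
  under [fun _ => _]eq_fun do rewrite expr0.
  by apply: (cdiff_eq (cdiff_cst 1 z)); rewrite !mul0r.
under [fun _ => _]eq_fun do rewrite exprS.
apply: (cdiff_eq (cdiffM fd IH)) => /=.
case: n {IH} => [|n] /=; first by rewrite expr0; ring.
by rewrite exprS -[n.+2]addn1 natrD; ring.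
Qed.

Variable f : C -> C.
Hypothesis fd : forall z, modC z < 1 -> derivable f z 1.

Let fcont z : modC z < 1 -> {for z, continuous f}.
Proof. by move=> z1; exact: cdiff_continuous (derivable_cdiff (fd z1)). Qed.

(** The circles with centre (1 - t) z and radius going linearly from e to r join the small circle
    about z to the large one about 0. They stay in the disc and never meet z, because t |z| <= t (r
    - e) is less than the radius e + t (r - e); [Goursat] applied to f(w) / (w - z) on this family
    equates the two ends. *)
Lemma Cauchy_small_circle (z : C) (r e : R) : 0 < e -> e < r - modC z -> r < 1 ->
  cint 0 1 (fun y => f (rC r * eC y) * (rC r * eC y) / (rC r * eC y - z)) =
  cint 0 1 (fun y => f (z + rC e * eC y)).
Proof.
move=> e0 er r1.
pose rho (t : R) : R := e + t * (r - e).
pose g (t y : R) : C := rC (1 - t) * z + rC (rho t) * eC y.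
pose gx (t y : R) : C := - z + rC (r - e) * eC y.
pose gy (t y : R) : C := rC (rho t) * (rC (2 * pi) * iC R * eC y).
pose phi (w : C) : C := f w / (w - z).
have z0 := modC_ge0 z.
have rho0 t : 0 <= t <= 1 -> 0 < rho t.
  move=> /andP[t0 t1]; rewrite /rho ltr_pwDl // mulr_ge0 //; lra.
have crC : continuous (@rC R : R -> C) := @continuous_rC R.
have dlin (k m : R) t : cder (fun t => rC (k + t * m)) t (rC m).
  under [fun _ => _]eq_fun do rewrite rCD rCM.
  apply: (cder_eq (cderD (cder_cst (rC k) t) (cderM (cder_rC t) (cder_cst (rC m) t)))).
  by rewrite mulr0 addr0 add0r mul1r.
have g_t t y : 0 <= t <= 1 -> 0 <= y <= 1 -> modC (g t y) < 1 /\ g t y - z != 0.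
  move=> /andP[t0 t1] y01; have rt := rho0 t; rewrite t0 t1 in rt; have {}rt := rt isT.
  split.
    apply: (le_lt_trans (modCD _ _)); rewrite !modCM !modC_rC modC_eC mulr1 (ger0_norm (ltW rt)).
    rewrite ger0_norm ?subr_ge0 // /rho.
    have : (1 - t) * (modC z + e) <= (1 - t) * r by rewrite ler_wpM2l ?subr_ge0 //; lra.
    lra.
  have -> : g t y - z = rC (rho t) * eC y - rC t * z by rewrite /g rCB rC1; ring.
  rewrite -modC_gt0; apply: lt_le_trans (modCBge _ _).
  rewrite !modCM !modC_rC modC_eC mulr1 (ger0_norm (ltW rt)) ger0_norm // subr_gt0 /rho.
  have : t * modC z <= t * (r - e) by rewrite ler_wpM2l //; lra.
  lra.
have ceC : continuous (@eC R : R -> C) := @continuous_eC R.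
have cg1 s : continuous (g ^~ s).
  move=> t; apply: cvgD; apply: cvgM; try exact: cvg_cst.
    have h : (fun x : R => 1 - x) @ t --> 1 - t by apply: cvgB; [exact: cvg_cst|exact: cvg_id].
    by apply: (cvg_comp _ _ h); exact: crC.
  have h : (rho : R -> R) @ t --> rho t.
    by apply: cvgD; [exact: cvg_cst|apply: cvgM; [exact: cvg_id|exact: cvg_cst]].
  by apply: (cvg_comp _ _ h); exact: crC.
have cg2 t : continuous (g t).
  by move=> s; apply: cvgD; [exact: cvg_cst|apply: cvgM; [exact: cvg_cst|exact: ceC]].
have cgx s : continuous (gx ^~ s) by move=> t; exact: cvg_cst.
have cgy t : continuous (gy t).
  by move=> s; apply: cvgM; [exact: cvg_cst|apply: cvgM; [exact: cvg_cst|exact: ceC]].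
have dgx t s : cder (g ^~ s) t (gx t s).
  have h1 := dlin 1 (-1) t; have h2 := dlin e (r - e) t.
  have -> : g ^~ s = (fun t => rC (1 + t * -1) * z + rC (e + t * (r - e)) * eC s).
    by apply/funext => x; rewrite /g /rho mulrN1.
  apply: (cder_eq (cderD (cderM h1 (cder_cst z t)) (cderM h2 (cder_cst (eC s) t)))).
  by rewrite !mulr0 !addr0 rCN rC1 mulN1r.
have dgy t s : cder (g t) s (gy t s).
  apply: (cder_eq (cderD (cder_cst (rC (1 - t) * z) s) (cderM (cder_cst (rC (rho t)) s) (cder_eC s)))).
  by rewrite mul0r !add0r.
have L1 t s : 0 <= t <= 1 -> 0 <= s <= 1 -> modC (gx t s) <= 2 + 2 * pi.
  move=> _ _; apply: (le_trans (modCD _ _)); rewrite modCN modCM modC_rC modC_eC mulr1 ger0_norm ?subr_ge0; last lra.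
  have := pi_ge0 R; lra.
have L2 t s : 0 <= t <= 1 -> 0 <= s <= 1 -> modC (gy t s) <= 2 + 2 * pi.
  move=> t01 _; rewrite /gy !modCM !modC_rC modC_iC modC_eC !mulr1 (ger0_norm (ltW (rho0 _ t01))).
  have pi0 := pi_ge0 R; rewrite ger0_norm ?mulr_ge0 //.
  have h : rho t <= 1.
    move: t01 => /andP[t0 t1]; rewrite /rho.
    have : t * (r - e) <= 1 * (r - e) by rewrite ler_wpM2r //; lra.
    lra.
  have : rho t * (2 * pi) <= 1 * (2 * pi) by rewrite ler_wpM2r ?mulr_ge0.
  lra.
have dphi t s : 0 <= t <= 1 -> 0 <= s <= 1 -> exists d, cdiff phi (g t s) d.
  move=> t01 s01; have [g1 g2] := g_t _ _ t01 s01.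
  eexists; apply: cdiffM; first exact: derivable_cdiff (fd g1).
  by apply: cdiffV => //; apply: cdiffD; [exact: cdiff_id|exact: cdiff_cst].
have := Goursat dgx dgy cgx cgy cg1 cg2 L1 L2 dphi.
rewrite /loop_sum !add0r.
(* The sides y = 0 and y = 1 have the same image by periodicity of [eC], so they cancel and only the
   two circles remain. *)
have -> : cint 0 1 (fun t => phi (g t 1) * gx t 1) = cint 0 1 (fun t => phi (g t 0) * gx t 0).
  by apply: eq_cint => t _; rewrite /gx /g eC1 eC0.
rewrite subrK => /eqP; rewrite subr_eq0 => /eqP.
have h0 : 0 <= (0 : R) <= 1 by rewrite lexx ler01.
have h1 : 0 <= (1 : R) <= 1 by rewrite lexx ler01.
have k0 : rC (2 * pi) * iC R != 0 :> C.
  by rewrite mulf_neq0 // -modC_gt0 ?modC_iC // modC_rC gtr0_norm ?mulr_gt0 ?pi_gt0.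
have c1 : cont_on 0 1 (fun y => f (rC r * eC y) * (rC r * eC y) / (rC r * eC y - z)).
  have cre : cont_on 0 1 (fun y => rC r * eC y).
    by apply: cont_onM; [exact: cont_on_cst|exact: continuous_cont_on].
  apply: cont_onM; last apply: cont_onV.
  - apply: cont_onM; last exact: cre.
    apply: cont_on_comp; first exact: cre.
    by move=> x x01; apply: fcont; rewrite modCM modC_eC mulr1 modC_rC ger0_norm; lra.
  - move=> x x01; have [_] := g_t 1 x h1 x01.
    by rewrite /g /rho subrr rC0 mul0r add0r mul1r (addrC e) subrK.
  - by apply: (cont_onB cre); exact: cont_on_cst.
have c0 : cont_on 0 1 (fun y => f (z + rC e * eC y)).
  have cre : cont_on 0 1 (fun y => z + rC e * eC y).
    by apply: cont_onD; [exact: cont_on_cst|apply: cont_onM; [exact: cont_on_cst|exact: continuous_cont_on]].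
  apply: cont_on_comp; first exact: cre.
  move=> x x01; apply: fcont; have [+ _] := g_t 0 x h0 x01.
  by rewrite /g /rho subr0 rC1 mul1r mul0r addr0.
have -> : cint 0 1 (fun s => phi (g 1 s) * gy 1 s) =
   rC (2 * pi) * iC R * cint 0 1 (fun y => f (rC r * eC y) * (rC r * eC y) / (rC r * eC y - z)).
  rewrite -cintZ //; apply: eq_cint => y y01.
  rewrite /phi /gy /g /rho subrr rC0 mul0r add0r mul1r (addrC e) subrK; ring.
have -> : cint 0 1 (fun s => phi (g 0 s) * gy 0 s) =
   rC (2 * pi) * iC R * cint 0 1 (fun y => f (z + rC e * eC y)).
  rewrite -cintZ //; apply: eq_cint => y y01.
  have e0' : rC e * eC y != 0 by rewrite -modC_gt0 modCM modC_eC modC_rC gtr0_norm ?mulr1.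
  rewrite /phi /gy /g /rho subr0 rC1 mul1r mul0r addr0 [_ + _ - z]addrAC subrr add0r.
  have -> : rC e * (rC (2 * pi) * iC R * eC y) = rC (2 * pi) * iC R * (rC e * eC y) by ring.
  by rewrite mulrCA mulfVK.
by move=> /(mulfI k0).
Qed.

(** By [Cauchy_small_circle] the mean over a small circle about z does not depend on its radius, and
    by continuity it tends to f z. *)
Lemma Cauchy_formula (z : C) (r : R) : modC z < r -> r < 1 ->
  cint 0 1 (fun y => f (rC r * eC y) * (rC r * eC y) / (rC r * eC y - z)) = f z.
Proof.
move=> zr r1; apply/eqP; rewrite -subr_eq0 -modC_eq0 eq_le modC_ge0 andbT.
apply/ler_addgt0Pl => d d0; rewrite addr0.
have z1 : modC z < 1 by lra.
have /(@cvgCxP _ _ (nbhs z) (nbhs_filter z)) /(_ (d / 2)) := fcont z1.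
rewrite divr_gt0 // => /(_ isT) /nbhsCxP [e e0 He].
pose e1 := Num.min (e / 2) ((r - modC z) / 2).
have e10 : 0 < e1 by rewrite lt_min !divr_gt0 // subr_gt0.
have e1e : e1 < e by rewrite gt_min ltr_pdivrMr // mulr_natr mulr2n ltrDl e0.
have e1r : e1 < r - modC z.
  by rewrite gt_min; apply/orP; right; rewrite ltr_pdivrMr // mulr_natr mulr2n ltrDl subr_gt0.
rewrite (Cauchy_small_circle e10 e1r r1).
have cre : cont_on 0 1 (fun y => z + rC e1 * eC y).
  apply: cont_onD; [exact: cont_on_cst|apply: cont_onM; [exact: cont_on_cst|]].
  by apply: continuous_cont_on; exact: continuous_eC.
have cf : cont_on 0 1 (fun y => f (z + rC e1 * eC y)).
  apply: cont_on_comp; first exact: cre.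
  move=> x x01; apply: fcont; apply: (le_lt_trans (modCD _ _)).
  by rewrite modCM modC_eC mulr1 modC_rC gtr0_norm //; lra.
have -> : f z = cint 0 1 (fun=> f z) by rewrite cint_cst // subr0 rC1 mulr1.
rewrite -cintB; [|exact: cf|exact: cont_on_cst].
apply: (@le_trans _ _ (2 * (d / 2) * (1 - 0))); last by rewrite subr0 mulr1 mulrC divfK.
apply: modC_cint_le; [exact: ler01|by apply: (cont_onB cf); exact: cont_on_cst|].
move=> x x01; apply/ltW/He.
by rewrite (addrC z) addrK modCM modC_rC modC_eC mulr1 gtr0_norm.
Qed.

End CauchyFormula.

(** * Cauchy's formula for the derivatives *)

Section CauchyDerivatives.
Variable R : realType.
Local Notation C := (Cx R).

(** For a point v of a circle this is used with a = 1/(v - w), b = 1/(v - z) and h = w - z, for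
    which a - b = h a b: it is the first order Taylor formula of (v - z)^-m with a remainder uniform
    in v, obtained algebraically by induction on m. *)
Lemma pow_inverse_taylor (D : R) (m : nat) : 0 <= D -> exists2 K : R, 0 <= K &
  forall a b h : C, modC a <= D -> modC b <= D -> a - b = h * a * b ->
    modC (a ^+ m - b ^+ m - m%:R * h * b ^+ m.+1) <= K * modC h ^+ 2.
Proof.
move=> D0; elim: m => [|m [K K0 IH]].
  by exists 0 => // a b h _ _ _; rewrite !expr0 subrr !mul0r subr0 modC0.
exists (D * K + m.+1%:R * D ^+ m.+3).
  by rewrite addr_ge0 // mulr_ge0 // exprn_ge0.
move=> a b h aD bD ab.
have -> : a ^+ m.+1 - b ^+ m.+1 - m.+1%:R * h * b ^+ m.+2 =
   a * (a ^+ m - b ^+ m - m%:R * h * b ^+ m.+1) + m.+1%:R * h ^+ 2 * (b ^+ m.+2 * a).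
  have -> : m.+1%:R * h ^+ 2 * (b ^+ m.+2 * a) = m.+1%:R * h * b ^+ m.+1 * (h * a * b).
    by rewrite (exprS b m.+1); ring.
  have -> : a ^+ m.+1 - b ^+ m.+1 = a * (a ^+ m - b ^+ m) + (a - b) * b ^+ m.
    by rewrite !exprS; ring.
  have e1 : (a - b) * b ^+ m = h * a * (b * b ^+ m) by rewrite ab; ring.
  by rewrite e1 -ab (exprS b m.+1) (exprS b m) -[m.+1]addn1 natrD; ring.
apply: (le_trans (modCD _ _)); rewrite mulrDl; apply: lerD.
  by rewrite modCM -(mulrA D); apply: ler_pM; rewrite ?modC_ge0 //; apply: IH.
rewrite modCM (modCM _ (h ^+ 2)) (modCX h) (modCM (b ^+ _)) (modCX b) -rCn modC_rC normr_nat.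
rewrite -mulrA -[leRHS]mulrA ler_wpM2l // mulrC ler_wpM2r ?exprn_ge0 ?modC_ge0 // (exprSr D).
rewrite ler_pM ?exprn_ge0 ?modC_ge0 //.
by rewrite lerXn2r ?nnegrE ?modC_ge0.
Qed.

Lemma circle_cont (r : R) : cont_on 0 1 (fun y => rC r * eC y : C).
Proof.
by apply: cont_onM; [exact: cont_on_cst|apply: continuous_cont_on; exact: continuous_eC].
Qed.

Lemma modC_circle (r y : R) : 0 <= r -> modC (rC r * eC y) = r.
Proof. by move=> r0; rewrite modCM modC_eC mulr1 modC_rC ger0_norm. Qed.

Lemma circle_dist (r y : R) (z : C) : 0 <= r -> r - modC z <= modC (rC r * eC y - z).
Proof. by move=> r0; rewrite -{1}(modC_circle y r0) modCBge. Qed.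

Lemma circle_neq (r y : R) (z : C) : modC z < r -> rC r * eC y - z != 0.
Proof.
move=> zr; rewrite -modC_gt0; apply: lt_le_trans (circle_dist y z _); first by rewrite subr_gt0.
by apply: le_trans (ltW zr); exact: modC_ge0.
Qed.

Lemma Cauchy_kernel_cont (u : R -> C) (r : R) (z : C) (m : nat) : modC z < r -> cont_on 0 1 u ->
  cont_on 0 1 (fun y => u y / (rC r * eC y - z) ^+ m).
Proof.
move=> zr uc; apply: (cont_onM uc); apply: cont_onV.
  by move=> y _; rewrite expf_neq0 // circle_neq.
by apply: cont_onX; apply: cont_onB; [exact: circle_cont|exact: cont_on_cst].
Qed.

(** Differentiation under the integral sign: the quadratic remainder of [pow_inverse_taylor] is
    uniform on the circle and can be integrated. *)
Lemma cdiff_Cauchy_integral (u : R -> C) (r : R) (z : C) (m : nat) : modC z < r -> cont_on 0 1 u ->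
  cdiff (fun w => cint 0 1 (fun y => u y / (rC r * eC y - w) ^+ m)) z
    (m%:R * cint 0 1 (fun y => u y / (rC r * eC y - z) ^+ m.+1)).
Proof.
move=> zr uc e e0.
have r0 : 0 <= r by apply: le_trans (ltW zr); exact: modC_ge0.
(* For |w - z| < d both z and w keep at least the distance d from the circle, which bounds both
   inverses by 1/d. *)
pose d := (r - modC z) / 2; have d0 : 0 < d by rewrite divr_gt0 ?subr_gt0.
have [K K0 HK] := pow_inverse_taylor m (ltW (divr_gt0 (ltr01 : 0 < (1 : R)) d0)).
pose M := rint 0 1 (fun y => modC (u y)).
have M0 : 0 <= M by apply: rint_ge0 => *; exact: modC_ge0.
pose B := 2 * K * M; have B0 : 0 <= B by rewrite !mulr_ge0.
exists (Num.min d (e / (B + 1))); first by rewrite lt_min d0 divr_gt0 // ltr_wpDl.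
move=> w; rewrite lt_min => /andP[wd]; rewrite ltr_pdivlMr ?ltr_wpDl // => we.
have wr : modC w < r.
  by have := modCD z (w - z); rewrite addrC subrK; rewrite /d in wd; lra.
have kz := Cauchy_kernel_cont (m:=m) zr uc; have kw := Cauchy_kernel_cont (m:=m) wr uc.
have kz1 := Cauchy_kernel_cont (m:=m.+1) zr uc.
have kz2 : cont_on 0 1 (fun y => m%:R * (w - z) * (u y / (rC r * eC y - z) ^+ m.+1)).
  by apply: (cont_onM _ kz1); exact: cont_on_cst.
rewrite mulrAC -(cintZ _ kz1) -(cintB kw kz) -cintB; [|exact: (cont_onB kw kz)|exact: kz2].
have cc : cont_on 0 1 (fun y => u y / (rC r * eC y - w) ^+ m - u y / (rC r * eC y - z) ^+ m -
    m%:R * (w - z) * (u y / (rC r * eC y - z) ^+ m.+1)).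
  by apply: (cont_onB _ kz2); exact: (cont_onB kw kz).
apply: (le_trans (modC_cint cc)).
apply: (@le_trans _ _ (2 * rint 0 1 (fun y => (K * modC (w - z) ^+ 2) * modC (u y)))); last first.
  rewrite rintZ -/M; last exact: cont_on_modC.
  have -> : 2 * (K * modC (w - z) ^+ 2 * M) = modC (w - z) * B * modC (w - z) by rewrite /B; ring.
  rewrite ler_wpM2r ?modC_ge0 // (le_trans _ (ltW we)) // ler_wpM2l ?modC_ge0 //; lra.
rewrite ler_pM2l //; apply: le_rint; first exact: cont_on_modC.
  by move=> x x01; apply: cvgM; [exact: cvg_cst|exact: (cont_on_modC uc)].
move=> y y01.
have -> : u y / (rC r * eC y - w) ^+ m - u y / (rC r * eC y - z) ^+ m -
    m%:R * (w - z) * (u y / (rC r * eC y - z) ^+ m.+1) =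
   ((rC r * eC y - w)^-1 ^+ m - (rC r * eC y - z)^-1 ^+ m -
    m%:R * (w - z) * (rC r * eC y - z)^-1 ^+ m.+1) * u y.
  by rewrite !exprVn; ring.
rewrite modCM ler_wpM2r ?modC_ge0 //.
have dz := circle_dist y z r0; have dw := circle_dist y w r0.
have nz := circle_neq y zr; have nw := circle_neq y wr.
have mz := nz; have mw := nw; rewrite -modC_gt0 in mz; rewrite -modC_gt0 in mw.
apply: HK.
- rewrite modCV div1r lef_pV2 ?posrE //; apply: le_trans dw.
  by have := modCD z (w - z); rewrite addrC subrK; rewrite /d in wd *; lra.
- rewrite modCV div1r lef_pV2 ?posrE //; apply: le_trans dz.
  by have := modC_ge0 z; rewrite /d; lra.
- by field; rewrite nz nw.
Qed.

Lemma cdiff_local (f g : C -> C) (z d : C) (r : R) : 0 < r ->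
  (forall w, modC (w - z) < r -> f w = g w) -> cdiff f z d -> cdiff g z d.
Proof.
move=> r0 fg fd e e0; have [s s0 H] := fd e e0.
exists (Num.min s r); first by rewrite lt_min s0.
move=> w; rewrite lt_min => /andP[ws wr].
by rewrite -fg // -(fg z) ?subrr ?modC0 //; exact: H.
Qed.

Variable f : C -> C.
Hypothesis fd : holo_disc f.

Lemma holo_cont z : modC z < 1 -> {for z, continuous f}.
Proof. by move=> z1; exact: cdiff_continuous (derivable_cdiff (fd z1)). Qed.

Lemma holo_circle_cont (r : R) : 0 <= r -> r < 1 -> cont_on 0 1 (fun y => f (rC r * eC y)).
Proof.
move=> r0 r1; apply: cont_on_comp; first exact: circle_cont.
by move=> y _; apply: holo_cont; rewrite modC_circle.
Qed.

Lemma holo_circle_cont2 (r : R) : 0 <= r -> r < 1 -> cont_on 0 1 (fun y => f (rC r * eC y) * (rC r * eC y)).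
Proof. by move=> r0 r1; apply: cont_onM; [exact: holo_circle_cont|exact: circle_cont]. Qed.

(** Induction on n: the formula of order n holds on a whole neighbourhood of z, so [cdiff_local]
    lets its derivative be computed under the integral. *)
Lemma Cauchy_derive1n (n : nat) (z : C) (r : R) : modC z < r -> r < 1 ->
  derive1n n f z = n`!%:R * cint 0 1 (fun y => f (rC r * eC y) * (rC r * eC y) / (rC r * eC y - z) ^+ n.+1).
Proof.
elim: n z => [|n IH] z zr r1.
  rewrite derive1n0 fact0 mul1r; under eq_cint => y _ do rewrite expr1.
  by rewrite (Cauchy_formula fd).
have r0 : 0 <= r by apply: le_trans (ltW zr); exact: modC_ge0.
rewrite derive1nS.
have uc := holo_circle_cont2 r0 r1.
have cd := cdiffM (cdiff_cst n`!%:R z) (cdiff_Cauchy_integral n.+1 zr uc).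
have d0 : 0 < r - modC z by rewrite subr_gt0.
have cd' : cdiff (derive1n n f) z (n.+1`!%:R * cint 0 1 (fun y => f (rC r * eC y) * (rC r * eC y) / (rC r * eC y - z) ^+ n.+2)).
  apply: (cdiff_local d0 _ (cdiff_eq cd _)).
    move=> w wz; rewrite -IH //.
    by have := modCD z (w - z); rewrite addrC subrK; lra.
  by rewrite mul0r add0r factS natrM mulrCA mulrA.
by have [_ ->] := cdiff_derive1 cd'.
Qed.

Lemma derive1n_cdiff (n : nat) (z : C) : modC z < 1 -> cdiff (derive1n n f) z (derive1n n.+1 f z).
Proof.
move=> z1; pose r := (1 + modC z) / 2.
have zr : modC z < r by rewrite /r; lra.
have r1 : r < 1 by rewrite /r; lra.
have r0 : 0 <= r by apply: le_trans (ltW zr); exact: modC_ge0.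
have uc := holo_circle_cont2 r0 r1.
have cd := cdiffM (cdiff_cst n`!%:R z) (cdiff_Cauchy_integral n.+1 zr uc).
have d0 : 0 < r - modC z by rewrite subr_gt0.
apply: (cdiff_local d0 _ (cdiff_eq cd _)).
  move=> w wz; rewrite -Cauchy_derive1n //.
  by have := modCD z (w - z); rewrite addrC subrK; lra.
by rewrite (@Cauchy_derive1n n.+1 z r) // mul0r add0r factS natrM mulrCA mulrA.
Qed.

Lemma holo_derive1n n : holo_disc (derive1n n f).
Proof. by move=> z /(derive1n_cdiff n) /cdiff_derive1 []. Qed.

Lemma modC_derive1n_le (n : nat) (z : C) (r : R) : modC z < r -> r < 1 ->
  modC (derive1n n f z) <= 2 * n`!%:R * rint 0 1 (fun y => modC (f (rC r * eC y)) / modC (rC r * eC y - z) ^+ n.+1).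
Proof.
move=> zr r1.
have r0 : 0 <= r by apply: le_trans (ltW zr); exact: modC_ge0.
rewrite (Cauchy_derive1n n zr r1) modCM -rCn modC_rC normr_nat -mulrA mulrCA ler_wpM2l //.
have uc := holo_circle_cont2 r0 r1.
have kc := Cauchy_kernel_cont (m:=n.+1) zr uc.
apply: (le_trans (modC_cint kc)); rewrite ler_pM2l //; apply: le_rint; first exact: cont_on_modC.
  have kc1 := Cauchy_kernel_cont (m:=n.+1) zr (holo_circle_cont r0 r1).
  have := cont_on_modC kc1; congr cont_on; apply/funext => y.
  by rewrite modCM modCV modCX.
move=> y _; rewrite 2!modCM modC_circle // modCV modCX ler_wpM2r ?invr_ge0 ?exprn_ge0 ?modC_ge0 //.
by rewrite ler_piMr ?modC_ge0 // ltW.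
Qed.

End CauchyDerivatives.

Section Linearity.
Variable R : realType.
Local Notation C := (Cx R).

Lemma derive1n_lin (a : C) (f g : C -> C) n z : holo_disc f -> holo_disc g -> modC z < 1 ->
  derive1n n (fun z => a * f z + g z) z = a * derive1n n f z + derive1n n g z.
Proof.
move=> hf hg; elim: n z => [|n IH] z z1; first by rewrite !derive1n0.
rewrite !derive1nS.
have d0 : 0 < 1 - modC z by rewrite subr_gt0.
have h1 := cdiffD (cdiffM (cdiff_cst a z) (derive1n_cdiff hf n z1)) (derive1n_cdiff hg n z1).
have h2 : cdiff (derive1n n (fun z => a * f z + g z)) z (a * derive1n n.+1 f z + derive1n n.+1 g z).
  apply: (cdiff_local d0 _ (cdiff_eq h1 _)).
    move=> w wz; rewrite IH //.
    by have := modCD z (w - z); rewrite addrC subrK; lra.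
  by rewrite mul0r add0r.
by have [_ ->] := cdiff_derive1 h2; rewrite !derive1nS.
Qed.

Lemma holo_lin (a : C) (f g : C -> C) : holo_disc f -> holo_disc g -> holo_disc (fun z => a * f z + g z).
Proof.
move=> hf hg z z1.
have h1 := cdiffD (cdiffM (cdiff_cst a z) (derivable_cdiff (hf z z1))) (derivable_cdiff (hg z z1)).
by have [] := cdiff_derive1 h1.
Qed.

Lemma holo_cst (k : C) : holo_disc (fun=> k).
Proof. by move=> z z1; have [] := cdiff_derive1 (cdiff_cst k z). Qed.

Lemma holoM (f g : C -> C) : holo_disc f -> holo_disc g -> holo_disc (fun z => f z * g z).
Proof.
move=> hf hg z z1.
by have [] := cdiff_derive1 (cdiffM (derivable_cdiff (hf z z1)) (derivable_cdiff (hg z z1))).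
Qed.

End Linearity.

(** * Polar coordinates *)

Section PlaneMeasure.
Variable R : realType.
Local Notation mu := (@lebesgue_measure R).
Local Notation MR := (measurableTypeR R).
Local Notation R2 := (MR * MR)%type.
Local Open Scope ereal_scope.

(** Lebesgue measure is determined by its values on half-open intervals, and the translated measure
    takes the same values there. *)
Lemma lebesgue_shift (t : R) (A : set (R)) : measurable A ->
  mu ((fun x : R => x + t)%R @^-1` A) = mu A.
Proof.
move=> mA.
have mf : measurable_fun setT ((fun x : R => x + t)%R : MR -> MR).
  by apply: measurable_funD => //; exact: measurable_id.
pose f : {mfun MR >-> MR} := HB.pack (fun x : R => (x + t)%R : R)
  (isMeasurableFun.Build _ _ _ _ _ mf).
have := @lebesgue_measure_unique R (pushforward mu f) _ A mA.
rewrite /pushforward /= => -> //.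
move=> _ [[a b]] /= _ <-.
rewrite /pushforward (_ : _ @^-1` _ = `](a - t)%R, (b - t)%R]%classic); last first.
  by apply/seteqP; split => x /=; rewrite !in_itv /= ltrBlDr lerBrDr.
rewrite !lebesgue_measure_itv /= !lte_fin ltrD2r -!EFinB.
by congr (if _ then _%:E else _); ring.
Qed.

Lemma lebesgue_dilate (t : R) (A : set (R)) : (0 < t)%R -> measurable A ->
  t%:E * mu ((fun x : R => t * x)%R @^-1` A) = mu A.
Proof.
move=> t0 mA.
have mf : measurable_fun setT ((fun x : R => t * x)%R : MR -> MR).
  by apply: measurable_funM => //; exact: measurable_id.
pose f : {mfun MR >-> MR} := HB.pack (fun x : R => (t * x)%R : R)
  (isMeasurableFun.Build _ _ _ _ _ mf).
have := @lebesgue_measure_unique R (mscale (NngNum (ltW t0)) (pushforward mu f)) _ A mA.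
move=> -> //.
move=> _ [[a b]] /= _ <-.
change (mu `]a, b]%classic = t%:E * mu ((fun x : R => t * x)%R @^-1` `]a, b]%classic)).
rewrite (_ : _ @^-1` _ = `](a / t)%R, (b / t)%R]%classic); last first.
  by apply/seteqP; split => x /=; rewrite !in_itv /= ltr_pdivrMr // ler_pdivlMr // mulrC.
rewrite !lebesgue_measure_itv /= !lte_fin ltr_pM2r ?invr_gt0 // -!EFinB.
case: ifP => _; last by rewrite mule0.
by rewrite -EFinM; congr _%:E; field; rewrite gt_eqF.
Qed.

(** Rotation invariance of plane measure is reduced to shears: a shear translates every section in
    one direction, so Fubini and translation invariance apply. *)
Definition shearY (a : R) (x : R2) : R2 := (x.1, x.2 + a * x.1)%R.
Definition shearX (a : R) (x : R2) : R2 := (x.1 + a * x.2, x.2)%R.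

Lemma measurable_shearY a : measurable_fun setT (shearY a).
Proof.
apply: measurable_fun_pair; first exact: measurable_fst.
apply: measurable_funD; first exact: measurable_snd.
by apply: measurable_funM; [exact: measurable_cst|exact: measurable_fst].
Qed.

Lemma measurable_shearX a : measurable_fun setT (shearX a).
Proof.
apply: measurable_fun_pair; last exact: measurable_snd.
apply: measurable_funD; first exact: measurable_fst.
by apply: measurable_funM; [exact: measurable_cst|exact: measurable_snd].
Qed.

Lemma leb2_shearY a (A : set R2) : measurable A -> leb2 (shearY a @^-1` A) = leb2 A.
Proof.
move=> mA; rewrite /leb2 /product_measure1; apply: eq_integral => x _ /=.
rewrite -[RHS](lebesgue_shift (a * x)); last exact: measurable_xsection.
congr (mu _); apply/seteqP; split => y; rewrite /xsection /shearY /= !inE //=.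
Qed.

Lemma leb2_swap (A : set R2) : measurable A -> leb2 A = (mu \x^ mu) A.
Proof.
move=> mA; apply: product_measure_unique => // B D mB mD /=.
by rewrite product_measure2E.
Qed.

(** A shear along the first axis translates the horizontal sections, so the measure is first
    rewritten with the other order of integration. *)
Lemma leb2_shearX a (A : set R2) : measurable A -> leb2 (shearX a @^-1` A) = leb2 A.
Proof.
move=> mA.
have mS : measurable (shearX a @^-1` A) by rewrite -[X in measurable X]setTI; exact: measurable_shearX.
rewrite !leb2_swap // /product_measure2; apply: eq_integral => x _ /=.
rewrite -[RHS](lebesgue_shift (a * x)); last exact: measurable_ysection.
congr (mu _); apply/seteqP; split => y; rewrite /ysection /shearX /= !inE //=.
Qed.

Definition rotP (c s : R) (x : R2) : R2 := (c * x.1 - s * x.2, s * x.1 + c * x.2)%R.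

Lemma measurable_rot c s : measurable_fun setT (rotP c s).
Proof.
apply: measurable_fun_pair.
  by apply: measurable_funB; apply: measurable_funM; try exact: measurable_cst; [exact: measurable_fst|exact: measurable_snd].
by apply: measurable_funD; apply: measurable_funM; try exact: measurable_cst; [exact: measurable_fst|exact: measurable_snd].
Qed.

Lemma measurable_rotP c s (A : set R2) : measurable A -> measurable (rotP c s @^-1` A).
Proof. by move=> mA; rewrite -[X in measurable X]setTI; exact: measurable_rot. Qed.

(* A rotation other than the half-turn is a product of three shears. *)
Lemma leb2_rot c s (A : set R2) : (c ^+ 2 + s ^+ 2 = 1)%R -> measurable A ->
  leb2 (rotP c s @^-1` A) = leb2 A.
Proof.
wlog s0 : c s A / s != 0%R.
  move=> W cs mA; have [s0|s0] := eqVneq s 0%R; last exact: W.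
  (* The formula with three shears divides by the sine. When s = 0 the rotation is a quarter turn
     followed by a rotation of sine -c, and both sines are nonzero. *)
  have -> : rotP c s @^-1` A = rotP 0 1 @^-1` (rotP s (- c) @^-1` A).
    have E : rotP c s = rotP s (- c)%R \o rotP 0 1.
      by apply/funext => -[x y]; rewrite /rotP /=; congr (_, _); ring.
    by rewrite E.
  have c0 : (- c != 0)%R.
    rewrite oppr_eq0; apply: contra_eqN cs => /eqP ->; rewrite s0 expr0n addr0 eq_sym oner_eq0 //.
  rewrite W ?oner_neq0 //; last first.
  - exact: measurable_rotP.
  - by rewrite expr0n expr1n add0r.
  by rewrite W //; rewrite sqrrN addrC.
move=> cs mA.
(* This is minus the tangent of half the angle, the classical coefficient of the two outer
   shears. *)
pose a := ((c - 1) / s)%R.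
have -> : rotP c s @^-1` A = shearX a @^-1` (shearY s @^-1` (shearX a @^-1` A)).
  suff E : rotP c s = shearX a \o (shearY s \o shearX a) by rewrite E.
  apply/funext => -[x y]; rewrite /rotP /shearX /shearY /a /=.
  have s2 : (s * s = 1 - c ^+ 2)%R by rewrite -cs; ring.
  congr (_, _); last by field.
  have -> : (x + (c - 1) / s * y + (c - 1) / s * (y + s * (x + (c - 1) / s * y)) =
    c * x + (c - 1) * (c + 1) / s * y)%R by field.
  have -> : ((c - 1) * (c + 1) = - (s * s))%R by rewrite s2; ring.
  by field.
rewrite leb2_shearX; last first.
  by rewrite -[X in measurable X]setTI; apply: measurable_shearY => //; rewrite -[X in measurable X]setTI; exact: measurable_shearX.
rewrite leb2_shearY; last by rewrite -[X in measurable X]setTI; exact: measurable_shearX.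
by rewrite leb2_shearX.
Qed.

Lemma integral_leb2_rot c s (F : R2 -> \bar R) : (c ^+ 2 + s ^+ 2 = 1)%R ->
  measurable_fun setT F -> (forall x, 0 <= F x) ->
  \int[@leb2 R]_x F (rotP c s x) = \int[@leb2 R]_x F x.
Proof.
move=> cs mF F0.
apply: (@eq_trans _ _ (\int[pushforward (@leb2 R) (rotP c s)]_y F y)).
  by apply/esym; apply: (ge0_integral_pushforward (measurable_rot c s) (@leb2 R) measurableT mF).
apply: eq_measure_integral; first exact: measurable_rot.
move=> mrot A mA _; rewrite -[RHS](leb2_rot cs mA).
by [].
Qed.

Lemma leb2_dilate (t : R) (A : set R2) : (0 < t)%R -> measurable A ->
  (t ^+ 2)%:E * leb2 ((fun x : R2 => (t * x.1, t * x.2)%R : R2) @^-1` A) = leb2 A.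
Proof.
move=> t0 mA.
have mf : measurable_fun setT (fun x : R2 => (t * x.1, t * x.2)%R : R2).
  by apply: measurable_fun_pair; apply: measurable_funM; try exact: measurable_cst; [exact: measurable_fst|exact: measurable_snd].
pose f : {mfun R2 >-> R2} := HB.pack (fun x : R2 => (t * x.1, t * x.2)%R : R2)
  (isMeasurableFun.Build _ _ _ _ _ mf).
have t20 : (0 <= t ^+ 2)%R by rewrite sqr_ge0.
rewrite [RHS](@product_measure_unique _ _ _ _ R mu mu (mscale (NngNum t20) (pushforward (@leb2 R) f))) //.
move=> A1 A2 mA1 mA2; rewrite /mscale /pushforward /=.
have mD (B : set MR) : measurable B -> measurable ((fun x : R => t * x)%R @^-1` B).
  move=> mB; rewrite -[X in measurable X]setTI.
  by have : measurable_fun setT ((fun x : R => t * x)%R : MR -> MR); [apply: measurable_funM => //; exact: measurable_id|apply].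
change ((t ^+ 2)%:E * leb2 (((fun x : R => t * x)%R @^-1` A1) `*` ((fun x : R => t * x)%R @^-1` A2)) = mu A1 * mu A2).
rewrite /leb2 product_measure1E; [|exact: mD|exact: mD].
rewrite -(lebesgue_dilate t0 mA1) -(lebesgue_dilate t0 mA2) expr2 EFinM.
by rewrite muleACA.
Qed.

End PlaneMeasure.

(** * Replacing a function by its circle means *)

Section Radial.
Variable R : realType.
Local Notation mu := (@lebesgue_measure R).
Local Notation MR := (measurableTypeR R).
Local Notation R2 := (MR * MR)%type.
Local Open Scope ereal_scope.

Lemma integral_shift (t : R) (D : set MR) (P : MR -> \bar R) : measurable D ->
  measurable_fun setT P -> (forall x, 0 <= P x) ->
  \int[mu]_(x in (fun x : R => x + t)%R @^-1` D) P (x + t)%R = \int[mu]_(x in D) P x.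
Proof.
move=> mD mP P0.
have mf : measurable_fun setT ((fun x : R => x + t)%R : MR -> MR).
  by apply: measurable_funD => //; exact: measurable_id.
pose f : {mfun MR >-> MR} := HB.pack (fun x : R => (x + t)%R : R) (isMeasurableFun.Build _ _ _ _ _ mf).
apply: (@eq_trans _ _ (\int[pushforward mu f]_(y in D) P y)).
  apply/esym; apply: (ge0_integral_pushforward mf mu mD) => //.
  exact: measurable_funS mP.
apply: eq_measure_integral => A mA _.
rewrite -[RHS](lebesgue_shift t mA).
by [].
Qed.

(** The part of the shifted window that lies beyond 1 is moved back by one period. *)
Lemma integral_period (P : MR -> \bar R) (t : R) : measurable_fun setT P -> (forall x, 0 <= P x) ->
  (forall x, P (x + 1)%R = P x) -> (0 <= t <= 1)%R ->
  \int[mu]_(x in `[0%R, 1%R[) P (x + t)%R = \int[mu]_(x in `[0%R, 1%R[) P x.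
Proof.
move=> mP P0 Pp /andP[t0 t1].
have mPD D : measurable_fun (D : set MR) P by exact: measurable_funS mP.
have E1 : `[0%R, 1%R[%classic = (fun x : R => x + t)%R @^-1` `[t, (1 + t)%R[.
  by apply/seteqP; split => x /=; rewrite !in_itv /= lerDr ltrD2r.
rewrite {1}E1 (@integral_shift t `[t, (1 + t)%R[%classic) //.
have -> : `[t, (1 + t)%R[%classic = `[t, 1%R[%classic `|` `[1%R, (1 + t)%R[%classic.
  by apply/seteqP; split => x /=; rewrite !in_itv /=; [case: (ltP x 1%R) => h; [left|right]|move=> [|]]; lra.
have -> : `[0%R, 1%R[%classic = `[0%R, t[%classic `|` `[t, 1%R[%classic.
  by apply/seteqP; split => x /=; rewrite !in_itv /=; [case: (ltP x t) => h; [left|right]|move=> [|]]; lra.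
rewrite !ge0_integral_setU //; try exact: mPD; try (apply/disj_setPS => x /=; rewrite !in_itv /=; lra).
rewrite addeC; congr (_ + _).
rewrite -(@integral_shift 1%R `[1%R, (1 + t)%R[%classic) //.
have -> : (fun x : R => x + 1)%R @^-1` `[1%R, (1 + t)%R[ = `[0%R, t[%classic.
  by apply/seteqP; split => x /=; rewrite !in_itv /= lerDr (addrC 1%R) ltrD2r.
by apply: eq_integral => x _; rewrite Pp.
Qed.

Definition polar2 (r y : R) : R2 := (r * cos (2 * pi * y), r * sin (2 * pi * y))%R.

Lemma polar_repr (x : R2) : exists2 y : R, (0 <= y <= 1)%R & x = polar2 (modC (toC x)) y.
Proof.
case: x => a b; set r := modC _.
have r2 : (r ^+ 2 = a ^+ 2 + b ^+ 2)%R by rewrite /r modC_sqr.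
have r0 : (0 <= r)%R by exact: modC_ge0.
have [r00|rn0] := eqVneq r 0%R.
  exists 0%R; first by rewrite lexx ler01.
  move: r2; rewrite r00 expr0n /= => /esym/eqP; rewrite paddr_eq0 ?sqr_ge0 // !sqrf_eq0.
  by move=> /andP[/eqP -> /eqP ->]; rewrite /polar2 !mul0r.
have rp : (0 < r)%R by rewrite lt_neqAle eq_sym rn0.
have u1 : (-1 <= a / r <= 1)%R.
  rewrite -ler_norml normrM normfV (gtr0_norm rp) ler_pdivrMr // mul1r.
  exact: (Re_le_modC (toC (a, b))).
have v2 : (1 - (a / r) ^+ 2 = (b / r) ^+ 2)%R.
  by rewrite !expr_div_n -(divff (x := (r ^+ 2)%R)) ?expf_neq0 // -mulrBl r2; congr (_ / _)%R; ring.
have pi0 := pi_gt0 R.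
have p20 : (2 * pi != 0 :> R)%R by rewrite mulf_neq0 ?pnatr_eq0 ?gt_eqF.
(* The arc cosine gives an angle in [0, pi]; for b < 0 its opposite is used, with parameter 1 - th /
   (2 pi) so as to stay in [0, 1]. *)
pose th := acos (a / r).
have th0 : (0 <= th)%R by rewrite acos_ge0.
have thp : (th <= pi)%R by rewrite acos_lepi.
have cth : (cos th = a / r)%R by rewrite acosK // in_itv.
have sth : (sin th = `|b / r|)%R by rewrite sin_acos // v2 sqrtr_sqr.
have [b0|b0] := leP 0%R b.
  exists (th / (2 * pi))%R.
    apply/andP; split; first by rewrite divr_ge0 // mulr_ge0 // ltW.
    by rewrite ler_pdivrMr ?mulr_gt0 // mul1r; lra.
  rewrite /polar2 (mulrC (2 * pi)%R) divfK // cth sth ger0_norm ?divr_ge0 //.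
  by congr (_, _); field.
exists (1 - th / (2 * pi))%R.
  have : (th / (2 * pi) <= 1)%R by rewrite ler_pdivrMr ?mulr_gt0 // mul1r; lra.
  have : (0 <= th / (2 * pi))%R by rewrite divr_ge0 // mulr_ge0 // ltW.
  lra.
rewrite /polar2.
have -> : (2 * pi * (1 - th / (2 * pi)) = - th + pi *+ 2)%R by rewrite mulrBr mulr1 (mulrC _ (th / _)%R) divfK // mulr_natl addrC.
rewrite cosD2pi sinD2pi cosN sinN cth sth ltr0_norm; last by rewrite pmulr_llt0 ?invr_gt0.
by congr (_, _); field.
Qed.

Lemma polar2_rot (r y t : R) : rotP (cos (2 * pi * t)%R) (sin (2 * pi * t)%R) (polar2 r y) = polar2 r (y + t)%R.
Proof.
rewrite /rotP /polar2 /= (mulrDr (2 * pi)%R y t) cosD sinD; congr (_, _); ring.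
Qed.

Lemma toC_polar2 r y : toC (polar2 r y) = (rC r * eC y)%R.
Proof. by apply: Cx_eq; rewrite ?ReCM ?ImCM /= ?mul0r ?subr0 ?addr0. Qed.

Lemma polar2_period r y : polar2 r (y + 1)%R = polar2 r y.
Proof. by rewrite /polar2 mulrDr mulr1 mulr_natl cosD2pi sinD2pi. Qed.

Lemma measurable_cos2pi d (T : measurableType d) (g : T -> MR) : measurable_fun setT g ->
  measurable_fun setT (fun x => cos (2 * pi * g x)%R : MR).
Proof.
move=> mg; apply: (measurableT_comp (f := cos)).
  by apply: continuous_measurable_fun; exact: continuous_cos.
by apply: measurable_funM => //; exact: measurable_cst.
Qed.
Lemma measurable_sin2pi d (T : measurableType d) (g : T -> MR) : measurable_fun setT g ->
  measurable_fun setT (fun x => sin (2 * pi * g x)%R : MR).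
Proof.
move=> mg; apply: (measurableT_comp (f := sin)).
  by apply: continuous_measurable_fun; exact: continuous_sin.
by apply: measurable_funM => //; exact: measurable_cst.
Qed.

Lemma measurable_polar2 : measurable_fun setT (fun x : R2 => polar2 x.1 x.2).
Proof.
apply: measurable_fun_pair; apply: measurable_funM; try exact: measurable_fst.
  by apply: measurable_cos2pi; exact: measurable_snd.
by apply: measurable_sin2pi; exact: measurable_snd.
Qed.

Lemma measurable_indic_comp d (T : measurableType d) d' (U : measurableType d') (A : set U) (g : T -> U) :
  measurable A -> measurable_fun setT g -> measurable_fun setT (fun x => \1_A (g x) : R).
Proof.
move=> mA mg; rewrite (_ : (fun x => _) = \1_(g @^-1` A)).
  by apply: measurable_indic; rewrite -[X in measurable X]setTI; exact: mg.
by apply/funext => x; rewrite !indicE; congr (_%:R); apply/idP/idP; rewrite !inE.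
Qed.

Lemma sigma_finite_leb2 : sigma_finite setT (mu \x mu).
Proof.
have /sigma_finiteP[F [TF ndF Foo]] := sigma_finiteT mu.
exists (fun n => F n `*` F n).
  rewrite -setXTT TF predeqE => -[x y]; split; last by move=> [n _ []/= ? ?]; split; exists n.
  move=> [/= [n _ Fnx] [k _ Fky]]; exists (maxn n k) => //; split.
    by move: x Fnx; exact/subsetPset/ndF/leq_maxl.
  by move: y Fky; exact/subsetPset/ndF/leq_maxr.
move=> k; have [? ?] := Foo k.
split; first exact: measurableX.
by rewrite product_measure1E// lte_mul_pinfty// ge0_fin_numE.
Qed.

(** A copy of plane measure on which the sigma-finite structure required by Tonelli's theorem is
    declared. *)
Definition leb2s : set R2 -> \bar R := mu \x mu.
HB.instance Definition _ := Measure.on leb2s.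
HB.instance Definition _ := Measure_isSigmaFinite.Build _ _ _ leb2s sigma_finite_leb2.

Lemma integral_leb2s (f : R2 -> \bar R) (D : set R2) : \int[leb2s]_(x in D) f x = \int[@leb2 R]_(x in D) f x.
Proof. exact: eq_measure_integral. Qed.

Variable F : R2 -> \bar R.
Hypothesis mF : measurable_fun setT F.
Hypothesis F0 : forall x, 0 <= F x.

Let H0 (r : R) := \int[mu]_(y in `[0%R, 1%R[) F (polar2 r y).

Let measurable_restr1 (g : R2 -> \bar R) : measurable_fun setT g ->
  measurable_fun setT (fun x : R2 => (\1_(`[0%R, 1%R[%classic : set MR) x.2)%:E * g x).
Proof.
move=> mg; apply: emeasurable_funM => //; apply/measurable_EFinP.
by apply: measurable_indic_comp => //; exact: measurable_snd.
Qed.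

Let integral01 (g : MR -> \bar R) : \int[mu]_(y in `[0%R, 1%R[) g y = \int[mu]_y ((\1_(`[0%R, 1%R[%classic : set MR) y)%:E * g y).
Proof.
rewrite integral_mkcond; apply: eq_integral => y _.
rewrite patchE indicE; case: ifPn => _; by rewrite ?mul1e ?mul0e.
Qed.

Lemma measurable_circle_mean : measurable_fun setT (H0 : MR -> \bar R).
Proof.
pose f (x : R2) := (\1_(`[0%R, 1%R[%classic : set MR) x.2)%:E * F (polar2 x.1 x.2).
have mf : measurable_fun setT f.
  by apply: measurable_restr1; apply: (measurableT_comp mF); exact: measurable_polar2.
have f0 x : 0 <= f x by rewrite mule_ge0 // lee_fin.
have := @measurable_fun_fubini_tonelli_F _ _ _ _ R mu f mf f0.
by congr measurable_fun; apply/funext => r; rewrite /fubini_F /H0 integral01.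
Qed.

(** Averaging the rotation-invariant integral over all angles and exchanging the integrals replaces
    [F] by its mean over the circle through x, which by periodicity does not depend on the starting
    angle. *)
Lemma integral_leb2_radialize : \int[@leb2 R]_x F x = \int[@leb2 R]_x H0 (modC (toC x)).
Proof.
pose G (z : MR * R2) := (\1_(`[0%R, 1%R[%classic : set MR) z.1)%:E * F (rotP (cos (2 * pi * z.1)%R) (sin (2 * pi * z.1)%R) z.2).
have mG : measurable_fun setT G.
  apply: emeasurable_funM.
    apply/measurable_EFinP.
    by apply: measurable_indic_comp => //; exact: measurable_fst.
  apply: (measurableT_comp mF).
  have m21 : measurable_fun setT (fun z : MR * R2 => z.2.1 : MR) by apply: (measurableT_comp measurable_fst); exact: measurable_snd.
  have m22 : measurable_fun setT (fun z : MR * R2 => z.2.2 : MR) by apply: (measurableT_comp measurable_snd); exact: measurable_snd.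
  have mc : measurable_fun setT (fun z : MR * R2 => cos (2 * pi * z.1)%R : MR) by apply: measurable_cos2pi; exact: measurable_fst.
  have ms : measurable_fun setT (fun z : MR * R2 => sin (2 * pi * z.1)%R : MR) by apply: measurable_sin2pi; exact: measurable_fst.
  apply: measurable_fun_pair.
    by apply: measurable_funB; exact: measurable_funM.
  by apply: measurable_funD; exact: measurable_funM.
have G0 z : 0 <= G z by rewrite mule_ge0 // lee_fin.
have := @fubini_tonelli _ _ _ _ R mu leb2s G mG G0.
have -> : \int[mu]_x \int[leb2s]_y G (x, y) = \int[mu]_(x in `[0%R, 1%R[) \int[@leb2 R]_y F y.
  rewrite integral01; apply: eq_integral => y _.
  rewrite /G /= integral_leb2s ge0_integralZl //.
  - by rewrite integral_leb2_rot // cos2Dsin2.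
  - by apply: (measurableT_comp mF); exact: measurable_rot.
have Hc (k : \bar R) : \int[mu]_(x in `[0%R, 1%R[) k = k.
  rewrite integral_cst // [X in k * X](_ : _ = 1) ?mule1 //.
  by rewrite /= lebesgue_measure_itv /= lte_fin ltr01 oppr0 adde0.
rewrite Hc => ->.
rewrite integral_leb2s.
apply: eq_integral => x _; rewrite -integral01.
have [y0 y01 ->] := polar_repr x.
set r := modC (toC x).
have -> : modC (toC (polar2 r y0)) = r.
  by rewrite toC_polar2 modC_circle // /r modC_ge0.
under eq_integral do rewrite polar2_rot addrC.
rewrite (@integral_period (fun y => F (polar2 r y))) //.
  apply: (measurableT_comp mF); apply: measurable_fun_pair; apply: measurable_funM; try exact: measurable_cst.
    by apply: measurable_cos2pi; exact: measurable_id.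
  by apply: measurable_sin2pi; exact: measurable_id.
by move=> y; rewrite polar2_period.
Qed.

End Radial.

(** * The law of the modulus under plane measure *)

Section Polar.
Variable R : realType.
Local Notation mu := (@lebesgue_measure R).
Local Notation MR := (measurableTypeR R).
Local Notation R2 := (MR * MR)%type.
Local Open Scope ereal_scope.

Definition norm2 (x : R2) : MR := modC (toC x).

Lemma norm2E x : norm2 x = Num.sqrt (x.1 ^+ 2 + x.2 ^+ 2)%R.
Proof. by []. Qed.

Lemma measurable_norm2 : measurable_fun setT norm2.
Proof.
rewrite (_ : norm2 = Num.sqrt \o (fun x : R2 => x.1 ^+ 2 + x.2 ^+ 2)%R); last by apply/funext => x; rewrite norm2E.
apply: measurableT_comp.
  by apply: continuous_measurable_fun; exact: sqrt_continuous.
by apply: measurable_funD; apply: measurable_funX; [exact: measurable_fst|exact: measurable_snd].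
Qed.

Lemma measurable_norm2_lt b : measurable [set x | (norm2 x < b)%R].
Proof.
rewrite -[X in measurable X]setTI.
have := measurable_norm2 measurableT (measurable_itv `]-oo, b[).
by congr measurable; apply/seteqP; split => x /=; rewrite in_itv.
Qed.

Lemma norm2_scale (t : R) (x : R2) : (0 <= t)%R -> norm2 (t * x.1, t * x.2)%R = (t * norm2 x)%R.
Proof.
move=> t0; rewrite !norm2E /=.
by rewrite !exprMn -mulrDr sqrtrM ?sqr_ge0 // sqrtr_sqr ger0_norm.
Qed.

Definition disc_area : R := fine (leb2 [set x : R2 | (norm2 x < 1)%R]).

Lemma disc_area_fin : leb2 [set x : R2 | (norm2 x < 1)%R] = disc_area%:E.
Proof.
rewrite /disc_area fineK // ge0_fin_numE ?measure_ge0 //.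
apply: (@le_lt_trans _ _ (leb2 (`[(-1)%R, 1%R]%classic `*` `[(-1)%R, 1%R]%classic : set R2))).
  apply: (@le_measure _ _ _ (@leb2 R)).
  - by rewrite inE; exact: measurable_norm2_lt.
  - by rewrite inE; exact: measurableX.
  - move=> x /= x1; rewrite !in_itv /= -!ler_norml; split.
      exact: le_trans (Re_le_modC (toC x)) (ltW x1).
    exact: le_trans (Im_le_modC (toC x)) (ltW x1).
rewrite /leb2 product_measure1E //= lebesgue_measure_itv /= lte_fin.
by rewrite -!EFinB; case: ifP => _; rewrite -?EFinM ltry.
Qed.

Lemma disc_area_gt0 : (0 < disc_area)%R.
Proof.
rewrite -lte_fin -disc_area_fin.
apply: (@lt_le_trans _ _ (leb2 (`[(0)%R, 2^-1%R]%classic `*` `[(0)%R, 2^-1%R]%classic : set R2))).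
  rewrite /leb2 product_measure1E //= lebesgue_measure_itv /= lte_fin.
  by rewrite invr_gt0 ltr0n -!EFinB subr0 -EFinM lte_fin mulr_gt0 // invr_gt0.
apply: (@le_measure _ _ _ (@leb2 R)).
- by rewrite inE; exact: measurableX.
- by rewrite inE; exact: measurable_norm2_lt.
move=> x /=; rewrite !in_itv /= => -[/andP[a0 a1] /andP[b0 b1]].
rewrite norm2E -[ltRHS]sqrtr1 ltr_sqrt //.
have : (x.1 ^+ 2 <= 2^-1 ^+ 2)%R by rewrite lerXn2r ?nnegrE.
have : (x.2 ^+ 2 <= 2^-1 ^+ 2)%R by rewrite lerXn2r ?nnegrE.
lra.
Qed.

Lemma leb2_disc (b : R) : leb2 [set x : R2 | (norm2 x < b)%R] = (disc_area * Num.max 0 b ^+ 2)%:E.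
Proof.
have [b0|b0] := leP b 0%R.
  have -> : [set x : R2 | (norm2 x < b)%R] = set0.
    apply/seteqP; split => x //= xb; have := le_lt_trans (modC_ge0 (toC x)) (lt_le_trans xb b0).
    by rewrite ltxx.
  by rewrite expr0n mulr0; exact: measure0.
rewrite -(leb2_dilate b0 (measurable_norm2_lt b)).
rewrite (mulrC disc_area) (EFinM (b ^+ 2)) -disc_area_fin; congr (_ * leb2 _); apply/seteqP; split => x /=.
  by rewrite norm2_scale ?ltW // gtr_pMr.
by rewrite norm2_scale ?ltW // gtr_pMr.
Qed.

(** The region under the graph of the linear function with slope 2 [disc_area]. The first marginal
    of plane measure on it has exactly the density expected of the law of the modulus. *)
Let S : set R2 := [set x | (0 <= x.2 < 2 * disc_area * x.1)%R].

Let mS : measurable S.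
Proof.
have -> : S = (snd @^-1` `[0%R, +oo[%classic) `&` ((fun x : R2 => (2 * disc_area * x.1 - x.2)%R : MR) @^-1` `]0%R, +oo[%classic).
  by apply/seteqP; split => x; rewrite /S /= !in_itv /= !andbT subr_gt0 => /andP.
apply: measurableI.
  by rewrite -[X in measurable X]setTI; apply: measurable_snd.
rewrite -[X in measurable X]setTI.
have mf : measurable_fun setT (fun x : R2 => (2 * disc_area * x.1 - x.2)%R : MR).
  apply: measurable_funB; last exact: measurable_snd.
  by apply: measurable_funM; [exact: measurable_cst|exact: measurable_fst].
exact: mf.
Qed.

Let mfst_mixin := isMeasurableFun.Build _ _ _ _ _ (@measurable_fst _ _ MR MR).
Let mfst_pack : {mfun R2 >-> MR} := HB.pack (fst : R2 -> MR) mfst_mixin.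
Local Notation nu2 := (pushforward (mrestr (@leb2 R) mS) mfst_pack).

Let mN_mixin := isMeasurableFun.Build _ _ _ _ _ measurable_norm2.
Let mN_pack : {mfun R2 >-> MR} := HB.pack norm2 mN_mixin.
Local Notation nu1 := (pushforward (@leb2 R) mN_pack).

Let Ssection (r : R) : mu (xsection S r) = (2 * disc_area * Num.max 0 r)%:E.
Proof.
have -> : xsection S r = `[0%R, (2 * disc_area * r)%R[%classic.
  by apply/seteqP; split => y; rewrite /xsection /= in_itv /= inE.
have a2 : (0 < 2 * disc_area)%R by rewrite mulr_gt0 // disc_area_gt0.
rewrite lebesgue_measure_itv /= lte_fin pmulr_rgt0 //.
by case: ltP => [r0|r0]; rewrite ?mulr0 // -EFinB subr0.
Qed.

Let nu2_itv (b : R) : nu2 `]-oo, b[%classic = (disc_area * Num.max 0 b ^+ 2)%:E.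
Proof.
have a2 : (0 < 2 * disc_area)%R by rewrite mulr_gt0 // disc_area_gt0.
change (leb2 ((fst @^-1` `]-oo, b[%classic) `&` S) = (disc_area * Num.max 0 b ^+ 2)%:E).
rewrite /leb2 /product_measure1.
transitivity (\int[mu]_(r in `[0%R, b[) (2 * disc_area * r)%:E).
  rewrite [RHS]integral_mkcond; apply: eq_integral => r _ /=.
  rewrite patchE; case: ifPn => [|/negP].
    rewrite inE /= in_itv /= => /andP[r0 rb].
    rewrite -[r in RHS](max_idPr r0) -Ssection; congr (mu _).
    by apply/seteqP; split => y; rewrite /xsection /= !inE /= in_itv /= ?rb; [case|].
  rewrite inE /= in_itv /= => rb.
  have [r0|r0] := ltP r 0%R.
    apply/eqP; rewrite -measure_le0 -(_ : mu (xsection S r) = 0%E); last first.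
      by rewrite Ssection (max_idPl (ltW r0)) mulr0.
    apply: le_measure; rewrite ?inE.
    - by apply: measurable_xsection; apply: measurableI => //; rewrite -[X in measurable X]setTI; apply: measurable_fst.
    - exact: measurable_xsection.
    - by move=> y; rewrite /xsection /= !inE => -[].
  rewrite (_ : xsection _ r = set0) ?measure0 //.
  apply/seteqP; split => y //; rewrite /xsection /= inE /= in_itv /= => -[] rb' _.
  by apply: rb; rewrite r0.
have [b0|b0] := leP b 0%R.
  rewrite expr0n mulr0 set_itv_ge ?integral_set0 //.
  by rewrite bnd_simp -leNgt.
have cg : cont_on 0%R b (fun r : R => (2 * disc_area * r)%R).
  by move=> r _; apply: cvgM; [exact: cvg_cst|exact: cvg_id].
have ig := cont_on_integrable cg.
rewrite integral_itv_bndo_bndc; last first.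
  apply/measurable_EFinP; apply: measurable_funM => //.
have dG (r : R) : (0 <= r <= b)%R -> is_derive r 1%R (fun r : R => disc_area * r ^+ 2)%R (2 * disc_area * r)%R.
  move=> _; have h := is_deriveM (is_derive_cst (disc_area : R) r 1%R) (is_deriveX 2 (is_derive_id r 1%R)).
  apply: (@is_derive_eq _ _ _ _ _ _ _ _ h).
  by rewrite /GRing.scale /=; ring.
suff <- : rint 0 b (fun r : R => (2 * disc_area * r)%R) = (disc_area * b ^+ 2)%R.
  by rewrite /rint /Rintegral fineK //; exact: integrable_fin_num ig.
rewrite (@rint_FTC R 0%R b _ (fun r => disc_area * r ^+ 2)%R (ltW b0) cg dG).
  by rewrite expr0n mulr0 subr0.
Qed.

(** The rays ]-oo, b[ are stable under intersection and generate the Borel sets; on them the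
    dilation formula for discs and the area under the graph give the same value. *)
Let nu12 (A : set MR) : measurable A -> nu1 A = nu2 A.
Proof.
apply: (@measure_unique _ R MR [set B | exists x, B = `]-oo, x[%classic] (fun k => `]-oo, k%:R[%classic)).
- exact: RGenInftyO.measurableE.
- move=> _ _ [x ->] [y ->]; exists (Num.min x y).
  by apply/seteqP; split => z /=; rewrite !in_itv /= lt_min => /andP.
- by move=> i; exists i%:R.
- apply/seteqP; split => // x _; exists (Num.truncn `|x|).+1 => //=.
  rewrite in_itv /=; apply: le_lt_trans (ler_norm x) _; exact: truncnS_gt.
- move=> _ [x ->]; transitivity ((disc_area * Num.max 0 x ^+ 2)%:E); last exact/esym/nu2_itv.
  rewrite -leb2_disc.
  change (leb2 (norm2 @^-1` `]-oo, x[%classic) = leb2 [set x0 : R2 | (norm2 x0 < x)%R]).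
  by congr leb2.
- move=> k; change (leb2 (norm2 @^-1` `]-oo, (k%:R : R)[%classic) < +oo).
  rewrite (_ : norm2 @^-1` _ = [set x : R2 | (norm2 x < k%:R)%R]) ?leb2_disc ?ltry //.
Qed.

(** The left side is an integral against the law of the modulus, which [nu12] exchanges for the
    marginal of [S]; Fubini then unfolds it, each vertical section of [S] over r > 0 having length 2
    [disc_area] r. *)
Lemma integral_leb2_norm (G : MR -> \bar R) : measurable_fun setT G -> (forall r, 0 <= G r) ->
  \int[@leb2 R]_x G (norm2 x) = \int[mu]_r ((2 * disc_area * Num.max 0 r)%:E * G r).
Proof.
move=> mG G0.
transitivity (\int[nu1]_r G r).
  by apply/esym; apply: (ge0_integral_pushforward measurable_norm2 (@leb2 R) measurableT mG).
transitivity (\int[nu2]_r G r).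
  by apply: eq_measure_integral => A mA _; exact: nu12.
transitivity (\int[mrestr (@leb2 R) mS]_x G x.1).
  by apply: (ge0_integral_pushforward (@measurable_fst _ _ MR MR) (mrestr (@leb2 R) mS) measurableT mG).
have mG1 : measurable_fun setT (fun x : R2 => G x.1).
  by apply: (measurableT_comp mG); exact: measurable_fst.
transitivity (\int[@leb2 R]_(x in S) G x.1).
  transitivity (\int[mrestr (@leb2 R) mS]_(x in setT `\` ~` S) G x.1).
    apply: ge0_negligible_integral; [exact: measurableC mS|exact: measurableT|exact: mG1|by move=> x _; exact: G0|].
    by rewrite /= /mrestr setICl; exact: measure0.
  rewrite setTD setCK; apply: eq_measure_integral => A mA AS.
  by rewrite /= /mrestr (setIidl AS).
rewrite integral_mkcond.
have mr : measurable_fun setT ((fun x : R2 => G x.1) \_ S).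
  by apply/(measurable_restrictT _ mS); exact: measurable_funS mG1.
rewrite /leb2 (fubini_tonelli1 _ mr); last first.
  by move=> x; rewrite patchE; case: ifP.
apply: eq_integral => r _; rewrite /fubini_F /=.
rewrite -Ssection muleC -integral_cst; last exact: measurable_xsection.
rewrite [RHS]integral_mkcond; apply: eq_integral => y _.
by rewrite !patchE /cst; congr (if _ then _ else _); rewrite mem_xsection.
Qed.

End Polar.

(** * Measurability of planar sets and of continuous functions on the disc *)

Section PlaneTopology.
Variable R : realType.
Local Notation C := (Cx R).
Local Notation MR := (measurableTypeR R).
Local Notation R2 := (MR * MR)%type.

Definition open2 (U : set R2) := forall x, U x -> exists2 e : R, 0 < e &
  forall y : R2, `|y.1 - x.1| < e -> `|y.2 - x.2| < e -> U y.

(** The boxes with rational centre and half-side 1/(k + 1) that fit inside [U] are countably many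
    and cover it. *)
Lemma measurable_open2 (U : set R2) : open2 U -> measurable U.
Proof.
move=> oU.
pose rect (q : rat * rat * nat) : set R2 :=
  `]ratr q.1.1 - q.2.+1%:R^-1, ratr q.1.1 + q.2.+1%:R^-1[%classic `*`
  `]ratr q.1.2 - q.2.+1%:R^-1, ratr q.1.2 + q.2.+1%:R^-1[%classic.
pose F q := if pselect (rect q `<=` U) then rect q else set0.
have -> : U = \bigcup_q F q.
  apply/seteqP; split => [x Ux|x [q _]]; last by rewrite /F; case: pselect => // qU /qU.
  have [e e0 He] := oU x Ux.
  pose n := Num.truncn (2 / e).
  have n0 : 0 < n.+1%:R^-1 :> R by rewrite invr_gt0.
  have ne : 2 * n.+1%:R^-1 < e.
    rewrite ltr_pdivrMr // -ltr_pdivrMl // mulrC; exact: truncnS_gt.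
  have ratn (t : R) : exists a : rat, t - n.+1%:R^-1 < ratr a < t + n.+1%:R^-1.
    have tt : t - n.+1%:R^-1 < t + n.+1%:R^-1 by rewrite ltrD2l gtrN.
    have [a] := rat_in_itvoo tt.
    by rewrite in_itv /=; exists a.
  have [a /andP[a1 a2]] := ratn x.1; have [b /andP[b1 b2]] := ratn x.2.
  exists (a, b, n) => //; rewrite /F; case: pselect => [H|[]].
    split; rewrite /= in_itv /=; apply/andP; split; rewrite ?ltrBlDr // -ltrBlDr //.
  move=> y; rewrite /rect /= => -[]; rewrite /= !in_itv /= => /andP[h1 h2] /andP[h3 h4].
  move: ne a1 a2 b1 b2 h1 h2 h3 h4; set k := n.+1%:R^-1 => ne a1 a2 b1 b2 h1 h2 h3 h4.
  by apply: He; rewrite ltr_norml; lra.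
apply: countable_bigcupT_measurable; first exact: countableP.
move=> q; rewrite /F; case: (pselect _) => H /=; last exact: measurable0.
by apply: measurableX; exact: measurable_itv.
Qed.

Lemma near_toC (P : C -> Prop) (x : R2) : nbhs (toC x : C) P -> exists2 e : R, 0 < e &
  forall y : R2, `|y.1 - x.1| < e -> `|y.2 - x.2| < e -> P (toC y).
Proof.
move=> /nbhsCxP [d d0 H]; exists (d / 2); first by rewrite divr_gt0.
move=> y h1 h2; apply: H; apply: le_lt_trans (modC_leReIm _) _.
by rewrite !(ReCD, ReCN, ImCD, ImCN) /= [ltRHS]splitr ltrD.
Qed.

Lemma measurable_toC_open (U : set C) : (forall z, U z -> nbhs z U) -> measurable (@toC R @^-1` U : set R2).
Proof.
move=> oU; apply: measurable_open2 => x /oU /near_toC [e e0 H].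
by exists e.
Qed.

Lemma disc_nbhs (z : C) : modC z < 1 -> nbhs z (@disc R).
Proof.
move=> z1; apply/nbhsCxP; exists (1 - modC z); first by rewrite subr_gt0.
move=> y yz; rewrite /disc /=.
by have := modCD z (y - z); rewrite addrC subrK; lra.
Qed.

Lemma measurable_Dset : measurable (@Dset R : set R2).
Proof. by apply: (@measurable_toC_open (@disc R)) => z; exact: disc_nbhs. Qed.

Lemma cont_measurable (g : C -> R) : (forall z, modC z < 1 -> {for z, continuous g}) ->
  measurable_fun (@Dset R : set R2) (fun x : R2 => g (toC x) : MR).
Proof.
move=> cg; apply: (measurability _ (RGenOInfty.measurableE R)) => // _ [_ [t ->] <-].
have := @measurable_toC_open [set z | modC z < 1 /\ t < g z].
have -> : @toC R @^-1` [set z | modC z < 1 /\ t < g z] = @Dset R `&` (fun x => g (toC x)) @^-1` `]t, +oo[.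
  by apply/seteqP; split => x /=; rewrite in_itv /= andbT.
apply => z /= [z1 tz].
have h1 := disc_nbhs z1.
have h2 : nbhs z (g @^-1` [set s | t < s]).
  by apply: cg => //; apply: lt_nbhsr.
by near=> w; split; near: w.
Unshelve. all: by end_near. Qed.

Lemma cont_measurable_modC (f : C -> C) : (forall z, modC z < 1 -> {for z, continuous f}) ->
  measurable_fun (@Dset R : set R2) (fun x : R2 => modC (f (toC x)) : MR).
Proof.
move=> cf; apply: (@cont_measurable (fun z => modC (f z))) => z z1.
by apply: continuous_comp; [exact: cf|exact: continuous_modC].
Qed.

Lemma cont_measurable_Re (f : C -> C) : (forall z, modC z < 1 -> {for z, continuous f}) ->
  measurable_fun (@Dset R : set R2) (fun x : R2 => ReC (f (toC x)) : MR).
Proof.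
move=> cf; apply: (@cont_measurable (fun z => ReC (f z))) => z z1.
by apply: continuous_comp; [exact: cf|exact: continuous_ReC].
Qed.

Lemma cont_measurable_Im (f : C -> C) : (forall z, modC z < 1 -> {for z, continuous f}) ->
  measurable_fun (@Dset R : set R2) (fun x : R2 => ImC (f (toC x)) : MR).
Proof.
move=> cf; apply: (@cont_measurable (fun z => ImC (f z))) => z z1.
by apply: continuous_comp; [exact: cf|exact: continuous_ImC].
Qed.

End PlaneTopology.

Section PolarDisc.
Variable R : realType.
Local Notation C := (Cx R).
Local Notation mu := (@lebesgue_measure R).
Local Notation MR := (measurableTypeR R).
Local Notation R2 := (MR * MR)%type.
Local Open Scope ereal_scope.

(* This is 2, but only its positivity matters, so the area of the disc is never computed. *)
Definition polar_const : R := (2 * disc_area R / pi)%R.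

Lemma polar_const_gt0 : (0 < polar_const)%R.
Proof. by rewrite divr_gt0 ?pi_gt0 // mulr_gt0 // disc_area_gt0. Qed.

Lemma integral_disc_polar (F : R2 -> \bar R) : measurable_fun (@Dset R : set R2) F ->
  (forall x, Dset x -> 0 <= F x) ->
  \int[@leb2 R]_(x in @Dset R) F x =
  \int[mu]_(r in `[0%R, 1%R[) ((2 * disc_area R * r)%:E * \int[mu]_(y in `[0%R, 1%R[) F (polar2 r y)).
Proof.
move=> mF F0.
have mF' : measurable_fun setT (F \_ (@Dset R)).
  by apply/(measurable_restrictT _ (@measurable_Dset R)).
have F'0 x : 0 <= (F \_ (@Dset R)) x.
  by rewrite patchE; case: ifPn => // /set_mem /F0.
rewrite integral_mkcond (integral_leb2_radialize mF' F'0).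
rewrite (integral_leb2_norm (measurable_circle_mean mF' F'0)); last by move=> r; exact: integral_ge0.
rewrite [RHS]integral_mkcond; apply: eq_integral => r _; rewrite [RHS]patchE.
have mp y : (0 <= r)%R -> modC (toC (polar2 r y)) = r by move=> r0; rewrite toC_polar2 modC_circle.
case: ifPn => [|/negP]; rewrite inE /= in_itv /=.
  move=> /andP[r0 r1]; rewrite (max_idPr r0); congr (_ * _).
  apply: eq_integral => y _; rewrite patchE ifT // inE /Dset /= mp //.
move=> nr; have [r0|r0] := leP r 0%R; first by rewrite mulr0 mul0e.
rewrite integral0_eq ?mule0 // => y _; rewrite patchE ifF //.
apply/negP; rewrite inE /Dset /= mp ?ltW // => r1; apply: nr.
by rewrite ltW.
Qed.

Lemma areaInt_polar (h : C -> \bar R) : measurable_fun (@Dset R : set R2) (fun x : R2 => h (toC x)) ->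
  (forall z, (modC z < 1)%R -> 0 <= h z) ->
  areaInt (@disc R) h =
  \int[mu]_(r in `[0%R, 1%R[) ((polar_const * r)%:E * \int[mu]_(y in `[0%R, 1%R[) h (rC r * eC y)%R).
Proof.
move=> mh h0.
have pi0 := pi_gt0 R.
rewrite /areaInt (integral_disc_polar mh) //.
have mI : measurable_fun (`[0%R, 1%R[%classic : set MR)
   (fun r : MR => \int[mu]_(y in `[0%R, 1%R[) h (toC (polar2 r y))).
  have mF' : measurable_fun setT ((fun x : R2 => h (toC x)) \_ (@Dset R)).
    by apply/(measurable_restrictT _ (@measurable_Dset R)).
  have F'0 x : 0 <= ((fun x : R2 => h (toC x)) \_ (@Dset R)) x.
    by rewrite patchE; case: ifPn => // /set_mem /h0.
  have := measurable_funTS (D := `[0%R, 1%R[%classic : set MR) (measurable_circle_mean mF' F'0).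
  apply: eq_measurable_fun => r; rewrite inE /= in_itv /= => /andP[r0 r1].
  by apply: eq_integral => y _; rewrite patchE ifT // inE /Dset /= toC_polar2 modC_circle.
rewrite -ge0_integralZl //.
- apply: eq_integral => r _; rewrite muleA -EFinM; congr (_%:E * _).
    by rewrite /polar_const; ring.
  by apply: eq_integral => y _; rewrite toC_polar2.
- apply: emeasurable_funM => //; apply/measurable_EFinP; apply: measurable_funM => //.
- move=> r /=; rewrite in_itv /= => /andP[r0 r1]; apply: mule_ge0.
    by rewrite lee_fin mulr_ge0 // mulr_ge0 // ltW // disc_area_gt0.
  apply: integral_ge0 => y _; apply: h0; by rewrite toC_polar2 modC_circle.
- by rewrite lee_fin invr_ge0 ltW.
by move=> x x1; exact: h0.
Qed.

End PolarDisc.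

(** * Radial weights *)

Section Weights.
Variable R : realType.
Local Notation mu := (@lebesgue_measure R).
Local Notation MR := (measurableTypeR R).

Variable w : R -> R.
Hypothesis rw : radial_weight w.

(* The argument is the distance x = 1 - r to the boundary. *)
Definition tailw (x : R) : R := fine (omega_hat w (1 - x)).

Let w0 t : 0 <= t <= 1 -> 0 <= w t. Proof. by case: rw => h _ _; exact: h. Qed.
Let iw : mu.-integrable `[0, 1] (EFin \o w). Proof. by case: rw. Qed.

Lemma weight_integrable (D : set MR) : measurable D -> D `<=` `[0, 1] -> mu.-integrable D (EFin \o w).
Proof. by move=> mD D01; exact: integrableS iw. Qed.

Lemma weight_measurable (D : set MR) : measurable D -> D `<=` `[0, 1] -> measurable_fun D (w : MR -> MR).
Proof.
by move=> mD D01; apply/measurable_EFinP; exact: measurable_int (weight_integrable mD D01).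
Qed.

Lemma omega_hatE x : 0 <= x <= 1 -> omega_hat w (1 - x) = (tailw x)%:E.
Proof.
move=> /andP[x0 x1]; rewrite /tailw fineK // /omega_hat.
apply: integrable_fin_num => //; apply: weight_integrable => //.
by apply: subset_itvr; rewrite bnd_simp subr_ge0.
Qed.

Lemma tailw_gt0 x : 0 < x <= 1 -> 0 < tailw x.
Proof.
move=> /andP[x0 x1]; rewrite -lte_fin -omega_hatE ?(ltW x0) //.
by case: rw => _ _; apply; rewrite subr_ge0 x1 gtrBl.
Qed.

Lemma tailw0 : tailw 0 = 0.
Proof. by rewrite /tailw /omega_hat subr0 set_itv1 integral_set1. Qed.

Lemma integral_weight (x y : R) : 0 <= y -> y <= x -> x <= 1 ->
  (\int[mu]_(t in `[(1 - x)%R, (1 - y)%R[) (w t)%:E = (tailw x - tailw y)%:E)%E.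
Proof.
move=> y0 yx x1.
have x0 : 0 <= x by apply: le_trans yx.
have y1 : y <= 1 by apply: le_trans x1.
apply/eqP; rewrite EFinB -omega_hatE ?x0 // -omega_hatE ?y0 //.
rewrite eq_sym sube_eq; last 2 first.
- by rewrite /omega_hat; apply: integrable_fin_num => //; apply: weight_integrable => //; apply: subset_itvr; rewrite bnd_simp subr_ge0.
- rewrite fin_num_adde_defl // /omega_hat; apply: integrable_fin_num => //; apply: weight_integrable => //.
  by apply: subset_itvr; rewrite bnd_simp subr_ge0.
rewrite /omega_hat.
have -> : `[1 - x, 1]%classic = `[1 - x, 1 - y[%classic `|` `[1 - y, 1]%classic :> set R.
  by apply/seteqP; split => t /=; rewrite !in_itv /=; [case: (ltP t (1 - y)) => h; [left|right]|move=> [|]]; lra.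
rewrite ge0_integral_setU //.
- apply/measurable_EFinP; apply: weight_measurable; first exact: measurableU.
  by move=> t /= [|]; rewrite !in_itv /=; lra.
- by move=> t /= [|]; rewrite !in_itv /= => h; rewrite lee_fin w0 //; lra.
- by apply/disj_setPS => t /=; rewrite !in_itv /=; lra.
Qed.

Lemma le_tailw (x y : R) : 0 <= y -> y <= x -> x <= 1 -> tailw y <= tailw x.
Proof.
move=> y0 yx x1; rewrite -subr_ge0 -lee_fin -integral_weight //.
apply: integral_ge0 => t /=; rewrite in_itv /= => h; rewrite lee_fin w0 //; lra.
Qed.

Hypothesis Dw : class_D w.

Lemma tailw_doubling2 : exists2 c : R, 1 <= c & forall x, 0 < x <= 1 -> tailw x <= c * tailw (x / 2).
Proof.
case: Dw => -[c [c1 H]] _; exists c => // x /andP[x0 x1].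
have := H (1 - x); rewrite subr_ge0 x1 gtrBl x0 => /(_ isT).
have -> : (1 + (1 - x)) / 2 = 1 - x / 2 :> R by field.
by rewrite !omega_hatE ?(ltW x0) // ?divr_ge0 ?(ltW x0) //=; lra.
Qed.

(** The halving inequality is iterated until 2^-m falls below l. *)
Lemma tailw_doubling (l : R) : 0 < l -> exists2 c : R, 1 <= c &
  forall x y, 0 < x -> x <= 1 -> l * x <= y -> y <= 1 -> tailw x <= c * tailw y.
Proof.
move=> l0; have [c c1 H] := tailw_doubling2.
have [m ml] : exists m, (2^-1 : R) ^+ m < l.
  have : (fun m => (2^-1 : R) ^+ m) @ \oo --> (0 : R).
    by apply: cvg_expr; rewrite ger0_norm ?invr_ge0 // invf_lt1 // ltr1n.
  move=> /cvgrPdist_lt /(_ l l0) [N _ HN]; exists N.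
  by have := HN N (leqnn N); rewrite /= sub0r normrN ger0_norm ?exprn_ge0 ?invr_ge0.
exists (c ^+ m); first by rewrite exprn_ege1.
move=> x y x0 x1 lxy y1.
have it k : tailw x <= c ^+ k * tailw (x * 2^-1 ^+ k).
  elim: k => [|k IH]; first by rewrite !expr0 mul1r mulr1.
  apply: (le_trans IH); rewrite exprSr (exprSr 2^-1) (mulrA x) -(mulrA (c ^+ k)) ler_wpM2l ?exprn_ge0 ?(le_trans ler01) //.
  apply: H; rewrite mulr_gt0 ?exprn_gt0 ?invr_gt0 //=.
  rewrite (le_trans _ x1) // ler_piMr ?(ltW x0) // exprn_ile1 ?invr_ge0 //.
  by rewrite invf_le1 // ler1n.
apply: (le_trans (it m)); rewrite ler_wpM2l ?exprn_ge0 ?(le_trans ler01) //.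
apply: le_tailw => //; first by rewrite mulr_ge0 ?exprn_ge0 ?invr_ge0 // ltW.
by apply: le_trans lxy; rewrite mulrC ler_pM2r // ltW.
Qed.

(** This is [class_Dcheck] in terms of the distance to the boundary: the annulus between the
    distances x/K and x keeps the fraction 1 - 1/c of the tail. *)
Lemma tailw_mass : exists K k : R, [/\ 1 < K, 0 < k &
  forall x, 0 < x <= 1 -> k * tailw x <= tailw x - tailw (x / K)].
Proof.
case: Dw => _ [K [c [K1 c1 H]]]; exists K, (1 - c^-1).
have c0 : 0 < c by lra.
have K0 : 0 < K by lra.
split=> //; first by rewrite subr_gt0 invf_lt1.
move=> x /andP[x0 x1]; rewrite mulrBl mul1r lerD2l lerN2.
have := H (1 - x); rewrite subr_ge0 x1 gtrBl x0 => /(_ isT).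
have -> : 1 - (1 - (1 - x)) / K = 1 - x / K :> R by congr (_ - _ / _); ring.
have xK : 0 <= x / K <= 1.
  by rewrite divr_ge0 ?(ltW x0) ?(ltW K0) //= ler_pdivrMr // mul1r (le_trans x1) // ltW.
by rewrite !omega_hatE ?(ltW x0) // -EFinM lee_fin ler_pdivlMl.
Qed.

(* Induction over dyadic x: the exponent 2 ^ m beats the doubling constant. *)
Lemma tailw_power_le : exists m0 : nat, forall m, (m0 <= m)%N ->
  exists2 A : R, 0 < A & forall x, 0 < x <= 1 -> x ^+ m <= A * tailw x.
Proof.
have [c c1 H] := tailw_doubling2.
pose m0 := Num.truncn c; have cm0 : c < 2 ^+ m0.+1.
  apply: lt_le_trans (truncnS_gt c) _; rewrite -natrX ler_nat.
  by apply: ltnW; exact: ltn_expl.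
exists m0.+1 => m mm.
have cm : c <= 2 ^+ m by apply: ltW; apply: lt_le_trans cm0 _; rewrite ler_weXn2l // ler1n.
have t1 : 0 < tailw 1 by apply: tailw_gt0; rewrite ltr01 lexx.
exists (c / tailw 1); first by rewrite divr_gt0 // (lt_le_trans ltr01).
have c0 : 0 < c by rewrite (lt_le_trans ltr01).
suff main j x : 2^-1 ^+ j <= x -> 0 < x <= 1 -> x ^+ m <= c / tailw 1 * tailw x.
  move=> x x01; have [x0 x1] := andP x01.
  have : (fun j => (2^-1 : R) ^+ j) @ \oo --> (0 : R).
    by apply: cvg_expr; rewrite ger0_norm ?invr_ge0 // invf_lt1 // ltr1n.
  move=> /cvgrPdist_lt /(_ x x0) [N _ HN].
  have := HN N (leqnn N); rewrite /= sub0r normrN ger0_norm ?exprn_ge0 ?invr_ge0 // => /ltW.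
  by move/main; apply.
elim: j x => [|j IH] x jx /andP[x0 x1].
  have -> : x = 1 by apply/eqP; rewrite eq_le x1 -(expr0 2^-1).
  by rewrite expr1n divfK ?gt_eqF.
have [x2|x2] := leP (2 * x) 1; last first.
  apply: (@le_trans _ _ 1); first by rewrite exprn_ile1 // ltW.
  rewrite mulrAC ler_pdivlMr // mul1r (le_trans (H 1 _)) ?ltr01 ?lexx //.
  by rewrite ler_pM2l // le_tailw ?divr_ge0 //; lra.
have := IH (2 * x); rewrite mulr_gt0 // x2 => /(_ _ isT) IH'.
have {}IH' : (2 * x) ^+ m <= c / tailw 1 * tailw (2 * x).
  by apply: IH'; move: jx; rewrite exprS ler_pdivrMl.
have h2 := H (2 * x); rewrite mulr_gt0 // x2 mulrAC divff // mul1r in h2; have {}h2 := h2 isT.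
rewrite -(ler_pM2l (exprn_gt0 m (ltr0n R 2))) -exprMn (le_trans IH') //.
rewrite [leRHS]mulrCA ler_pM2l ?divr_gt0 // (le_trans h2) // ler_wpM2r //.
by apply: ltW; apply: tailw_gt0; rewrite x0.
Qed.

(** Dyadic induction on x. Going from 2x to x adds one annulus, worth at most tailw(2x) / x^m, while
    the bound at 2x carries a factor 2^-m with 2^m >= 2c and so is also at most tailw(2x) / x^m.
    Since tailw(2x) <= c tailw(x), the sum reproduces the constant 2c. *)
Lemma integral_weight_power : exists m0 : nat, forall m, (m0 <= m)%N ->
  exists2 A : R, 0 < A & forall x, 0 < x <= 1 ->
    (\int[mu]_(t in `[0%R, (1 - x)%R[) (w t / (1 - t) ^+ m)%:E <= (A * tailw x / x ^+ m)%:E)%E.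
Proof.
have [c c1 H] := tailw_doubling2.
have c0 : 0 < c by rewrite (lt_le_trans ltr01).
pose m0 := Num.truncn (2 * c); have cm0 : 2 * c < 2 ^+ m0.+1.
  apply: lt_le_trans (truncnS_gt (2 * c)) _; rewrite -natrX ler_nat.
  by apply: ltnW; exact: ltn_expl.
exists m0.+1 => m mm.
have cm : 2 * c <= 2 ^+ m by apply: ltW; apply: lt_le_trans cm0 _; rewrite ler_weXn2l // ler1n.
exists (2 * c); first by rewrite mulr_gt0.
have f0 (x t : R) : 0 < x -> 0 <= t -> t < 1 - x -> 0 <= w t / (1 - t) ^+ m.
  by move=> x0 t0 t1; rewrite divr_ge0 ?w0 ?exprn_ge0 //; lra.
have mf (a b : R) : 0 <= a -> b < 1 -> measurable_fun (`[a, b[%classic : set MR) (fun t : MR => (w t / (1 - t) ^+ m)%:E).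
  move=> a0 b1; apply/measurable_EFinP; apply: measurable_funM.
    by apply: weight_measurable => // t /=; rewrite !in_itv /=; lra.
  have : measurable_fun (`[a, b[%classic : set MR) (fun t : MR => (1 - t) `^ (- m%:R) : MR).
    apply: measurable_funTS; apply: (measurableT_comp (@measurable_powR R (- m%:R))).
    exact: measurable_funB.
  apply: eq_measurable_fun => t; rewrite inE /= in_itv /= => h.
  by rewrite powRN powR_mulrn //; lra.
have piece (x y : R) : 0 < x -> x <= y -> y <= 1 ->
    (\int[mu]_(t in `[(1 - y)%R, (1 - x)%R[) (w t / (1 - t) ^+ m)%:E <= (tailw y / x ^+ m)%:E)%E.
  move=> x0 xy y1.
  apply: (@le_trans _ _ (\int[mu]_(t in `[(1 - y)%R, (1 - x)%R[) ((x ^+ m)^-1%:E * (w t)%:E))%E).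
    apply: ge0_le_integral => //.
    - by move=> t /=; rewrite in_itv /= => /andP[h1 h2]; rewrite lee_fin (f0 x) //; lra.
    - by apply: mf; lra.
    - apply/measurable_EFinP; apply: measurable_funM => //; apply: weight_measurable => // t /=.
      by rewrite !in_itv /=; lra.
    - move=> t /=; rewrite in_itv /= => /andP[h1 h2]; rewrite -EFinM lee_fin mulrC ler_wpM2r ?w0 //; first lra.
      by rewrite lef_pV2 ?posrE ?exprn_gt0 //; [rewrite lerXn2r ?nnegrE //; lra|lra].
  rewrite ge0_integralZl //.
  - rewrite integral_weight ?(ltW x0) // -EFinM lee_fin mulrC ler_wpM2r ?invr_ge0 ?exprn_ge0 ?(ltW x0) //.
    by rewrite gerBl -tailw0 le_tailw //; lra.
  - apply/measurable_EFinP; apply: weight_measurable => // t /=.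
    by rewrite !in_itv /=; lra.
  - by move=> t /=; rewrite in_itv /= => /andP[h1 h2]; rewrite lee_fin w0 //; lra.
  - by rewrite lee_fin invr_ge0 exprn_ge0 // ltW.
suff main j x : 2^-1 ^+ j <= x -> 0 < x <= 1 ->
    (\int[mu]_(t in `[0%R, (1 - x)%R[) (w t / (1 - t) ^+ m)%:E <= (2 * c * tailw x / x ^+ m)%:E)%E.
  move=> x x01; have [x0 x1] := andP x01.
  have : (fun j => (2^-1 : R) ^+ j) @ \oo --> (0 : R).
    by apply: cvg_expr; rewrite ger0_norm ?invr_ge0 // invf_lt1 // ltr1n.
  move=> /cvgrPdist_lt /(_ x x0) [N _ HN].
  have := HN N (leqnn N); rewrite /= sub0r normrN ger0_norm ?exprn_ge0 ?invr_ge0 // => /ltW.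
  by move/main; apply.
elim: j x => [|j IH] x jx /andP[x0 x1].
  have -> : x = 1 by apply/eqP; rewrite eq_le x1 -(expr0 2^-1).
  rewrite subrr set_itv_ge ?integral_set0 ?lee_fin; last by rewrite bnd_simp ltxx.
  by rewrite expr1n divr1 mulr_ge0 ?mulr_ge0 ?(ltW c0) // ltW // tailw_gt0 // ltr01 lexx.
have tx : 0 < tailw x by rewrite tailw_gt0 // x0.
(* For 2x > 1 the whole range is a single annulus, and one halving compares the tail at 1 with the
   tail at x. *)
have [x2|x2] := leP (2 * x) 1; last first.
  have := piece x 1 x0 x1 (lexx _); rewrite subrr => h; apply: (le_trans h).
  rewrite lee_fin ler_wpM2r ?invr_ge0 ?exprn_ge0 ?(ltW x0) //.
  have h1 : tailw 1 <= c * tailw (1 / 2) by apply: H; rewrite ltr01 lexx.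
  have h2 : tailw (1 / 2) <= tailw x by apply: le_tailw => //; lra.
  have h3 : c * tailw (1 / 2) <= c * tailw x by rewrite ler_pM2l.
  have h4 : 0 < c * tailw x by rewrite mulr_gt0.
  lra.
have := IH (2 * x); rewrite mulr_gt0 // x2 => /(_ _ isT) IH'.
have {}IH' : (\int[mu]_(t in `[0%R, (1 - 2 * x)%R[) (w t / (1 - t) ^+ m)%:E <= (2 * c * tailw (2 * x) / (2 * x) ^+ m)%:E)%E.
  by apply: IH'; move: jx; rewrite exprS ler_pdivrMl.
have h2 := H (2 * x); rewrite mulr_gt0 // x2 mulrAC divff // mul1r in h2; have {}h2 := h2 isT.
have -> : `[0, 1 - x[%classic = `[0, 1 - 2 * x[%classic `|` `[1 - 2 * x, 1 - x[%classic :> set R.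
  by apply/seteqP; split => t /=; rewrite !in_itv /=; [case: (ltP t (1 - 2 * x)) => h; [left|right]|move=> [|]]; lra.
rewrite ge0_integral_setU //.
- have := piece x (2 * x) x0 _ x2; rewrite ler_peMl ?(ltW x0) ?ler1n // => /(_ isT) p2.
  apply: (le_trans (leeD IH' p2)); rewrite -EFinD lee_fin.
  have xm : 0 < (x ^+ m)^-1 by rewrite invr_gt0 exprn_gt0.
  rewrite exprMn invfM mulrA -mulrDl ler_pM2r //.
  have h5 : 2 * c * tailw (2 * x) / 2 ^+ m <= tailw (2 * x).
    have t2 : 0 < tailw (2 * x) by rewrite tailw_gt0 // mulr_gt0.
    by rewrite ler_pdivrMr ?exprn_gt0 // [leRHS]mulrC ler_pM2r.
  lra.
- have -> : `[0, 1 - 2 * x[%classic `|` `[1 - 2 * x, 1 - x[%classic = `[0, 1 - x[%classic :> set R.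
    by apply/seteqP; split => t /=; rewrite !in_itv /=; [move=> [|]|case: (ltP t (1 - 2 * x)) => h; [left|right]]; lra.
  by apply: mf; lra.
- by move=> t /= [|]; rewrite !in_itv /= => h; rewrite lee_fin (f0 x) //; lra.
- by apply/disj_setPS => t /=; rewrite !in_itv /=; lra.
Qed.

End Weights.

(** * Carleson squares and their weights *)

Section Carleson.
Variable R : realType.
Local Notation C := (Cx R).
Local Notation mu := (@lebesgue_measure R).
Local Notation MR := (measurableTypeR R).
Local Notation R2 := (MR * MR)%type.

Lemma modC_polar (r t : R) : modC (polar r t) = `|r|.
Proof.
rewrite /modC /polar /= -sqrtr_sqr; congr Num.sqrt.
by rewrite -[RHS]mulr1 -(cos2Dsin2 t); ring.
Qed.

Lemma polarE (r y : R) : rC r * eC y = polar r (2 * pi * y).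
Proof. by apply: Cx_eq; rewrite ?ReCM ?ImCM /= ?mul0r ?subr0 ?addr0. Qed.

Lemma polarM (r1 r2 t1 t2 : R) : polar r1 t1 * polar r2 t2 = polar (r1 * r2) (t1 + t2).
Proof. by apply: Cx_eq; rewrite ?ReCM ?ImCM /= ?cosD ?sinD; ring. Qed.

Lemma cj_polar (r t : R) : cjC (polar r t) = polar r (- t).
Proof. by apply: Cx_eq; rewrite /= ?cosN ?sinN ?mulrN. Qed.

Lemma polar_arg (z : C) : exists2 t : R, - pi < t <= pi & z = polar (modC z) t.
Proof.
have pi0 := pi_gt0 R.
case: z => a b; have [y /andP[y0 y1] e] := polar_repr (a, b).
have {}e : Complex a b = polar (modC (Complex a b)) (2 * pi * y) :> C.
  by move: e => [ea eb]; apply: Cx_eq; [exact: ea|exact: eb].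
set r := modC _ in e *.
have [h|h] := leP (2 * pi * y) pi.
  exists (2 * pi * y) => //; rewrite h andbT (lt_le_trans (y := 0)) ?oppr_lt0 //.
  by rewrite !mulr_ge0 // ltW.
exists (2 * pi * y - 2 * pi); first by apply/andP; split; nra.
rewrite e /polar; have e2 : 2 * pi = pi *+ 2 :> R by rewrite mulr_natl.
rewrite e2; congr (Complex (_ * _) (_ * _)).
  by rewrite -[RHS]cosD2pi subrK.
by rewrite -[RHS]sinD2pi subrK.
Qed.

Lemma cos_lt_norm (h t : R) : 0 <= h <= pi -> - pi <= t <= pi -> (cos h < cos t) = (`|t| < h).
Proof.
move=> hh tt; rewrite -(cos_norm t) ltr_cos // in_itv /= ?hh // normr_ge0 /=.
by rewrite ler_norml.
Qed.

Lemma carlesonP (a z : C) : 0 < modC a < 1 ->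
  carleson a z <-> modC a <= modC z < 1 /\
    modC z * modC a * cos ((1 - modC a) / 2) < ReC (z * cjC a).
Proof.
move=> /andP[a0 a1].
have pi2 := pi_ge2 R.
have hh : 0 <= (1 - modC a) / 2 <= pi by lra.
split.
  move=> [r [th [th0 [[_ [ea _]] r1 hth ez]]]].
  have rz : modC z = r by rewrite ez modC_polar ger0_norm //; lra.
  rewrite rz; split=> //.
  have -> : ReC (z * cjC a) = r * modC a * cos (th - th0) by rewrite ez {1}ea cj_polar polarM.
  rewrite ltr_pM2l; last by rewrite mulr_gt0 //; lra.
  rewrite distrC in hth; rewrite cos_lt_norm; [exact: hth|exact: hh|].
  by move: hth; rewrite ltr_norml; clear -a1 a0 pi2; lra.
move=> [z1 hz].
have [th0 hth0 ea] := polar_arg a.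
have [d hd ed] := polar_arg (z * cjC a).
have z0 : 0 < modC z by lra.
exists (modC z), (th0 + d), th0; split=> //.
- by split=> //; split=> // a00; move: a0; rewrite a00 modC0 ltxx.
- rewrite opprD addrA subrr sub0r normrN -cos_lt_norm //; last by lra.
  move: hz; rewrite ed /= modCM modC_cj ltr_pM2l // mulr_gt0 //.
- apply: (@mulIf _ (rC (modC a ^+ 2))).
    by rewrite -modC_gt0 modC_rC normr_gt0 expf_neq0 // gt_eqF.
  rewrite -mulcj (mulrC a) mulrA ed modCM modC_cj {2}ea polarM.
  rewrite (mulrC (cjC a)) mulcj; apply: Cx_eq; rewrite ?ReCM ?ImCM /=; rewrite (addrC d); ring.
Qed.

Lemma measurable_carleson (a : C) : 0 < modC a < 1 -> measurable (@toC R @^-1` carleson a : set R2).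
Proof.
move=> a01; have [a0 a1] := andP a01.
pose g (z : C) := ReC (z * cjC a) - modC z * (modC a * cos ((1 - modC a) / 2)).
have -> : @toC R @^-1` carleson a = (@Dset R `&` (fun x => modC (toC x)) @^-1` `[modC a, +oo[) `&`
    (@Dset R `&` (fun x => g (toC x)) @^-1` `]0, +oo[).
  apply/seteqP; split => x /=; rewrite !in_itv /= !andbT.
    by move=> /(carlesonP _ a01) [/andP[h1 h2] h3]; rewrite /Dset /= /g subr_gt0 mulrA.
  move=> [[h1 h2] [_]]; rewrite /g subr_gt0 mulrA => h3; apply/(carlesonP _ a01).
  by split=> //; apply/andP.
apply: measurableI.
  apply: (@cont_measurable R (@modC R)); [|exact: measurable_Dset|exact: measurable_itv].
  by move=> z _; exact: continuous_modC.
apply: (@cont_measurable R g); [|exact: measurable_Dset|exact: measurable_itv].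
move=> z _; rewrite /g.
have h1 : {for z, continuous (fun z : C => ReC (z * cjC a))}.
  apply: (@continuous_comp _ _ _ (fun z : C => z * cjC a : C) (@ReC R)); last exact: continuous_ReC.
  by apply: (@cvgM _ _ (nbhs z) _ (fun z : C => z : C) (fun _ => cjC a)); [exact: cvg_id|exact: cvg_cst].
have h2 : {for z, continuous (fun z : C => modC z * (modC a * cos ((1 - modC a) / 2)))}.
  by apply: (@cvgM _ _ (nbhs z) _ (@modC R) (fun _ => modC a * cos ((1 - modC a) / 2))); [exact: continuous_modC|exact: cvg_cst].
exact: (@cvgB _ _ _ (nbhs z) _ (fun z : C => ReC (z * cjC a)) (fun z : C => modC z * (modC a * cos ((1 - modC a) / 2))) _ _ h1 h2).
Qed.

Lemma carleson_circle (a : C) (r y y0 : R) : 0 < modC a < 1 -> a = rC (modC a) * eC y0 -> 0 <= r < 1 ->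
  carleson a (rC r * eC (y + y0)) <-> modC a <= r /\ cos ((1 - modC a) / 2) < cos (2 * pi * y).
Proof.
move=> a01 ea /andP[r0 r1]; have [a0 a1] := andP a01.
have mz : modC (rC r * eC (y + y0)) = r by rewrite modCM modC_eC modC_rC mulr1 ger0_norm.
have hRe : ReC (rC r * eC (y + y0) * cjC a) = r * modC a * cos (2 * pi * y).
  rewrite {1}ea !polarE cj_polar polarM /=; congr (_ * cos _); ring.
split.
  move=> /(carlesonP _ a01); rewrite mz hRe => -[/andP[h1 _] h2]; split=> //.
  by move: h2; rewrite ltr_pM2l // mulr_gt0 //; lra.
move=> [h1 h2]; apply/(carlesonP _ a01); rewrite mz hRe h1 r1; split=> //.
by rewrite ltr_pM2l // mulr_gt0 //; lra.
Qed.

(** After the rotation taking a to the positive axis, the square meets the circle in an arc of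
    half-angle (1 - |a|)/2, a share (1 - |a|)/(2 pi) of the whole. *)
Lemma integral_carleson_circle (a : C) (r : R) : 0 < modC a < 1 -> 0 <= r < 1 ->
  (\int[mu]_(y in `[0%R, 1%R[) (\1_(carleson a) (rC r * eC y))%:E =
   (if modC a <= r then (1 - modC a) / 2 / pi else 0)%:E)%E.
Proof.
move=> a01 r01; have [a0 a1] := andP a01; have [r0 r1] := andP r01.
have pi2 := pi_ge2 R.
have [y0 y01 ea0] : exists2 y : R, 0 <= y <= 1 & a = rC (modC a) * eC y.
  have [y yy e] := polar_repr (ReC a, ImC a); exists y => //.
  have ae : toC (ReC a, ImC a) = a by apply: Cx_eq.
  by rewrite -toC_polar2; move: e; rewrite ae => <-; rewrite ae.
pose P (y : MR) : \bar R := (\1_(carleson a) (rC r * eC y))%:E.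
have PE y : P (y + y0) = (if (modC a <= r) && (cos ((1 - modC a) / 2) < cos (2 * pi * y)) then 1 else 0)%:E.
  rewrite /P indicE; have H := @carleson_circle a r y y0 a01 ea0 r01.
  case: ifPn => [/andP[h1 h2]|h]; first by rewrite mem_set //; apply/H.
  rewrite memNset // => /H [h1 h2]; by rewrite h1 h2 in h.
have mP : measurable_fun setT P.
  apply/measurable_EFinP.
  have -> : (fun y : MR => \1_(carleson a) (rC r * eC y)) = (fun y : MR => \1_(@toC R @^-1` carleson a) (polar2 r y)) :> (MR -> MR).
    by apply/funext => y; rewrite !indicE -toC_polar2; congr (nat_of_bool _)%:R; apply/idP/idP; rewrite !inE.
  apply: measurable_indic_comp; first exact: measurable_carleson.
  apply: (measurableT_comp (f := fun x : R2 => polar2 x.1 x.2) (g := fun y => (r, y))); last exact: measurable_fun_pair.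
  exact: measurable_polar2.
have Pp y : P (y + 1) = P y by rewrite /P eCD eC1 mulr1.
have P0 y : (0 <= P y)%E by rewrite lee_fin indicE.
rewrite -[LHS](@integral_period R P y0 mP P0 Pp) //.
under eq_integral => y _ do rewrite PE.
case: ifPn => h1 /=; last by rewrite integral0_eq.
set h := (1 - modC a) / 2.
have hpi : 0 < h / (2 * pi) < 1 / 2.
  by rewrite divr_gt0 ?ltr_pdivrMr ?mulr_gt0 /h; lra.
have p2 : 0 < 2 * pi :> R by lra.
have hh : 0 <= h <= pi by rewrite /h; lra.
(* The arc straddles y = 0, so in [0, 1[ it appears as two end pieces; on the second half y is
   reflected to 1 - y. *)
have key (y : R) : 0 <= y -> y < 1 -> (cos h < cos (2 * pi * y)) = (y < h / (2 * pi)) || (1 - h / (2 * pi) < y).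
  move=> yy0 yy1; have [y2|y2] := leP y (1 / 2).
    have hy : - pi <= 2 * pi * y <= pi by nra.
    have py : 0 <= 2 * pi * y by apply: mulr_ge0 => //; exact: ltW.
    rewrite (cos_lt_norm hh hy) (ger0_norm py) [X in X < _]mulrC -ltr_pdivlMr //.
    have -> : (1 - h / (2 * pi) < y) = false by apply/negbTE; rewrite -leNgt; lra.
    by rewrite orbF.
  have -> : cos (2 * pi * y) = cos (2 * pi * (1 - y)).
    by rewrite -[RHS]cosN -[RHS]cosD2pi; congr cos; ring.
  have hy : - pi <= 2 * pi * (1 - y) <= pi by nra.
  have py : 0 <= 2 * pi * (1 - y) by apply: mulr_ge0; [exact: ltW|rewrite subr_ge0 ltW].
  rewrite (cos_lt_norm hh hy) (ger0_norm py) [X in X < _]mulrC -ltr_pdivlMr //.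
  have -> : (y < h / (2 * pi)) = false by apply/negbTE; rewrite -leNgt; lra.
  by apply/idP/idP; lra.
have e1 y : y \in (`[0, 1[%classic : set MR) -> (if cos h < cos (2 * pi * y) then 1 else 0)%:E =
   (\1_(`[0, h / (2 * pi)[ `|` `]1 - h / (2 * pi), 1[)%classic (y : MR))%:E :> \bar R.
  rewrite inE /= in_itv /= => /andP[yy0 yy1]; rewrite key //.
  rewrite indicE; case: ifPn => [/orP[hy|hy]|/negP hy].
  - by rewrite mem_set //; left; rewrite /= in_itv /= yy0.
  - by rewrite mem_set //; right; rewrite /= in_itv /= hy.
  - by rewrite memNset // => -[] /=; rewrite in_itv /= => /andP[b1 b2]; apply: hy; rewrite ?b1 ?b2 ?orbT.
rewrite (eq_integral _ _ e1) integral_indic //; last by apply: measurableU.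
have -> : (`[0, h / (2 * pi)[ `|` `]1 - h / (2 * pi), 1[)%classic `&` `[0, 1[%classic =
   `[0, h / (2 * pi)[%classic `|` `]1 - h / (2 * pi), 1[%classic :> set R.
  apply/seteqP; split => y; first by case.
  by move=> yy; split=> //; case: yy => /=; rewrite !in_itv /=; lra.
transitivity (mu `[0%R, (h / (2 * pi))%R[%classic + mu `](1 - h / (2 * pi))%R, 1%R[%classic)%E.
  apply: measureU => //.
  by apply/seteqP; split => y //= []; rewrite !in_itv /=; lra.
rewrite !lebesgue_measure_itv /= !lte_fin.
have -> : (0 < h / (2 * pi)) by lra.
have -> : (1 - h / (2 * pi) < 1) by lra.
rewrite -!EFinD; congr _%:E; field.
by rewrite gt_eqF //; lra.
Qed.

Variable w : R -> R.
Hypothesis rw : radial_weight w.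

Let w0 t : 0 <= t <= 1 -> 0 <= w t. Proof. by case: rw => h _ _; exact: h. Qed.

Lemma measurable_weight_modC : measurable_fun (@Dset R : set R2) (fun x : R2 => w (modC (toC x)) : MR).
Proof.
apply: (@measurable_comp _ _ _ _ _ _ (`[0, 1[%classic : set MR)) => //.
- by move=> _ [x x1 <-]; rewrite /= in_itv /= modC_ge0 x1.
- by apply: weight_measurable => // t /=; rewrite !in_itv /= => /andP[-> /ltW].
- by apply: (@cont_measurable R (@modC R)) => z _; exact: continuous_modC.
Qed.

Lemma measurable_circle_mean_disc (g : C -> R) : measurable_fun (@Dset R : set R2) (fun x : R2 => g (toC x) : MR) ->
  (forall z, modC z < 1 -> 0 <= g z) ->
  measurable_fun (`[0%R, 1%R[%classic : set MR) (fun r : MR => (\int[mu]_(y in `[0%R, 1%R[) (g (rC r * eC y))%:E)%E).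
Proof.
move=> /measurable_EFinP mg g0.
have mF' : measurable_fun setT ((fun x : R2 => (g (toC x))%:E) \_ (@Dset R)).
  by apply/(measurable_restrictT _ (@measurable_Dset R)).
have F'0 x : (0 <= ((fun x : R2 => (g (toC x))%:E) \_ (@Dset R)) x)%E.
  by rewrite patchE; case: ifPn => // /set_mem /g0; rewrite lee_fin.
have := measurable_funTS (D := `[0%R, 1%R[%classic : set MR) (measurable_circle_mean mF' F'0).
apply: eq_measurable_fun => r; rewrite inE /= in_itv /= => /andP[r0 r1].
by apply: eq_integral => y _; rewrite patchE toC_polar2 ifT // inE /Dset /= toC_polar2 modC_circle.
Qed.

Lemma measurable_circle_slice (g : C -> R) (r : R) : measurable_fun (@Dset R : set R2) (fun x : R2 => g (toC x) : MR) ->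
  0 <= r < 1 -> measurable_fun setT (fun y : MR => g (rC r * eC y) : MR).
Proof.
move=> mg /andP[r0 r1].
apply: (eq_measurable_fun (fun y : MR => (fun x : R2 => g (toC x)) (polar2 r y))).
  by move=> y _; rewrite toC_polar2.
apply: (@measurable_comp _ _ _ _ _ _ (@Dset R : set R2) (fun x : R2 => g (toC x) : MR) setT (fun y : MR => polar2 r y : R2)) => //; first exact: measurable_Dset.
  by move=> _ [y _ <-]; rewrite /Dset /= toC_polar2 modC_circle.
apply: (measurableT_comp (f := fun x : R2 => polar2 x.1 x.2) (g := fun y => (r, y))); last exact: measurable_fun_pair.
exact: measurable_polar2.
Qed.

Lemma areaInt_weight (g : C -> R) : measurable_fun (@Dset R : set R2) (fun x : R2 => g (toC x) : MR) ->
  (forall z, modC z < 1 -> 0 <= g z) ->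
  (areaInt (@disc R) (fun z => (g z * w (modC z))%:E) =
   \int[mu]_(r in `[0%R, 1%R[) ((polar_const R * r * w r)%:E * \int[mu]_(y in `[0%R, 1%R[) (g (rC r * eC y))%:E))%E.
Proof.
move=> mg g0; rewrite areaInt_polar.
- apply: eq_integral => r; rewrite inE /= in_itv /= => r01; have [r0 r1] := andP r01.
  under eq_integral => y _ do rewrite modC_circle // EFinM muleC.
  rewrite ge0_integralZl //.
  + by rewrite muleA -EFinM.
  + by apply/measurable_EFinP; apply: measurable_funTS; exact: measurable_circle_slice.
  + by move=> y _; rewrite lee_fin g0 // modC_circle.
  + by rewrite lee_fin w0 // r0 ltW.
- apply/measurable_EFinP; apply: measurable_funM => //; exact: measurable_weight_modC.
- by move=> z z1; rewrite lee_fin mulr_ge0 ?g0 ?w0 // modC_ge0 ltW.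
Qed.

(** In polar coordinates the angular integral is the constant [k], and the Jacobian factor r lies
    between 1/2 and 1 because |a| >= 1/2; this accounts for the factor 2 between the two bounds. *)
Lemma wmeas_carleson (a : C) : 1 / 2 <= modC a < 1 -> exists2 W : R, wmeas w (carleson a) = W%:E &
  polar_const R / (4 * pi) * ((1 - modC a) * tailw w (1 - modC a)) <= W <=
  polar_const R / (2 * pi) * ((1 - modC a) * tailw w (1 - modC a)).
Proof.
move=> /andP[a0 a1].
have a01 : 0 < modC a < 1 by lra.
have pc := polar_const_gt0 R; have pi0 := pi_gt0 R.
have E1 : wmeas w (carleson a) = areaInt (@disc R) (fun z => (\1_(carleson a) z * w (modC z))%:E).
  rewrite /wmeas /areaInt; congr (_ * _)%E; rewrite integral_mkcond [RHS]integral_mkcond.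
  apply: eq_integral => x _; rewrite !patchE indicE.
  have e1 : (x \in @toC R @^-1` carleson a) = (toC x \in carleson a) by apply/idP/idP; rewrite !inE.
  rewrite e1; case: (boolP (toC x \in carleson a)) => [/[dup]/set_mem/(carlesonP _ a01)[/andP[_ h] _] _|_].
    by rewrite mem_set // mul1r.
  by rewrite mul0r; case: ifP.
have mI : measurable_fun (@Dset R : set R2) (fun x : R2 => \1_(carleson a) (toC x) : MR).
  apply: measurable_funTS.
  have -> : (fun x : R2 => \1_(carleson a) (toC x)) = \1_(@toC R @^-1` carleson a) :> (R2 -> MR).
    by apply/funext => y; rewrite !indicE; congr (nat_of_bool _)%:R; apply/idP/idP; rewrite !inE.
  by apply: measurable_indic; exact: measurable_carleson.
rewrite {}E1 areaInt_weight //.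
set k := (1 - modC a) / 2 / pi.
have k0 : 0 < k by rewrite !divr_gt0 //; lra.
have pos (x y : R) : 0 <= x -> 0 <= y -> 0 <= polar_const R * x * y * k.
  by move=> x0 y0; apply: mulr_ge0; [apply: mulr_ge0 => //; apply: mulr_ge0 => //; exact: ltW|exact: ltW].
have pos2 (y : R) : 0 <= y -> 0 <= polar_const R / 2 * k * y.
  by move=> y0; have := pos (1 / 2) _ _ y0; rewrite mul1r mulrAC; apply; rewrite invr_ge0.
have mw (b : R) : 0 <= b -> measurable_fun (`[b, 1[%classic : set MR) (w : MR -> MR).
  by move=> b0; apply: weight_measurable => // t /=; rewrite !in_itv /=; lra.
have -> : (\int[mu]_(r in `[0%R, 1%R[) ((polar_const R * r * w r)%:E * \int[mu]_(y in `[0%R, 1%R[) (\1_(carleson a) (rC r * eC y))%:E)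
   = \int[mu]_(r in `[modC a, 1%R[) (polar_const R * r * w r * k)%:E)%E.
  rewrite integral_mkcond [RHS]integral_mkcond; apply: eq_integral => r _; rewrite !patchE.
  case: ifPn => [|/negP]; rewrite inE /= in_itv /=.
    move=> r01; rewrite integral_carleson_circle //.
    case: ifPn => ar.
      by rewrite mem_set /= ?in_itv /= ?ar //; lra.
    by rewrite mule0 memNset //= in_itv /=; apply/negP; rewrite (negbTE ar).
  move=> nr; rewrite memNset //= in_itv /= => h; apply: nr; lra.
have iw : (\int[mu]_(r in `[modC a, 1%R[) (w r)%:E)%E = (tailw w (1 - modC a))%:E.
  have := @integral_weight R w rw (1 - modC a) 0; rewrite tailw0 !subr0 subKr => -> //; lra.
have up : (\int[mu]_(r in `[modC a, 1%R[) (polar_const R * r * w r * k)%:E <= (polar_const R * k * tailw w (1 - modC a))%:E)%E.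
  rewrite (EFinM (_ * k)) -iw -ge0_integralZl //.
  - apply: ge0_le_integral => //.
    + move=> r /=; rewrite in_itv /= => /andP[h1 h2]; rewrite lee_fin.
      have wr : 0 <= w r by apply: w0; lra.
      have r0 : 0 <= r by lra.
      by apply: pos => //; lra.
    + apply/measurable_EFinP; apply: measurable_funM => //; apply: measurable_funM; last by apply: mw; lra.
      exact: measurable_funM.
    + by apply/measurable_EFinP; apply: measurable_funM => //; apply: mw; lra.
    + move=> r /=; rewrite in_itv /= => /andP[h1 h2]; rewrite -EFinM lee_fin.
      have wr : 0 <= w r by apply: w0; lra.
      have -> : polar_const R * r * w r * k = r * (polar_const R * k * w r) by ring.
      by rewrite ler_piMl ?(ltW h2) //; have := pos 1 _ ler01 wr; rewrite mulr1 mulrAC.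
  - by apply/measurable_EFinP; apply: mw; lra.
  - by move=> r /=; rewrite in_itv /= => h; rewrite lee_fin w0 //; lra.
  - by rewrite lee_fin; have := pos 1 1 ler01 ler01; rewrite !mulr1.
have lo : ((polar_const R / 2 * k * tailw w (1 - modC a))%:E <= \int[mu]_(r in `[modC a, 1%R[) (polar_const R * r * w r * k)%:E)%E.
  rewrite (EFinM (_ * k)) -iw -ge0_integralZl //.
  - apply: ge0_le_integral => //.
    + move=> r /=; rewrite in_itv /= => /andP[h1 h2]; rewrite -EFinM lee_fin.
      by apply: pos2; apply: w0; lra.
    + by apply/measurable_EFinP; apply: measurable_funM => //; apply: mw; lra.
    + apply/measurable_EFinP; apply: measurable_funM => //; apply: measurable_funM; last by apply: mw; lra.
      exact: measurable_funM.
    + move=> r /=; rewrite in_itv /= => /andP[h1 h2]; rewrite -EFinM lee_fin.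
      have wr : 0 <= w r by apply: w0; lra.
      have -> : polar_const R * r * w r * k = r * (polar_const R * k * w r) by ring.
      have -> : polar_const R / 2 * k * w r = (1 / 2) * (polar_const R * k * w r) by field.
      by rewrite ler_wpM2r ?(le_trans a0) //; have := pos 1 _ ler01 wr; rewrite mulr1 mulrAC.
  - by apply/measurable_EFinP; apply: mw; lra.
  - by move=> r /=; rewrite in_itv /= => h; rewrite lee_fin w0 //; lra.
  - by rewrite lee_fin; have := pos2 1 ler01; rewrite mulr1.
set I := (\int[mu]_(r in _) _)%E in up lo *.
have fI : I \is a fin_num.
  rewrite fin_numE; apply/andP; split; apply/eqP => e; move: up lo; rewrite e ?leye_eq ?leeNy_eq //.
exists (fine I); first by rewrite fineK.
move: up lo; rewrite -(fineK fI) !lee_fin => up lo.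
have ar1 (b p T x : R) : p != 0 -> b / (4 * p) * (x * T) = b / 2 * (x / 2 / p) * T by move=> p0; field.
have ar2 (b p T x : R) : p != 0 -> b / (2 * p) * (x * T) = b * (x / 2 / p) * T by move=> p0; field.
by rewrite /= ar1 ?ar2 ?(lt0r_neq0 pi0) // lo up.
Qed.

End Carleson.

(** * Local estimate of the derivatives *)

Section Kernel.
Variable R : realType.
Local Notation C := (Cx R).

(** The denominator of the Poisson and Bergman kernels; for a and z in the disc it is comparable to
    1 - |a| plus the distance from a to z. *)
Definition bk (a z : C) : R := modC (1 - cjC a * z).

Lemma bkC (a z : C) : bk a z = bk z a.
Proof. by rewrite /bk -modC_cj cjCB cjC1 cjCM cjCK mulrC. Qed.

Lemma bk_ge (a z : C) : 1 - modC a * modC z <= bk a z.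
Proof. by rewrite -{1}(@modC1 R) -(modC_cj a) -modCM; exact: modCBge. Qed.

Lemma bk_gt0 (a z : C) : modC a < 1 -> modC z < 1 -> 0 < bk a z.
Proof.
move=> a1 z1; apply: lt_le_trans (bk_ge a z); have := modC_ge0 a; have := modC_ge0 z; nra.
Qed.

Lemma bk_ge1 (a z : C) : modC z < 1 -> 1 - modC a <= bk a z.
Proof.
by move=> z1; apply: le_trans (bk_ge a z); rewrite lerD2l lerN2 ler_piMr ?modC_ge0 ?ltW.
Qed.

Lemma bk_lip (a b z : C) : modC z < 1 -> bk a z <= bk b z + modC (a - b).
Proof.
move=> z1; rewrite /bk.
have -> : 1 - cjC a * z = (1 - cjC b * z) + (- (cjC (a - b) * z)) by rewrite cjCB; ring.
apply: (le_trans (modCD _ _)); rewrite modCN lerD2l modCM modC_cj ler_piMr ?modC_ge0 //.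
exact: ltW.
Qed.

Lemma bk_le (a z : C) : modC a < 1 -> bk a z <= 2 * (1 - modC a) + modC (z - a).
Proof.
move=> a1; rewrite /bk.
have -> : 1 - cjC a * z = rC (1 - modC a ^+ 2) - cjC a * (z - a).
  rewrite rCB -mulcj rC1; ring.
apply: (le_trans (modCB _ _)); rewrite modCM modC_cj modC_rC.
have a0 := modC_ge0 a.
rewrite ger0_norm; last by nra.
have : modC a * modC (z - a) <= modC (z - a) by rewrite ler_piMl ?modC_ge0 ?ltW.
nra.
Qed.

Lemma bk_neq0 (a z : C) : modC a < 1 -> modC z < 1 -> 1 - cjC a * z != 0.
Proof. by move=> a1 z1; rewrite -modC_gt0; exact: bk_gt0. Qed.

Lemma cdiff_kernel (a z : C) (m : nat) : modC a < 1 -> modC z < 1 ->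
  cdiff (fun z : C => ((1 - cjC a * z) ^+ m)^-1) z (m%:R * cjC a * ((1 - cjC a * z) ^+ m.+1)^-1).
Proof.
move=> a1 z1; have b0 := bk_neq0 a1 z1.
have h1 := cdiffD (cdiff_cst 1 z) (cdiffN (cdiffM (cdiff_cst (cjC a) z) (cdiff_id z))).
have h2 := @cdiffV R (fun w => (1 - cjC a * w) ^+ m) z _ (expf_neq0 m b0) (cdiffX m h1).
apply: (cdiff_eq h2); set b := 1 - cjC a * z in b0 *.
case: m {h2} => [|m]; first by rewrite !mul0r oppr0 mul0r.
rewrite /= mul0r !add0r mulr1 !exprS; field.
by rewrite b0 expf_neq0.
Qed.

Lemma holo_kernel (a : C) (m : nat) : modC a < 1 -> holo_disc (fun z : C => ((1 - cjC a * z) ^+ m)^-1).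
Proof. by move=> a1 z z1; have [] := cdiff_derive1 (cdiff_kernel m a1 z1). Qed.

Lemma derive1n_kernel (a z : C) (m n : nat) : modC a < 1 -> modC z < 1 ->
  derive1n n (fun z : C => ((1 - cjC a * z) ^+ m)^-1) z =
  (\prod_(i < n) (m + i)%:R) * cjC a ^+ n * ((1 - cjC a * z) ^+ (m + n))^-1.
Proof.
move=> a1; elim: n z => [|n IH] z z1; first by rewrite derive1n0 big_ord0 expr0 !mul1r addn0.
rewrite derive1nS.
pose P : C := (\prod_(i < n) (m + i)%:R) * cjC a ^+ n.
have h1 := cdiffM (cdiff_cst P z) (cdiff_kernel (m + n) a1 z1).
have h2 : cdiff (derive1n n (fun z : C => ((1 - cjC a * z) ^+ m)^-1)) z
   (0 * ((1 - cjC a * z) ^+ (m + n))^-1 + P * ((m + n)%:R * cjC a * ((1 - cjC a * z) ^+ (m + n).+1)^-1)).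
  apply: (@cdiff_local _ _ _ _ _ (1 - modC z)) h1; first by rewrite subr_gt0.
  move=> v vz; rewrite IH //.
  by have := modCD z (v - z); rewrite addrC subrK; lra.
have [_ ->] := cdiff_derive1 h2.
rewrite mul0r add0r big_ord_recr /= addnS (exprS (cjC a)) /P.
set K := (_ ^+ (m + n).+1)^-1; set Q := \prod_(i < n) _; set M := (m + n)%:R; ring.
Qed.

Lemma cont_on_bk (a : C) (r : R) : cont_on 0 1 (fun y => bk a (rC r * eC y)).
Proof.
apply: (@cont_on_modC R 0 1 (fun y => 1 - cjC a * (rC r * eC y))).
apply: cont_onB; first exact: cont_on_cst.
by apply: cont_onM; [exact: cont_on_cst|exact: circle_cont].
Qed.

Lemma cont_on_bkV (a : C) (r : R) (m : nat) : modC a < 1 -> 0 <= r < 1 ->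
  cont_on 0 1 (fun y => ((bk a (rC r * eC y)) ^+ m)^-1).
Proof.
move=> a1 /andP[r0 r1] x x01.
have hc : {for x, continuous (fun y => bk a (rC r * eC y) ^+ m)}.
  by apply: (@continuous_comp _ _ _ (fun y => bk a (rC r * eC y)) (fun t : R => t ^+ m)); [exact: cont_on_bk|exact: exprn_continuous].
apply: cvgV; last exact: hc.
by rewrite expf_neq0 // gt_eqF // bk_gt0 // modC_circle.
Qed.

(** On |z| = r > 0 the conjugate of z is r^2 / z, so 1 / |1 - conj(a) z|^2 becomes the Cauchy
    integrand of 1 / (1 - conj(a) z) at the point r^2 a, and the mean is the value of that function
    there. *)
Lemma poisson_mean (a : C) (r : R) : modC a < 1 -> 0 <= r < 1 ->
  rint 0 1 (fun y => (bk a (rC r * eC y) ^+ 2)^-1) = (1 - modC a ^+ 2 * r ^+ 2)^-1.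
Proof.
move=> a1 /andP[r0 r1]; have a0 := modC_ge0 a.
have [r00|rn0] := eqVneq r 0.
  rewrite r00 expr0n /= mulr0 subr0 invr1.
  rewrite (@eq_rint _ _ _ _ (fun=> 1)); first by rewrite rint_cst // subr0 mulr1.
  by move=> y _; rewrite /bk mul0r mulr0 subr0 modC1 expr1n invr1.
have {}r0 : 0 < r by rewrite lt_neqAle eq_sym rn0.
have z0r : modC (rC (r ^+ 2) * a) < r.
  by rewrite modCM modC_rC ger0_norm ?sqr_ge0 // expr2 -mulrA gtr_pMr //; nra.
have := Cauchy_formula (holo_kernel (m := 1) a1) z0r r1.
rewrite (@eq_cint _ _ _ _ (fun y => rC ((bk a (rC r * eC y) ^+ 2)^-1))).
  move=> /(congr1 (@ReC R)).
  have -> : ReC (cint 0 1 (fun y : R => rC (bk a (rC r * eC y) ^+ 2)^-1)) =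
     rint 0 1 (fun y => (bk a (rC r * eC y) ^+ 2)^-1) by [].
  move=> ->; rewrite expr1.
  have -> : 1 - cjC a * (rC (r ^+ 2) * a) = rC (1 - modC a ^+ 2 * r ^+ 2).
    rewrite rCB (rCM (modC a ^+ 2)) -mulcj rC1; ring.
  set t := 1 - _; have t0 : rC t != 0.
    by rewrite -modC_gt0 modC_rC normr_gt0 /t gt_eqF // subr_gt0 -exprMn; apply: exprn_ilt1; [exact: mulr_ge0 (ltW _)|rewrite //; nra].
  suff -> : (rC t)^-1 = rC t^-1 by [].
  apply: (mulfI t0); rewrite divff // -rCM divff //.
  by apply: contraNneq t0 => ->.
move=> y _; set z := rC r * eC y.
have zn : z != 0 by rewrite -modC_gt0 modC_circle // ltW.
have z1 : modC z < 1 by rewrite modC_circle // ltW.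
have rz : rC (r ^+ 2) = z * cjC z by rewrite mulcj modC_circle // ltW.
have b0 := bk_neq0 a1 z1.
have b0' : 1 - cjC z * a != 0 by exact: bk_neq0.
have b2 : rC (bk a z ^+ 2) = (1 - cjC a * z) * (1 - cjC z * a).
  by rewrite -mulcj cjCB cjC1 cjCM cjCK (mulrC a).
have bb : rC (bk a z ^+ 2)^-1 = (rC (bk a z ^+ 2))^-1.
  have t0 : bk a z ^+ 2 != 0 by rewrite expf_neq0 // gt_eqF // bk_gt0.
  have t1 : rC (bk a z ^+ 2) != 0 by rewrite b2 mulf_neq0.
  by apply: (mulfI t1); rewrite divff // -rCM divff.
rewrite bb b2 rz expr1.
have -> : z - z * cjC z * a = z * (1 - cjC z * a) by ring.
by field; rewrite b0 b0' zn.
Qed.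

Lemma poisson_mean_le (a : C) (r : R) : modC a < 1 -> 0 <= r < 1 ->
  rint 0 1 (fun y => (bk a (rC r * eC y) ^+ 2)^-1) <= (1 - modC a)^-1.
Proof.
move=> a1 /[dup] /andP[r0 r1] r01; have a0 := modC_ge0 a; rewrite poisson_mean //.
rewrite lef_pV2 ?posrE ?subr_gt0 //.
  rewrite lerD2l lerN2 -exprMn expr2 -[leRHS]mulr1 -[leRHS]mulr1 -mulrA; apply: ler_pM; rewrite ?mulr_ge0 //; nra.
by rewrite -exprMn; apply: exprn_ilt1 => //; [rewrite mulr_ge0|nra].
Qed.

(** On the circle |v| = r the distance |v - z| is bounded below by a multiple of |1 - conj(a) v|,
    which is at least 1 - |a|. For n >= 1 Cauchy's kernel of order n + 1 is therefore dominated by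
    the kernel of order 2 times (1 - |a|)^(1 - n). *)
Lemma derive_pointwise (n : nat) : exists2 c : R, 0 < c & forall (f : C -> C) (a z : C) (r : R), holo_disc f ->
  modC a < 1 -> modC (z - a) <= (1 - modC a) / 4 -> 1 - (1 - modC a) / 4 <= r -> r < 1 ->
  modC (derive1n n f z) <= c / (1 - modC a) ^+ n *
    rint 0 1 (fun y => modC (f (rC r * eC y)) * ((1 - modC a) / bk a (rC r * eC y) ^+ 2)).
Proof.
(* With d = 1 - |a| and v the point of the circle, replacing v / r by v and r a by z costs at most
   3d/4, while |v - z| >= r - |z| >= d/2; hence the constant 1 + 3/2. *)
have bkr (a z : C) (r y : R) : modC a < 1 -> modC (z - a) <= (1 - modC a) / 4 -> 1 - (1 - modC a) / 4 <= r -> r < 1 ->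
   bk a (rC r * eC y) <= 5 / 2 * modC (rC r * eC y - z).
  move=> a1 za rlo r1; have a0 := modC_ge0 a; have r0 : 0 <= r by lra.
  have e1 : bk a (rC r * eC y) = modC (eC y - rC r * a).
    have e0 := eC_neq0 y.
    rewrite bkC /bk cjCM cjC_rC cj_eC -[LHS]mul1r -(modC_eC y) -modCM; congr modC.
    by field.
  have e2 : eC y - rC r * a = (rC (1 - r) * eC y) + ((rC r * eC y - z) + ((z - a) + rC (1 - r) * a)).
    by rewrite rCB rC1; ring.
  have h1 := modCD (rC (1 - r) * eC y) ((rC r * eC y - z) + ((z - a) + rC (1 - r) * a)).
  have h2 := modCD (rC r * eC y - z) ((z - a) + rC (1 - r) * a).
  have h3 := modCD (z - a) (rC (1 - r) * a).
  have h4 : modC (rC (1 - r) * a) <= (1 - modC a) / 4.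
    by rewrite modCM modC_rC ger0_norm ?subr_ge0 ?(ltW r1) //; nra.
  have h5 : modC (rC (1 - r) * eC y) <= (1 - modC a) / 4.
    by rewrite modC_circle ?subr_ge0 ?(ltW r1) //; lra.
  have h6 := circle_dist y z r0.
  have h7 := modCD a (z - a); rewrite addrC subrK in h7.
  by rewrite e1 e2; lra.
have za1 (a z : C) : modC a < 1 -> modC (z - a) <= (1 - modC a) / 4 -> modC z < 1.
  by move=> a1 za; have h7 := modCD a (z - a); rewrite addrC subrK in h7; lra.
have zar (a z : C) (r : R) : modC a < 1 -> modC (z - a) <= (1 - modC a) / 4 -> 1 - (1 - modC a) / 4 <= r -> modC z < r.
  by move=> a1 za rlo; have h7 := modCD a (z - a); rewrite addrC subrK in h7; lra.
have inv (a z : C) (r y : R) : modC a < 1 -> modC (z - a) <= (1 - modC a) / 4 -> 1 - (1 - modC a) / 4 <= r -> r < 1 ->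
   (modC (rC r * eC y - z))^-1 <= 5 / 2 / bk a (rC r * eC y).
  move=> a1 za rlo r1; have a0 := modC_ge0 a; have r0 : 0 <= r by lra.
  have b0 : 0 < bk a (rC r * eC y) by rewrite bk_gt0 // modC_circle.
  have m0 : 0 < modC (rC r * eC y - z) by rewrite modC_gt0 circle_neq //; exact: (zar a).
  have := bkr _ _ _ y a1 za rlo r1; move: (bk _ _) (modC _) b0 m0 => b m b0 m0 h.
  by rewrite ler_pdivlMr // ler_pdivrMl // mulrC.
have contA f (a : C) (r : R) : holo_disc f -> modC a < 1 -> 0 <= r -> r < 1 ->
   cont_on 0 1 (fun y => modC (f (rC r * eC y)) * ((1 - modC a) / bk a (rC r * eC y) ^+ 2)).
  move=> hf a1 r0 r1 x x01.
  have h1 : {for x, continuous (fun y => modC (f (rC r * eC y)))} by apply: (cont_on_modC (holo_circle_cont hf r0 r1)).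
  have h2 : {for x, continuous (fun y => (bk a (rC r * eC y) ^+ 2)^-1)} by apply: (@cont_on_bkV a r 2 a1 _ x x01); rewrite r0.
  by apply: continuousM; [exact: h1|apply: continuousM; [exact: cvg_cst|exact: h2]].
have contB f (z : C) (r : R) m : holo_disc f -> modC z < r -> r < 1 ->
   cont_on 0 1 (fun y => modC (f (rC r * eC y)) / modC (rC r * eC y - z) ^+ m).
  move=> hf zr r1.
  have r0 : 0 <= r by apply: le_trans (ltW zr); exact: modC_ge0.
  have := cont_on_modC (Cauchy_kernel_cont (m := m) zr (holo_circle_cont hf r0 r1)).
  by under eq_fun do rewrite modCM modCV modCX.
(* For n = 0 Cauchy's kernel has order 1 only. The formula is applied to f(v) / (1 - conj(a) v),
   which supplies the second factor, at the price of |1 - conj(a) z| <= 9/4 (1 - |a|). *)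
case: n => [|n].
  exists (2 * (5 / 2) * (9 / 4)) => [|f a z r hf a1 za rlo r1]; first by lra.
  have a0 := modC_ge0 a; have r0 : 0 <= r by lra.
  pose g (z : C) := f z * ((1 - cjC a * z) ^+ 1)^-1.
  have hg : holo_disc g := holoM hf (holo_kernel (m := 1) a1).
  have zr := zar _ _ _ a1 za rlo; have z1 := za1 _ _ a1 za.
  have := modC_derive1n_le hg 0 zr r1; rewrite derive1n0 fact0 mulr1 /g modCM modCV expr1 -/(bk a z).
  have b0 : 0 < bk a z by rewrite bk_gt0.
  rewrite ler_pdivrMr // => h; rewrite derive1n0; apply: (le_trans h); rewrite expr0 divr1.
  have d0 : 0 < 1 - modC a by lra.
  have bz : bk a z <= 9 / 4 * (1 - modC a) by have := bk_le z a1; lra.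
  have h1 : rint 0 1 (fun y => modC (g (rC r * eC y)) / modC (rC r * eC y - z) ^+ 1) <=
     5 / 2 / (1 - modC a) * rint 0 1 (fun y => modC (f (rC r * eC y)) * ((1 - modC a) / bk a (rC r * eC y) ^+ 2)).
    rewrite -(rintZ _ (contA _ _ _ hf a1 r0 r1)).
    apply: le_rint; first exact: (contB _ _ _ _ hg zr r1).
      by move=> x x01; apply: continuousM; [exact: cvg_cst|exact: (contA _ _ _ hf a1 r0 r1 x x01)].
    move=> y y01; rewrite /g modCM modCV !expr1 -/(bk a (rC r * eC y)).
    have b1 : 0 < bk a (rC r * eC y) by rewrite bk_gt0 // modC_circle.
    have -> : 5 / 2 / (1 - modC a) * (modC (f (rC r * eC y)) * ((1 - modC a) / bk a (rC r * eC y) ^+ 2)) =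
      modC (f (rC r * eC y)) / bk a (rC r * eC y) * (5 / 2 / bk a (rC r * eC y)) by field; rewrite ?gt_eqF.
    by rewrite ler_wpM2l ?divr_ge0 ?modC_ge0 ?(ltW b1) //; exact: inv.
  set I1 := rint 0 1 _ in h1 *; set I2 := rint 0 1 _ in h1 *.
  have I20 : 0 <= I2.
    apply: rint_ge0 => y _; rewrite mulr_ge0 ?modC_ge0 // divr_ge0 ?(ltW d0) ?exprn_ge0 ?modC_ge0 //.
  apply: (@le_trans _ _ (2 * (5 / 2 / (1 - modC a) * I2) * (9 / 4 * (1 - modC a)))).
    apply: ler_pM => //; [|exact: ltW|by rewrite ler_pM2l].
    rewrite mulr_ge0 // /I1; apply: rint_ge0 => y _; rewrite divr_ge0 ?modC_ge0 ?exprn_ge0 ?modC_ge0 //.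
  rewrite le_eqVlt; apply/orP; left; apply/eqP; field; exact: lt0r_neq0.
exists (2 * n.+1`!%:R * (5 / 2) ^+ n.+2) => [|f a z r hf a1 za rlo r1].
  have h : 0 < (5 / 2 : R) ^+ n.+2 by apply: exprn_gt0; lra.
  by apply: mulr_gt0 => //; apply: mulr_gt0; rewrite ?ltr0n ?fact_gt0.
have a0 := modC_ge0 a; have r0 : 0 <= r by lra.
have zr := zar _ _ _ a1 za rlo; have z1 := za1 _ _ a1 za.
have d0 : 0 < 1 - modC a by lra.
apply: (le_trans (modC_derive1n_le hf n.+1 zr r1)).
set k := (5 / 2) ^+ n.+2; set F := n.+1`!%:R.
have F0 : 0 < F by rewrite ltr0n fact_gt0.
have k0 : 0 < k by apply: exprn_gt0; lra.
rewrite -(mulrA (2 * F)) -(mulrA (2 * F)) ler_pM2l ?mulr_gt0 //.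
rewrite -(rintZ _ (contA _ _ _ hf a1 r0 r1)).
apply: le_rint; first exact: (contB _ _ _ _ hf zr r1).
  by move=> x x01; apply: continuousM; [exact: cvg_cst|exact: (contA _ _ _ hf a1 r0 r1 x x01)].
move=> y y01.
have b1 : 0 < bk a (rC r * eC y) by rewrite bk_gt0 // modC_circle.
have bd : 1 - modC a <= bk a (rC r * eC y) by rewrite bk_ge1 // modC_circle.
rewrite mulrCA; apply: ler_wpM2l; first exact: modC_ge0.
apply: (@le_trans _ _ ((5 / 2 / bk a (rC r * eC y)) ^+ n.+2)).
  rewrite -exprVn lerXn2r ?nnegrE ?invr_ge0 ?modC_ge0 ?divr_ge0 ?(ltW b1) //; last exact: inv.
set b := bk _ _ in b1 bd *; set d := 1 - modC a in d0 bd *.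
rewrite exprMn -/k; move: k k0 => k k0; rewrite -[leRHS]mulrA ler_pM2l //.
have -> : (d ^+ n.+1)^-1 * (d / b ^+ 2) = (d ^+ n)^-1 * (b ^+ 2)^-1 by rewrite exprS; field; rewrite ?expf_neq0 ?gt_eqF.
rewrite exprVn -addn2 exprD invfM ler_pM2r ?invr_gt0 ?exprn_gt0 //.
rewrite lef_pV2 ?posrE ?exprn_gt0 //.
by apply: lerXn2r; rewrite ?nnegrE // ltW.
Qed.

End Kernel.

(** * From circles to weighted area integrals *)

Section LocalEstimate.
Variable R : realType.
Local Notation C := (Cx R).
Local Notation mu := (@lebesgue_measure R).
Local Notation MR := (measurableTypeR R).
Local Notation R2 := (MR * MR)%type.

(** Where g exceeds t, write g = g^(1-p) g^p with g^(1-p) <= t^(1-p); elsewhere g <= t. The scale t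
    stays free and is optimised after integration. *)
Lemma le_powR_scaled (p t g : R) : 1 < p -> 0 < t -> 0 <= g -> g <= t `^ (1 - p) * g `^ p + t.
Proof.
move=> p1 t0 g0; have [gt|tg] := leP g t.
  by apply: (le_trans gt); rewrite lerDr mulr_ge0 ?powR_ge0.
apply: (@le_trans _ _ (t `^ (1 - p) * g `^ p)); last by rewrite lerDl ltW.
have gp : 0 < g by apply: lt_trans tg.
have e : g `^ (1 - p) * g `^ p = g by rewrite -powRD ?subrK ?powRr1 // (gt_eqF gp) implybT.
rewrite -{1}e ler_pM2r ?powR_gt0 // -(opprB p 1) !powRN lef_pV2 ?posrE ?powR_gt0 //.
by apply: ge0_ler_powR; rewrite ?nnegrE ?ltW // subr_gt0.
Qed.

(* Minimising t ^ (1 - p) M + t over t > 0 avoids Jensen's inequality. *)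
Lemma mean_power (p X : R) (F P : MR -> MR) : 1 < p -> 0 <= X ->
  measurable_fun (`[0, 1[%classic : set MR) F -> measurable_fun (`[0, 1[%classic : set MR) P ->
  (forall y, 0 <= y < 1 -> 0 <= F y) -> (forall y, 0 <= y < 1 -> 0 <= P y) ->
  (\int[mu]_(y in `[0%R, 1%R[) (P y)%:E <= 1)%E ->
  (X%:E <= \int[mu]_(y in `[0%R, 1%R[) (F y * P y)%:E)%E ->
  ((X `^ p)%:E <= (2 `^ p)%:E * \int[mu]_(y in `[0%R, 1%R[) (F y `^ p * P y)%:E)%E.
Proof.
move=> p1 X0 mF mP F0 P0 IP XF.
have pp : 0 < p by apply: lt_trans p1.
have mFp : measurable_fun (`[0, 1[%classic : set MR) (fun y : MR => F y `^ p : MR).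
  exact: (measurableT_comp (@measurable_powR R p) mF).
set M := (\int[mu]_(y in _) (F y `^ p * P y)%:E)%E.
have M0 : (0 <= M)%E.
  by apply: integral_ge0 => y /=; rewrite in_itv /= => y01; rewrite lee_fin mulr_ge0 ?powR_ge0 ?P0.
have H (t : R) : 0 < t -> (X%:E <= (t `^ (1 - p))%:E * M + t%:E)%E.
  move=> t0; apply: (le_trans XF).
  apply: (@le_trans _ _ (\int[mu]_(y in `[0%R, 1%R[) ((t `^ (1 - p))%:E * (F y `^ p * P y)%:E + t%:E * (P y)%:E))%E).
    apply: ge0_le_integral => //.
    - by move=> y /=; rewrite in_itv /= => y01; rewrite lee_fin mulr_ge0 ?F0 ?P0.
    - by apply/measurable_EFinP; exact: measurable_funM.
    - apply/measurable_EFinP; apply: measurable_funD; apply: measurable_funM => //; exact: measurable_funM.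
    - move=> y /=; rewrite in_itv /= => y01; rewrite -!EFinM -EFinD lee_fin mulrA -mulrDl.
      by rewrite ler_wpM2r ?P0 // le_powR_scaled ?F0.
  rewrite ge0_integralD //.
  - have -> : (\int[mu]_(y in `[0%R, 1%R[) ((t `^ (1 - p))%:E * (F y `^ p * P y)%:E) = (t `^ (1 - p))%:E * M)%E.
      apply: ge0_integralZl => //.
      + by apply/measurable_EFinP; exact: measurable_funM.
      + by move=> y /=; rewrite in_itv /= => y01; rewrite lee_fin mulr_ge0 ?powR_ge0 ?P0.
      + by rewrite lee_fin powR_ge0.
    have -> : (\int[mu]_(y in `[0%R, 1%R[) (t%:E * (P y)%:E) = t%:E * \int[mu]_(y in `[0%R, 1%R[) (P y)%:E)%E.
      apply: ge0_integralZl => //.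
      + by apply/measurable_EFinP.
      + by rewrite lee_fin ltW.
    by apply: leeD => //; rewrite -[leRHS]mule1 lee_pmul2l.
  - by move=> y /=; rewrite in_itv /= => y01; rewrite -EFinM lee_fin !mulr_ge0 ?powR_ge0 ?P0.
  - by apply/measurable_EFinP; apply: measurable_funM => //; exact: measurable_funM.
  - by move=> y /=; rewrite in_itv /= => y01; rewrite -EFinM lee_fin !mulr_ge0 ?(ltW t0) ?P0.
  - by apply/measurable_EFinP; apply: measurable_funM.
have [Moo|Mfin] := eqVneq M +oo%E.
  by rewrite Moo gt0_muley ?leey // lte_fin powR_gt0.
have fM : M \is a fin_num by rewrite ge0_fin_numE // lt_neqAle Mfin leey.
move: M0 H; rewrite -(fineK fM) lee_fin; move: (fine M) => m m0 H.
have {}H t : 0 < t -> X <= t `^ (1 - p) * m + t by move=> /H; rewrite -EFinM -EFinD lee_fin.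
rewrite -EFinM lee_fin.
have [m00|mn0] := eqVneq m 0.
  have X00 : X = 0.
    apply/eqP; rewrite eq_le X0 andbT; apply/ler_addgt0Pl => t t0.
    by have := H t t0; rewrite m00 mulr0 add0r addr0.
  by rewrite X00 powR0 ?gt_eqF // mulr_ge0 ?powR_ge0.
have mp : 0 < m by rewrite lt_neqAle eq_sym mn0.
(* At t = m^(1/p) the two terms t^(1-p) m and t are equal. *)
have t0 : 0 < m `^ p^-1 by rewrite powR_gt0.
have e : (m `^ p^-1) `^ (1 - p) * m = m `^ p^-1.
  rewrite -powRrM -{2}(powRr1 (ltW mp)) -powRD; last by rewrite (gt_eqF mp) implybT.
  by congr (_ `^ _); field; rewrite gt_eqF.
have := H _ t0; rewrite e => h.
have -> : 2 `^ p * m = (2 * m `^ p^-1) `^ p.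
  by rewrite powRM ?powR_ge0 // -powRrM mulVf ?gt_eqF // powRr1 // ltW.
apply: ge0_ler_powR; rewrite ?nnegrE ?(ltW pp) // ?mulr_ge0 ?powR_ge0 //.
by rewrite mulr_natl mulr2n.
Qed.

Lemma rint_integral (g : R -> R) : cont_on 0 1 g -> (forall y, 0 <= y <= 1 -> 0 <= g y) ->
  ((rint 0 1 g)%:E = \int[mu]_(y in `[0%R, 1%R[) (g y)%:E)%E.
Proof.
move=> cg g0; have ig := cont_on_integrable cg.
rewrite integral_itv_bndo_bndc; last first.
  by apply: (@measurable_funS _ _ _ _ (`[0, 1]%classic : set MR)) => //; [move=> x /=; rewrite !in_itv /= => /andP[-> /ltW]|exact: measurable_int ig].
by rewrite /rint /Rintegral fineK //; exact: integrable_fin_num ig.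
Qed.

Lemma cont_on_measurable (g : R -> R) : cont_on 0 1 g -> measurable_fun (`[0, 1[%classic : set MR) (g : MR -> MR).
Proof.
move=> cg; apply/measurable_EFinP; apply: (@measurable_funS _ _ _ _ (`[0, 1]%classic : set MR)) => //.
  by move=> x /=; rewrite !in_itv /= => /andP[-> /ltW].
exact: measurable_int (cont_on_integrable cg).
Qed.

Lemma measurable_modC_powR (f : C -> C) (p : R) : holo_disc f ->
  measurable_fun (@Dset R : set R2) (fun x : R2 => modC (f (toC x)) `^ p : MR).
Proof.
move=> hf; apply: (measurableT_comp (@measurable_powR R p)).
by apply: cont_measurable_modC => z; exact: holo_cont.
Qed.

Lemma measurable_bkV2 (a : C) : modC a < 1 ->
  measurable_fun (@Dset R : set R2) (fun x : R2 => (bk a (toC x) ^+ 2)^-1 : MR).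
Proof.
move=> a1.
have := cont_measurable_modC (fun z => holo_cont (holo_kernel (m := 1) a1) (z := z)).
move=> /(measurable_funX 2%N); apply: eq_measurable_fun => x _.
by rewrite modCV expr1 exprVn.
Qed.

Lemma measurable_indic_modC (D : set MR) : measurable D ->
  measurable_fun (@Dset R : set R2) (fun x : R2 => \1_D (modC (toC x)) : MR).
Proof.
move=> mD; apply: (measurableT_comp (f := \1_D : MR -> MR)); first exact: measurable_indic.
by apply: (@cont_measurable R (@modC R)) => z _; exact: continuous_modC.
Qed.

Variable w : R -> R.
Hypothesis rw : radial_weight w.

Let w0 t : 0 <= t <= 1 -> 0 <= w t. Proof. by case: rw => h _ _; exact: h. Qed.

(** The pointwise bound is raised to the power p on each circle by [mean_power], whose weight d / |1
    - conj(a) v|^2 has mean at most 1, and is then integrated in r against w over an annulus close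
    enough to the boundary. There r >= 1/2, which disposes of the Jacobian. *)
Lemma area_pointwise (n : nat) (p : R) : 1 < p -> exists2 c : R, 0 < c &
  forall (f : C -> C) (a z : C) (x x' : R), holo_disc f ->
  modC a < 1 -> modC (z - a) <= (1 - modC a) / 4 -> 0 <= x' -> x' <= x -> x <= (1 - modC a) / 4 ->
  ((modC (derive1n n f z) `^ p * (tailw w x - tailw w x'))%:E <=
   (c / ((1 - modC a) ^+ n) `^ p)%:E *
   areaInt (@disc R) (fun v => (\1_(`[(1 - x)%R, (1 - x')%R[%classic : set R) (modC v) *
       (modC (f v) `^ p * ((1 - modC a) / bk a v ^+ 2)) * w (modC v))%:E))%E.
Proof.
move=> p1; have [c c0 H] := derive_pointwise R n.
have pp : 0 < p by apply: lt_trans p1.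
have pc := polar_const_gt0 R.
exists (c `^ p * 2 `^ p * (2 / polar_const R)).
  by rewrite !mulr_gt0 ?powR_gt0 ?invr_gt0.
move=> f a z x x' hf a1 za x'0 x'x xd; have a0 := modC_ge0 a.
have d0 : 0 < 1 - modC a by lra.
set d := 1 - modC a in d0 za xd *.
set J := (`[(1 - x)%R, (1 - x')%R[%classic : set R).
pose G (v : C) := modC (f v) `^ p * (d / bk a v ^+ 2).
have G0 v : 0 <= G v by rewrite mulr_ge0 ?powR_ge0 // divr_ge0 ?(ltW d0) ?exprn_ge0 ?modC_ge0.
have mG : measurable_fun (@Dset R : set R2) (fun x : R2 => G (toC x) : MR).
  apply: measurable_funM; first exact: measurable_modC_powR.
  by apply: measurable_funM => //; exact: measurable_bkV2.
have mg : measurable_fun (@Dset R : set R2) (fun x : R2 => \1_J (modC (toC x)) * G (toC x) : MR).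
  by apply: measurable_funM => //; apply: measurable_indic_modC; exact: measurable_itv.
rewrite (areaInt_weight rw mg); last by move=> v _; rewrite mulr_ge0 ?G0.
pose X := modC (derive1n n f z).
have X0 : 0 <= X by exact: modC_ge0.
have key (r : R) : 1 - x <= r -> r < 1 ->
   ((X `^ p)%:E <= (c `^ p * 2 `^ p / (d ^+ n) `^ p)%:E * \int[mu]_(y in `[0%R, 1%R[) (G (rC r * eC y))%:E)%E.
  move=> rx r1.
  have r0 : 0 <= r by rewrite /d in xd; lra.
  have r01 : 0 <= r < 1 by rewrite r0.
  have cF := cont_on_modC (holo_circle_cont hf r0 r1).
  have cP : cont_on 0 1 (fun y => d / bk a (rC r * eC y) ^+ 2).
    move=> y y01.
    have h2 : {for y, continuous (fun y => (bk a (rC r * eC y) ^+ 2)^-1)} by apply: (cont_on_bkV (m := 2) a1 r01).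
    by apply: continuousM; [exact: cvg_cst|exact: h2].
  have P0 y : 0 <= d / bk a (rC r * eC y) ^+ 2 by rewrite divr_ge0 ?(ltW d0) ?exprn_ge0 ?modC_ge0.
  have IP : (\int[mu]_(y in `[0%R, 1%R[) (d / bk a (rC r * eC y) ^+ 2)%:E <= 1)%E.
    rewrite -rint_integral // lee_fin rintZ; last exact: cont_on_bkV.
    by rewrite mulrC -ler_pdivlMr // mul1r; exact: poisson_mean_le.
  have cFP : cont_on 0 1 (fun y => modC (f (rC r * eC y)) * (d / bk a (rC r * eC y) ^+ 2)).
    by move=> y y01; apply: continuousM; [exact: cF|exact: cP].
  have rlo : 1 - d / 4 <= r by lra.
  have h0 := H f a z r hf a1 za rlo r1.
  have dn : 0 < d ^+ n by rewrite exprn_gt0.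
  have X1 : 0 <= X * (d ^+ n / c) by rewrite mulr_ge0 // divr_ge0 // ltW.
  have XF : ((X * (d ^+ n / c))%:E <= \int[mu]_(y in `[0%R, 1%R[) (modC (f (rC r * eC y)) * (d / bk a (rC r * eC y) ^+ 2))%:E)%E.
    rewrite -rint_integral //; last by move=> y _; rewrite mulr_ge0 ?modC_ge0.
    rewrite lee_fin mulrA ler_pdivrMr // mulrC -ler_pdivlMl // (le_trans h0) //.
    by rewrite le_eqVlt; apply/orP; left; apply/eqP; ring.
  have F0 y : 0 <= y < 1 -> 0 <= modC (f (rC r * eC y)) by move=> _; exact: modC_ge0.
  have := mean_power p1 X1 (cont_on_measurable cF) (cont_on_measurable cP) F0 (fun y _ => P0 y) IP XF.
  rewrite powRM // ?divr_ge0 ?(ltW dn) ?(ltW c0) //.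
  have k0 : 0 < (d ^+ n / c) `^ p by rewrite powR_gt0 // divr_gt0.
  rewrite EFinM muleC -lee_pdivlMl // => h; apply: (le_trans h).
  rewrite muleA -EFinM; apply: (@lee_wpmul2r R); first by apply: integral_ge0 => y _; rewrite lee_fin G0.
  rewrite lee_fin le_eqVlt; apply/orP; left; apply/eqP.
  have e : (d ^+ n / c) `^ p * c `^ p = (d ^+ n) `^ p.
    by rewrite -powRM ?divr_ge0 ?(ltW dn) ?(ltW c0) // divfK ?gt_eqF.
  rewrite -e; have c1 : c `^ p != 0 by rewrite gt_eqF // powR_gt0.
  by field; rewrite c1 gt_eqF.
set A := c `^ p * 2 `^ p / (d ^+ n) `^ p in key.
have A0 : 0 < A by rewrite divr_gt0 ?mulr_gt0 ?powR_gt0 ?exprn_gt0.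
have JS : J `<=` `[0%R, 1%R[.
  move=> r; rewrite /J /= !in_itv /= => /andP[h1 h2]; apply/andP; split; last by lra.
  by rewrite /d in xd; lra.
have mIG := measurable_circle_mean_disc mG (fun z _ => G0 z).
have -> : (\int[mu]_(r in `[0%R, 1%R[) ((polar_const R * r * w r)%:E *
     \int[mu]_(y in `[0%R, 1%R[) (\1_J (modC (rC r * eC y)) * G (rC r * eC y))%:E) =
   \int[mu]_(r in J) ((polar_const R * r * w r)%:E * \int[mu]_(y in `[0%R, 1%R[) (G (rC r * eC y))%:E))%E.
  rewrite integral_mkcond [RHS]integral_mkcond; apply: eq_integral => r _; rewrite !patchE.
  case: ifPn => [|/negP]; rewrite inE /= in_itv /=.
    move=> /andP[r0 r1]; case: ifPn => rJ.
      by congr (_ * _)%E; apply: eq_integral => y _; rewrite modC_circle // indicE rJ mul1r.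
    rewrite integral0_eq ?mule0 // => y _; rewrite modC_circle // indicE (negbTE rJ) mul0r //.
  move=> nr; rewrite ifF //; apply/negP => /set_mem /JS /=; rewrite in_itv /= => h; exact: nr.
have iJ : (\int[mu]_(r in J) (w r)%:E)%E = (tailw w x - tailw w x')%:E.
  by apply: integral_weight => //; rewrite /d in xd; lra.
have wJ r : J r -> 0 <= w r by move=> /JS /=; rewrite in_itv /= => /andP[h1 h2]; rewrite w0 // h1 ltW.
have mwJ : measurable_fun (J : set MR) (w : MR -> MR).
  apply: weight_measurable => //; first exact: measurable_itv.
  by move=> r /JS /=; rewrite !in_itv /= => /andP[-> /ltW].
have k0 : 0 <= polar_const R / 2 * (X `^ p / A) by apply: mulr_ge0; apply: divr_ge0; [exact: ltW|by []|exact: powR_ge0|exact: ltW].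
have main : ((polar_const R / 2 * (X `^ p / A))%:E * (tailw w x - tailw w x')%:E <=
   \int[mu]_(r in J) ((polar_const R * r * w r)%:E * \int[mu]_(y in `[0%R, 1%R[) (G (rC r * eC y))%:E))%E.
  have mJ : measurable (J : set MR) by exact: measurable_itv.
  rewrite -iJ -ge0_integralZl //; last by apply/measurable_EFinP.
  apply: ge0_le_integral => //.
  - by move=> r rJ; rewrite -EFinM lee_fin mulr_ge0 // wJ.
  - by apply/measurable_EFinP; apply: measurable_funM.
  - apply: emeasurable_funM.
      by apply/measurable_EFinP; apply: measurable_funM => //; apply: measurable_funM.
    by apply: measurable_funS JS mIG.
  - move=> r rJ; have := rJ; rewrite /J /= in_itv /= => /andP[h1 h2].
    have r1 : r < 1 by lra.
    have rh : 1 / 2 <= r by rewrite /d in xd; lra.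
    have h := key r h1 r1.
    have -> : polar_const R / 2 * (X `^ p / A) = polar_const R / 2 / A * X `^ p by ring.
    have e1 : (polar_const R * r * w r)%:E = ((polar_const R * r * w r / A)%:E * A%:E)%E.
      by rewrite -EFinM divfK // gt_eqF.
    rewrite e1 -muleA.
    have h2' : 0 <= polar_const R * r * w r / A by apply: divr_ge0; [apply: mulr_ge0; [apply: mulr_ge0; [exact: ltW|lra]|exact: wJ]|exact: ltW].
    apply: le_trans (lee_wpmul2l _ h); last by rewrite lee_fin.
    rewrite -!EFinM lee_fin.
    have -> : polar_const R / 2 / A * X `^ p * w r = (1 / 2) * (polar_const R / A * X `^ p * w r) by field; exact: lt0r_neq0.
    have -> : polar_const R * r * w r / A * X `^ p = r * (polar_const R / A * X `^ p * w r) by ring.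
    by apply: ler_wpM2r => //; apply: mulr_ge0; [apply: mulr_ge0; [apply: divr_ge0; exact: ltW|exact: powR_ge0]|exact: wJ].
have e2 : 0 <= c `^ p * 2 `^ p * (2 / polar_const R) / (d ^+ n) `^ p.
  by apply: divr_ge0; [apply: mulr_ge0; [apply: mulr_ge0; exact: powR_ge0|apply: divr_ge0; [by []|exact: ltW]]|exact: powR_ge0].
apply: le_trans (lee_wpmul2l _ main); last by rewrite lee_fin.
rewrite -!EFinM lee_fin -/X le_eqVlt; apply/orP; left; apply/eqP.
rewrite /A; have c1 : c `^ p != 0 by rewrite gt_eqF // powR_gt0.
have c2 : 2 `^ p != 0 :> R by rewrite gt_eqF // powR_gt0.
have c3 : (d ^+ n) `^ p != 0 by rewrite gt_eqF // powR_gt0 // exprn_gt0.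
have c4 : polar_const R != 0 by rewrite gt_eqF.
move: (c `^ p) (2 `^ p) ((d ^+ n) `^ p) (polar_const R) (X `^ p) (tailw w x) (tailw w x') c1 c2 c3 c4 => t1 t2 t3 t4 t5 t6 t7 c1 c2 c3 c4.
by field; rewrite c1 c2 c3 c4.
Qed.

Hypothesis Dw : class_D w.

(** The Poisson-type kernel multiplied by 1 - |a|, so that it is at most 1: the integrals built on
    it never exceed the full norm. *)
Definition kap (a v : C) : R := (1 - modC a) ^+ 2 / bk a v ^+ 2.

Lemma kap_ge0 (a v : C) : 0 <= kap a v.
Proof. by rewrite divr_ge0 // sqr_ge0. Qed.

Lemma kap_le1 (a v : C) : modC a < 1 -> modC v < 1 -> kap a v <= 1.
Proof.
move=> a1 v1; have b0 := bk_gt0 a1 v1; have b1 := bk_ge1 a v1.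
rewrite /kap -expr_div_n; apply: exprn_ile1; first by rewrite divr_ge0 ?(ltW b0) // subr_ge0 ltW.
by rewrite ler_pdivrMr // mul1r.
Qed.

Lemma measurable_kap (a : C) : modC a < 1 -> measurable_fun (@Dset R : set R2) (fun x : R2 => kap a (toC x) : MR).
Proof. by move=> a1; apply: measurable_funM => //; exact: measurable_bkV2. Qed.

(* Annuli in which w has mass comparable to its whole tail; this is where class_Dcheck enters. *)
Definition bandw (K d : R) : set R := `[1 - d / 4, 1 - d / (4 * K)[%classic.

Definition band_int (K : R) (a : C) (p : R) (f : C -> C) : \bar R :=
  areaInt (@disc R) (fun v => (\1_(bandw K (1 - modC a)) (modC v) * (kap a v * modC (f v) `^ p) * w (modC v))%:E).

Lemma band_integrand_ge0 (D : set R) (a v : C) (p : R) (f : C -> C) : modC v < 1 ->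
  0 <= \1_D (modC v) * (kap a v * modC (f v) `^ p) * w (modC v).
Proof.
move=> v1; apply: mulr_ge0; last by rewrite w0 // modC_ge0 ltW.
by apply: mulr_ge0 => //; apply: mulr_ge0; [exact: kap_ge0|exact: powR_ge0].
Qed.

(** This is [area_pointwise] on the annulus [bandw]: by [tailw_mass] it carries a fixed share of the
    tail at d/4, and doubling compares that tail with the one at d = 1 - |a|, which governs the
    weight of the Carleson square. *)
Lemma local_estimate (n : nat) (p : R) : 1 < p -> exists K c : R, [/\ 1 < K, 0 < c &
  forall (f : C -> C) (a z : C), holo_disc f -> modC a < 1 -> modC (z - a) <= (1 - modC a) / 4 ->
  ((modC (derive1n n f z) `^ p)%:E <=
   (c / ((1 - modC a) * tailw w (1 - modC a) * ((1 - modC a) ^+ n) `^ p))%:E * band_int K a p f)%E].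
Proof.
move=> p1; have [c c0 H] := area_pointwise n p1.
have [K [k [K1 k0 Hk]]] := tailw_mass rw Dw.
have [c' c'1 Hc'] := tailw_doubling rw Dw (l := 1 / 4) ltac:(lra).
exists K, (c * c' / k); split=> //; first by rewrite !mulr_gt0 ?invr_gt0 // (lt_le_trans ltr01).
have c'0 : 0 < c' by lra.
move=> f a z hf a1 za; have a0 := modC_ge0 a.
have d0 : 0 < 1 - modC a by lra.
have K0 : 0 < K by lra.
set d := 1 - modC a in d0 za *.
have d1 : d <= 1 by rewrite /d; lra.
have x'0 : 0 <= d / (4 * K) by rewrite divr_ge0 ?mulr_ge0 ?ltW.
have x'x : d / (4 * K) <= d / 4.
  by rewrite ler_pdivrMr ?mulr_gt0 // mulrA divfK // ler_peMr ?ltW.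
have := H f a z _ _ hf a1 za x'0 x'x (lexx _).
have -> : areaInt (@disc R) (fun v => (\1_(`[(1 - d / 4)%R, (1 - d / (4 * K))%R[%classic : set R) (modC v) *
       (modC (f v) `^ p * (d / bk a v ^+ 2)) * w (modC v))%:E) =
   ((d^-1)%:E * band_int K a p f)%E.
  rewrite /band_int /areaInt muleCA; congr (_ * _)%E.
  rewrite -ge0_integralZl //.
  - apply: eq_integral => x; rewrite inE => Dx; rewrite -EFinM; congr _%:E.
    rewrite /kap -/d /bandw; set i := \1_ _ _.
    have b0 : bk a (toC x) != 0 by rewrite gt_eqF // bk_gt0.
    by field; rewrite b0 gt_eqF.
  - exact: measurable_Dset.
  - apply/measurable_EFinP; apply: measurable_funM; last exact: measurable_weight_modC.
    apply: measurable_funM; first by apply: measurable_indic_modC; exact: measurable_itv.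
    by apply: measurable_funM; [exact: measurable_kap|exact: measurable_modC_powR].
  - by move=> x Dx; rewrite lee_fin; exact: band_integrand_ge0.
  - by rewrite lee_fin invr_ge0 ltW.
have B0 : (0 <= band_int K a p f)%E.
  rewrite /band_int /areaInt mule_ge0 ?lee_fin ?invr_ge0 ?pi_ge0 //.
  by apply: integral_ge0 => x Dx; rewrite lee_fin; exact: band_integrand_ge0.
have t4 : k * tailw w (d / 4) <= tailw w (d / 4) - tailw w (d / (4 * K)).
  have -> : d / (4 * K) = d / 4 / K by field; exact: lt0r_neq0.
  by apply: Hk; apply/andP; split; lra.
have td : tailw w d <= c' * tailw w (d / 4) by apply: Hc' => //; lra.
have t0 : 0 < tailw w d by apply: tailw_gt0 => //; rewrite d0.
have T0 : k / c' * tailw w d <= tailw w (d / 4) - tailw w (d / (4 * K)).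
  apply: le_trans t4; rewrite -mulrA ler_pM2l // ler_pdivrMl //.
set X := modC _ `^ p => h.
have X0 : 0 <= X by exact: powR_ge0.
have h1 : ((X * (k / c' * tailw w d))%:E <= (c / (d ^+ n) `^ p)%:E * ((d^-1)%:E * band_int K a p f))%E.
  by apply: le_trans h; rewrite lee_fin ler_wpM2l.
have kt : 0 < k / c' * tailw w d by rewrite mulr_gt0 // divr_gt0.
move: h1; rewrite EFinM muleC -lee_pdivlMl // => h1; apply: (le_trans h1).
move: (band_int _ _ _ _) B0 => B B0; rewrite !muleA -!EFinM; apply: lee_wpmul2r => //.
rewrite lee_fin le_eqVlt; apply/orP; left; apply/eqP.
have D0 : 0 < (d ^+ n) `^ p by rewrite powR_gt0 // exprn_gt0.
move: ((d ^+ n) `^ p) (tailw w d) t0 D0 {T0 t4 td h h1 kt} => D t t0 D0.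
by field; rewrite !gt_eqF.
Qed.

Lemma band_int_le (K : R) (a : C) (p : R) (f : C -> C) : holo_disc f -> modC a < 1 ->
  (0 <= band_int K a p f <= Apnorm_p p w f)%E.
Proof.
move=> hf a1; have wx x : @Dset R x -> 0 <= w (modC (toC x)) by move=> Dx; rewrite w0 // modC_ge0 ltW.
have B0 x : @Dset R x -> (0 <= (\1_(bandw K (1 - modC a)) (modC (toC x)) * (kap a (toC x) * modC (f (toC x)) `^ p) * w (modC (toC x)))%:E)%E.
  by move=> Dx; rewrite lee_fin; exact: band_integrand_ge0.
apply/andP; split.
  rewrite /band_int /areaInt mule_ge0 ?lee_fin ?invr_ge0 ?pi_ge0 //.
  by apply: integral_ge0 => x; exact: B0.
rewrite /band_int /Apnorm_p /areaInt; apply: lee_wpmul2l; first by rewrite lee_fin invr_ge0 pi_ge0.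
apply: ge0_le_integral => //.
- exact: measurable_Dset.
- apply/measurable_EFinP; apply: measurable_funM; last exact: measurable_weight_modC.
  apply: measurable_funM; first by apply: measurable_indic_modC; exact: measurable_itv.
  by apply: measurable_funM; [exact: measurable_kap|exact: measurable_modC_powR].
- by apply/measurable_EFinP; apply: measurable_funM; [exact: measurable_modC_powR|exact: measurable_weight_modC].
- move=> x Dx; rewrite lee_fin ler_wpM2r ?wx // mulrA ler_piMl ?powR_ge0 // mulr_ile1 ?kap_ge0 ?kap_le1 //.
Qed.

End LocalEstimate.

(** * Covering of annuli *)

Section Grid.
Variable R : realType.
Local Notation C := (Cx R).
Local Notation MR := (measurableTypeR R).
Local Notation R2 := (MR * MR)%type.

(** The constant is 4 pi rather than 2 pi because of the factor 2 in [modC_cint_le]. *)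
Lemma eC_lip (x y : R) : x <= y -> modC (eC y - eC x) <= 4 * pi * (y - x).
Proof.
move=> xy; pose u (t : R) := rC (2 * pi) * iC R * eC t.
have cu : cont_on x y u by apply: cont_onM; [exact: cont_on_cst|apply: continuous_cont_on; exact: continuous_eC].
rewrite -(cint_FTC xy cu); last by move=> t _; exact: cder_eC.
have pi0 := pi_ge0 R.
apply: (le_trans (modC_cint_le (M := 2 * pi) xy cu _)).
  by move=> t _; rewrite /u !modCM modC_rC modC_iC modC_eC !mulr1 ger0_norm // mulr_ge0.
by rewrite le_eqVlt; apply/orP; left; apply/eqP; ring.
Qed.

Lemma rint_pieces (N : nat) (g : R -> R) : (0 < N)%N -> cont_on 0 1 g ->
  \sum_(j < N) rint (j%:R / N%:R) (j.+1%:R / N%:R) g = rint 0 1 g.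
Proof.
move=> N0 cg; have N0' : 0 < N%:R :> R by rewrite ltr0n.
have H m : (m <= N)%N -> \sum_(j < m) rint (j%:R / N%:R) (j.+1%:R / N%:R) g = rint 0 (m%:R / N%:R) g.
  elim: m => [_|m IH mN]; first by rewrite big_ord0 mul0r /rint set_itv1 Rintegral_set1.
  have m1 : m.+1%:R / N%:R <= 1 :> R by rewrite ler_pdivrMr // mul1r ler_nat.
  rewrite big_ord_recr /= (IH (ltnW mN)).
  have h1 : 0 <= (m%:R / N%:R : R) <= m.+1%:R / N%:R.
    by rewrite divr_ge0 //= ler_pM2r ?invr_gt0 // ler_nat.
  by rewrite -(rint_split h1 (cont_onS (lexx _) m1 cg)).
by rewrite H // divff // gt_eqF.
Qed.

Definition gridpt (d : R) (N j : nat) : C := rC (1 - d) * eC (j%:R / N%:R).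

Lemma modC_gridpt (d : R) (N j : nat) : d <= 1 -> modC (gridpt d N j) = 1 - d.
Proof. by move=> d1; rewrite modC_circle // subr_ge0. Qed.

(* Each kernel is compared with its mean over an arc of length 1 / N, and the means add up to the Poisson integral. *)
Lemma sum_kap (d : R) (N : nat) (v : C) : 0 < d <= 1 -> (0 < N)%N -> 4 * pi / N%:R <= d -> modC v < 1 ->
  \sum_(j < N) kap (gridpt d N j) v <= 4 * N%:R * d.
Proof.
move=> /andP[d0 d1] N0 Nd v1; have N0' : 0 < N%:R :> R by rewrite ltr0n.
have r01 : 0 <= 1 - d < 1 by lra.
pose g (y : R) := (bk v (rC (1 - d) * eC y) ^+ 2)^-1.
have cg : cont_on 0 1 g by exact: (cont_on_bkV (m := 2) v1 r01).
have piece (j : 'I_N) : kap (gridpt d N j) v <= 4 * N%:R * d ^+ 2 * rint (j%:R / N%:R) (j.+1%:R / N%:R) g.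
  have j1 : j.+1%:R / N%:R <= 1 :> R by rewrite ler_pdivrMr // mul1r ler_nat ltn_ord.
  have jj : j%:R / N%:R <= j.+1%:R / N%:R :> R by rewrite ler_pM2r ?invr_gt0 // ler_nat.
  have a1 : modC (gridpt d N j) < 1 by rewrite modC_gridpt //; lra.
  have ej : j.+1%:R / N%:R - j%:R / N%:R = N%:R^-1 :> R.
    by rewrite -mulrBl -natrB // subSn // subnn mul1r.
  have b0 : 0 < bk (gridpt d N j) v by exact: bk_gt0.
  have b1 : d <= bk (gridpt d N j) v.
    by have := bk_ge1 (gridpt d N j) v1; rewrite modC_gridpt // opprB addrC subrK.
  (* Moving the centre along an arc of parameter length 1/N changes |1 - conj(a) v| by at most 4 pi
     / N <= d, hence at most doubles it; on the arc the integrand is then at least a quarter of its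
     value at the grid point. *)
  have lo : (4 * bk (gridpt d N j) v ^+ 2)^-1 * N%:R^-1 <= rint (j%:R / N%:R) (j.+1%:R / N%:R) g.
    have := rint_cst (4 * bk (gridpt d N j) v ^+ 2)^-1 jj; rewrite ej => <-.
    apply: le_rint; first exact: cont_on_cst.
      by apply: (cont_onS _ j1 cg); rewrite divr_ge0.
    move=> y /andP[y0 y1]; rewrite /g.
    have a'1 : modC (rC (1 - d) * eC y) < 1 by rewrite modC_circle; lra.
    have b0' : 0 < bk v (rC (1 - d) * eC y) by exact: bk_gt0.
    rewrite lef_pV2 ?posrE ?mulr_gt0 ?exprn_gt0 //.
    have -> : 4 * bk (gridpt d N j) v ^+ 2 = (2 * bk (gridpt d N j) v) ^+ 2 by ring.
    apply: lerXn2r; rewrite ?nnegrE ?mulr_ge0 ?(ltW b0) ?(ltW b0') //.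
    rewrite bkC; apply: (le_trans (bk_lip _ (gridpt d N j) v1)).
    rewrite -mulrBr modCM modC_rC ger0_norm; last by lra.
    have h1 := eC_lip y0.
    have h2 : 4 * pi * (y - j%:R / N%:R) <= 4 * pi / N%:R.
      rewrite ler_wpM2l ?mulr_ge0 ?pi_ge0 //.
      by move: y1 ej; clear; lra.
    have h3 : modC (eC y - eC (j%:R / N%:R)) <= d by lra.
    have h4 : (1 - d) * modC (eC y - eC (j%:R / N%:R)) <= modC (eC y - eC (j%:R / N%:R)).
      by rewrite ler_piMl ?modC_ge0 //; lra.
    lra.
  have -> : kap (gridpt d N j) v = 4 * N%:R * d ^+ 2 * ((4 * bk (gridpt d N j) v ^+ 2)^-1 * N%:R^-1).
    rewrite /kap modC_gridpt // opprB addrC subrK; field.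
    by rewrite !gt_eqF.
  by apply: ler_wpM2l lo; apply: mulr_ge0; [apply: mulr_ge0|exact: sqr_ge0].
apply: (le_trans (ler_sum _ (fun j _ => piece j))).
rewrite -mulr_sumr rint_pieces // /g poisson_mean //.
set P := (_ - _)^-1; have -> : 4 * N%:R * d ^+ 2 * P = 4 * N%:R * d * (d * P) by ring.
rewrite /P; apply: ler_piMr; first by apply: mulr_ge0; [exact: mulr_ge0|exact: ltW].
have v0 := modC_ge0 v.
have h : d <= 1 - modC v ^+ 2 * (1 - d) ^+ 2.
  have : modC v ^+ 2 <= 1 by rewrite exprn_ile1 // ltW.
  have := sqr_ge0 (modC v); nra.
by rewrite ler_pdivrMr ?mul1r // (lt_le_trans d0).
Qed.

(** Half of the allowed distance e d is spent on the radial displacement, at most (1 - t) d, and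
    half on the angular one, at most 4 pi / N. *)
Lemma grid_cover (d t e : R) (N : nat) (x : R2) : 0 < d <= 1 -> (0 < N)%N -> 1 - t <= e / 2 -> 4 * pi / N%:R <= e * d / 2 ->
  t * d <= 1 - modC (toC x) <= d -> exists j : 'I_N, modC (toC x - gridpt d N j) <= e * d.
Proof.
move=> /andP[d0 d1] N0 te Ne /andP[x1 x2]; have N0' : 0 < N%:R :> R by rewrite ltr0n.
have m0 := modC_ge0 (toC x).
have [y /andP[y0 y1] ex] : exists2 y : R, 0 <= y < 1 & toC x = rC (modC (toC x)) * eC y.
  have [y /andP[y0 y1] e1] := polar_repr x.
  have [yy|yy] := ltP y 1; first by exists y; rewrite ?y0 // -toC_polar2 -e1.
  have y11 : y = 1 by apply/eqP; rewrite eq_le y1.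
  by exists 0; rewrite ?lexx ?ltr01 // eC0 -(@eC1 R) -toC_polar2 -{1}y11 -e1.
have yN : 0 <= y * N%:R by rewrite mulr_ge0.
have /andP[t1 t2] := truncn_itv yN.
pose j := Num.truncn (y * N%:R).
have jN : (j < N)%N.
  rewrite -(ltr_nat R); apply: (le_lt_trans t1); by rewrite gtr_pMl.
exists (Ordinal jN) => /=.
have j1 : j%:R / N%:R <= y by rewrite ler_pdivrMr.
have j2 : y - j%:R / N%:R <= N%:R^-1.
  rewrite lerBlDr -[X in X + _]mul1r -mulrDl -(natrD _ 1) add1n ler_pdivlMr //; exact: ltW.
have -> : toC x - gridpt d N j = rC (modC (toC x) - (1 - d)) * eC y + rC (1 - d) * (eC y - eC (j%:R / N%:R)).
  by rewrite [X in X - _]ex /gridpt (rCB (modC _)); ring.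
apply: (le_trans (modCD _ _)); rewrite !modCM modC_eC mulr1 !modC_rC.
have h1 : `|modC (toC x) - (1 - d)| <= (1 - t) * d by rewrite ler_norml; apply/andP; split; nra.
have h2 := eC_lip j1.
have h3 : 4 * pi * (y - j%:R / N%:R) <= 4 * pi / N%:R by rewrite ler_wpM2l ?mulr_ge0 ?pi_ge0.
have h4 : `|1 - d| * modC (eC y - eC (j%:R / N%:R)) <= modC (eC y - eC (j%:R / N%:R)).
  by rewrite ler_piMl ?modC_ge0 // ger0_norm; lra.
have h5 : (1 - t) * d <= e / 2 * d by rewrite ler_pM2r.
lra.
Qed.

(** With u = 4 (1 - r), lying in the k-th annulus forces u <= t^k < K u; since t^m <= 1/K, such k
    fit in a window of m consecutive integers that starts at the first k with t^k < K u. *)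
Lemma band_count (K t : R) (m n : nat) (r : R) : 1 < K -> 0 < t < 1 -> t ^+ m <= K^-1 -> r < 1 ->
  \sum_(k < n) \1_(bandw K (t ^+ k)) r <= m%:R :> R.
Proof.
move=> K1 /andP[t0 t1] tm r1; have K0 : 0 < K by lra.
pose u := 4 * (1 - r).
have inb k : bandw K (t ^+ k) r -> u <= t ^+ k /\ t ^+ k < K * u.
  rewrite /bandw /= in_itv /= => /andP[h1 h2]; rewrite /u; split; first by lra.
  have : t ^+ k / (4 * K) < 1 - r -> t ^+ k < (1 - r) * (4 * K) by rewrite ltr_pdivrMr ?mulr_gt0.
  have h : t ^+ k / (4 * K) < 1 - r.
    rewrite -subr_gt0 in h2; rewrite -subr_gt0; lra.
  by move=> /(_ h); lra.
have [k0 Hk0] : exists k0, forall k, bandw K (t ^+ k) r -> (k0 <= k < k0 + m)%N.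
  have [[k1 Pk1]|nP] := pselect (exists k, t ^+ k < K * u); last first.
    by exists 0%N => k /inb [_ h]; exfalso; apply: nP; exists k.
  have ex : exists k, t ^+ k < K * u by exists k1.
  exists (ex_minn ex) => k /inb [h1 h2]; case: ex_minnP => k0 h3 h4.
  rewrite h4 //= ltnNge; apply/negP => h5.
  have : t ^+ k <= t ^+ (k0 + m) by apply: ler_wiXn2l => //; exact: ltW.
  rewrite exprD => h6.
  have : t ^+ k0 * t ^+ m < u.
    apply: (@le_lt_trans _ _ (t ^+ k0 / K)); first by rewrite ler_pM2l ?exprn_gt0.
    by rewrite ltr_pdivrMr // mulrC.
  lra.
apply: (@le_trans _ _ (\sum_(k < n) (k0 <= k < k0 + m)%N%:R)).
  apply: ler_sum => k _; rewrite indicE ler_nat.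
  case: (boolP (r \in _)) => // /set_mem /Hk0 -> //.
rewrite -natr_sum ler_nat.
have -> : (\sum_(k < n) (k0 <= k < k0 + m) = minn n (k0 + m) - k0)%N.
  elim: n => [|n IH]; first by rewrite big_ord0 min0n.
  rewrite big_ord_recr /= IH.
  case: (leqP k0 n) => h1; case: (ltnP n (k0 + m)) => h2 /=; lia.
lia.
Qed.

End Grid.

(** * The derivative on one thin annulus *)

Section Level.
Variable R : realType.
Local Notation C := (Cx R).
Local Notation MR := (measurableTypeR R).
Local Notation R2 := (MR * MR)%type.

Lemma measurable_fun_set_lt (g : C -> R) (c : R) : (forall z, modC z < 1 -> {for z, continuous g}) ->
  measurable (@Dset R `&` [set x : R2 | g (toC x) < c]).
Proof.
move=> cg; have := cont_measurable cg; move=> /(_ (@measurable_Dset R) `]-oo, c[%classic (measurable_itv _)).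
by congr measurable; apply/seteqP; split => x /=; rewrite in_itv.
Qed.

Lemma measurable_fun_set_le (g : C -> R) (c : R) : (forall z, modC z < 1 -> {for z, continuous g}) ->
  measurable (@Dset R `&` [set x : R2 | g (toC x) <= c]).
Proof.
move=> cg; have := cont_measurable cg; move=> /(_ (@measurable_Dset R) `]-oo, c]%classic (measurable_itv _)).
by congr measurable; apply/seteqP; split => x /=; rewrite in_itv.
Qed.

(** Clearing the denominator describes the disc by the sign of a continuous function. *)
Lemma EdiscP (s : R) (a z : C) : modC a < 1 ->
  Edisc s a z <-> modC z < 1 /\ modC (a - z) - s * bk a z < 0.
Proof.
move=> a1; rewrite /Edisc /=.
have H : modC z < 1 -> (modC ((a - z) / (1 - cjC a * z)) < s) = (modC (a - z) - s * bk a z < 0).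
  by move=> z1; rewrite modCM modCV ltr_pdivrMr ?bk_gt0 // subr_lt0.
by split=> -[z1 h]; split=> //; move: h; [rewrite -H|rewrite -(H z1)].
Qed.

Lemma continuous_bk (a z : C) : {for z, continuous (bk a)}.
Proof.
have h : {for z, continuous (fun z : C => 1 - cjC a * z)}.
  apply: (@cvgB _ _ _ (nbhs z) _ (fun _ : C => 1 : C) (fun z : C => cjC a * z : C)); first exact: cvg_cst.
  by apply: (@cvgM _ _ (nbhs z) _ (fun _ : C => cjC a : C) (fun z : C => z : C)); [exact: cvg_cst|exact: cvg_id].
by apply: (continuous_comp h); exact: continuous_modC.
Qed.

Lemma continuous_modC_dist (a z : C) : {for z, continuous (fun z : C => modC (z - a))}.
Proof.
have h : {for z, continuous (fun z : C => z - a)}.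
  by apply: (@cvgB _ _ _ (nbhs z) _ (fun z : C => z : C) (fun=> a)); [exact: cvg_id|exact: cvg_cst].
by apply: (continuous_comp h); exact: continuous_modC.
Qed.

Lemma measurable_Edisc (s : R) (a : C) : modC a < 1 -> measurable (@toC R @^-1` Edisc s a : set R2).
Proof.
move=> a1; pose g (z : C) := modC (z - a) - s * bk a z.
have cg z : modC z < 1 -> {for z, continuous g}.
  move=> _; have h : {for z, continuous (fun z : C => s * bk a z)}.
    by apply: (@cvgM _ _ (nbhs z) _ (fun _ => s) (bk a)); [exact: cvg_cst|exact: continuous_bk].
  by apply: (@cvgB _ _ _ (nbhs z) _ (fun z : C => modC (z - a)) (fun z : C => s * bk a z)); [exact: continuous_modC_dist|exact: h].
have -> : @toC R @^-1` Edisc s a = @Dset R `&` [set x : R2 | g (toC x) < 0].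
  apply/seteqP; split => x; [move=> /(EdiscP _ _ a1)|move=> h; apply/(EdiscP _ _ a1)]; rewrite /g modC_distC //.
exact: measurable_fun_set_lt.
Qed.

Variables (p q : R) (n : nat) (w : R -> R) (s : R).
Hypothesis p1 : 1 < p.
Hypothesis pq : p <= q.
Hypothesis rw : radial_weight w.
Hypothesis Dw : class_D w.
Hypothesis s01 : 0 < s < 1.

Let w0 t : 0 <= t <= 1 -> 0 <= w t. Proof. by case: rw => h _ _; exact: h. Qed.

(** What remains of [band_int] once the kernels of a whole grid have been summed. *)
Definition band_norm (K d : R) (f : C -> C) : \bar R :=
  areaInt (@disc R) (fun v => (\1_(bandw K d) (modC v) * modC (f v) `^ p * w (modC v))%:E).

Lemma band_norm_ge0 K d f : (0 <= band_norm K d f)%E.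
Proof.
rewrite /band_norm /areaInt mule_ge0 ?lee_fin ?invr_ge0 ?pi_ge0 //.
apply: integral_ge0 => x Dx; rewrite lee_fin; apply: mulr_ge0; last by rewrite w0 // modC_ge0 ltW.
by apply: mulr_ge0 => //; exact: powR_ge0.
Qed.

Lemma sum_band_int (K d : R) (N : nat) (f : C -> C) : holo_disc f -> 0 < d <= 1 -> (0 < N)%N -> 4 * pi / N%:R <= d ->
  (\sum_(j < N) band_int w K (gridpt d N j) p f <= (4 * N%:R * d)%:E * band_norm K d f)%E.
Proof.
move=> hf /[dup] d01 /andP[d0 d1] N0 Nd.
have a1 (j : 'I_N) : modC (gridpt d N j) < 1 by rewrite modC_gridpt //; lra.
have Nd0 : 0 <= 4 * N%:R * d by rewrite !mulr_ge0 // ltW.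
rewrite /band_int /band_norm /areaInt -ge0_sume_distrr; last first.
  by move=> j _; apply: integral_ge0 => x Dx; rewrite lee_fin; apply: band_integrand_ge0 => //.
rewrite muleCA; apply: lee_wpmul2l; first by rewrite lee_fin invr_ge0 pi_ge0.
have mb (a : C) (b : R) : modC a < 1 -> measurable_fun (@Dset R : set R2)
    (fun x : R2 => \1_(bandw K b) (modC (toC x)) * (kap a (toC x) * modC (f (toC x)) `^ p) * w (modC (toC x)) : MR).
  move=> ha; apply: measurable_funM; last exact: measurable_weight_modC.
  apply: measurable_funM; first by apply: measurable_indic_modC; exact: measurable_itv.
  by apply: measurable_funM; [exact: measurable_kap|exact: measurable_modC_powR].
have mb' : measurable_fun (@Dset R : set R2)
    (fun x : R2 => \1_(bandw K d) (modC (toC x)) * modC (f (toC x)) `^ p * w (modC (toC x)) : MR).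
  apply: measurable_funM; last exact: measurable_weight_modC.
  apply: measurable_funM; first by apply: measurable_indic_modC; exact: measurable_itv.
  exact: measurable_modC_powR.
have b0 (x : R2) : @Dset R x -> 0 <= \1_(bandw K d) (modC (toC x)) * modC (f (toC x)) `^ p * w (modC (toC x)).
  move=> Dx; apply: mulr_ge0; last by rewrite w0 // modC_ge0 ltW.
  by apply: mulr_ge0 => //; exact: powR_ge0.
rewrite -ge0_integralZl; last 4 first.
- exact: measurable_Dset.
- by apply/measurable_EFinP.
- by move=> x Dx; rewrite lee_fin; exact: b0.
- by rewrite lee_fin.
rewrite -ge0_integral_sum; last 3 first.
- exact: measurable_Dset.
- by move=> j; apply/measurable_EFinP; exact: mb.
- by move=> j x Dx; rewrite lee_fin; exact: band_integrand_ge0.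
apply: ge0_le_integral.
- exact: measurable_Dset.
- by move=> x Dx; apply: sume_ge0 => j _; rewrite lee_fin; exact: band_integrand_ge0.
- by apply: emeasurable_sum => j; apply/measurable_EFinP; exact: mb.
- by apply/measurable_EFinP; apply: measurable_funM.
move=> x Dx; rewrite sumEFin -EFinM lee_fin.
have -> : \sum_(j < N) \1_(bandw K (1 - modC (gridpt d N j))) (modC (toC x)) * (kap (gridpt d N j) (toC x) * modC (f (toC x)) `^ p) * w (modC (toC x)) =
   (\sum_(j < N) kap (gridpt d N j) (toC x)) * (\1_(bandw K d) (modC (toC x)) * modC (f (toC x)) `^ p * w (modC (toC x))).
  rewrite mulr_suml; apply: eq_bigr => j _; rewrite modC_gridpt // opprB addrC subrK; ring.
by apply: ler_wpM2r; [exact: b0|exact: sum_kap].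
Qed.

(** Near the j-th grid point the local estimate bounds |f^(n)|^p by a multiple of the kernel
    integral i_j. On the unit ball i_j <= 1, so i_j^(q/p) <= i_j for q >= p; the q-th powers can
    then be summed linearly, and [sum_band_int] turns the sum into the integral of |f|^p w over one
    annulus. The measure of each small disc is absorbed by the Carleson ratio. *)
Lemma level_estimate : exists K t c : R, [/\ 1 < K, 0 < t < 1, 0 < c &
  forall (mu : {measure set (R * R)%type -> \bar R}) (d S : R), 0 < d <= 1 / 2 -> 0 <= S ->
  (forall a, modC a = 1 - d -> (carleson_ratio p q n w s mu a <= S%:E)%E) ->
  forall f, holo_disc f -> (Apnorm_p p w f <= 1)%E ->
  (\int[mu]_(x in [set x : (R * R)%type | (t * d < 1 - modC (toC x) <= d)%R]) (modC (derive1n n f (toC x)) `^ q)%:E <=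
   (c * S)%:E * band_norm K d f)%E].
Proof.
have [s0 s1] := andP s01.
have pp : 0 < p by apply: lt_trans p1.
have qq : 0 < q by apply: lt_le_trans pq.
have qp1 : 1 <= q / p by rewrite ler_pdivlMr // mul1r.
have pi0 := pi_gt0 R; have pi2 := pi_ge2 R.
have pc := polar_const_gt0 R.
have [K [c [K1 c0 H]]] := local_estimate rw Dw n p1.
(* The bound e <= s places the covering discs inside E_s, and e <= 1/4 is the range of the local
   estimate. *)
pose e := Num.min s (1 / 4).
have e0 : 0 < e by rewrite lt_min s0 /=; lra.
have e4 : e <= 1 / 4 by rewrite ge_min lexx orbT.
have es : e <= s by rewrite ge_min lexx.
have [c2 c20 c2E] : exists2 c2 : R, 0 < c2 & c2 = polar_const R / (2 * pi).
  by exists (polar_const R / (2 * pi)) => //; rewrite divr_gt0 // mulr_gt0.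
(* About B / d grid points make 4 pi / N <= e d / 2, the spacing required by [grid_cover], while N d
   <= B + 1 stays bounded. *)
have [B B0 BE0] : exists2 B : R, 0 < B & B = 8 * pi / e.
  by exists (8 * pi / e) => //; rewrite divr_gt0 // mulr_gt0.
exists K, (1 - e / 2), (4 * (B + 1) * (c * c2) `^ (q / p)); split=> //; first by lra.
  by apply: mulr_gt0; [lra|rewrite powR_gt0 // mulr_gt0].
move=> mu d S /andP[d0 d2] S0 HS f hf f1.
pose N := (Num.truncn (B / d)).+1.
have NB : B / d < N%:R := truncnS_gt _.
have N0 : (0 < N)%N by [].
have Bd : 0 <= B / d by rewrite divr_ge0 // ltW.
have N2 : N%:R * d <= B + 1.
  have /andP[h1 _] := truncn_itv Bd.
  rewrite /N -add1n natrD mulrDl mul1r.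
  have : (Num.truncn (B / d))%:R * d <= B by rewrite -ler_pdivlMr.
  lra.
have N1 : 4 * pi / N%:R <= e * d / 2.
  rewrite ler_pdivrMr ?ltr0n //.
  have : B < N%:R * d by rewrite -ltr_pdivrMr.
  rewrite BE0.
  rewrite ltr_pdivrMr // => h.
  have -> : e * d / 2 * N%:R = N%:R * d * e / 2 by ring.
  lra.
have Nd : 4 * pi / N%:R <= d by apply: (le_trans N1); nra.
have d1 : 0 < d <= 1 by lra.
pose a (j : 'I_N) := gridpt d N j.
have ma j : modC (a j) = 1 - d by rewrite modC_gridpt //; lra.
have a1 j : modC (a j) < 1 by rewrite ma; lra.
have da j : 1 - modC (a j) = d by rewrite ma; ring.
have BI j : (0 <= band_int w K (a j) p f <= 1)%E.
  by have /andP[h1 h2] := band_int_le rw K p hf (a1 j); rewrite h1 (le_trans h2).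
pose i j := fine (band_int w K (a j) p f).
have iE j : (i j)%:E = band_int w K (a j) p f.
  rewrite /i fineK // ge0_fin_numE; last by case/andP: (BI j).
  by apply: le_lt_trans (ltry 1); case/andP: (BI j).
have i0 j : 0 <= i j by rewrite -lee_fin iE; case/andP: (BI j).
have i1 j : i j <= 1 by rewrite -lee_fin iE; case/andP: (BI j).
have t0 : 0 < tailw w d by apply: tailw_gt0.
pose D := (d ^+ n) `^ p.
have D0 : 0 < D by rewrite /D powR_gt0 // exprn_gt0.
pose M := (c / (d * tailw w d * D)) `^ (q / p).
have M0 : 0 <= M by exact: powR_ge0.
pose Bj j : set R2 := @Dset R `&` [set x : R2 | modC (toC x - a j) <= e * d].
have mB j : measurable (Bj j) by apply: (@measurable_fun_set_le (fun z => modC (z - a j))) => z _; exact: continuous_modC_dist.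
have BE j : Bj j `<=` @toC R @^-1` Edisc s (a j).
  move=> x [x1 /= h]; apply/(EdiscP _ _ (a1 j)); split=> //.
  have b1 := bk_ge1 (a j) x1; rewrite da in b1.
  have b2 : bk (a j) (toC x) <> d -> d < bk (a j) (toC x) by move=> /eqP h1; rewrite lt_neqAle eq_sym h1.
  rewrite modC_distC.
  (* The strict inequality in [Edisc] is reached because 1 - |a_j| |x| > 1 - |a_j|, as |x| < 1 and
     a_j is nonzero. *)
  have b3 : d < bk (a j) (toC x).
    apply: lt_le_trans (bk_ge (a j) (toC x)); rewrite ma; have : modC (toC x) < 1 := x1; nra.
  nra.
pose F (x : R2) : \bar R := (modC (derive1n n f (toC x)) `^ q)%:E.
have mF : measurable_fun (@Dset R : set R2) F.
  by apply/measurable_EFinP; apply: measurable_modC_powR; exact: holo_derive1n.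
have FB j x : Bj j x -> (F x <= (M * i j)%:E)%E.
  move=> [x1 /= h]; have h4 : modC (toC x - a j) <= (1 - modC (a j)) / 4 by rewrite da; nra.
  have := H f (a j) (toC x) hf (a1 j) h4; rewrite -iE da -EFinM lee_fin -/D => h5.
  rewrite lee_fin.
  have -> : modC (derive1n n f (toC x)) `^ q = (modC (derive1n n f (toC x)) `^ p) `^ (q / p).
    by rewrite -powRrM mulrCA mulfV ?mulr1 // gt_eqF.
  apply: (@le_trans _ _ ((c / (d * tailw w d * D) * i j) `^ (q / p))).
    have cd : 0 <= c / (d * tailw w d * D) by rewrite divr_ge0 ?mulr_ge0 // ltW.
    have q0 : 0 <= q / p by lra.
    by apply: ge0_ler_powR => //; rewrite nnegrE; [exact: powR_ge0|exact: mulr_ge0].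
  rewrite powRM //; last by rewrite divr_ge0 ?mulr_ge0 // ltW.
  apply: ler_wpM2l => //.
  have [->|ij0] := eqVneq (i j) 0; first by rewrite powR0 // gt_eqF // (lt_le_trans ltr01).
  by apply: ge1r_powR => //; rewrite i1 andbT lt_neqAle eq_sym ij0 i0.
(* M is at most a constant times the normalising factor of [carleson_ratio], because the weight W of
   the Carleson square is at most c2 d tailw(d). *)
have mE j : (mu (@toC R @^-1` Edisc s (a j)) * M%:E <= ((c * c2) `^ (q / p) * S)%:E)%E.
  have a12 : 1 / 2 <= modC (a j) < 1 by rewrite ma; lra.
  have [W eW /andP[W1 W2]] := wmeas_carleson rw a12.
  have W0 : 0 < W by apply: lt_le_trans W1; rewrite da; apply: mulr_gt0; [apply: divr_gt0 => //; exact: mulr_gt0|exact: mulr_gt0].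
  have := HS (a j) (ma j); rewrite /carleson_ratio eW /= da => h.
  have dnq : d `^ (n%:R * q) = D `^ (q / p).
    rewrite /D -powR_mulrn ?(ltW d0) // -!powRrM; congr (_ `^ _); field; exact: lt0r_neq0.
  have h1 : M <= (c * c2) `^ (q / p) * (d `^ (n%:R * q) * W `^ (q / p))^-1.
    rewrite dnq -powRM ?(ltW D0) ?(ltW W0) // -powRN.
    have -> : (D * W) `^ (- (q / p)) = (D * W)^-1 `^ (q / p).
      by rewrite -(powR_inv1 (mulr_ge0 (ltW D0) (ltW W0))) -powRrM mulN1r.
    rewrite -powRM ?invr_ge0 ?mulr_ge0 ?(ltW D0) ?(ltW W0) ?(ltW c0) ?(ltW c20) //.
    apply: ge0_ler_powR; rewrite ?nnegrE.
    - lra.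
    - by rewrite divr_ge0 ?mulr_ge0 // ltW.
    - by rewrite divr_ge0 ?mulr_ge0 // ltW.
    - rewrite ler_pdivrMr ?mulr_gt0 //.
      have W2' : W <= c2 * (d * tailw w d) by move: W2; rewrite da c2E.
      have -> : c * c2 / (D * W) * (d * tailw w d * D) = c * (c2 * (d * tailw w d)) / W by field; rewrite !gt_eqF.
      by rewrite ler_pdivlMr // ler_pM2l.
  apply: (@le_trans _ _ (mu (@toC R @^-1` Edisc s (a j)) * ((c * c2) `^ (q / p) * (d `^ (n%:R * q) * W `^ (q / p))^-1)%:E)%E).
    by apply: lee_wpmul2l.
  rewrite EFinM muleCA [leRHS]EFinM; apply: lee_wpmul2l => //.
  by rewrite lee_fin powR_ge0.
pose A : set R2 := [set x | (1 - e / 2) * d < 1 - modC (toC x) <= d].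
have AD : A `<=` @Dset R by move=> x /= /andP[h1 h2]; rewrite /Dset /=; nra.
have mA : measurable A.
  have -> : A = (@Dset R `&` [set x : R2 | modC (toC x) < 1 - (1 - e / 2) * d]) `&` (@Dset R `&` [set x : R2 | - modC (toC x) <= - (1 - d)]).
    apply/seteqP; split => x /=.
      by move=> /[dup] /AD Dx /andP[h1 h2]; split; split=> //; lra.
    by move=> [[h1 h2] [_ h3]]; rewrite /A /=; lra.
  apply: measurableI; [apply: (@measurable_fun_set_lt (@modC R))|apply: (@measurable_fun_set_le (fun z => - modC z))] => z _; first exact: continuous_modC.
  by apply: (@cvgN _ _ _ (nbhs z) _ (@modC R)); exact: continuous_modC.
have mA' : @measurable _ (R * R)%type A by exact: mA.
have mB' j : @measurable _ (R * R)%type (Bj j) by exact: mB.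
have mI j : measurable_fun (A : set (R * R)%type) (fun x : (R * R)%type => (\1_(Bj j) x : R)%:E).
  apply/measurable_EFinP; apply: measurable_funTS; exact: (measurable_indic (mB' j)).
rewrite -[X in (\int[mu]_(x in X) _)%E]/A.
apply: (@le_trans _ _ (\int[mu]_(x in A) (\sum_(j < N) (M * i j)%:E * (\1_(Bj j) x)%:E))%E).
  apply: ge0_le_integral => //.
  - by move=> x _; rewrite lee_fin powR_ge0.
  - exact: (measurable_funS (@measurable_Dset R) AD mF).
  - apply: emeasurable_sum => j; apply: emeasurable_funM => //.
  - move=> x Ax; have xd : (1 - e / 2) * d <= 1 - modC (toC x) <= d by move: Ax => /= /andP[/ltW -> ->].
    have te : 1 - (1 - e / 2) <= e / 2 by lra.
    have [j hj] := grid_cover d1 N0 te N1 xd.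
    have Bx : Bj j x by split=> //; exact: AD.
    apply: (le_trans (FB j x Bx)).
    rewrite (bigD1 j) //= indicE mem_set // mule1 leeDl //.
    by apply: sume_ge0 => k _; rewrite -EFinM lee_fin mulr_ge0 // mulr_ge0.
rewrite ge0_integral_sum //; last 2 first.
- move=> j; apply: emeasurable_funM => //.
- by move=> j x _; rewrite -EFinM lee_fin mulr_ge0 // mulr_ge0.
apply: (@le_trans _ _ (\sum_(j < N) ((c * c2) `^ (q / p) * S)%:E * band_int w K (a j) p f)%E).
  apply: lee_sum => j _.
  have -> : (\int[mu]_(x in A) ((M * i j)%:E * (\1_(Bj j) x)%:E) = (M * i j)%:E * mu (Bj j `&` A))%E.
    rewrite ge0_integralZl //.
    - by congr (_ * _)%E; rewrite (integral_indic mu mA' (mB' j)).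
    - by rewrite lee_fin mulr_ge0.
  apply: (@le_trans _ _ ((M * i j)%:E * mu (@toC R @^-1` Edisc s (a j)))%E).
    apply: lee_wpmul2l; first by rewrite lee_fin mulr_ge0.
    apply: le_measure; rewrite ?inE.
    - exact: (measurableI _ _ (mB' j) mA').
    - exact: measurable_Edisc.
    - by move=> x [/BE].
  rewrite -iE EFinM -muleA muleCA [leRHS]muleC (muleC M%:E); apply: lee_wpmul2l => //.
  by rewrite lee_fin.
rewrite -ge0_sume_distrr; last by move=> j _; case/andP: (BI j).
have cS : 0 <= (c * c2) `^ (q / p) * S by rewrite mulr_ge0 ?powR_ge0.
apply: (@le_trans _ _ (((c * c2) `^ (q / p) * S)%:E * ((4 * N%:R * d)%:E * band_norm K d f))%E).
  by apply: lee_wpmul2l; [rewrite lee_fin|exact: sum_band_int].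
rewrite muleA -EFinM; apply: lee_wpmul2r; first exact: band_norm_ge0.
rewrite lee_fin -mulrA.
have -> : 4 * (B + 1) * (c * c2) `^ (q / p) * S = (c * c2) `^ (q / p) * S * (4 * (B + 1)) by ring.
rewrite mulrA; apply: ler_wpM2l => //.
by rewrite -mulrA ler_pM2l.
Qed.

End Level.

(** * Test functions *)

Section TestFunctions.
Variable R : realType.
Local Notation C := (Cx R).
Local Notation mu := (@lebesgue_measure R).
Local Notation MR := (measurableTypeR R).
Local Notation R2 := (MR * MR)%type.

Lemma derive1nZ (a : C) (f : C -> C) n z : holo_disc f -> modC z < 1 ->
  derive1n n (fun z => a * f z) z = a * derive1n n f z.
Proof.
move=> hf z1; have := @derive1n_lin R (a - 1) f f n z hf hf z1.
have -> : (fun z => (a - 1) * f z + f z) = (fun z => a * f z) by apply/funext => v; ring.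
by move=> ->; ring.
Qed.

Lemma holoZ (a : C) (f : C -> C) : holo_disc f -> holo_disc (fun z => a * f z).
Proof. by move=> hf; exact: (@holoM R (fun=> a) f (@holo_cst R a) hf). Qed.

Variables (p : R) (w : R -> R).
Hypothesis p1 : 1 < p.
Hypothesis rw : radial_weight w.
Hypothesis Dw : class_D w.

Let w0 t : 0 <= t <= 1 -> 0 <= w t. Proof. by case: rw => h _ _; exact: h. Qed.

Lemma Apnorm_ge0 (f : C -> C) : (0 <= Apnorm_p p w f)%E.
Proof.
rewrite /Apnorm_p /areaInt mule_ge0 ?lee_fin ?invr_ge0 ?pi_ge0 //.
apply: integral_ge0 => x Dx; rewrite lee_fin mulr_ge0 ?powR_ge0 // w0 // modC_ge0 ltW //.
Qed.

Lemma measurable_Apnorm (f : C -> C) : holo_disc f ->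
  measurable_fun (@Dset R : set R2) (fun x : R2 => (modC (f (toC x)) `^ p * w (modC (toC x)))%:E).
Proof.
by move=> hf; apply/measurable_EFinP; apply: measurable_funM; [exact: measurable_modC_powR|exact: measurable_weight_modC].
Qed.

Lemma ApnormZ (a : C) (f : C -> C) : holo_disc f ->
  Apnorm_p p w (fun z => a * f z) = ((modC a `^ p)%:E * Apnorm_p p w f)%E.
Proof.
move=> hf; rewrite /Apnorm_p /areaInt muleCA; congr (_ * _)%E.
rewrite -ge0_integralZl; last 4 first.
- exact: measurable_Dset.
- exact: measurable_Apnorm.
- by move=> x Dx; rewrite lee_fin mulr_ge0 ?powR_ge0 // w0 // modC_ge0 ltW.
- by rewrite lee_fin powR_ge0.
by apply: eq_integral => x _; rewrite -EFinM modCM powRM ?modC_ge0 // mulrA.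
Qed.

(** Scaled to have modulus at most 1 on the disc; the division by its norm is left to
    [test_functions]. *)
Definition kpow (a : C) (m : nat) (z : C) : C := rC ((1 - modC a) ^+ m) * ((1 - cjC a * z) ^+ m)^-1.

Lemma holo_kpow (a : C) m : modC a < 1 -> holo_disc (kpow a m).
Proof. by move=> a1; apply: holoZ; exact: (holo_kernel (m := m) a1). Qed.

Lemma modC_kpow (a z : C) m : modC a < 1 -> modC (kpow a m z) = ((1 - modC a) / bk a z) ^+ m.
Proof.
move=> a1; rewrite /kpow modCM modC_rC modCV modCX expr_div_n ger0_norm // exprn_ge0 //.
by rewrite subr_ge0 ltW.
Qed.

(** The modulus is at most 1, so its p-th power is dominated by the modulus itself. Two factors 1 /
    |1 - conj(a) z| are spent on the Poisson mean, the others are bounded by 1 / (1 - |a| r) on each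
    circle; the remaining radial integral is split at the distance d = 1 - |a| from the boundary. *)
Lemma Apnorm_kpow : exists m0 : nat, forall m, (m0 <= m)%N -> exists2 c : R, 0 < c &
  forall a, modC a < 1 -> (Apnorm_p p w (kpow a m) <= (c * ((1 - modC a) * tailw w (1 - modC a)))%:E)%E.
Proof.
have [m0 H] := integral_weight_power rw Dw; exists m0.+2 => -[//|[//|m]] mm.
have [A A0 HA] := H m.+1 ltac:(by apply: leqW).
have pc := polar_const_gt0 R.
exists (polar_const R * (A + 1)); first by apply: mulr_gt0 => //; lra.
move=> a a1; have a0 := modC_ge0 a.
set d := 1 - modC a.
have d0 : 0 < d by rewrite /d; lra.
have d1 : d <= 1 by rewrite /d; lra.
have d01 : 0 < d <= 1 by rewrite d0.
have hk : holo_disc (kpow a m.+2) := holo_kpow a1.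
rewrite /Apnorm_p areaInt_weight //; last 2 first.
- exact: measurable_modC_powR.
- by move=> z _; exact: powR_ge0.
pose h (r : R) := d ^+ m.+2 / (1 - modC a * r) ^+ m.+1.
have inner (r : R) : 0 <= r < 1 ->
   (\int[mu]_(y in `[0%R, 1%R[) (modC (kpow a m.+2 (rC r * eC y)) `^ p)%:E <= (h r)%:E)%E.
  move=> /[dup] r01 /andP[r0 r1].
  have ar : modC a * r < 1 by nra.
  have ar0 : 0 <= modC a * r by exact: mulr_ge0.
  have mk : measurable_fun setT (fun y : MR => modC (kpow a m.+2 (rC r * eC y)) `^ p : MR).
    by apply: (measurable_circle_slice (g := fun z => modC (kpow a m.+2 z) `^ p)) => //; exact: measurable_modC_powR.
  have cb := cont_on_bkV (m := 2) a1 r01.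
  have rn : 0 <= (d / (1 - modC a * r)) ^+ m by rewrite exprn_ge0 // divr_ge0 ?ltW // subr_gt0.
  apply: (@le_trans _ _ (\int[mu]_(y in `[0%R, 1%R[) (((d / (1 - modC a * r)) ^+ m * d ^+ 2)%:E * ((bk a (rC r * eC y) ^+ 2)^-1)%:E))%E).
    apply: ge0_le_integral => //.
    - by move=> y _; rewrite lee_fin powR_ge0.
    - by apply/measurable_EFinP; apply: measurable_funTS.
    - by apply: emeasurable_funM => //; apply/measurable_EFinP; exact: cont_on_measurable.
    - move=> y _; rewrite -EFinM lee_fin modC_kpow // -/d.
      have z1 : modC (rC r * eC y) < 1 by rewrite modC_circle.
      have b0 := bk_gt0 a1 z1; have b1 := bk_ge1 a z1.
      have b2 := bk_ge a (rC r * eC y); rewrite modC_circle // in b2.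
      set b := bk _ _ in b0 b1 b2 *.
      have db : 0 <= d / b by rewrite divr_ge0 ?ltW.
      have db1 : d / b <= 1 by rewrite ler_pdivrMr // mul1r.
      apply: (@le_trans _ _ ((d / b) ^+ m.+2)).
        have dbp : 0 < (d / b) ^+ m.+2 by rewrite exprn_gt0 // divr_gt0.
        by apply: ge1r_powR; [rewrite dbp exprn_ile1|exact: ltW].
      rewrite -addn2 exprD -mulrA -expr_div_n; apply: ler_pM; rewrite ?exprn_ge0 //.
      apply: lerXn2r; rewrite ?nnegrE // ?divr_ge0 ?(ltW d0) ?subr_ge0 ?(ltW ar) //.
      by rewrite ler_pM2l // lef_pV2 ?posrE // subr_gt0.
  rewrite ge0_integralZl //; last 3 first.
  - by apply/measurable_EFinP; exact: cont_on_measurable.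
  - by move=> y _; rewrite lee_fin invr_ge0 sqr_ge0.
  - by rewrite lee_fin mulr_ge0 // sqr_ge0.
  rewrite -rint_integral //; last by move=> y _; rewrite invr_ge0 sqr_ge0.
  rewrite poisson_mean // -EFinM lee_fin.
  apply: (@le_trans _ _ ((d / (1 - modC a * r)) ^+ m * d ^+ 2 * (1 - modC a * r)^-1)).
    apply: ler_wpM2l; first by rewrite mulr_ge0 // sqr_ge0.
    rewrite -exprMn; rewrite lef_pV2 ?posrE; nra.
  have q0 : 1 - modC a * r != 0 by rewrite gt_eqF // subr_gt0.
  have -> : h r = d ^+ m * d ^+ 2 / ((1 - modC a * r) * (1 - modC a * r) ^+ m) by rewrite /h -exprD addn2 -exprS.
  rewrite expr_div_n le_eqVlt; apply/orP; left; apply/eqP.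
  by field; rewrite q0 expf_neq0.
have mI := @measurable_circle_mean_disc R (fun z => modC (kpow a m.+2 z) `^ p) (measurable_modC_powR p hk) (fun z _ => powR_ge0 _ _).
have mw (x y : R) : 0 <= x -> y <= 1 -> measurable_fun (`[x, y[%classic : set MR) (w : MR -> MR).
  by move=> x0 y1; apply: weight_measurable => // t /=; rewrite !in_itv /= => /andP[h1 h2]; apply/andP; split; lra.
have minv (x y : R) : 0 <= x -> y <= 1 -> measurable_fun (`[x, y[%classic : set MR) (fun r : MR => (w r / (1 - r) ^+ m.+1)%:E).
  move=> x0 y1; apply/measurable_EFinP; apply: measurable_funM; first exact: mw.
  have : measurable_fun (`[x, y[%classic : set MR) (fun t : MR => (1 - t) `^ (- m.+1%:R) : MR).
    apply: measurable_funTS; apply: (measurableT_comp (@measurable_powR R (- m.+1%:R))).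
    exact: measurable_funB.
  apply: eq_measurable_fun => t; rewrite inE /= in_itv /= => /andP[h1 h2].
  by rewrite powRN powR_mulrn // subr_ge0 ltW //; lra.
have wr r : 0 <= r < 1 -> 0 <= w r by move=> /andP[h1 h2]; rewrite w0 // h1 ltW.
have mII (x y : R) : 0 <= x -> y <= 1 -> measurable_fun (`[x, y[%classic : set MR) (fun r : MR =>
   ((polar_const R * r * w r)%:E * \int[mu]_(y in `[0%R, 1%R[) (modC (kpow a m.+2 (rC r * eC y)) `^ p)%:E)%E).
  move=> x0 y1; apply: emeasurable_funM.
    by apply/measurable_EFinP; apply: measurable_funM; [exact: measurable_funM|exact: mw].
  apply: measurable_funS mI => // t /=; rewrite !in_itv /= => /andP[h1 h2]; apply/andP; split; lra.
have II0 r : 0 <= r < 1 -> (0 <= (polar_const R * r * w r)%:E * \int[mu]_(y in `[0%R, 1%R[) (modC (kpow a m.+2 (rC r * eC y)) `^ p)%:E)%E.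
  move=> r01; apply: mule_ge0; last by apply: integral_ge0 => y _; rewrite lee_fin powR_ge0.
  by rewrite lee_fin; apply: mulr_ge0; [apply: mulr_ge0; [exact: ltW|by case/andP: r01]|exact: wr].
have IIle r (k : R) : 0 <= r < 1 -> h r <= k ->
   ((polar_const R * r * w r)%:E * \int[mu]_(y in `[0%R, 1%R[) (modC (kpow a m.+2 (rC r * eC y)) `^ p)%:E <= (polar_const R * k * w r)%:E)%E.
  move=> r01 hk'; have [r0 r1] := andP r01; have wr0 := wr _ r01.
  have pr : 0 <= polar_const R * r * w r by apply: mulr_ge0 => //; apply: mulr_ge0 => //; exact: ltW.
  apply: (@le_trans _ _ ((polar_const R * r * w r)%:E * (h r)%:E)%E).
    by apply: lee_wpmul2l; [rewrite lee_fin|exact: inner].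
  have h0 : 0 <= h r by rewrite /h divr_ge0 ?exprn_ge0 ?subr_ge0 ?(ltW d0) //; nra.
  rewrite -EFinM lee_fin.
  have -> : polar_const R * r * w r * h r = polar_const R * w r * (r * h r) by ring.
  have -> : polar_const R * k * w r = polar_const R * w r * k by ring.
  apply: ler_wpM2l; first by apply: mulr_ge0 => //; exact: ltW.
  by apply: le_trans hk'; rewrite ler_piMl // ltW.
pose I (r : R) : \bar R := (\int[mu]_(y in `[0%R, 1%R[) (modC (kpow a m.+2 (rC r * eC y)) `^ p)%:E)%E.
rewrite -[leLHS]/(\int[mu]_(r in `[0%R, 1%R[) ((polar_const R * r * w r)%:E * I r))%E.
have -> : `[0%R, 1%R[%classic = `[0%R, 1 - d[%classic `|` `[1 - d, 1%R[%classic :> set R.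
  apply/seteqP; split => t /=; rewrite !in_itv /=; first by case: (ltP t (1 - d)) => h1 /andP[h2 h3]; [left|right]; apply/andP.
  by move=> [|] /andP[h1 h2]; apply/andP; split => //; lra.
rewrite ge0_integral_setU //; last 3 first.
- have -> : `[0%R, 1 - d[%classic `|` `[1 - d, 1%R[%classic = `[0%R, 1%R[%classic :> set R.
    apply/seteqP; split => t /=; rewrite !in_itv /=; last by case: (ltP t (1 - d)) => h1 /andP[h2 h3]; [left|right]; apply/andP.
    by move=> [|] /andP[h1 h2]; apply/andP; split => //; lra.
  exact: mII.
- by move=> r /= [|]; rewrite in_itv /= => /andP[h1 h2]; apply: II0; apply/andP; split => //; lra.
- by apply/disj_setPS => t /=; rewrite !in_itv /= => -[/andP[h1 h2] /andP[h3 h4]]; move: h2; rewrite ltNge h3.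
have -> : (polar_const R * (A + 1) * (d * tailw w d))%:E = ((polar_const R * A * (d * tailw w d))%:E + (polar_const R * (d * tailw w d))%:E)%E.
  by rewrite -EFinD; congr _%:E; ring.
(* On the inner part 1 - |a| r >= 1 - r and [integral_weight_power] applies; on the outer part 1 -
   |a| r >= d bounds the circle mean by d. *)
apply: leeD.
  apply: (@le_trans _ _ (\int[mu]_(r in `[0%R, (1 - d)%R[) ((polar_const R * d ^+ m.+2)%:E * (w r / (1 - r) ^+ m.+1)%:E))%E).
    apply: ge0_le_integral => //.
    - by move=> r /=; rewrite in_itv /= => /andP[h1 h2]; apply: II0; apply/andP; split => //; lra.
    - by apply: mII => //; lra.
    - by apply: emeasurable_funM => //; apply: minv => //; lra.
    - move=> r /=; rewrite in_itv /= => /andP[h1 h2].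
      have r01 : 0 <= r < 1 by rewrite h1 /=; lra.
      apply: (le_trans (IIle r (d ^+ m.+2 / (1 - r) ^+ m.+1) r01 _)).
        have q1 : 0 < 1 - r by lra.
        have q2 : 1 - r <= 1 - modC a * r by nra.
        have q3 : 0 < 1 - modC a * r by lra.
        rewrite /h ler_pM2l ?exprn_gt0 // lef_pV2 ?posrE ?exprn_gt0 //.
        by apply: lerXn2r; rewrite ?nnegrE //; exact: ltW.
      by rewrite -EFinM lee_fin le_eqVlt; apply/orP; left; apply/eqP; ring.
  rewrite ge0_integralZl //; last 3 first.
  - by apply: minv => //; lra.
  - move=> r /=; rewrite in_itv /= => /andP[h1 h2]; rewrite lee_fin divr_ge0 ?wr ?h1 //=; first lra.
    by rewrite exprn_ge0 //; lra.
  - by rewrite lee_fin; apply: mulr_ge0; [exact: ltW|rewrite exprn_ge0 // ltW].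
  apply: (@le_trans _ _ ((polar_const R * d ^+ m.+2)%:E * (A * tailw w d / d ^+ m.+1)%:E)%E).
    by apply: lee_wpmul2l; [rewrite lee_fin; apply: mulr_ge0; [exact: ltW|rewrite exprn_ge0 // ltW]|exact: HA].
  rewrite -EFinM lee_fin le_eqVlt; apply/orP; left; apply/eqP; rewrite exprS.
  have D0 : d ^+ m.+1 != 0 by rewrite expf_neq0 // gt_eqF.
  move: (d ^+ m.+1) (polar_const R) D0 => D pc' D0; by field.
apply: (@le_trans _ _ (\int[mu]_(r in `[(1 - d)%R, 1%R[) ((polar_const R * d)%:E * (w r)%:E))%E).
  apply: ge0_le_integral => //.
  - by move=> r /=; rewrite in_itv /= => /andP[h1 h2]; apply: II0; apply/andP; split => //; lra.
  - by apply: mII => //; lra.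
  - by apply: emeasurable_funM => //; apply/measurable_EFinP; apply: mw => //; lra.
  - move=> r /=; rewrite in_itv /= => /andP[h1 h2]; rewrite -EFinM.
    have r01 : 0 <= r < 1 by rewrite h2 andbT; lra.
    apply: IIle => //; rewrite /h.
    have ad : d <= 1 - modC a * r by rewrite /d; nra.
    rewrite ler_pdivrMr ?exprn_gt0 ?(lt_le_trans d0) // [leLHS]exprS ler_pM2l //.
    by apply: lerXn2r; rewrite ?nnegrE ?(ltW d0) // (le_trans (ltW d0)).
rewrite ge0_integralZl //; last 3 first.
- by apply/measurable_EFinP; apply: mw => //; lra.
- by move=> r /=; rewrite in_itv /= => /andP[h1 h2]; rewrite lee_fin wr // h2 andbT; lra.
- by rewrite lee_fin; apply: mulr_ge0; exact: ltW.
have := @integral_weight R w rw d 0; rewrite tailw0 !subr0 => -> //; last exact: ltW.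
by rewrite -EFinM lee_fin mulrA.
Qed.

(** The exponent m collects three demands: m1 for the norm bound, m2 + 1 to absorb the normalising
    factor, and one more power of 1 - |a| for the decay on smaller discs. The region |1 - conj(a) z|
    <= L (1 - |a|) contains E_s(a) when L = 2 / (1 - s). *)
Lemma test_functions (n : nat) (L : R) : 0 < L -> exists m : nat, exists2 c : R, 0 < c &
  forall a, 1 / 2 <= modC a < 1 -> exists u : C -> C, [/\ inAp p w u, (Apnorm_p p w u <= 1)%E,
    forall z, modC z < 1 -> bk a z <= L * (1 - modC a) ->
      c / ((1 - modC a) ^+ n * ((1 - modC a) * tailw w (1 - modC a)) `^ p^-1) <= modC (derive1n n u z)
  & forall r z, modC z <= r -> r < 1 -> modC (u z) <= c^-1 * (1 - modC a) / (1 - r) ^+ m].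
Proof.
move=> L0; have pp : 0 < p by apply: lt_trans p1.
have [m1 H1] := Apnorm_kpow; have [m2 H2] := tailw_power_le rw Dw.
pose m := (m1 + m2).+2.
have [k k0 Hk] := H1 m ltac:(by rewrite /m; lia).
have [A A0 HA] := H2 m2 (leqnn _).
pose kp := k `^ p^-1; have kp0 : 0 < kp by rewrite powR_gt0.
pose Ap := A `^ p^-1; have Ap0 : 0 < Ap by rewrite powR_gt0.
pose c1 := kp^-1 * 2^-1 ^+ n / L ^+ (m + n).
have c10 : 0 < c1 by rewrite /c1 divr_gt0 ?exprn_gt0 // mulr_gt0 ?invr_gt0 // exprn_gt0 ?invr_gt0.
pose c := Num.min c1 (kp / Ap).
have c0 : 0 < c by rewrite lt_min c10 divr_gt0.
exists m, c => // a /andP[ah a1]; have a0 := modC_ge0 a.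
set d := 1 - modC a.
have d0 : 0 < d by rewrite /d; lra.
have d1 : d <= 1 by rewrite /d; lra.
have t0 : 0 < tailw w d by apply: tailw_gt0; rewrite ?d0.
pose T := (d * tailw w d) `^ p^-1.
have T0 : 0 < T by rewrite powR_gt0 // mulr_gt0.
pose s := (kp * T)^-1; have s0 : 0 < s by rewrite invr_gt0 mulr_gt0.
have hk : holo_disc (kpow a m) := holo_kpow a1.
have ukn : (Apnorm_p p w (fun z => (rC s * kpow a m z)%R) <= 1)%E.
  rewrite ApnormZ // modC_rC ger0_norm ?(ltW s0) //.
  apply: (@le_trans _ _ ((s `^ p)%:E * (k * (d * tailw w d))%:E)%E).
    by apply: lee_wpmul2l; [rewrite lee_fin powR_ge0|exact: Hk].
  rewrite -EFinM lee_fin /s /kp /T -powRM ?mulr_ge0 ?(ltW k0) ?(ltW d0) ?(ltW t0) //.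
  have X0 : 0 < k * (d * tailw w d) by rewrite !mulr_gt0.
  rewrite -powRN -powRrM mulNr mulVf ?gt_eqF // powR_inv1 ?(ltW X0) // mulVf // gt_eqF //.
exists (fun z => rC s * kpow a m z); split.
- split; first by apply: holoZ.
  by apply: (le_lt_trans ukn); exact: ltry.
- exact: ukn.
- move=> z z1 bz.
  have b0 := bk_gt0 a1 z1.
  rewrite (derive1nZ _ _ hk z1) (derive1nZ _ _ (holo_kernel (m := m) a1) z1) (derive1n_kernel _ _ a1 z1).
  rewrite !modCM !modC_rC modCV !modCX modC_cj -/(bk a z) -/d ger0_norm ?(ltW s0) // ger0_norm ?exprn_ge0 ?(ltW d0) //.
  (* The n-th derivative of the kernel brings out the integers m, ..., m + n - 1, all positive, and
     conj(a)^n, of modulus at least 2^-n since |a| >= 1/2. *)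
  have pr1 : 1 <= modC (\prod_(i < n) (m + i)%:R : C).
    rewrite -natr_prod -rCn modC_rC ger0_norm // ler1n prodn_gt0 // => i; by rewrite /m.
  apply: (@le_trans _ _ (s * (d ^+ m * (1 * 2^-1 ^+ n / (L * d) ^+ (m + n))))).
    have -> : s * (d ^+ m * (1 * 2^-1 ^+ n / (L * d) ^+ (m + n))) = c1 / (d ^+ n * T).
      rewrite /s /c1 exprMn (exprD d); field.
      by rewrite !expf_neq0 ?gt_eqF.
    by rewrite ler_pM2r ?invr_gt0 ?mulr_gt0 ?exprn_gt0 // ge_min lexx.
  rewrite ler_pM2l // ler_pM2l ?exprn_gt0 //.
  apply: ler_pM; rewrite ?mulr_ge0 ?invr_ge0 ?exprn_ge0 ?invr_ge0 ?mulr_ge0 ?(ltW L0) ?(ltW d0) //.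
    apply: ler_pM => //.
    by apply: lerXn2r; rewrite ?nnegrE ?invr_ge0 //; lra.
  rewrite lef_pV2 ?posrE ?exprn_gt0 ?mulr_gt0 //.
  by apply: lerXn2r; rewrite ?nnegrE ?(ltW b0) // ltW // mulr_gt0.
- move=> r z zr r1.
  have z1 : modC z < 1 by lra.
  have r0 : 0 <= r by apply: le_trans zr; exact: modC_ge0.
  have b0 := bk_gt0 a1 z1.
  have br : 1 - r <= bk a z by apply: le_trans (bk_ge a z); have := modC_ge0 z; nra.
  have r10 : 0 < 1 - r by lra.
  rewrite modCM modC_rC ger0_norm ?(ltW s0) // modC_kpow // -/d.
  (* The normalising factor T is bounded below by a multiple of d^(m2 + 1), so dividing by it costs
     only that many of the m powers of d. *)
  have T1 : d ^+ m2.+1 <= Ap * T.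
    have h1 : d ^+ m2.+1 <= A * (d * tailw w d).
      by rewrite exprS mulrCA ler_pM2l //; apply: HA; rewrite d0.
    rewrite /Ap /T -powRM ?(ltW A0) ?mulr_ge0 ?(ltW d0) ?(ltW t0) //.
    apply: (@le_trans _ _ ((d ^+ m2.+1) `^ p^-1)).
      apply: ger1_powR; first by rewrite exprn_gt0 // exprn_ile1 // ltW.
      by rewrite invf_le1 // ltW.
    by apply: ge0_ler_powR; rewrite ?nnegrE ?invr_ge0 ?exprn_ge0 ?mulr_ge0 ?(ltW pp) ?(ltW d0) ?(ltW A0) ?(ltW t0).
  have sd : s * d ^+ m <= c^-1 * d.
    have -> : d ^+ m = d ^+ m1 * (d ^+ m2.+1 * d) by rewrite /m -exprSr -exprD addnS addnS.
    have h2 : d ^+ m1 * (d ^+ m2.+1 * d) <= Ap * T * d.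
      rewrite -[leRHS]mul1r; apply: ler_pM; rewrite ?exprn_ge0 ?mulr_ge0 ?exprn_ge0 ?(ltW d0) //.
        by rewrite exprn_ile1 // ltW.
      by rewrite ler_pM2r.
    apply: (@le_trans _ _ (s * (Ap * T * d))); first by rewrite ler_pM2l.
    have -> : s * (Ap * T * d) = (kp / Ap)^-1 * d by rewrite /s; field; rewrite !gt_eqF.
    by rewrite ler_pM2r // lef_pV2 ?posrE ?divr_gt0 // ge_min lexx orbT.
  rewrite expr_div_n mulrA; apply: ler_pM.
  + by apply: mulr_ge0; [exact: ltW|rewrite exprn_ge0 // ltW].
  + by rewrite invr_ge0 exprn_ge0 // ltW.
  + exact: sd.
  + rewrite lef_pV2 ?posrE ?exprn_gt0 //.
    by apply: lerXn2r; rewrite ?nnegrE ?(ltW b0) ?(ltW r10).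
Qed.

End TestFunctions.

(** * Taylor truncations and the upper bound *)

Section Subsequences.
Variable R : realType.
Local Notation C := (Cx R).

Lemma real_subsequence (x : nat -> R) (M : R) : (forall k, `|x k| <= M) ->
  exists2 phi : nat -> nat, (forall k, (phi k < phi k.+1)%N) & exists l : R,
    forall e, 0 < e -> exists N, forall k, (N <= k)%N -> `|x (phi k) - l| < e.
Proof.
move=> xM.
have bx : bounded_fun x.
  by exists M; split; [exact: num_real|move=> y My k _; exact: le_trans (xM k) (ltW My)].
have [phi iphi cphi] := bolzano_weierstrass bx.
exists phi; first by move=> k; have := iphi k.+1 k; rewrite leEnat ltnn ltnNge => ->.
exists (lim (x \o phi @ \oo)) => e e0.
move/cvgrPdist_lt: cphi => /(_ e e0) [N _ HN]; exists N => k Nk.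
by rewrite distrC; exact: HN.
Qed.

Lemma increasing_ge (phi : nat -> nat) : (forall k, (phi k < phi k.+1)%N) -> forall k, (k <= phi k)%N.
Proof. by move=> H; elim=> // k IH; exact: leq_ltn_trans IH (H k). Qed.

Lemma increasing_comp (phi psi : nat -> nat) : (forall k, (phi k < phi k.+1)%N) -> (forall k, (psi k < psi k.+1)%N) ->
  forall k, (phi (psi k) < phi (psi k.+1))%N.
Proof.
move=> H1 H2 k; have H3 i j : (i < j)%N -> (phi i < phi j)%N.
  elim: j => // j IH; rewrite ltnS leq_eqVlt => /orP[/eqP ->|/IH h]; first exact: H1.
  exact: ltn_trans h (H1 j).
exact: H3.
Qed.

Lemma complex_subsequence (x : nat -> C) (M : R) : (forall k, modC (x k) <= M) ->
  exists2 phi : nat -> nat, (forall k, (phi k < phi k.+1)%N) & exists l : C,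
    forall e, 0 < e -> exists N, forall k, (N <= k)%N -> modC (x (phi k) - l) < e.
Proof.
move=> xM.
have [phi1 i1 [l1 H1]] := @real_subsequence (fun k => ReC (x k)) M (fun k => le_trans (Re_le_modC _) (xM k)).
have [phi2 i2 [l2 H2]] := @real_subsequence (fun k => ImC (x (phi1 k))) M (fun k => le_trans (Im_le_modC _) (xM _)).
exists (fun k => phi1 (phi2 k)); first exact: increasing_comp.
exists (Complex l1 l2) => e e0; have e2 : 0 < e / 2 by rewrite divr_gt0.
have [N1 HN1] := H1 _ e2; have [N2 HN2] := H2 _ e2.
exists (maxn N1 N2) => k; rewrite geq_max => /andP[k1 k2].
apply: le_lt_trans (modC_leReIm _) _; rewrite ReCD ImCD ReCN ImCN [ltRHS]splitr; apply: ltrD.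
  by apply: HN1; exact: leq_trans k1 (increasing_ge i2 k).
exact: HN2.
Qed.

(** Subsequences are extracted for one coordinate after the other; the N coefficients of a truncated
    polynomial call for finitely many extractions. *)
Lemma diagonal_subsequence (N : nat) (x : nat -> nat -> C) (M : nat -> R) : (forall k j, modC (x k j) <= M j) ->
  exists2 phi : nat -> nat, (forall k, (phi k < phi k.+1)%N) & exists l : nat -> C,
    forall j e, (j < N)%N -> 0 < e -> exists N, forall k, (N <= k)%N -> modC (x (phi k) j - l j) < e.
Proof.
move=> xM; elim: N => [|N [phi i1 [l H]]]; first by exists id => //; exists (fun=> 0).
have [psi i2 [l' H']] := @complex_subsequence (fun k => x (phi k) N) (M N) (fun k => xM _ N).
exists (fun k => phi (psi k)); first exact: increasing_comp.
exists (fun j => if j == N then l' else l j) => j e; rewrite ltnS leq_eqVlt => /orP[/eqP ->|jN] e0.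
  by rewrite eqxx; have [N' HN'] := H' e e0; exists N'.
rewrite ltn_eqF //; have [N' HN'] := H j e jN e0; exists N' => k kN.
by apply: HN'; exact: leq_trans kN (increasing_ge i2 k).
Qed.

End Subsequences.

(** * Truncated Taylor polynomials *)

Section Truncation.
Variable R : realType.
Local Notation C := (Cx R).
Local Notation MR := (measurableTypeR R).
Local Notation R2 := (MR * MR)%type.

(** Beyond |z| = r the operator vanishes, so there its difference with D^(n) is the derivative
    itself and the annulus estimates apply unchanged. *)
Definition truncpoly (r : R) (N : nat) (b : nat -> C) (z : C) : C :=
  if modC z <= r then \sum_(k < N) b k * z ^+ k else 0.

Lemma truncpoly_lin r N (a : C) (b b' : nat -> C) z :
  truncpoly r N (fun k => a * b k + b' k) z = a * truncpoly r N b z + truncpoly r N b' z.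
Proof.
rewrite /truncpoly; case: ifP => _; last by rewrite mulr0 addr0.
by rewrite mulr_sumr -big_split /=; apply: eq_bigr => k _; ring.
Qed.

Lemma modC_truncpoly r N (b : nat -> C) z : modC z < 1 -> modC (truncpoly r N b z) <= \sum_(k < N) modC (b k).
Proof.
move=> z1; rewrite /truncpoly; case: ifP => _; last first.
  by rewrite modC0 sumr_ge0 // => k _; exact: modC_ge0.
apply: (le_trans (modC_sum _ _)); apply: ler_sum => k _.
by rewrite modCM modCX ler_piMr ?modC_ge0 // exprn_ile1 ?modC_ge0 // ltW.
Qed.

Lemma continuous_poly N (b : nat -> C) (z : C) : {for z, continuous (fun z : C => \sum_(k < N) b k * z ^+ k)}.
Proof.
suff [d /cdiff_continuous] : exists d, cdiff (fun z : C => \sum_(k < N) b k * z ^+ k) z d by [].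
elim: N => [|N [d IH]].
  have -> : (fun z : C => \sum_(k < 0) b k * z ^+ k) = (fun _ : C => 0 : C) by apply/funext => v; rewrite big_ord0.
  by exists 0; exact: cdiff_cst.
have -> : (fun z : C => \sum_(k < N.+1) b k * z ^+ k) = (fun z : C => (\sum_(k < N) b k * z ^+ k) + b N * z ^+ N).
  by apply/funext => v; rewrite big_ord_recr.
have h := cdiffD IH (cdiffM (cdiff_cst (b N) z) (cdiffX N (cdiff_id z))).
by eexists; exact: h.
Qed.

Lemma measurable_truncpoly r N (b : nat -> C) :
  measurable_fun (@Dset R : set R2) (fun x : R2 => ReC (truncpoly r N b (toC x)) : MR) /\
  measurable_fun (@Dset R : set R2) (fun x : R2 => ImC (truncpoly r N b (toC x)) : MR).
Proof.
have mi := measurable_indic_modC (measurable_itv (`]-oo, r] : interval R)).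
have cp z : modC z < 1 -> {for z, continuous (fun z : C => \sum_(k < N) b k * z ^+ k)} by move=> _; exact: continuous_poly.
have iE x : \1_(`]-oo, r]%classic : set MR) (modC (toC x)) = (modC (@toC R x) <= r)%R%:R :> R.
  by rewrite indicE; congr (nat_of_bool _)%:R; apply/idP/idP; rewrite inE /= in_itv.
split.
  apply: (eq_measurable_fun _ _ (measurable_funM mi (cont_measurable_Re cp))) => x _.
  by rewrite /= iE /truncpoly; case: ifP => _; rewrite ?mul1r ?mul0r.
apply: (eq_measurable_fun _ _ (measurable_funM mi (cont_measurable_Im cp))) => x _.
by rewrite /= iE /truncpoly; case: ifP => _; rewrite ?mul1r ?mul0r.
Qed.

Lemma measurable_modC_ReIm (g : C -> C) : measurable_fun (@Dset R : set R2) (fun x : R2 => ReC (g (toC x)) : MR) ->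
  measurable_fun (@Dset R : set R2) (fun x : R2 => ImC (g (toC x)) : MR) ->
  measurable_fun (@Dset R : set R2) (fun x : R2 => modC (g (toC x)) : MR).
Proof.
move=> m1 m2; have := measurable_funD (measurable_funX 2%N m1) (measurable_funX 2%N m2).
move=> /(measurableT_comp (@measurable_powR R 2^-1)).
by apply: eq_measurable_fun => x _; rewrite /= powR12_sqrt // addr_ge0 // sqr_ge0.
Qed.

Lemma measurable_Lqint (q : R) (g : C -> C) : measurable_fun (@Dset R : set R2) (fun x : R2 => ReC (g (toC x)) : MR) ->
  measurable_fun (@Dset R : set R2) (fun x : R2 => ImC (g (toC x)) : MR) ->
  measurable_fun (@Dset R : set R2) (fun x : R2 => (modC (g (toC x)) `^ q)%:E).
Proof.
move=> m1 m2; apply/measurable_EFinP; apply: (measurableT_comp (@measurable_powR R q)).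
exact: measurable_modC_ReIm.
Qed.

Lemma Lqint_bounded (mu : {measure set (R * R)%type -> \bar R}) (q M : R) (g : C -> C) : 0 < q ->
  measurable_fun (@Dset R : set R2) (fun x : R2 => ReC (g (toC x)) : MR) ->
  measurable_fun (@Dset R : set R2) (fun x : R2 => ImC (g (toC x)) : MR) ->
  (forall z, modC z < 1 -> modC (g z) <= M) -> (Lqint mu q g <= (M `^ q)%:E * mu (@Dset R))%E.
Proof.
move=> q0 m1 m2 gM; have mD : @measurable _ (R * R)%type (@Dset R) by exact: measurable_Dset.
rewrite -integral_cst //; apply: ge0_le_integral => //.
- by move=> x _; rewrite lee_fin powR_ge0.
- exact: measurable_Lqint.
- move=> x Dx; rewrite lee_fin; apply: ge0_ler_powR; rewrite ?nnegrE ?(ltW q0) ?modC_ge0 //; last exact: gM.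
  exact: le_trans (modC_ge0 _) (gM _ Dx).
Qed.

(** The k-th Taylor coefficient at 0 of the n-th derivative, written as a mean over a circle so that
    linearity in f and the bound by the supremum on that circle are immediate. *)
Definition tcoef (n : nat) (r : R) (f : C -> C) (k : nat) : C :=
  cint 0 1 (fun y => derive1n n f (rC r * eC y) / (rC r * eC y) ^+ k).

Lemma cont_tcoef n (r : R) (f : C -> C) k : holo_disc f -> 0 < r < 1 ->
  cont_on 0 1 (fun y => derive1n n f (rC r * eC y) / (rC r * eC y) ^+ k).
Proof.
move=> hf /andP[r0 r1].
apply: cont_onM; first exact: (holo_circle_cont (holo_derive1n (n := n) hf) (ltW r0) r1).
apply: cont_onV; last by apply: cont_onX; exact: circle_cont.
by move=> y _; rewrite expf_neq0 // -modC_gt0 modC_circle // ltW.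
Qed.

Lemma cont_on_cstC (a : C) : cont_on (0 : R) 1 (fun=> a).
Proof. exact: cont_on_cst. Qed.

Lemma tcoef_lin n (r : R) (a : C) (f g : C -> C) k : holo_disc f -> holo_disc g -> 0 < r < 1 ->
  tcoef n r (fun z => a * f z + g z) k = a * tcoef n r f k + tcoef n r g k.
Proof.
move=> hf hg r01; have cf := cont_tcoef (n := n) (k := k) hf r01; have cg := cont_tcoef (n := n) (k := k) hg r01.
rewrite /tcoef -(cintZ _ cf) -(cintD (cont_onM (@cont_on_cstC a) cf) cg); apply: eq_cint => y _.
have [r0 r1] := andP r01.
rewrite derive1n_lin // ?modC_circle ?(ltW r0) //; ring.
Qed.

Lemma modC_tcoef n (r M : R) (f : C -> C) k : holo_disc f -> 0 < r < 1 -> (forall z, modC z = r -> modC (derive1n n f z) <= M) ->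
  modC (tcoef n r f k) <= 2 * (M / r ^+ k).
Proof.
move=> hf /[dup] r01 /andP[r0 r1] HM; have := modC_cint_le (M := M / r ^+ k) ler01 (cont_tcoef (n := n) (k := k) hf r01).
rewrite subr0 mulr1; apply => y _; rewrite modCM modCV modCX modC_circle ?(ltW r0) //.
by rewrite ler_pM2r ?invr_gt0 ?exprn_gt0 // HM // modC_circle // ltW.
Qed.

(** Expanding v / (v - z) as a finite geometric series in z / v leaves the exact remainder (z / v)^N
    v / (v - z) under Cauchy's integral. *)
Lemma taylor_remainder n (r M : R) (f : C -> C) N z : holo_disc f -> 0 < r < 1 -> (forall z, modC z = r -> modC (derive1n n f z) <= M) ->
  modC z < r -> modC (derive1n n f z - \sum_(k < N) tcoef n r f k * z ^+ k) <= 2 * (M * ((modC z / r) ^+ N * (r / (r - modC z)))).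
Proof.
move=> hf /[dup] r01 /andP[r0 r1] HM zr; have hg := holo_derive1n (n := n) hf.
pose g := derive1n n f.
have c0 y : rC r * eC y != 0 by rewrite -modC_gt0 modC_circle // ltW.
have c1 y : rC r * eC y - z != 0 by exact: circle_neq.
pose T N y := g (rC r * eC y) / (rC r * eC y) ^+ N * (z ^+ N * ((rC r * eC y) / (rC r * eC y - z))).
have cT m : cont_on 0 1 (T m).
  apply: cont_onM; first exact: (cont_tcoef (n := n) (k := m) hf r01).
  apply: cont_onM; first exact: cont_on_cst.
  apply: cont_onM; first exact: circle_cont.
  have := Cauchy_kernel_cont (u := fun=> 1) (m := 1) zr (@cont_on_cstC 1).
  by under eq_fun do rewrite div1r expr1.
have -> : g z - \sum_(k < N) tcoef n r f k * z ^+ k = cint 0 1 (T N).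
  elim: N => [|N IH].
    rewrite big_ord0 subr0 /g -(Cauchy_formula hg zr r1); apply: eq_cint => y _.
    rewrite /T /g; set v := rC r * eC y; set u := derive1n n f v.
    by rewrite !expr0 invr1 mulr1 mul1r -mulrA.
  rewrite big_ord_recr /= opprD addrA IH; apply/eqP; rewrite subr_eq; apply/eqP.
  rewrite mulrC /tcoef -(cintZ _ (cont_tcoef (n := n) (k := N) hf r01)).
  rewrite -(cintD (cT N.+1) (cont_onM (@cont_on_cstC (z ^+ N)) (cont_tcoef (n := n) (k := N) hf r01))).
  apply: eq_cint => y _; rewrite /T -/g !exprS.
  have := c0 y; have := c1 y; set v := rC r * eC y => v1 v0.
  have vN : v ^+ N != 0 by rewrite expf_neq0.
  move: (v ^+ N) (z ^+ N) (g v) vN => t1 t2 t3 t10; field.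
  by rewrite t10 v1 v0.
have rz : 0 < r - modC z by rewrite subr_gt0.
have H0 := modC_cint_le (M := M * ((modC z / r) ^+ N * (r / (r - modC z)))) ler01 (cT N).
rewrite subr0 mulr1 in H0; apply: H0 => y _.
rewrite /T !modCM !modCV !modCX modC_circle ?(ltW r0) // modC_rC modC_eC mulr1 (ger0_norm (ltW r0)) expr_div_n.
have h1 := HM (rC r * eC y) (modC_circle y (ltW r0)).
have h2 := circle_dist y z (ltW r0).
have -> : modC (g (rC r * eC y)) / r ^+ N * (modC z ^+ N * (r / modC (rC r * eC y - z))) =
   modC (g (rC r * eC y)) * (modC z ^+ N / r ^+ N * (r / modC (rC r * eC y - z))) by ring.
have h3 : 0 < modC (rC r * eC y - z) by rewrite (lt_le_trans rz).
have e1 : 0 <= modC z ^+ N / r ^+ N by rewrite divr_ge0 ?exprn_ge0 ?modC_ge0 // ltW.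
apply: ler_pM => //; first exact: modC_ge0.
  by apply: mulr_ge0 => //; rewrite divr_ge0 // ltW.
apply: ler_wpM2l => //; rewrite ler_pM2l // lef_pV2 ?posrE //.
Qed.

End Truncation.

Lemma le_poweR (R : realType) (r : R) (x y : \bar R) : 0 <= r -> (0 <= x)%E -> (x <= y)%E -> (x `^ r <= y `^ r)%E.
Proof.
move=> r0 x0 xy; have y0 := le_trans x0 xy.
by apply: gt0_ler_poweR => //; rewrite in_itv /= leey andbT.
Qed.

(** * The upper bound for the essential norm *)

Section UpperBound.
Variable R : realType.
Local Notation C := (Cx R).
Local Notation MR := (measurableTypeR R).
Local Notation R2 := (MR * MR)%type.

Variables (p q : R) (n : nat) (w : R -> R) (s : R).
Hypothesis p1 : 1 < p.
Hypothesis pq : p <= q.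
Hypothesis rw : radial_weight w.
Hypothesis Dw : class_D w.
Hypothesis s01 : 0 < s < 1.

Let w0 t : 0 <= t <= 1 -> 0 <= w t. Proof. by case: rw => h _ _; exact: h. Qed.
Let p0 : 0 < p. Proof. exact: lt_trans p1. Qed.
Let q0 : 0 < q. Proof. exact: lt_le_trans pq. Qed.

(** For a = 1/2 every point of the disc satisfies |1 - conj(a) z| <= 5/2 = 5 (1 - |a|), so with L =
    5 the test function has an n-th derivative bounded below on the whole disc, and this derivative
    lies in L^q. *)
Lemma measure_disc_fin (mu : {measure set (R * R)%type -> \bar R}) : Dn_bounded p q n w mu -> (mu (@Dset R) < +oo)%E.
Proof.
move=> [Dn_in _].
have [m [c c0 H]] := test_functions p1 rw Dw n (L := 5) ltac:(lra).
have ma : modC (rC (1 / 2 : R)) = 1 / 2 by rewrite modC_rC ger0_norm //; lra.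
have [|u [uA _ uD _]] := H (rC (1 / 2)); first by rewrite ma; lra.
have [m1 m2 fin] := Dn_in u uA.
set k := c / _ in uD.
have tw : 0 < tailw w (1 - modC (rC (1 / 2 : R))) by apply: tailw_gt0 => //; rewrite ma; lra.
have k0 : 0 < k.
  rewrite /k; apply: divr_gt0 => //; apply: mulr_gt0; first by rewrite exprn_gt0 // ma; lra.
  by rewrite powR_gt0 // mulr_gt0 // ma; lra.
have mD : @measurable _ (R * R)%type (@Dset R) by exact: measurable_Dset.
have h : ((k `^ q)%:E * mu (@Dset R) <= Lqint mu q (Dn n u))%E.
  rewrite -integral_cst //; apply: ge0_le_integral => //.
  - by move=> x _; rewrite lee_fin powR_ge0.
  - exact: measurable_Lqint.
  - move=> x Dx; rewrite lee_fin; apply: ge0_ler_powR; rewrite ?nnegrE ?(ltW q0) ?(ltW k0) ?modC_ge0 //.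
    apply: uD => //; have a1 : modC (rC (1 / 2 : R)) < 1 by rewrite ma; lra.
    have h1 := bk_le (toC x) a1; have h2 := modCB (toC x) (rC (1 / 2)).
    have h3 : modC (toC x) < 1 := Dx.
    rewrite ma in h1 h2 *; lra.
have kq : 0 < k `^ q by rewrite powR_gt0.
have h' := le_lt_trans h fin.
have [e|e] := eqVneq (mu (@Dset R)) +oo%E; last by rewrite lt_neqAle e leey.
by move: h'; rewrite e gt0_muley ?lte_fin // ltxx.
Qed.

(** The local estimate is taken at the centre z = a: its constant depends on |z| only, and the
    kernel integral is at most the norm. *)
Lemma local_bound (r : R) : 0 <= r < 1 -> exists2 M : R, 0 < M & forall f, holo_disc f -> (Apnorm_p p w f <= 1)%E ->
  forall z, modC z = r -> modC (derive1n n f z) <= M.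
Proof.
move=> /andP[r0 r1]; have [K [c [K1 c0 H]]] := local_estimate rw Dw n p1.
pose B := c / ((1 - r) * tailw w (1 - r) * ((1 - r) ^+ n) `^ p).
have B0 : 0 < B.
  apply: divr_gt0 => //; apply: mulr_gt0; first by apply: mulr_gt0; [lra|apply: tailw_gt0 => //; lra].
  by rewrite powR_gt0 // exprn_gt0 //; lra.
exists (B `^ p^-1); first by rewrite powR_gt0.
move=> f hf f1 z zr; have z1 : modC z < 1 by rewrite zr.
have za : modC (z - z) <= (1 - modC z) / 4 by rewrite subrr modC0; lra.
have := H f z z hf z1 za; rewrite zr -/B => h.
have {}h : ((modC (derive1n n f z) `^ p)%:E <= B%:E)%E.
  apply: (le_trans h); rewrite -[leRHS]mule1; apply: lee_wpmul2l; first by rewrite lee_fin ltW.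
  by have /andP[_ h1] := band_int_le rw K p hf z1; exact: le_trans h1 f1.
rewrite lee_fin in h.
have -> : modC (derive1n n f z) = (modC (derive1n n f z) `^ p) `^ p^-1.
  by rewrite -powRrM mulfV ?gt_eqF // powRr1 // modC_ge0.
by apply: ge0_ler_powR; rewrite ?nnegrE ?invr_ge0 ?(ltW p0) ?(ltW B0) ?powR_ge0.
Qed.

Lemma sum_band_norm (K t : R) (m k0 N : nat) (f : C -> C) : 1 < K -> 0 < t < 1 -> t ^+ m <= K^-1 -> holo_disc f ->
  (\sum_(k < N) band_norm p w K (t ^+ (k0 + k)) f <= m%:R%:E * Apnorm_p p w f)%E.
Proof.
move=> K1 t01 tm hf.
have cnt r : r < 1 -> \sum_(k < N) \1_(bandw K (t ^+ (k0 + k))) r <= m%:R :> R.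
  move=> r1; apply: le_trans (band_count (k0 + N) K1 t01 tm r1).
  by rewrite big_split_ord /= lerDr sumr_ge0.
rewrite /band_norm /Apnorm_p /areaInt -ge0_sume_distrr; last first.
  move=> k _; apply: integral_ge0 => x Dx; rewrite lee_fin; apply: mulr_ge0; last by rewrite w0 // modC_ge0 ltW.
  by apply: mulr_ge0 => //; exact: powR_ge0.
rewrite muleCA; apply: lee_wpmul2l; first by rewrite lee_fin invr_ge0 pi_ge0.
have b0 (D : set R) (x : R2) : @Dset R x -> 0 <= \1_D (modC (toC x)) * modC (f (toC x)) `^ p * w (modC (toC x)).
  move=> Dx; apply: mulr_ge0; last by rewrite w0 // modC_ge0 ltW.
  by apply: mulr_ge0 => //; exact: powR_ge0.
have mb k : measurable_fun (@Dset R : set R2)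
    (fun x : R2 => \1_(bandw K (t ^+ (k0 + k))) (modC (toC x)) * modC (f (toC x)) `^ p * w (modC (toC x)) : MR).
  apply: measurable_funM; last exact: measurable_weight_modC.
  apply: measurable_funM; first by apply: measurable_indic_modC; exact: measurable_itv.
  exact: measurable_modC_powR.
rewrite -ge0_integralZl; last 4 first.
- exact: measurable_Dset.
- exact: (measurable_Apnorm p rw hf).
- by move=> x Dx; rewrite lee_fin mulr_ge0 ?powR_ge0 // w0 // modC_ge0 ltW.
- by rewrite lee_fin.
rewrite -ge0_integral_sum; last 3 first.
- exact: measurable_Dset.
- by move=> k; apply/measurable_EFinP; exact: mb.
- by move=> k x Dx; rewrite lee_fin; exact: b0.
apply: ge0_le_integral.
- exact: measurable_Dset.
- by move=> x Dx; apply: sume_ge0 => k _; rewrite lee_fin; exact: b0.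
- by apply: emeasurable_sum => k; apply/measurable_EFinP; exact: mb.
- by apply: emeasurable_funM => //; exact: (measurable_Apnorm p rw hf).
move=> x Dx; rewrite sumEFin -EFinM lee_fin.
have -> : \sum_(k < N) \1_(bandw K (t ^+ (k0 + k))) (modC (toC x)) * modC (f (toC x)) `^ p * w (modC (toC x)) =
   (\sum_(k < N) \1_(bandw K (t ^+ (k0 + k))) (modC (toC x))) * (modC (f (toC x)) `^ p * w (modC (toC x))).
  by rewrite mulr_suml; apply: eq_bigr => k _; rewrite mulrA.
by apply: ler_wpM2r; [rewrite mulr_ge0 ?powR_ge0 // w0 // modC_ge0 ltW|exact: cnt].
Qed.

Lemma expr_small (t e : R) : 0 <= t < 1 -> 0 < e -> exists k, t ^+ k < e.
Proof.
move=> /andP[t0 t1] e0.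
have : (fun m => t ^+ m) @ \oo --> (0 : R) by apply: cvg_expr; rewrite ger0_norm.
move=> /cvgrPdist_lt /(_ e e0) [N _ HN]; exists N.
by have := HN N (leqnn N); rewrite /= sub0r normrN ger0_norm ?exprn_ge0.
Qed.

Definition outer (r : R) : set R2 := @Dset R `&` [set x : R2 | r <= modC (toC x)].

Lemma measurable_outer r : measurable (outer r).
Proof.
have -> : outer r = @Dset R `&` [set x : R2 | - modC (toC x) <= - r].
  by apply/seteqP; split => x [x1 /= h]; split => //; move: h => /=; rewrite lerN2.
apply: (@measurable_fun_set_le R (fun z => - modC z)) => z _.
by apply: (@cvgN _ _ _ (nbhs z) _ (@modC R)); exact: continuous_modC.
Qed.

Lemma upper_tail : exists2 c : R, 0 < c &
  forall (mu : {measure set (R * R)%type -> \bar R}) (r0 S : R), 0 <= r0 < 1 -> 0 <= S ->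
  (forall a, r0 < modC a < 1 -> (carleson_ratio p q n w s mu a <= S%:E)%E) ->
  exists2 r : R, 0 < r < 1 & forall f, holo_disc f -> (Apnorm_p p w f <= 1)%E ->
  (\int[mu]_(x in outer r) (modC (derive1n n f (toC x)) `^ q)%:E <= (c * S)%:E)%E.
Proof.
have [K [t [c [K1 t01 c0 H]]]] := level_estimate n p1 pq rw Dw s01.
have [t0 t1] := andP t01.
have [m0 tm0] : exists m, t ^+ m < K^-1 by apply: expr_small; rewrite ?(ltW t0) // invr_gt0; lra.
(* The successor makes m positive, hence also the final constant. *)
pose m := m0.+1.
have tm : t ^+ m <= K^-1.
  by apply: le_trans (ltW tm0); rewrite /m exprS ler_piMl ?exprn_ge0 // ltW.
exists (c * m%:R); first by rewrite mulr_gt0 // ltr0n.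
move=> mu r0 S /andP[r00 r01] S0 HS.
(* Below 1 - r0 the grid centres lie where the ratio is bounded by S; below 1/2 [level_estimate]
   applies. *)
have [k0 tk0] : exists k, t ^+ k < Num.min (1 - r0) (1 / 2).
  by apply: expr_small; rewrite ?(ltW t0) // lt_min; lra.
rewrite lt_min in tk0; have /andP[tk1 tk2] := tk0.
have tk : 0 < t ^+ k0 by rewrite exprn_gt0.
exists (1 - t ^+ k0); first by lra.
move=> f hf f1.
pose F (x : R2) : \bar R := (modC (derive1n n f (toC x)) `^ q)%:E.
have F0 x : (0 <= F x)%E by rewrite lee_fin powR_ge0.
have mF : measurable_fun (@Dset R : set R2) F.
  by apply/measurable_EFinP; apply: measurable_modC_powR; exact: holo_derive1n.
pose A k : set R2 := [set x | t * t ^+ (k0 + k) < 1 - modC (toC x) <= t ^+ (k0 + k)].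
have tp k : 0 < t ^+ (k0 + k) by rewrite exprn_gt0.
have AD k : A k `<=` @Dset R.
  move=> x /= /andP[h1 h2]; rewrite /Dset /=.
  have : 0 < t * t ^+ (k0 + k) by rewrite mulr_gt0.
  lra.
have mA k : measurable (A k).
  have -> : A k = (@Dset R `&` [set x : R2 | modC (toC x) < 1 - t * t ^+ (k0 + k)]) `&` outer (1 - t ^+ (k0 + k)).
    apply/seteqP; split => x.
      by move=> /[dup] /AD Dx /= /andP[h1 h2]; split; split=> //=; lra.
    by move=> [[h1 /= h2] [_ /= h3]]; apply/andP; split; lra.
  apply: measurableI; last exact: measurable_outer.
  by apply: (@measurable_fun_set_lt R (@modC R)) => z _; exact: continuous_modC.
have tdec i j : (i <= j)%N -> t ^+ j <= t ^+ i by move=> ij; apply: ler_wiXn2l => //; exact: ltW.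
have UA : outer (1 - t ^+ k0) = \bigcup_k A k.
  apply/seteqP; split => x; last first.
    move=> [k _ /[dup] /AD Dx /= /andP[h1 h2]]; split => //=.
    have := tdec k0 (k0 + k)%N (leq_addr _ _); lra.
  move=> [x1 /= x2]; have u0 : 0 < 1 - modC (toC x) by rewrite subr_gt0.
  have ex : exists k, t ^+ (k0 + k).+1 < 1 - modC (toC x).
    have [k hk] := expr_small (t := t) (e := 1 - modC (toC x)) ltac:(by rewrite (ltW t0)) u0.
    exists k; apply: le_lt_trans hk; apply: tdec; exact: leqW (leq_addl _ _).
  (* The annulus containing x is given by the first k with t^(k0 + k + 1) < 1 - |x|. *)
  exists (ex_minn ex) => //; case: ex_minnP => k h1 h2; rewrite /A /= -exprS h1 /=.
  case: k h1 h2 => [|k] h1 h2; first by rewrite addn0; lra.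
  rewrite leNgt; apply/negP => h3; have := h2 k; rewrite -addnS h3 => /(_ isT).
  by rewrite ltnn.
have tA : trivIset setT A.
  apply/trivIsetP => i j _ _; wlog ij : i j / (i < j)%N.
    move=> W; rewrite neq_ltn => /orP[h|h]; first by apply: W => //; rewrite neq_ltn h.
    by rewrite setIC; apply: W => //; rewrite neq_ltn h.
  move=> _; apply/seteqP; split => x // [/= /andP[h1 h2] /andP[h3 h4]].
  have := tdec (k0 + i).+1 (k0 + j)%N; rewrite -addnS leq_add2l => /(_ ij).
  rewrite addnS exprS; lra.
rewrite UA ge0_integral_bigcup //; last 2 first.
- by apply: measurable_funS mF; [exact: measurable_Dset|move=> x [k _ /AD]].
- by move=> x _; exact: F0.
apply: lime_le; first by apply: is_cvg_ereal_nneg_natsum => k _; apply: integral_ge0 => x _; exact: F0.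
apply: nearW => N; rewrite big_mkord.
apply: (@le_trans _ _ (\sum_(k < N) (c * S)%:E * band_norm p w K (t ^+ (k0 + k)) f)%E).
  apply: lee_sum => k _; apply: H => //.
    by rewrite tp /=; have := tdec k0 (k0 + k)%N (leq_addr _ _); lra.
  move=> a ea; apply: HS; rewrite ea.
  by have := tdec k0 (k0 + k)%N (leq_addr _ _); have := tp k; lra.
rewrite -ge0_sume_distrr; last by move=> k _; exact: band_norm_ge0.
have cS : 0 <= c * S by rewrite mulr_ge0 // ltW.
have -> : c * m%:R * S = c * S * m%:R by ring.
rewrite (EFinM (c * S)); apply: lee_wpmul2l; first by rewrite lee_fin.
apply: (le_trans (sum_band_norm k0 N K1 t01 tm hf)).
by rewrite -[leRHS]mule1; apply: lee_wpmul2l; rewrite ?lee_fin.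
Qed.

Lemma inLq_truncpoly (mu : {measure set (R * R)%type -> \bar R}) r N b : (mu (@Dset R) < +oo)%E ->
  inLq mu q (truncpoly r N b).
Proof.
move=> muD; have [m1 m2] := measurable_truncpoly r N b; split=> //.
apply: (le_lt_trans (Lqint_bounded mu q0 m1 m2 (fun z z1 => modC_truncpoly r N b z1))).
by apply: lte_mul_pinfty; rewrite ?lee_fin ?powR_ge0.
Qed.

(** The operator factors through N coefficients, which are bounded on the unit ball. Along a
    subsequence they converge, and then the truncated polynomials converge uniformly, hence in L^q
    because mu is finite on the disc. *)
Lemma compact_truncation (mu : {measure set (R * R)%type -> \bar R}) (r r' : R) (N : nat) :
  (mu (@Dset R) < +oo)%E -> 0 < r' < 1 -> compact_op p q w mu (fun f => truncpoly r N (tcoef n r' f)).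
Proof.
move=> muD /[dup] r'01 /andP[r'0 r'1]; split.
- by move=> f _; exact: inLq_truncpoly.
- move=> a f g [hf _] [hg _]; apply: aeW => x _.
  rewrite -truncpoly_lin; congr (truncpoly _ _ _ _); apply/funext => k; exact: tcoef_lin.
move=> u Hu.
have [M M0 HM] := local_bound (r := r') ltac:(by rewrite (ltW r'0)).
have bd k j : modC (tcoef n r' (u k) j) <= 2 * (M / r' ^+ j).
  have [[hu _] nu] := Hu k; apply: modC_tcoef => // z zr; exact: HM.
have [phi iphi [l Hl]] := diagonal_subsequence N bd.
exists phi; split=> //; exists (truncpoly r N l); split; first exact: inLq_truncpoly.
have muf : mu (@Dset R) \is a fin_num by rewrite ge0_fin_numE.
pose m := fine (mu (@Dset R)); have mE : mu (@Dset R) = m%:E by rewrite fineK.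
have m0 : 0 <= m by rewrite fine_ge0.
have L0 k : (0 <= Lqint mu q (fun z => truncpoly r N (tcoef n r' (u (phi k))) z - truncpoly r N l z)%R)%E.
  by apply: integral_ge0 => x _; rewrite lee_fin powR_ge0.
have main (e : R) : 0 < e -> exists N0, forall k, (N0 <= k)%N ->
   (Lqint mu q (fun z => truncpoly r N (tcoef n r' (u (phi k))) z - truncpoly r N l z)%R <= e%:E)%E.
  move=> e0; pose d := (e / (m + 1)) `^ q^-1.
  have d0 : 0 < d by rewrite powR_gt0 // divr_gt0 //; lra.
  have [N0 HN0] : exists N0, forall k j, (N0 <= k)%N -> (j < N)%N -> modC (tcoef n r' (u (phi k)) j - l j) < d / (N%:R + 1).
    have dN : 0 < d / (N%:R + 1) by rewrite divr_gt0 // ltr_wpDl.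
    move: (d / _) dN => D D0.
    elim: (N) (fun j jN => Hl j _ jN D0) => [|i IH] Hj; first by exists 0%N.
    have [N1 HN1] := IH (fun j jN => Hj j (ltnW jN)); have [N2 HN2] := Hj i (ltnSn i).
    exists (maxn N1 N2) => k j; rewrite geq_max => /andP[k1 k2]; rewrite ltnS leq_eqVlt => /orP[/eqP ->|ji].
      exact: HN2.
    exact: HN1.
  exists N0 => k kN0.
  have tpE z : truncpoly r N (tcoef n r' (u (phi k))) z - truncpoly r N l z = truncpoly r N (fun j => tcoef n r' (u (phi k)) j - l j) z.
    have := truncpoly_lin r N (-1) l (tcoef n r' (u (phi k))) z.
    have -> : (fun j => -1 * l j + tcoef n r' (u (phi k)) j) = (fun j => tcoef n r' (u (phi k)) j - l j).
      by apply/funext => j; rewrite mulN1r addrC.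
    by move=> ->; rewrite mulN1r addrC.
  rewrite (_ : (fun z => _) = truncpoly r N (fun j => tcoef n r' (u (phi k)) j - l j)); last by apply/funext.
  have [m1 m2] := measurable_truncpoly r N (fun j => tcoef n r' (u (phi k)) j - l j).
  have bb z : modC z < 1 -> modC (truncpoly r N (fun j => tcoef n r' (u (phi k)) j - l j) z) <= d.
    move=> z1; apply: (le_trans (modC_truncpoly r N _ z1)).
    apply: (@le_trans _ _ (\sum_(j < N) d / (N%:R + 1))).
      by apply: ler_sum => j _; apply: ltW; exact: HN0.
    rewrite sumr_const card_ord -[X in X <= _]mulr_natr mulrAC ler_pdivrMr ?ltr_wpDl // ler_pM2l //; lra.
  apply: (le_trans (Lqint_bounded mu q0 m1 m2 bb)).
  rewrite mE -EFinM lee_fin /d -powRrM mulVf ?gt_eqF // powRr1; last by rewrite divr_ge0 ?(ltW e0) //; lra.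
  rewrite mulrAC ler_pdivrMr; last by lra.
  by rewrite ler_pM2l //; lra.
apply/fine_cvgP; split.
  have [N0 HN0] := main 1 ltr01; exists N0 => // k /= kN; rewrite ge0_fin_numE //.
  by apply: le_lt_trans (HN0 k kN) _; exact: ltry.
apply/cvgrPdist_le => e e0; have [N0 HN0] := main e e0; exists N0 => // k /= kN.
rewrite sub0r normrN ger0_norm ?fine_ge0 // -lee_fin fineK; first exact: HN0.
by rewrite ge0_fin_numE //; apply: le_lt_trans (HN0 k kN) _; exact: ltry.
Qed.

(** For each r0 a truncation leaves the part near the boundary, controlled by the supremum of the
    ratio beyond r0, and an inner error that a large degree N makes arbitrarily small. *)
Lemma ess_upper : exists2 c : R, 0 < c & forall mu : {measure set (R * R)%type -> \bar R}, Dn_bounded p q n w mu ->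
  (ess_norm_Dn p q n w mu `^ q <= c%:E * limsup_boundary (carleson_ratio p q n w s mu))%E.
Proof.
have [c c0 H] := upper_tail; exists c => // mu HD.
have muD := measure_disc_fin HD.
have muf : mu (@Dset R) \is a fin_num by rewrite ge0_fin_numE.
pose m := fine (mu (@Dset R)); have mE : mu (@Dset R) = m%:E by rewrite fineK.
have m0 : 0 <= m by rewrite fine_ge0.
have ratio0 a : (0 <= carleson_ratio p q n w s mu a)%E.
  by rewrite /carleson_ratio mule_ge0 // lee_fin invr_ge0 mulr_ge0 ?powR_ge0.
have main (r0 : R) : 0 <= r0 < 1 -> (ess_norm_Dn p q n w mu `^ q <=
    c%:E * ereal_sup [set carleson_ratio p q n w s mu z | z in [set z : C | (r0 < modC z < 1)%R]])%E.
  move=> r001; set S := ereal_sup _.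
  have [r00 r01] := andP r001.
  have S0 : (0 <= S)%E.
    apply: le_trans (ratio0 (rC ((r0 + 1) / 2))) _; apply: ereal_sup_ubound; exists (rC ((r0 + 1) / 2)) => //=.
    by rewrite modC_rC ger0_norm; lra.
  have [->|Sfin] := eqVneq S +oo%E; first by rewrite gt0_muley ?leey // lte_fin.
  have fS : S \is a fin_num by rewrite ge0_fin_numE // lt_neqAle Sfin leey.
  pose T := fine S; have TE : S = T%:E by rewrite fineK.
  have T0 : 0 <= T by rewrite fine_ge0.
  have [r r_01 Hr] := H mu r0 T r001 T0 (fun a ha => ltac:(rewrite -TE; apply: ereal_sup_ubound; exists a => //)).
  have [rp r1] := andP r_01.
  rewrite TE -EFinM; apply/lee_addgt0Pr => e e0.
  (* A uniform error d contributes at most d^q times the mass of the disc, which is at most e. *)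
  pose d := (e / (m + 1)) `^ q^-1.
  have d0 : 0 < d by rewrite powR_gt0 // divr_gt0 //; lra.
  have dq : d `^ q * m <= e.
    rewrite /d -powRrM mulVf ?gt_eqF // powRr1; last by rewrite divr_ge0 ?(ltW e0) //; lra.
    rewrite mulrAC ler_pdivrMr; last by lra.
    by rewrite ler_pM2l //; lra.
  (* The coefficients are taken on a circle strictly outside |z| <= r, so the Taylor remainder
     decays there like (r / r')^N. *)
  have [r' r'r r'01] : exists2 r' : R, r < r' & 0 < r' < 1.
    by exists ((1 + r) / 2); lra.
  have [r'0 r'1] := andP r'01.
  have [M M0 HM] := local_bound (r := r') ltac:(by rewrite (ltW r'0)).
  have X0 : 0 < 2 * (M * (r' / (r' - r))) by rewrite mulr_gt0 // mulr_gt0 // divr_gt0 // subr_gt0.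
  have [N HN] : exists N, (r / r') ^+ N < d / (2 * (M * (r' / (r' - r)))).
    apply: expr_small; last exact: divr_gt0.
    by rewrite divr_ge0 ?(ltW rp) ?(ltW r'0) //= ltr_pdivrMr // mul1r.
  pose K f := truncpoly r N (tcoef n r' f).
  have cK : compact_op p q w mu K by exact: compact_truncation.
  have key f : inAp p w f -> (Apnorm_p p w f <= 1)%E -> (Lqint mu q (fun z => Dn n f z - K f z)%R <= (c * T)%:E + e%:E)%E.
    move=> [hf _] f1; have hg := holo_derive1n (n := n) hf.
    pose F (x : R2) : \bar R := (modC (derive1n n f (toC x)) `^ q)%:E.
    have mF : measurable_fun (@Dset R : set R2) F.
      by apply/measurable_EFinP; apply: measurable_modC_powR; exact: holo_derive1n.
    have [m1 m2] := measurable_truncpoly r N (tcoef n r' f).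
    have mL : measurable_fun (@Dset R : set R2) (fun x : R2 => (modC (Dn n f (toC x) - K f (toC x)) `^ q)%:E).
      apply: (@measurable_Lqint R q (fun z => Dn n f z - K f z)).
        have := measurable_funB (cont_measurable_Re (fun z => holo_cont hg (z := z))) m1.
        by apply: eq_measurable_fun => x _; rewrite ReCD ReCN.
      have := measurable_funB (cont_measurable_Im (fun z => holo_cont hg (z := z))) m2.
      by apply: eq_measurable_fun => x _; rewrite ImCD ImCN.
    have mD : @measurable _ (R * R)%type (@Dset R) by exact: measurable_Dset.
    have mO : @measurable _ (R * R)%type (outer r) by exact: measurable_outer.
    have OD : outer r `<=` @Dset R by move=> x [].
    have F0 x : (0 <= F x)%E by rewrite lee_fin powR_ge0.
    have mFO : measurable_fun (@Dset R : set (R * R)%type) (F \_ (outer r)).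
      apply/(measurable_restrict _ mO mD); rewrite setIidr //.
      exact: measurable_funS mF.
    apply: (@le_trans _ _ (\int[mu]_(x in @Dset R) ((F \_ (outer r)) x + (d `^ q)%:E))%E).
      apply: ge0_le_integral => //.
      - by move=> x _; rewrite lee_fin powR_ge0.
      - exact: emeasurable_funD.
      move=> x Dx; rewrite patchE; case: ifPn => [/set_mem [_ /= rx]|/negP xO].
        (* The circle |z| = r belongs both to [outer r] and to the region of the polynomial; on it
           the Taylor error is used. *)
        have [rx'|rx'] := ltP r (modC (toC x)).
          have -> : K f (toC x) = 0 by rewrite /K /truncpoly leNgt rx'.
          by rewrite subr0 leeDl // lee_fin powR_ge0.
        have ex : modC (toC x) = r by apply/eqP; rewrite eq_le rx' rx.
        apply: (@le_trans _ _ (d `^ q)%:E); last by rewrite leeDr.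
        rewrite lee_fin; apply: ge0_ler_powR; rewrite ?nnegrE ?(ltW q0) ?(ltW d0) ?modC_ge0 //.
        rewrite /K /truncpoly rx'.
        have xr' : modC (toC x) < r' by rewrite ex.
        apply: (le_trans (taylor_remainder N hf r'01 (HM f hf f1) xr')); rewrite ex.
        have -> : 2 * (M * ((r / r') ^+ N * (r' / (r' - r)))) = (r / r') ^+ N * (2 * (M * (r' / (r' - r)))) by ring.
        by rewrite -ler_pdivlMr // ltW.
      rewrite add0e lee_fin; apply: ge0_ler_powR; rewrite ?nnegrE ?(ltW q0) ?(ltW d0) ?modC_ge0 //.
      have rx : modC (toC x) < r by rewrite ltNge; apply/negP => h; apply: xO; rewrite inE; split.
      rewrite /K /truncpoly (ltW rx).
      have xr' : modC (toC x) < r' by exact: lt_trans r'r.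
      apply: (le_trans (taylor_remainder N hf r'01 (HM f hf f1) xr')).
      apply: (@le_trans _ _ ((r / r') ^+ N * (2 * (M * (r' / (r' - r)))))); last by rewrite -ler_pdivlMr // ltW.
      have -> : (r / r') ^+ N * (2 * (M * (r' / (r' - r)))) = 2 * (M * ((r / r') ^+ N * (r' / (r' - r)))) by ring.
      rewrite ler_pM2l // ler_pM2l //.
      have h1 : 0 < r' - modC (toC x) by rewrite subr_gt0.
      apply: ler_pM.
      - by rewrite exprn_ge0 // divr_ge0 ?modC_ge0 // ltW.
      - by rewrite divr_ge0 // ltW.
      - apply: lerXn2r; rewrite ?nnegrE ?divr_ge0 ?modC_ge0 ?(ltW r'0) ?(ltW rp) //.
        by rewrite ler_pM2r ?invr_gt0 // ltW.
      - rewrite ler_pM2l // lef_pV2 ?posrE ?subr_gt0 //.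
        by rewrite lerD2l lerN2 ltW.
    rewrite ge0_integralD //; last 2 first.
    - by move=> x _; rewrite patchE; case: ifP.
    - by move=> x _; rewrite lee_fin powR_ge0.
    apply: leeD; last by rewrite integral_cst // mE -EFinM lee_fin.
    rewrite -integral_mkcondr setIidr //; exact: Hr.
  have V0 : (0 <= (c * T)%:E + e%:E)%E by rewrite -EFinD lee_fin addr_ge0 ?(ltW e0) // mulr_ge0 // ltW.
  have opK : (opnorm p q w mu (fun f z => Dn n f z - K f z)%R <= ((c * T)%:E + e%:E) `^ q^-1)%E.
    apply: ge_ereal_sup => _ [f [fA f1] <-].
    apply: le_poweR; [by rewrite invr_ge0 ltW| |exact: key].
    by apply: integral_ge0 => x _; rewrite lee_fin powR_ge0.
  have essK : (ess_norm_Dn p q n w mu <= ((c * T)%:E + e%:E) `^ q^-1)%E.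
    apply: le_trans opK; apply: ereal_inf_lbound; by exists K.
  have ess0 : (0 <= ess_norm_Dn p q n w mu)%E.
    apply: le_ereal_inf_tmp => _ [K' _ <-].
    apply: le_trans (ereal_sup_ubound _); last first.
      exists (fun=> 0) => //=; split; first split.
      - exact: holo_cst.
      - rewrite /Apnorm_p /areaInt integral0_eq ?mule0 ?ltry // => x _; by rewrite modC0 powR0 ?mul0r // gt_eqF.
      - rewrite /Apnorm_p /areaInt integral0_eq ?mule0 ?lee_fin // => x _; by rewrite modC0 powR0 ?mul0r // gt_eqF.
    exact: poweR_ge0.
  apply: (@le_trans _ _ ((((c * T)%:E + e%:E) `^ q^-1) `^ q)%E).
    by apply: le_poweR => //; exact: ltW.
  by rewrite -poweRrM mulVf ?gt_eqF // poweRe1.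
(* The constant is moved to the left so that the bound passes to the infimum over r0. *)
have cE : ((c^-1)%:E * (ess_norm_Dn p q n w mu `^ q) <= limsup_boundary (carleson_ratio p q n w s mu))%E.
  apply: le_ereal_inf_tmp => _ [r0 r001 <-].
  by rewrite lee_pdivrMl // main.
by rewrite lee_pdivrMl // in cE.
Qed.

End UpperBound.

(** * Compact operators on sequences tending to zero *)

(** The triangle inequalities for p-th and q-th powers of norms are obtained by integrating
    pointwise bounds of this form. *)
Lemma ge0_integral_combine d (T : measurableType d) (R : realType) (m : {measure set T -> \bar R}) (D : set T)
    (F G H : T -> R) (a b : R) : measurable D ->
  measurable_fun D (EFin \o F) -> measurable_fun D (EFin \o G) -> measurable_fun D (EFin \o H) -> 
  (forall x, D x -> 0 <= F x) -> (forall x, D x -> 0 <= G x) -> (forall x, D x -> 0 <= H x) -> 0 <= a -> 0 <= b ->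
  (forall x, D x -> H x <= a * F x + b * G x) ->
  (\int[m]_(x in D) (H x)%:E <= a%:E * \int[m]_(x in D) (F x)%:E + b%:E * \int[m]_(x in D) (G x)%:E)%E.
Proof.
move=> mD mF mG mH F0 G0 H0 a0 b0 HFG.
rewrite -!ge0_integralZl //.
have maF : measurable_fun D (fun x => a%:E * (F x)%:E)%E by apply: emeasurable_funM.
have mbG : measurable_fun D (fun x => b%:E * (G x)%:E)%E by apply: emeasurable_funM.
rewrite -ge0_integralD //.
- apply: ge0_le_integral => //.
  + exact: emeasurable_funD.
- by move=> x Dx; rewrite -EFinM lee_fin mulr_ge0 // F0.
- by move=> x Dx; rewrite -EFinM lee_fin mulr_ge0 // G0.
Qed.

Lemma combine_lty (R : realType) (a b : R) (x y : \bar R) : 0 <= a -> 0 <= b -> (x < +oo)%E -> (y < +oo)%E ->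
  (0 <= x)%E -> (0 <= y)%E -> (a%:E * x + b%:E * y < +oo)%E.
Proof.
by move=> a0 b0 xf yf x0 y0; apply: lte_add_pinfty; apply: lte_mul_pinfty; rewrite ?lee_fin.
Qed.

(** * Power inequalities and the space L^q *)

Section LqSpace.
Variable R : realType.
Local Notation C := (Cx R).
Local Notation MR := (measurableTypeR R).
Local Notation R2 := (MR * MR)%type.

(** Both summands are at most the larger one, whence 2^q; this takes the place of Minkowski's
    inequality. *)
Lemma powR_add_le (q a b : R) : 0 < q -> 0 <= a -> 0 <= b -> (a + b) `^ q <= 2 `^ q * (a `^ q + b `^ q).
Proof.
move=> q0 a0 b0; wlog ab : a b a0 b0 / a <= b.
  by move=> W; have [ab|/ltW ba] := leP a b; [exact: W|rewrite addrC (addrC (a `^ q)); exact: W].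
apply: (@le_trans _ _ ((2 * b) `^ q)).
  by apply: ge0_ler_powR; rewrite ?nnegrE ?(ltW q0) ?addr_ge0 ?mulr_ge0 //; lra.
by rewrite powRM // ler_wpM2l ?powR_ge0 // lerDr powR_ge0.
Qed.

(** The coefficient of x^p can be taken as close to 1 as desired, at the price of a large
    coefficient for the small term; the two cases are y <= t x and x < y / t. *)
Lemma powR_add_small (p t e x y : R) : 0 < p -> 0 < t -> 0 <= x -> 0 <= y -> y <= e ->
  (y + x) `^ p <= (1 + t) `^ p * x `^ p + (1 + t^-1) `^ p * e `^ p.
Proof.
move=> p0 t0 x0 y0 ye; have ti : 0 < t^-1 by rewrite invr_gt0.
have e0 : 0 <= e := le_trans y0 ye.
have t1 : 0 <= 1 + t by rewrite addr_ge0 // ltW.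
have ti1 : 0 <= 1 + t^-1 by rewrite addr_ge0 // ltW.
have yx0 : 0 <= y + x by exact: addr_ge0.
have [yx|xy] := leP y (t * x).
  apply: (@le_trans _ _ ((1 + t) `^ p * x `^ p)); last by rewrite lerDl mulr_ge0 ?powR_ge0.
  rewrite -powRM //; apply: ge0_ler_powR; rewrite ?nnegrE ?(ltW p0) ?mulr_ge0 //.
  by rewrite mulrDl mul1r addrC lerD2l.
apply: (@le_trans _ _ ((1 + t^-1) `^ p * e `^ p)); last by rewrite lerDr mulr_ge0 ?powR_ge0.
rewrite -powRM //; apply: ge0_ler_powR; rewrite ?nnegrE ?(ltW p0) ?mulr_ge0 //.
rewrite mulrDl mul1r lerD // mulrC ler_pdivlMr // mulrC.
exact: le_trans (ltW xy) ye.
Qed.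

Variables (mu : {measure set (R * R)%type -> \bar R}) (q : R).
Hypothesis q0 : 0 < q.

Lemma Lqint_ge0 g : (0 <= Lqint mu q g)%E.
Proof. by apply: integral_ge0 => x _; rewrite lee_fin powR_ge0. Qed.

Let mD : @measurable _ (R * R)%type (@Dset R). Proof. exact: measurable_Dset. Qed.

Lemma inLq_measurable g : inLq mu q g ->
  measurable_fun (@Dset R : set (R * R)%type) (fun x : (R * R)%type => (modC (g (toC x)) `^ q)%:E).
Proof. by move=> [m1 m2 _]; exact: measurable_Lqint. Qed.

Lemma measurable_lin (a : C) (g h : C -> C) : 
  measurable_fun (@Dset R : set R2) (fun x : R2 => ReC (g (toC x)) : MR) ->
  measurable_fun (@Dset R : set R2) (fun x : R2 => ImC (g (toC x)) : MR) ->
  measurable_fun (@Dset R : set R2) (fun x : R2 => ReC (h (toC x)) : MR) ->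
  measurable_fun (@Dset R : set R2) (fun x : R2 => ImC (h (toC x)) : MR) ->
  measurable_fun (@Dset R : set R2) (fun x : R2 => ReC (a * g (toC x) + h (toC x)) : MR) /\
  measurable_fun (@Dset R : set R2) (fun x : R2 => ImC (a * g (toC x) + h (toC x)) : MR).
Proof.
move=> g1 g2 h1 h2; split.
  have mc k (f : R2 -> MR) : measurable_fun (@Dset R : set R2) f -> measurable_fun (@Dset R : set R2) (fun x => k * f x : MR).
    by move=> mf; apply: measurable_funM.
  have := measurable_funD (measurable_funB (mc (ReC a) _ g1) (mc (ImC a) _ g2)) h1.
  by apply: eq_measurable_fun => x _; rewrite /= ReCD ReCM.
have mc k (f : R2 -> MR) : measurable_fun (@Dset R : set R2) f -> measurable_fun (@Dset R : set R2) (fun x => k * f x : MR).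
  by move=> mf; apply: measurable_funM.
have := measurable_funD (measurable_funD (mc (ReC a) _ g2) (mc (ImC a) _ g1)) h2.
by apply: eq_measurable_fun => x _; rewrite /= ImCD ImCM.
Qed.

Lemma Lqint_lin (a : C) (g h : C -> C) : inLq mu q g -> inLq mu q h ->
  (Lqint mu q (fun z => a * g z + h z)%R <= (2 `^ q * modC a `^ q)%:E * Lqint mu q g + (2 `^ q)%:E * Lqint mu q h)%E.
Proof.
move=> Lg Lh; have mg := inLq_measurable Lg; have mh := inLq_measurable Lh.
have [g1 g2 _] := Lg; have [h1 h2 _] := Lh; have [l1 l2] := measurable_lin a g1 g2 h1 h2.
refine (@ge0_integral_combine _ _ _ mu _ (fun x => modC (g (toC x)) `^ q) (fun x => modC (h (toC x)) `^ q) (fun x => modC (a * g (toC x) + h (toC x)) `^ q) _ _ mD mg mh _ _ _ _ _ _ _).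
- exact: (@measurable_Lqint R q (fun z => a * g z + h z)).
- by move=> x _; exact: powR_ge0.
- by move=> x _; exact: powR_ge0.
- by move=> x _; exact: powR_ge0.
- by rewrite mulr_ge0 ?powR_ge0.
- exact: powR_ge0.
move=> x Dx; rewrite -mulrA -mulrDr -powRM ?modC_ge0 // -modCM.
apply: le_trans (powR_add_le q0 (modC_ge0 _) (modC_ge0 _)).
by apply: ge0_ler_powR; rewrite ?nnegrE ?(ltW q0) ?addr_ge0 ?modC_ge0 ?modCD.
Qed.

Lemma inLq_lin (a : C) (g h : C -> C) : inLq mu q g -> inLq mu q h -> inLq mu q (fun z => a * g z + h z).
Proof.
move=> Lg Lh; have [g1 g2 gf] := Lg; have [h1 h2 hf] := Lh; have [l1 l2] := measurable_lin a g1 g2 h1 h2.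
split; [exact: l1|exact: l2|]; apply: (le_lt_trans (Lqint_lin a Lg Lh)).
by apply: combine_lty; rewrite ?mulr_ge0 ?powR_ge0 ?Lqint_ge0.
Qed.

Lemma Lqint_add (g h : C -> C) : inLq mu q g -> inLq mu q h ->
  (Lqint mu q (fun z => g z + h z)%R <= (2 `^ q)%:E * Lqint mu q g + (2 `^ q)%:E * Lqint mu q h)%E.
Proof.
move=> Lg Lh; have := Lqint_lin 1 Lg Lh; rewrite modC1 powR1 mulr1.
by under [fun z => 1 * _ + _]eq_fun do rewrite mul1r.
Qed.

Lemma inLqB (g h : C -> C) : inLq mu q g -> inLq mu q h -> inLq mu q (fun z => g z - h z).
Proof.
move=> Lg Lh; have := inLq_lin (-1) Lh Lg.
by under [fun z => -1 * _ + _]eq_fun do rewrite mulN1r addrC.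
Qed.

Lemma LqintZ (a : C) (g : C -> C) : inLq mu q g -> Lqint mu q (fun z => a * g z)%R = ((modC a `^ q)%:E * Lqint mu q g)%E.
Proof.
move=> Lg; rewrite /Lqint -ge0_integralZl; last 4 first.
- exact: mD.
- exact: inLq_measurable.
- by move=> x _; rewrite lee_fin powR_ge0.
- by rewrite lee_fin powR_ge0.
by apply: eq_integral => x _; rewrite modCM powRM ?modC_ge0 // EFinM.
Qed.

Lemma inLqZ (a : C) (g : C -> C) : inLq mu q g -> inLq mu q (fun z => a * g z).
Proof.
move=> Lg; have := inLq_lin (a - 1) Lg Lg.
by under [fun z => (a - 1) * _ + _]eq_fun do rewrite mulrBl mul1r subrK.
Qed.

Lemma Lqint_ae (g h : C -> C) : inLq mu q g -> inLq mu q h ->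
  {ae mu, forall x, @Dset R x -> g (toC x) = h (toC x)} -> Lqint mu q g = Lqint mu q h.
Proof.
move=> Lg Lh gh; apply: ae_eq_integral => //; try exact: inLq_measurable.
by apply: filterS gh => x H Dx; rewrite H.
Qed.

End LqSpace.

(** * Bergman norms of sparse sums *)

Section BergmanSpace.
Variable R : realType.
Local Notation C := (Cx R).
Local Notation MR := (measurableTypeR R).
Local Notation R2 := (MR * MR)%type.
Variables (p : R) (w : R -> R).
Hypothesis p1 : 1 < p.
Hypothesis rw : radial_weight w.
Hypothesis Dw : class_D w.

Let w0 t : 0 <= t <= 1 -> 0 <= w t. Proof. by case: rw => h _ _; exact: h. Qed.
Let p0 : 0 < p. Proof. exact: lt_trans p1. Qed.
Let mD : measurable (@Dset R : set R2). Proof. exact: measurable_Dset. Qed.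

Let dens (f : C -> C) (x : R2) : R := modC (f (toC x)) `^ p * w (modC (toC x)).

Let dens_ge0 f x : @Dset R x -> 0 <= dens f x.
Proof. by move=> Dx; rewrite mulr_ge0 ?powR_ge0 // w0 // modC_ge0 ltW. Qed.

Lemma ApnormE (f : C -> C) : Apnorm_p p w f = ((pi^-1)%:E * \int[@leb2 R]_(x in @Dset R) (dens f x)%:E)%E.
Proof. by []. Qed.

Lemma Apnorm_lin (a : C) (f g : C -> C) : holo_disc f -> holo_disc g ->
  (Apnorm_p p w (fun z => a * f z + g z)%R <= (2 `^ p * modC a `^ p)%:E * Apnorm_p p w f + (2 `^ p)%:E * Apnorm_p p w g)%E.
Proof.
move=> hf hg; rewrite !ApnormE (muleCA _ (pi^-1)%:E) (muleCA (2 `^ p)%:E) -ge0_muleDr; last 2 first.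
- by apply: mule_ge0; rewrite ?lee_fin ?mulr_ge0 ?powR_ge0 //; apply: integral_ge0 => x Dx; rewrite lee_fin dens_ge0.
- by apply: mule_ge0; rewrite ?lee_fin ?powR_ge0 //; apply: integral_ge0 => x Dx; rewrite lee_fin dens_ge0.
apply: lee_wpmul2l; first by rewrite lee_fin invr_ge0 pi_ge0.
refine (@ge0_integral_combine _ _ _ (@leb2 R) _ (dens f) (dens g) (dens (fun z => a * f z + g z)) (2 `^ p * modC a `^ p) (2 `^ p) mD _ _ _ _ _ _ _ _ _).
- exact: (measurable_Apnorm p rw hf).
- exact: (measurable_Apnorm p rw hg).
- exact: (measurable_Apnorm p rw (holo_lin (a := a) hf hg)).
- by move=> x; exact: dens_ge0.
- by move=> x; exact: dens_ge0.
- by move=> x; exact: dens_ge0.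
- by rewrite mulr_ge0 ?powR_ge0.
- exact: powR_ge0.
move=> x Dx; rewrite /dens mulrA (mulrA (2 `^ p)) -mulrDl; apply: ler_wpM2r; first by rewrite w0 // modC_ge0 ltW.
rewrite -mulrA -mulrDr -powRM ?modC_ge0 // -modCM.
apply: le_trans (powR_add_le p0 (modC_ge0 _) (modC_ge0 _)).
by apply: ge0_ler_powR; rewrite ?nnegrE ?(ltW p0) ?addr_ge0 ?modC_ge0 ?modCD.
Qed.

Lemma inAp_lin (a : C) (f g : C -> C) : inAp p w f -> inAp p w g -> inAp p w (fun z => a * f z + g z).
Proof.
move=> [hf ff] [hg fg]; split; first exact: (holo_lin (a := a) hf hg).
apply: (le_lt_trans (Apnorm_lin a hf hg)).
apply: combine_lty; [by rewrite mulr_ge0 ?powR_ge0|exact: powR_ge0|exact: ff|exact: fg| |]; exact: Apnorm_ge0.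
Qed.

Lemma inAp0 : inAp p w (fun=> 0).
Proof.
split; first exact: (@holo_cst R 0).
by rewrite /Apnorm_p /areaInt integral0_eq ?mule0 ?ltry // => x _; rewrite modC0 powR0 ?mul0r // gt_eqF.
Qed.

Lemma Apnorm0 : Apnorm_p p w (fun=> 0) = 0%E.
Proof. by rewrite /Apnorm_p /areaInt integral0_eq ?mule0 // => x _; rewrite modC0 powR0 ?mul0r // gt_eqF. Qed.

Lemma inApZ (a : C) (f : C -> C) : inAp p w f -> inAp p w (fun z => a * f z).
Proof.
by move=> fA; have := inAp_lin a fA inAp0; under [fun z => a * _ + 0]eq_fun do rewrite addr0.
Qed.

Lemma inApD (f g : C -> C) : inAp p w f -> inAp p w g -> inAp p w (fun z => f z + g z).
Proof.
by move=> fA gA; have := inAp_lin 1 fA gA; under [fun z => 1 * _ + _]eq_fun do rewrite mul1r.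
Qed.

(** Dominated convergence on the sets |z| >= 1 - 1/(k + 2), whose indicators vanish eventually at
    each point of the disc. *)
Lemma Apnorm_tail (f : C -> C) (e : R) : inAp p w f -> 0 < e -> exists2 r : R, 0 < r < 1 &
  (\int[@leb2 R]_(x in outer r) (modC (f (toC x)) `^ p * w (modC (toC x)))%:E <= e%:E)%E.
Proof.
move=> [hf ff] e0.
pose F (x : R2) : \bar R := (modC (f (toC x)) `^ p * w (modC (toC x)))%:E.
have mF : measurable_fun (@Dset R : set R2) F by exact: measurable_Apnorm.
have F0 x : @Dset R x -> (0 <= F x)%E by move=> Dx; rewrite lee_fin mulr_ge0 ?powR_ge0 // w0 // modC_ge0 ltW.
have IF : (\int[@leb2 R]_(x in @Dset R) F x < +oo)%E.
  have pi0 := pi_gt0 R.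
  have [E|E] := eqVneq (\int[@leb2 R]_(x in @Dset R) F x)%E +oo%E; last by rewrite lt_neqAle E leey.
  by move: ff; rewrite /Apnorm_p /areaInt -[X in (_ * X)%E]/(\int[@leb2 R]_(x in @Dset R) F x)%E E gt0_muley ?ltxx // lte_fin invr_gt0.
pose rr (k : nat) : R := 1 - k.+2%:R^-1.
pose fk (k : nat) (x : R2) : \bar R := (F \_ (outer (rr k))) x.
have OD k : outer (rr k) `<=` @Dset R by move=> x [].
have mO k : measurable (outer (rr k)) := measurable_outer (rr k).
have mfk k : measurable_fun (@Dset R : set R2) (fk k).
  apply/(measurable_restrict _ (mO k) mD); rewrite setIidr //.
  exact: measurable_funS mF.
have iF : (@leb2 R).-integrable (@Dset R) F.
  apply/integrableP; split => //.
  rewrite (eq_integral F) // => x; rewrite inE => Dx; exact: gee0_abs (F0 x Dx).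
have fF x : @Dset R x -> F x \is a fin_num by [].
have fk0 x : @Dset R x -> fk ^~ x @ \oo --> 0%E.
  move=> Dx; apply: cvg_near_cst.
  have u0 : 0 < 1 - modC (toC x) by rewrite subr_gt0.
  exists (Num.truncn (1 - modC (toC x))^-1) => // k /= hk; rewrite /fk patchE ifF //.
  apply/negP; rewrite inE => -[_ /=]; rewrite /rr leNgt => /negP; apply.
  rewrite ltrBrDl -ltrBrDr -[ltRHS]invrK ltf_pV2 ?posrE ?invr_gt0 //.
  apply: lt_le_trans (truncnS_gt _) _; rewrite ler_nat; exact: leqW.
have fkF k x : @Dset R x -> (`|fk k x| <= F x)%E.
  move=> Dx; rewrite /fk patchE; case: ifP => _; last by rewrite abse0 F0.
  by rewrite gee0_abs // F0.
have := @dominated_cvg _ R2 R (@leb2 R) (@Dset R) mD fk (fun=> 0%E) F mfk fk0 fF iF fkF.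
rewrite integral0 => /fine_cvgP [_ /cvgrPdist_lt /(_ e e0)] [N _ HN].
have := HN N (leqnn N); rewrite /= sub0r normrN.
have E : (\int[@leb2 R]_(x in @Dset R) fk N x = \int[@leb2 R]_(x in outer (rr N)) F x)%E.
  by rewrite -integral_mkcondr setIidr.
rewrite E.
have fin : (\int[@leb2 R]_(x in outer (rr N)) F x)%E \is a fin_num.
  rewrite ge0_fin_numE; last by apply: integral_ge0 => x [Dx _]; exact: F0.
  by apply: le_lt_trans IF; apply: ge0_subset_integral.
rewrite ger0_norm; last by rewrite fine_ge0 //; apply: integral_ge0 => x [Dx _]; exact: F0.
move=> h; exists (rr N); last by rewrite -(fineK fin) lee_fin ltW.
rewrite /rr; have k1 : N.+2%:R^-1 < 1 :> R by rewrite invf_lt1 // ltr1n.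
have k0 : 0 < N.+2%:R^-1 :> R by rewrite invr_gt0.
move: k1 k0; set k := N.+2%:R^-1; lra.
Qed.

(** For a = 0 the function [kpow] is the constant 1, and its norm bound is the finiteness of the
    weight. *)
Lemma weight_area_fin : (\int[@leb2 R]_(x in @Dset R) (w (modC (toC x)))%:E < +oo)%E.
Proof.
have := Apnorm_kpow p1 rw Dw; move=> [m1 /(_ m1 (leqnn _)) [c c0 Hc]].
have h := Hc 0; rewrite modC0 subr0 in h.
have {}h := h ltr01.
have pi0 := pi_gt0 R.
have := le_lt_trans h (ltry _); rewrite ApnormE.
have -> : (\int[@leb2 R]_(x in @Dset R) (dens (kpow 0 m1) x)%:E = \int[@leb2 R]_(x in @Dset R) (w (modC (toC x)))%:E)%E.
  apply: eq_integral => x; rewrite inE => Dx; rewrite /dens modC_kpow ?modC0 // /bk.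
  have -> : cjC (0 : C) = 0 by apply: Cx_eq; rewrite /= ?oppr0.
  by rewrite mul0r !subr0 modC1 divr1 expr1n powR1 mul1r.
move=> hh; set X := (\int[_]_(x in _) _)%E in hh *.
have [E|E] := eqVneq X +oo%E; last by rewrite lt_neqAle E leey.
by move: hh; rewrite E gt0_muley ?ltxx // lte_fin invr_gt0.
Qed.

(* A weak Brezis-Lieb lemma: the increment of the p-th power of the norm does not depend on h. *)
Lemma sparse_step (h : C -> C) (u : nat -> C -> C) : inAp p w h ->
  (forall k, inAp p w (u k) /\ (Apnorm_p p w (u k) <= 1)%E) ->
  (forall r e, 0 < r < 1 -> 0 < e -> exists N, forall k, (N <= k)%N -> forall z, modC z <= r -> modC (u k z) <= e) ->
  exists N, forall k, (N <= k)%N -> (Apnorm_p p w (fun z => u k z + h z)%R <= Apnorm_p p w h + (2 + 2 `^ p * 2)%:E)%E.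
Proof.
move=> hA uA u0; have [hh hf] := hA; have pi0 := pi_gt0 R.
have [r r01 Hr] := Apnorm_tail hA pi0.
have fA : Apnorm_p p w h \is a fin_num by rewrite ge0_fin_numE // Apnorm_ge0.
pose A := fine (Apnorm_p p w h).
have A0 : 0 <= A by rewrite fine_ge0 // Apnorm_ge0.
(* Chosen so that (1 + t)^p = 1 + 1/(A + 1): this factor raises the norm A of h by at most 1. *)
pose t := (1 + (A + 1)^-1) `^ p^-1 - 1.
have a1 : 0 < (A + 1)^-1 by rewrite invr_gt0; lra.
have t1 : (1 + t) `^ p = 1 + (A + 1)^-1.
  by rewrite /t addrC subrK -powRrM mulVf ?gt_eqF // powRr1 //; lra.
have t0 : 0 < t.
  rewrite /t subr_gt0; apply: (@le_lt_trans _ _ (1 `^ p^-1)); first by rewrite powR1.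
  by apply: gt0_ltr_powR; rewrite ?invr_gt0 ?nnegrE //; lra.
have fW := weight_area_fin.
set IW := (\int[_]_(x in _) _)%E in fW.
have IW0 : (0 <= IW)%E by apply: integral_ge0 => x Dx; rewrite lee_fin w0 // modC_ge0 ltW.
have fIW : IW \is a fin_num by rewrite ge0_fin_numE.
pose W := fine IW; have WE : IW = W%:E by rewrite fineK.
have W0 : 0 <= W by rewrite fine_ge0.
pose B := (1 + t^-1) `^ p.
have ti : 0 < t^-1 by rewrite invr_gt0.
have B0 : 0 < B by apply: powR_gt0; lra.
(* The size of u_k on |z| <= r for which its contribution there, B e^p W, is at most pi, that is at
   most 1 for the normalised area. *)
pose e := (pi / (B * (W + 1))) `^ p^-1.
have BW : 0 < B * (W + 1) by apply: mulr_gt0; lra.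
have e0 : 0 < e by apply: powR_gt0; exact: divr_gt0.
have eB : B * e `^ p * W <= pi.
  rewrite /e -powRrM mulVf ?gt_eqF // powRr1; last by rewrite divr_ge0 // ltW.
  have Bn : B != 0 by rewrite gt_eqF.
  have Wn : W + 1 != 0 by rewrite gt_eqF //; lra.
  have -> : B * (pi / (B * (W + 1))) * W = pi * (W / (W + 1)) by field; rewrite Bn Wn.
  by rewrite ler_piMr ?(ltW pi0) // ler_pdivrMr; lra.
have [N HN] := u0 r e r01 e0; exists N => k kN.
have [[hu uf] u1] := uA k.
pose O : set R2 := outer r.
have mO : measurable O := measurable_outer r.
have OD : O `<=` @Dset R by move=> x [].
pose F3 (x : R2) : R := dens h x * \1_O x.
have mh : measurable_fun (@Dset R : set R2) (EFin \o dens h) by exact: (measurable_Apnorm p rw hh).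
have mu' : measurable_fun (@Dset R : set R2) (EFin \o dens (u k)) by exact: (measurable_Apnorm p rw hu).
have mw : measurable_fun (@Dset R : set R2) (EFin \o (fun x : R2 => w (modC (toC x)))).
  by apply/measurable_EFinP; exact: measurable_weight_modC.
have mF3 : measurable_fun (@Dset R : set R2) (EFin \o F3).
  have /measurable_EFinP mh' := mh.
  have mi : measurable_fun (@Dset R : set R2) (\1_O : R2 -> MR) by apply: measurable_funTS; exact: measurable_indic.
  by apply/measurable_EFinP; exact: (measurable_funM mh' mi).
have wx (x : R2) : @Dset R x -> 0 <= w (modC (toC x)) by move=> Dx; rewrite w0 // modC_ge0 ltW.
have F30 x : @Dset R x -> 0 <= F3 x by move=> Dx; rewrite mulr_ge0 // dens_ge0.
(* [G1] bounds the density on |z| <= r, where u_k is small, and [G2] bounds it outside, where h has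
   little mass. The increment 2 + 2 2^p counts 1 from the factor (1 + t)^p, 1 from u_k inside, 2^p
   from the tail of h and 2^p from the norm of u_k. *)
pose G1 x := (1 + t) `^ p * dens h x + B * e `^ p * w (modC (toC x)).
pose G2 x := 2 `^ p * F3 x + 2 `^ p * dens (u k) x.
have cm (a b : R) (f g : R2 -> R) : measurable_fun (@Dset R : set R2) (EFin \o f) -> measurable_fun (@Dset R : set R2) (EFin \o g) ->
   measurable_fun (@Dset R : set R2) (EFin \o (fun x => a * f x + b * g x)).
  move=> /measurable_EFinP mf /measurable_EFinP mg; apply/measurable_EFinP.
  by apply: measurable_funD; apply: measurable_funM.
have mG1 := cm ((1 + t) `^ p) (B * e `^ p) _ _ mh mw.
have mG2 := cm (2 `^ p) (2 `^ p) _ _ mF3 mu'.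
have Be0 : 0 <= B * e `^ p by rewrite mulr_ge0 ?powR_ge0.
have G10 x : @Dset R x -> 0 <= G1 x.
  by move=> Dx; apply: addr_ge0; apply: mulr_ge0; [exact: powR_ge0|exact: dens_ge0|exact: Be0|exact: wx].
have G20 x : @Dset R x -> 0 <= G2 x.
  by move=> Dx; apply: addr_ge0; apply: mulr_ge0; [exact: powR_ge0|exact: F30|exact: powR_ge0|exact: dens_ge0].
have hk := holo_lin (a := 1) hu hh.
have hs : holo_disc (fun z => u k z + h z) by move: hk; under [fun z => 1 * _ + _]eq_fun do rewrite mul1r.
have I0 : (\int[@leb2 R]_(x in @Dset R) (dens (fun z => (u k z + h z)%R) x)%:E <=
   1%:E * \int[@leb2 R]_(x in @Dset R) (G1 x)%:E + 1%:E * \int[@leb2 R]_(x in @Dset R) (G2 x)%:E)%E.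
  refine (@ge0_integral_combine _ _ _ (@leb2 R) _ G1 G2 (dens (fun z => u k z + h z)) 1 1 mD mG1 mG2 _ _ _ _ _ _ _).
  - exact: (measurable_Apnorm p rw hs).
  - exact: G10.
  - exact: G20.
  - by move=> x; exact: dens_ge0.
  - exact: ler01.
  - exact: ler01.
  move=> x Dx; rewrite !mul1r.
  have [xr|rx] := leP (modC (toC x)) r.
    apply: (@le_trans _ _ (G1 x)); last by rewrite lerDl G20.
    rewrite /dens /G1 /dens mulrA -mulrDl ler_wpM2r ?wx //.
    apply: le_trans (powR_add_small p0 t0 (modC_ge0 (h (toC x))) (modC_ge0 _) (HN k kN _ xr)).
    by apply: ge0_ler_powR; rewrite ?nnegrE ?(ltW p0) ?addr_ge0 ?modC_ge0 ?modCD.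
  apply: (@le_trans _ _ (G2 x)); last by rewrite lerDr G10.
  have -> : G2 x = 2 `^ p * (dens (u k) x + dens h x).
    have xO : x \in O by apply/mem_set; split; [exact: Dx|exact: ltW].
    by rewrite /G2 /F3 indicE xO mulr1 addrC mulrDr.
  rewrite /dens -mulrDl mulrA ler_wpM2r ?wx //.
  apply: le_trans (powR_add_le p0 (modC_ge0 _) (modC_ge0 _)).
  by apply: ge0_ler_powR; rewrite ?nnegrE ?(ltW p0) ?addr_ge0 ?modC_ge0 ?modCD.
have I1 : (\int[@leb2 R]_(x in @Dset R) (G1 x)%:E <= ((1 + t) `^ p)%:E * \int[@leb2 R]_(x in @Dset R) (dens h x)%:E + (B * e `^ p)%:E * IW)%E.
  refine (@ge0_integral_combine _ _ _ (@leb2 R) _ (dens h) (fun x => w (modC (toC x))) G1 _ _ mD mh mw mG1 _ wx G10 _ Be0 _).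
  - by move=> x; exact: dens_ge0.
  - exact: powR_ge0.
  - by [].
have I2 : (\int[@leb2 R]_(x in @Dset R) (G2 x)%:E <= (2 `^ p)%:E * \int[@leb2 R]_(x in @Dset R) (F3 x)%:E + (2 `^ p)%:E * \int[@leb2 R]_(x in @Dset R) (dens (u k) x)%:E)%E.
  refine (@ge0_integral_combine _ _ _ (@leb2 R) _ F3 (dens (u k)) G2 _ _ mD mF3 mu' mG2 F30 _ G20 _ _ _).
  - by move=> x; exact: dens_ge0.
  - exact: powR_ge0.
  - exact: powR_ge0.
  - by [].
have I3 : (\int[@leb2 R]_(x in @Dset R) (F3 x)%:E <= pi%:E)%E.
  apply: le_trans Hr; rewrite -[outer r](setIidr OD) integral_mkcondr.
  rewrite le_eqVlt; apply/orP; left; apply/eqP; apply: eq_integral => x _.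
  by rewrite patchE /F3 indicE; case: ifP => _; rewrite ?mulr1 ?mulr0.
have pinv : (pi * pi^-1 = 1 :> R) by rewrite mulfV // gt_eqF.
have unp (X : \bar R) : (pi%:E * ((pi^-1)%:E * X) = X)%E by rewrite muleA -EFinM pinv mul1e.
have dh : (\int[@leb2 R]_(x in @Dset R) (dens h x)%:E = (pi * A)%:E)%E.
  by rewrite EFinM fineK // ApnormE unp.
have du : (\int[@leb2 R]_(x in @Dset R) (dens (u k) x)%:E <= pi%:E)%E.
  by rewrite -[leLHS]unp -ApnormE -[leRHS]mule1; apply: lee_wpmul2l => //; rewrite lee_fin ltW.
have tot : (\int[@leb2 R]_(x in @Dset R) (dens (fun z => (u k z + h z)%R) x)%:E <= (pi * (A + (2 + 2 `^ p * 2)))%:E)%E.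
  apply: (le_trans I0); rewrite !mul1e.
  apply: (@le_trans _ _ ((pi * A + pi + pi)%:E + (2 `^ p * pi + 2 `^ p * pi)%:E)%E).
    apply: leeD.
      apply: (le_trans I1); rewrite dh WE -!EFinM -EFinD lee_fin t1.
      have h1 : (A + 1)^-1 * A <= 1 by rewrite mulrC ler_pdivrMr ?mul1r ?lerDl // ltr_wpDl.
      have h2 : pi * ((A + 1)^-1 * A) <= pi by rewrite ler_piMr // ltW.
      have -> : (1 + (A + 1)^-1) * (pi * A) = pi * A + pi * ((A + 1)^-1 * A) by ring.
      by apply: lerD eB; rewrite lerD2l.
    apply: (le_trans I2); rewrite EFinD !EFinM; apply: leeD; apply: lee_wpmul2l => //; by rewrite lee_fin powR_ge0.
  rewrite -EFinD lee_fin le_eqVlt; apply/orP; left; apply/eqP; ring.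
rewrite ApnormE -(fineK fA) -EFinD -/A.
apply: (@le_trans _ _ ((pi^-1)%:E * (pi * (A + (2 + 2 `^ p * 2)))%:E)%E).
  by apply: lee_wpmul2l => //; rewrite lee_fin invr_ge0 ltW.
by rewrite -EFinM mulrA mulVf ?mul1r // gt_eqF.
Qed.

End BergmanSpace.

(** * Images of sparse sums under a compact operator *)

Section Hump.
Variable R : realType.
Local Notation C := (Cx R).
Variables (p q : R) (w : R -> R).
Hypothesis p1 : 1 < p.
Hypothesis pq : p <= q.
Hypothesis rw : radial_weight w.
Hypothesis Dw : class_D w.
Variables (mu : {measure set (R * R)%type -> \bar R}) (K : (C -> C) -> (C -> C)).
Hypothesis HK : compact_op p q w mu K.

Let p0 : 0 < p. Proof. exact: lt_trans p1. Qed.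
Let q0 : 0 < q. Proof. exact: lt_le_trans pq. Qed.
Let KL f : inAp p w f -> inLq mu q (K f). Proof. by case: HK => h _ _; exact: h. Qed.

(** Linearity with coefficient -1 at the zero function reads K 0 = - K 0 + K 0 almost everywhere. *)
Lemma compact_op0_ae : {ae mu, forall x, @Dset R x -> K (fun=> 0) (toC x) = 0}.
Proof.
have [_ h _] := HK; have := h (-1) _ _ (inAp0 w p1) (inAp0 w p1).
have -> : (fun z : C => -1 * (fun=> 0) z + (fun=> 0) z) = (fun=> 0 : C).
  by apply: funext => z; rewrite mulr0 addr0.
by apply: filterS => x H Dx; rewrite (H Dx) mulN1r addNr.
Qed.

Lemma Lqint0 : Lqint mu q (fun=> 0) = 0%E.
Proof. by rewrite /Lqint integral0_eq // => x _; rewrite modC0 powR0 // gt_eqF. Qed.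

Lemma inLq0 : inLq mu q (fun=> 0).
Proof.
have := inLqZ q0 0 (KL (inAp0 w p1)).
by under [fun z => 0 * _]eq_fun do rewrite mul0r.
Qed.

Lemma Lqint_compact_op0 : Lqint mu q (K (fun=> 0)) = 0%E.
Proof. by rewrite (Lqint_ae (KL (inAp0 w p1)) inLq0 compact_op0_ae) Lqint0. Qed.

Lemma compact_opZ (a : C) f : inAp p w f ->
  Lqint mu q (K (fun z => a * f z)) = ((modC a `^ q)%:E * Lqint mu q (K f))%E.
Proof.
move=> fA; rewrite -(LqintZ a (KL fA)); have [_ h _] := HK.
apply: Lqint_ae; [exact: (KL (inApZ p1 rw a fA))|exact: (inLqZ q0 a (KL fA))|].
have := h a _ _ fA (inAp0 w p1).
under [fun z => a * _ + _]eq_fun do rewrite addr0.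
apply: filterS2 compact_op0_ae => x H0 H Dx.
by rewrite (H Dx) (H0 Dx) addr0.
Qed.

Lemma compact_opD_ae f g : inAp p w f -> inAp p w g ->
  {ae mu, forall x, @Dset R x -> K (fun z => f z + g z) (toC x) = K f (toC x) + K g (toC x)}.
Proof.
move=> fA gA; have [_ h _] := HK; have := h 1 _ _ fA gA.
under [fun z => 1 * _ + _]eq_fun do rewrite mul1r.
by apply: filterS => x H Dx; rewrite (H Dx) mul1r.
Qed.

Lemma Lqint_cvg0 (x : nat -> \bar R) (e : R) : (forall k, 0 <= x k)%E -> x @ \oo --> 0%E -> 0 < e ->
  exists N, forall k, (N <= k)%N -> (x k <= e%:E)%E.
Proof.
move=> x0 /fine_cvgP [[N1 _ H1] /cvgrPdist_lt /(_ e)] + e0 => /(_ e0) [N2 _ H2].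
exists (maxn N1 N2) => k; rewrite geq_max => /andP[k1 k2].
rewrite -(fineK (H1 k k1)) lee_fin; have := H2 k k2; rewrite /= sub0r normrN => h.
exact: le_trans (ler_norm _) (ltW h).
Qed.

(** Otherwise some sequence in the unit ball would have its k-th image of size above k, yet a
    subsequence of the images would converge in L^q and hence be bounded. *)
Lemma compact_op_bounded : exists2 B : R, 0 <= B &
  forall f, inAp p w f -> (Apnorm_p p w f <= 1)%E -> (Lqint mu q (K f) <= B%:E)%E.
Proof.
apply: contrapT => nB.
have : forall k : nat, exists f, [/\ inAp p w f, (Apnorm_p p w f <= 1)%E & (k%:R%:E < Lqint mu q (K f))%E].
  move=> k; apply: contrapT => nf; apply: nB; exists k%:R => // f fA f1.
  by rewrite leNgt; apply/negP => h; apply: nf; exists f.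
move=> /choice [u Hu]; have [_ _ hc] := HK.
have [k|phi [phiS [g [gL]]]] := hc u; first by have [] := Hu k.
move=> /(Lqint_cvg0 (fun k => Lqint_ge0 mu q _)) => /(_ 1 ltr01) [N HN].
have [_ _ gf] := gL.
have fg : Lqint mu q g \is a fin_num by rewrite ge0_fin_numE // Lqint_ge0.
pose M := 2 `^ q + 2 `^ q * fine (Lqint mu q g).
pose k := maxn N (Num.truncn M).+1.
have [uA _ uk] := Hu (phi k).
have := inLqB q0 (KL uA) gL => dL.
have := Lqint_add q0 dL gL.
under [fun z => K _ z - _ + _]eq_fun do rewrite subrK.
move=> h; have h2 := HN k (leq_maxl _ _).
have : (Lqint mu q (K (u (phi k))) <= M%:E)%E.
  apply: (le_trans h); rewrite /M EFinD EFinM fineK //; apply: leeD => //.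
  by rewrite -[leRHS]mule1; apply: lee_wpmul2l => //; rewrite lee_fin powR_ge0.
apply/negP; rewrite -ltNge; apply: le_lt_trans uk; rewrite lee_fin.
apply: (le_trans (ltW (truncnS_gt M))); rewrite ler_nat.
exact: leq_trans (leq_maxr _ _) (increasing_ge phiS k).
Qed.

(** Multiplication by A^(-1/p) brings f into the unit ball. *)
Lemma compact_op_homogeneous (B A : R) f : 0 < A ->
  (forall f, inAp p w f -> (Apnorm_p p w f <= 1)%E -> (Lqint mu q (K f) <= B%:E)%E) ->
  inAp p w f -> (Apnorm_p p w f <= A%:E)%E -> (Lqint mu q (K f) <= (A `^ (q / p) * B)%:E)%E.
Proof.
move=> A0 HB fA fn; pose a : R := A `^ (- p^-1).
have a0 : 0 < a by exact: powR_gt0.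
have ap : modC (rC a) `^ p = A^-1.
  by rewrite modC_rC gtr0_norm // -powRrM mulNr mulVf ?gt_eqF // powR_inv1 // ltW.
have aq : modC (rC a) `^ q = (A `^ (q / p))^-1.
  by rewrite modC_rC gtr0_norm // -powRrM mulNr mulrC powRN.
have [hf _] := fA.
have := HB _ (inApZ p1 rw (rC a) fA); rewrite (ApnormZ p rw _ hf) ap (compact_opZ _ fA) aq.
have Aq : 0 < A `^ (q / p) by exact: powR_gt0.
move=> h; rewrite EFinM -lee_pdivrMl //; apply: h.
rewrite lee_pdivrMl // mule1 //.
Qed.

(** The next term is taken far enough along the sequence for [sparse_step] to apply to the sum
    already formed and for its image to be close to g; each step asks for its tolerance divided by 2
    2^q. *)
Lemma sparse_sum (v : nat -> C -> C) (g : C -> C) :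
  (forall k, inAp p w (v k) /\ (Apnorm_p p w (v k) <= 1)%E) ->
  (forall r e : R, 0 < r < 1 -> 0 < e -> exists N, forall k, (N <= k)%N -> forall z, modC z <= r -> modC (v k z) <= e) ->
  inLq mu q g -> (fun k => Lqint mu q (fun z => K (v k) z - g z)) @ \oo --> 0%E ->
  forall (N : nat) (e : R), 0 < e -> exists h, [/\ inAp p w h, (Apnorm_p p w h <= ((2 + 2 `^ p * 2) * N%:R)%:E)%E
    & (Lqint mu q (fun z => K h z - N%:R * g z)%R <= e%:E)%E].
Proof.
move=> vA v0 gL cv; elim => [|N IH] e e0.
  exists (fun=> 0); split; first exact: inAp0.
    by rewrite Apnorm0 // lee_fin mulr0.
  under [fun z => K _ z - _]eq_fun do rewrite mul0r subr0.
  by rewrite Lqint_compact_op0 lee_fin ltW.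
have q2 : 0 < 2 `^ q :> R by exact: powR_gt0.
pose e' := e / (2 * 2 `^ q).
have e'0 : 0 < e' by rewrite divr_gt0 // mulr_gt0.
have [h [hA hn hL]] := IH e' e'0.
have [N1 H1] := sparse_step p1 rw Dw hA vA v0.
have [N2 H2] := Lqint_cvg0 (fun k => Lqint_ge0 mu q _) cv e'0.
pose k := maxn N1 N2; have [vkA vk1] := vA k.
have sA := inApD p1 rw vkA hA.
exists (fun z => v k z + h z); split => //.
  apply: (le_trans (H1 k (leq_maxl _ _))); move: hn; set c := 2 + _ => hn.
  have -> : c * N.+1%:R = c * N%:R + c by rewrite mulrSr mulrDr mulr1.
  by rewrite (EFinD (c * N%:R) c); apply: leeD; [exact: hn|exact: lexx].
have d1 := inLqB q0 (KL vkA) gL.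
have d2 := inLqB q0 (KL hA) (inLqZ q0 N%:R gL).
have sL := inLqB q0 (KL sA) (inLqZ q0 N.+1%:R gL).
have dL := inLq_lin q0 1 d1 d2.
rewrite (Lqint_ae sL dL); last first.
  apply: filterS (compact_opD_ae vkA hA) => x H Dx.
  rewrite (H Dx) -[N.+1]addn1 natrD; set y := K (v k) _; set z := K h _; set t := g _; set n := N%:R.
  by rewrite mulrDl !mul1r opprD (addrC (- (n * t))) addrACA.
apply: (le_trans (Lqint_lin q0 1 d1 d2)); rewrite modC1 powR1 mulr1.
have -> : e%:E = ((2 `^ q)%:E * e'%:E + (2 `^ q)%:E * e'%:E)%E.
  rewrite -!EFinM -EFinD /e'; congr EFin; field; exact: lt0r_neq0.
have q2' : (0 <= (2 `^ q)%:E)%E by rewrite lee_fin ltW.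
apply: leeD; apply: lee_wpmul2l; [exact: q2'|exact: (H2 k (leq_maxr _ _))|exact: q2'|exact: hL].
Qed.

(** For a sparse sum h of N terms the q-th power integral of N g - K h is at most 1, so that of N g
    is at most 2^q plus a multiple of N^(q/p). Dividing by N^(q/p) shows that N^(q - q/p) times the
    integral for g stays bounded, and q > q/p. *)
Lemma compact_limit_null (v : nat -> C -> C) (g : C -> C) :
  (forall k, inAp p w (v k) /\ (Apnorm_p p w (v k) <= 1)%E) ->
  (forall r e : R, 0 < r < 1 -> 0 < e -> exists N, forall k, (N <= k)%N -> forall z, modC z <= r -> modC (v k z) <= e) ->
  inLq mu q g -> (fun k => Lqint mu q (fun z => K (v k) z - g z)) @ \oo --> 0%E -> Lqint mu q g = 0%E.
Proof.
move=> vA v0 gL cv; have [B B0 HB] := compact_op_bounded.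
have [_ _ gf] := gL; have fg : Lqint mu q g \is a fin_num by rewrite ge0_fin_numE // Lqint_ge0.
pose Y := fine (Lqint mu q g); have YE : Lqint mu q g = Y%:E by rewrite fineK.
have Y0 : 0 <= Y by rewrite fine_ge0 // Lqint_ge0.
have q2 : 0 < 2 `^ q :> R by exact: powR_gt0.
pose C0 : R := 2 + 2 `^ p * 2.
have C00 : 0 < C0 by rewrite addr_gt0 // mulr_gt0 // powR_gt0.
pose E : R := 2 `^ q + 2 `^ q * (C0 `^ (q / p) * B).
have key (N : nat) : (0 < N)%N -> N%:R `^ (q - q / p) * Y <= E.
  move=> N0; have [h [hA hn hL]] := sparse_sum vA v0 gL cv N ltr01.
  have Np : 0 < N%:R :> R by rewrite ltr0n.
  have hB := compact_op_homogeneous (mulr_gt0 C00 Np) HB hA hn.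
  have d2 := inLqB q0 (KL hA) (inLqZ q0 N%:R gL).
  have := Lqint_lin q0 (-1) d2 (KL hA).
  have -> : (fun z => -1 * (K h z - N%:R * g z) + K h z) = (fun z => N%:R * g z).
    by apply: funext => z; rewrite mulN1r opprB subrK.
  rewrite (LqintZ _ gL) modCN modC1 powR1 mulr1 YE => le.
  have Nm : modC (N%:R : C) = N%:R by rewrite -(rCn R N) modC_rC ger0_norm.
  rewrite Nm in le.
  have : ((N%:R `^ q * Y)%:E <= ((2 `^ q + 2 `^ q * ((C0 * N%:R) `^ (q / p) * B))%:E))%E.
    rewrite EFinM; apply: (le_trans le); rewrite EFinD (EFinM (2 `^ q)); apply: leeD.
      by rewrite -[leRHS]mule1; apply: lee_wpmul2l => //; rewrite lee_fin ltW.
    by apply: lee_wpmul2l => //; rewrite lee_fin ltW.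
  rewrite lee_fin => le2.
  have Nq : 0 < N%:R `^ (q / p) :> R by exact: powR_gt0.
  have N1 : 1 <= N%:R `^ (q / p) :> R.
    by rewrite -[leLHS](powRr0 N%:R); apply: ler_powR; rewrite ?ler1n // divr_ge0 ?ltW.
  have Nn : N%:R != 0 :> R by rewrite gt_eqF.
  rewrite powRD; last by rewrite Nn implybT.
  rewrite powRN mulrAC ler_pdivrMr // (le_trans le2) // powRM ?(ltW C00) //.
  rewrite /E mulrDl; apply: lerD; first by rewrite ler_peMr // ltW.
  by rewrite le_eqVlt; apply/orP; left; apply/eqP; ring.
rewrite YE; congr EFin; apply/eqP; rewrite eq_le Y0 andbT leNgt; apply/negP => Yp.
have al : 0 < q - q / p.
  by rewrite subr_gt0 ltr_pdivrMr // ltr_pMr.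
(* Large enough that N^(q - q/p) exceeds E / Y. *)
pose N := (Num.truncn ((E / Y) `^ (q - q / p)^-1)).+1.
have E0 : 0 <= E / Y.
  by rewrite divr_ge0 // addr_ge0 ?(ltW q2) // mulr_ge0 ?(ltW q2) // mulr_ge0 // powR_ge0.
have : E / Y < N%:R `^ (q - q / p).
  have -> : E / Y = ((E / Y) `^ (q - q / p)^-1) `^ (q - q / p).
    by rewrite -powRrM mulVf ?gt_eqF // powRr1.
  by apply: gt0_ltr_powR; rewrite ?nnegrE ?powR_ge0 ?truncnS_gt.
rewrite ltr_pdivrMr // ltNge => /negP; apply; exact: key.
Qed.

(* If [K u_k] did not tend to zero, a subsequence would tend to some [g <> 0], and sums of [N] sparse terms
   would have norm [O(N^(1/p))] while their images are close to [N g]; this contradicts [p > 1]. *)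
Lemma compact_op_null (u : nat -> C -> C) :
  (forall k, inAp p w (u k) /\ (Apnorm_p p w (u k) <= 1)%E) ->
  (forall r e : R, 0 < r < 1 -> 0 < e -> exists N, forall k, (N <= k)%N -> forall z, modC z <= r -> modC (u k z) <= e) ->
  forall e : R, 0 < e -> exists k, (Lqint mu q (K (u k)) <= e%:E)%E.
Proof.
move=> uA u0 e e0; have [_ _ hc] := HK.
have [phi [phiS [g [gL cv]]]] := hc u uA.
have vA k := uA (phi k).
have v0 (r d : R) : 0 < r < 1 -> 0 < d -> exists N, forall k, (N <= k)%N -> forall z, modC z <= r -> modC (u (phi k) z) <= d.
  move=> r01 d0; have [N HN] := u0 r d r01 d0; exists N => k kN; apply: HN.
  exact: leq_trans kN (increasing_ge phiS k).
have g0 := compact_limit_null vA v0 gL cv.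
have q2 : 0 < 2 `^ q :> R by exact: powR_gt0.
have e'0 : 0 < e / 2 `^ q by exact: divr_gt0.
have [N HN] := Lqint_cvg0 (fun k => Lqint_ge0 mu q _) cv e'0.
exists (phi N); have [uNA _] := vA N.
have := Lqint_add q0 (inLqB q0 (KL uNA) gL) gL; rewrite g0 mule0 adde0.
under [fun z => K _ z - _ + _]eq_fun do rewrite subrK.
move=> h; apply: (le_trans h).
have -> : e%:E = ((2 `^ q)%:E * (e / 2 `^ q)%:E)%E by rewrite -EFinM mulrC divfK // gt_eqF.
by apply: lee_wpmul2l; [rewrite lee_fin ltW|exact: HN].
Qed.

End Hump.

(** * The lower bound *)

(** Each region r < |z| < 1 contains the point (1 + r)/2, so the supremum over it is at least one
    nonnegative ratio. *)
Lemma limsup_ratio_ge0 (R : realType) (p q : R) n (w : R -> R) (s : R) (mu : {measure set (R * R)%type -> \bar R}) :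
  (0 <= limsup_boundary (carleson_ratio p q n w s mu))%E.
Proof.
apply: le_ereal_inf_tmp => _ [r /andP[r0 r1] <-].
apply: (@le_trans _ _ (carleson_ratio p q n w s mu (rC ((1 + r) / 2)))).
  by apply: mule_ge0 => //; rewrite lee_fin invr_ge0 mulr_ge0 ?powR_ge0.
apply: ereal_sup_ubound; exists (rC ((1 + r) / 2)) => //=.
by rewrite modC_rC ger0_norm; [apply/andP; split; lra|lra].
Qed.

Section LowerBound.
Variable R : realType.
Local Notation C := (Cx R).
Variables (p q : R) (n : nat) (w : R -> R) (s : R).
Hypothesis p1 : 1 < p.
Hypothesis pq : p <= q.
Hypothesis rw : radial_weight w.
Hypothesis Dw : class_D w.
Hypothesis s01 : 0 < s < 1.

Let p0 : 0 < p. Proof. exact: lt_trans p1. Qed.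
Let q0 : 0 < q. Proof. exact: lt_le_trans pq. Qed.

(** On E_s(a) the distance |z - a| is below s |1 - conj(a) z|, and [bk_le] bounds the latter by 2 (1
    - |a|) plus that distance, which is absorbed since s < 1. *)
Lemma bk_Edisc (a z : C) : modC a < 1 -> Edisc s a z -> bk a z <= 2 / (1 - s) * (1 - modC a).
Proof.
move=> a1 /(EdiscP s z a1) [_ h]; have [_ s1] := andP s01.
have := bk_le z a1; rewrite -[modC (z - a)]modCN opprB => h2.
have s10 : 0 < 1 - s by rewrite subr_gt0.
rewrite mulrAC ler_pdivlMr //; move: h h2; set b := bk a z; set d := modC (a - z); set t := modC a.
lra.
Qed.

(** Chebyshev's inequality on E_s(a), where the n-th derivative is bounded below; the lower bound in
    [wmeas_carleson] then turns the tail into the weight of the Carleson square. *)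
Lemma carleson_ratio_le (mu : {measure set (R * R)%type -> \bar R}) (a : C) (u : C -> C) (c : R) :
  1 / 2 <= modC a < 1 -> 0 < c -> inLq mu q (Dn n u) ->
  (forall z, modC z < 1 -> bk a z <= 2 / (1 - s) * (1 - modC a) ->
     c / ((1 - modC a) ^+ n * ((1 - modC a) * tailw w (1 - modC a)) `^ p^-1) <= modC (derive1n n u z)) ->
  (carleson_ratio p q n w s mu a <=
     (((polar_const R / (4 * pi)) `^ (q / p) * c `^ q)^-1)%:E * Lqint mu q (Dn n u))%E.
Proof.
move=> a12 c0 uL lb; have [a2 a1] := andP a12.
have [W WE /andP[W1 _]] := wmeas_carleson rw a12.
set D := (_ `^ (q / p) * _)^-1.
have pi0 := pi_gt0 R.
have c1 : 0 < polar_const R / (4 * pi) by rewrite divr_gt0 ?polar_const_gt0 // mulr_gt0.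
have D0 : 0 < D by rewrite /D invr_gt0; apply: mulr_gt0; exact: powR_gt0.
have d0 : 0 < 1 - modC a by rewrite subr_gt0.
have T0 : 0 < (1 - modC a) * tailw w (1 - modC a).
  apply: mulr_gt0 => //; apply: (tailw_gt0 rw); rewrite d0 /=; have := modC_ge0 a; lra.
set d := 1 - modC a in lb W1 d0 T0; set T := d * _ in lb W1 T0.
set k := c / _ in lb.
have k0 : 0 < k by rewrite /k divr_gt0 // mulr_gt0 ?exprn_gt0 ?powR_gt0.
have mE : @measurable _ (R * R)%type (@toC R @^-1` Edisc s a) by exact: measurable_Edisc.
have mD : @measurable _ (R * R)%type (@Dset R) by exact: measurable_Dset.
have ED : @toC R @^-1` Edisc s a `<=` @Dset R by move=> x /(EdiscP s _ a1) [].
have mF := inLq_measurable uL.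
have S1 : ((k `^ q)%:E * mu (@toC R @^-1` Edisc s a) <= Lqint mu q (Dn n u))%E.
  rewrite -integral_cst //.
  apply: (@le_trans _ _ (\int[mu]_(x in @toC R @^-1` Edisc s a) (modC (Dn n u (toC x)) `^ q)%:E)%E).
    apply: ge0_le_integral => //.
    - by move=> x _; rewrite lee_fin powR_ge0.
    - exact: measurable_funS mF.
    move=> x Ex; rewrite lee_fin; apply: ge0_ler_powR; rewrite ?nnegrE ?(ltW q0) ?(ltW k0) ?modC_ge0 //.
    by apply: lb; [exact: ED|exact: bk_Edisc].
  apply: ge0_subset_integral => //.
  by move=> x _; rewrite lee_fin powR_ge0.
have S2 : (d `^ (n%:R * q) * W `^ (q / p))^-1 <= D * k `^ q.
  have kq : k `^ q = c `^ q / (d `^ (n%:R * q) * T `^ (q / p)).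
    rewrite /k powRM ?invr_ge0 ?(ltW c0) //; last by rewrite mulr_ge0 ?exprn_ge0 ?powR_ge0 // ltW.
    rewrite -powR_inv1; last by rewrite mulr_ge0 ?exprn_ge0 ?powR_ge0 // ltW.
    rewrite -powRrM mulN1r powRN powRM ?exprn_ge0 ?powR_ge0 ?(ltW d0) //.
    by rewrite -powR_mulrn ?(ltW d0) // -!powRrM (mulrC p^-1).
  have -> : D * k `^ q = (d `^ (n%:R * q) * ((polar_const R / (4 * pi)) * T) `^ (q / p))^-1.
    rewrite kq powRM ?(ltW c1) ?(ltW T0) // /D.
    have e1 : c `^ q != 0 by rewrite gt_eqF ?powR_gt0.
    have e2 : d `^ (n%:R * q) != 0 by rewrite gt_eqF ?powR_gt0.
    have e3 : T `^ (q / p) != 0 by rewrite gt_eqF ?powR_gt0.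
    have e4 : (polar_const R / (4 * pi)) `^ (q / p) != 0 by rewrite gt_eqF ?powR_gt0.
    move: e1 e2 e3 e4; set x1 := c `^ q; set x2 := d `^ _; set x3 := T `^ _; set x4 := (_ / _) `^ _ => e1 e2 e3 e4.
    by field; rewrite e1 e2 e3 e4.
  have cT : 0 < polar_const R / (4 * pi) * T by exact: mulr_gt0.
  rewrite lef_pV2 ?posrE ?mulr_gt0 ?powR_gt0 ?(lt_le_trans cT W1) //.
  rewrite ler_wpM2l ?powR_ge0 //; apply: ge0_ler_powR; rewrite ?nnegrE ?(ltW cT) ?(le_trans (ltW cT) W1) //.
  by rewrite divr_ge0 // ltW.
rewrite /carleson_ratio WE /=.
apply: (@le_trans _ _ (mu (@toC R @^-1` Edisc s a) * (D * k `^ q)%:E)%E).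
  by apply: lee_wpmul2l => //; rewrite lee_fin.
rewrite muleC EFinM -muleA; apply: lee_wpmul2l => //.
by rewrite lee_fin ltW.
Qed.

Lemma opnorm_ge0 (mu : {measure set (R * R)%type -> \bar R}) T : (0 <= opnorm p q w mu T)%E.
Proof.
apply: le_trans (ereal_sup_ubound _); last first.
  exists (fun=> 0) => //=; split; first exact: (inAp0 w p1).
  by rewrite Apnorm0.
exact: poweR_ge0.
Qed.

Lemma Lqint_le_opnorm (mu : {measure set (R * R)%type -> \bar R}) T f : inAp p w f -> (Apnorm_p p w f <= 1)%E ->
  (Lqint mu q (T f) <= opnorm p q w mu T `^ q)%E.
Proof.
move=> fA f1.
have h : (Lqint mu q (T f) `^ q^-1 <= opnorm p q w mu T)%E by apply: ereal_sup_ubound; exists f.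
have := le_poweR (ltW q0) (poweR_ge0 _ _) h.
by rewrite -poweRrM mulVf ?gt_eqF // poweRe1 // Lqint_ge0.
Qed.

(** Given a compact K, points a_k approaching the boundary nearly realise the limsup. For some k the
    test function at a_k has a small image under K, so D^(n) - K is large on it. *)
Lemma ess_lower : exists2 c : R, 0 < c & forall mu : {measure set (R * R)%type -> \bar R},
  Dn_bounded p q n w mu ->
  (c%:E * limsup_boundary (carleson_ratio p q n w s mu) <= ess_norm_Dn p q n w mu `^ q)%E.
Proof.
have [_ s1] := andP s01.
have L0 : 0 < 2 / (1 - s) by rewrite divr_gt0 // subr_gt0.
have [m [c c0 Hc]] := test_functions p1 rw Dw n L0.
have pi0 := pi_gt0 R.
have c1 : 0 < polar_const R / (4 * pi) by rewrite divr_gt0 ?polar_const_gt0 // mulr_gt0.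
have [D D0 HD] : exists2 D : R, 0 < D & D = ((polar_const R / (4 * pi)) `^ (q / p) * c `^ q)^-1.
  by eexists; last reflexivity; rewrite invr_gt0; apply: mulr_gt0; exact: powR_gt0.
have q2 : 0 < 2 `^ q :> R by exact: powR_gt0.
have [A A0 HA] : exists2 A : R, 0 < A & A = D * 2 `^ q by eexists; last reflexivity; exact: mulr_gt0.
exists A^-1; first by rewrite invr_gt0.
move=> mu [DL _]; set l := limsup_boundary _.
have lK K : compact_op p q w mu K -> (l <= A%:E * opnorm p q w mu (fun f z => Dn n f z - K f z)%R `^ q)%E.
  move=> HK; set X := opnorm _ _ _ _ _; rewrite leNgt; apply/negP => lX.
  have X0 : (0 <= X)%E by exact: opnorm_ge0.
  have Y0 : (0 <= X `^ q)%E by exact: poweR_ge0.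
  have Yf : (X `^ q)%E \is a fin_num.
    rewrite ge0_fin_numE // ltNge leye_eq; apply/negP => /eqP E; move: lX; rewrite E gt0_muley ?lte_fin //.
    by rewrite ltNge leey.
  pose Y := fine (X `^ q)%E; have YE : (X `^ q)%E = Y%:E by rewrite fineK.
  rewrite YE -EFinM in lX.
  (* A margin below the limsup, which may be infinite, to pay for the norm of K u_k. *)
  have [e e0 le] : exists2 e : R, 0 < e & ((A * (Y + e))%:E < l)%E.
    case: l lX => [l| |] lX; last by [].
    - exists ((l - A * Y) / (2 * A)).
        by rewrite lte_fin in lX; rewrite divr_gt0 ?subr_gt0 // mulr_gt0.
      rewrite lte_fin in lX; rewrite lte_fin mulrDr.
      have -> : A * ((l - A * Y) / (2 * A)) = (l - A * Y) / 2 by field; rewrite gt_eqF.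
      lra.
    - by exists 1; rewrite ?ltry.
  (* Radii tending to 1 and at least 1/2, the range of the test functions. *)
  pose rr (k : nat) : R := 1 - k.+2%:R^-1.
  have rr2 k : 1 / 2 <= rr k < 1.
    rewrite /rr ltrBlDr ltrDl invr_gt0 ltr0n andbT.
    have : k.+2%:R^-1 <= 2^-1 :> R by rewrite lef_pV2 ?posrE ?ltr0n // ler_nat.
    set y := k.+2%:R^-1; lra.
  have : forall k : nat, exists a : C, rr k < modC a < 1 /\ ((A * (Y + e))%:E < carleson_ratio p q n w s mu a)%E.
    move=> k; have : ((A * (Y + e))%:E < ereal_sup [set carleson_ratio p q n w s mu z | z in [set z : C | (rr k < modC z < 1)%R]])%E.
      apply: (lt_le_trans le); apply: ereal_inf_lbound; exists (rr k) => //=.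
      have := rr2 k; lra.
    by move=> /ereal_sup_gt [_ [a ra <-] h]; exists a.
  move=> /choice [a Ha].
  have aM k : 1 / 2 <= modC (a k) < 1.
    have [/andP[h1 h2] _] := Ha k; have /andP[h3 _] := rr2 k; rewrite h2 andbT; exact: le_trans (ltW h1).
  have := fun k => Hc (a k) (aM k).
  move=> /choice [u Hu].
  have uA k : inAp p w (u k) /\ (Apnorm_p p w (u k) <= 1)%E by have [h1 h2 _ _] := Hu k.
  have u0 (r d : R) : 0 < r < 1 -> 0 < d -> exists N, forall k, (N <= k)%N -> forall z, modC z <= r -> modC (u k z) <= d.
    move=> /andP[r0 r1] d0; have r10 : 0 < (1 - r) ^+ m by rewrite exprn_gt0 // subr_gt0.
    have B0 : 0 < d * (1 - r) ^+ m * c by rewrite !mulr_gt0.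
    (* The bound (1 - |a_k|) / (c (1 - r)^m) is at most d as soon as 1/(k + 2) <= d c (1 - r)^m. *)
    exists (Num.truncn (d * (1 - r) ^+ m * c)^-1) => k Nk z zr.
    have [_ _ _ h] := Hu k; apply: (le_trans (h r z zr r1)).
    rewrite ler_pdivrMr // mulrC ler_pdivrMr //.
    have [/andP[h1 _] _] := Ha k.
    apply: (@le_trans _ _ k.+2%:R^-1); first by rewrite lerBlDr -lerBlDl ltW.
    rewrite -[leRHS]invrK lef_pV2 ?posrE ?invr_gt0 //.
    apply: (le_trans (ltW (truncnS_gt _))); rewrite ler_nat; exact: leqW.
  have [k kL] := compact_op_null p1 pq rw Dw HK uA u0 e0.
  have [uAk u1] := uA k; have [_ _ ulb _] := Hu k; have [_ ak] := Ha k.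
  have dL := DL _ uAk; have [KL _ _] := HK; have kLq := KL _ uAk.
  have h1 := carleson_ratio_le (aM k) c0 dL ulb.
  have := Lqint_add q0 (inLqB q0 dL kLq) kLq.
  under [fun z => Dn n _ z - _ + _]eq_fun do rewrite subrK.
  move=> h2; have h3 := Lqint_le_opnorm mu (fun f z => Dn n f z - K f z) uAk u1.
  move: ak; apply/negP; rewrite -leNgt; apply: (le_trans h1); rewrite -HD.
  have -> : (A * (Y + e))%:E = (D%:E * ((2 `^ q)%:E * Y%:E + (2 `^ q)%:E * e%:E))%E.
    by rewrite -(EFinM (2 `^ q) Y) -(EFinM (2 `^ q) e) -EFinD -(EFinM D) HA; congr EFin; ring.
  have q2' : (0 <= (2 `^ q)%:E)%E by rewrite lee_fin ltW.
  apply: lee_wpmul2l; first by rewrite lee_fin ltW.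
  apply: (le_trans h2); apply: leeD; apply: lee_wpmul2l; [exact: q2'|rewrite -YE; exact: h3|exact: q2'|exact: kL].
have l0 : (0 <= l)%E by exact: limsup_ratio_ge0.
have Al0 : (0 <= (A^-1)%:E * l)%E by rewrite mule_ge0 // lee_fin invr_ge0 ltW.
(* The essential norm is an infimum of norms, not of their q-th powers, so the root is taken before
   passing to the infimum. *)
have h : (((A^-1)%:E * l) `^ q^-1 <= ess_norm_Dn p q n w mu)%E.
  apply: le_ereal_inf_tmp => _ [K HK <-].
  have : ((A^-1)%:E * l <= opnorm p q w mu (fun f z => Dn n f z - K f z)%R `^ q)%E.
    by rewrite lee_pdivrMl //; exact: lK.
  have qi : 0 <= q^-1 by rewrite invr_ge0 ltW.
  move=> /(le_poweR qi Al0); rewrite -poweRrM mulfV ?gt_eqF // poweRe1 //; exact: opnorm_ge0.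
have := le_poweR (ltW q0) (poweR_ge0 _ _) h.
by rewrite -poweRrM mulVf ?gt_eqF // poweRe1.
Qed.

End LowerBound.

Theorem theorem2p2 (R : realType) (p q : R) (n : nat) (w : R -> R) (s : R) :
  1 < p -> p <= q -> radial_weight w -> class_D w -> 0 < s < 1 ->
  exists c : R, 0 < c /\
    forall mu : {measure set (R * R)%type -> \bar R},
      Dn_bounded p q n w mu ->
      (c%:E * limsup_boundary (carleson_ratio p q n w s mu)
         <= (ess_norm_Dn p q n w mu) `^ q)%E /\
      ((ess_norm_Dn p q n w mu) `^ q
         <= c^-1%:E * limsup_boundary (carleson_ratio p q n w s mu))%E.
Proof.
move=> p1 pq rw Dw s01.
have [c1 c10 H1] := ess_lower n p1 pq rw Dw s01.
have [c2 c20 H2] := ess_upper n p1 pq rw Dw s01.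
(* One constant serves both inequalities: it is at most c1, and its inverse is at least c2. *)
have c0 : 0 < Num.min c1 c2^-1 by rewrite lt_min c10 invr_gt0.
exists (Num.min c1 c2^-1); split=> // mu Hmu.
have l0 := limsup_ratio_ge0 p q n w s mu.
split.
  apply: le_trans (H1 mu Hmu); apply: lee_wpmul2r => //.
  by rewrite lee_fin ge_min lexx.
apply: (le_trans (H2 mu Hmu)); apply: lee_wpmul2r => //.
by rewrite lee_fin -[leLHS]invrK lef_pV2 ?posrE ?invr_gt0 // ge_min lexx orbT.
Qed.
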